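(* Let $0<\sigma<1$, let $b\in\mathbb{C}$ be arbitrary, let $\vartheta=\tfrac12-b$ and let $M$ be a positive integer. Put $\kappa=1-\sigma$, $h=\sigma^\sigma$ and $X=\kappa(hx)^{1/\kappa}$. Then the generalised Bessel function ${}_0\Psi_1(z)=\sum_{n=0}^\infty\frac{z^n}{\Gamma(-\sigma n+b)\,n!}$ (that is, with $a=-\sigma$) satisfies $$ {}_0\Psi_1(-x)=\frac{X^\vartheta e^{-X}}{2\pi}\left\{\sum_{j=0}^{M-1}(-1)^jA_j(\sigma)X^{-j}+O(X^{-M})\right\} $$ as $x\to+\infty$, where the coefficients $A_j(\sigma)$ are those defined in the context, with $A_0(\sigma)=(2\pi/\kappa)^{1/2}(\sigma/\kappa)^\vartheta$.
   Context: Coefficients: put $\delta=1-b$, $\vartheta'=1-\vartheta$ (so $\vartheta=\delta-\tfrac12$). The $A_j(\sigma)$ (independent of $s$, depending only on $\sigma,b$) are those appearing in the inverse factorial expansion, for each positive integer $M$, $$\frac{\Gamma(\sigma s+\delta)}{\Gamma(1+s)}=\kappa(h\kappa^\kappa)^s\left\{\sum_{j=0}^{M-1}\frac{A_j(\sigma)}{\Gamma(\kappa s+\vartheta'+j)}+\frac{\rho_M(s)}{\Gamma(\kappa s+\vartheta'+M)}\right\},$$ with $\rho_M(s)=O(1)$ as $|s|\to\infty$ in $|\arg s|\le\pi-\epsilon$ (any fixed $\epsilon>0$). For example $A_1(\sigma)/A_0(\sigma)=\frac{1}{24\sigma}\{2+7\sigma+2\sigma^2-12\delta(1+\sigma)+12\delta^2\}$.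 Convention: $1/\Gamma$ is the entire reciprocal gamma function. *)

(* Defs.v *)
(* Stdlib reals with Coquelicot's complex numbers. *)
From Stdlib Require Export Reals Factorial.
From Coquelicot Require Export Coquelicot.
Open Scope R_scope.

Definition Cexp (z : C) : C := (exp (Re z) * cos (Im z), exp (Re z) * sin (Im z)).

(* [x ^ z] for real [x > 0], with the real logarithm; since [ln x = 0] for
   [x <= 0] in Stdlib, the value is then 1. *)
Definition Rcpow (x : R) (z : C) : C := Cexp (z * ln x)%C.

(* Principal argument, in ]-PI, PI], meaningful for [z <> 0]. *)
Definition Carg (z : C) : R :=
  if Rle_dec 0 (Im z) then acos (Re z / Cmod z) else - acos (Re z / Cmod z).

Definition Clim_seq (u : nat -> C) : C :=
  (real (Lim_seq (fun n => Re (u n))), real (Lim_seq (fun n => Im (u n)))).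

Definition CSeries (u : nat -> C) : C :=
  (Series (fun n => Re (u n)), Series (fun n => Im (u n))).

(* z (z + 1) ... (z + n - 1) *)
Fixpoint Crising (z : C) (n : nat) : C :=
  match n with
  | O => RtoC 1
  | S m => (Crising z m * (z + INR m))%C
  end.

(* The entire function 1/Gamma, by Gauss's product
   1/Gamma(z) = lim z (z + 1) ... (z + n) / (n! n^z), valid for every z. *)
Definition rGamma (z : C) : C :=
  Clim_seq (fun n => Crising z (S n) / (INR (fact n) * Rcpow (INR n) z))%C.

(* Gamma itself; not meaningful at its poles 0, -1, -2, ... *)
Definition CGamma (z : C) : C := (/ rGamma z)%C.

(* Generalised Bessel (Wright) function: sum of z^n / (Gamma(a n + b) n!). *)
Definition Psi01 (a : R) (b z : C) : C :=
  CSeries (fun n => z ^ n * rGamma (RtoC a * INR n + b) / INR (fact n))%C.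

(* [A] is the coefficient sequence of the inverse factorial expansion of
   Gamma(sigma s + delta) / Gamma(1 + s).  These conditions determine [A].
   The identity is only required for large |s| in each sector
   |arg s| <= PI - eps: this avoids the poles of Gamma(sigma s + delta) and the
   zeros of 1/Gamma(kappa s + theta' + M), where [rho] would be infinite. *)
Definition inverse_factorial_coeffs (sigma : R) (b : C) (A : nat -> C) : Prop :=
  let kappa := 1 - sigma in
  let h := Rpower sigma sigma in
  let delta := (RtoC 1 - b)%C in
  let theta := (RtoC (1 / 2) - b)%C in
  let theta' := (RtoC 1 - theta)%C in
  forall M : nat, (1 <= M)%nat ->
  exists rho : C -> C,
  forall eps : R, 0 < eps ->
  exists K R0 : R,
  forall s : C, R0 <= Cmod s -> Rabs (Carg s) <= PI - eps ->
    (CGamma (RtoC sigma * s + delta) * rGamma (RtoC 1 + s))%C =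
      (RtoC kappa * Rcpow (h * Rpower kappa kappa) s *
       (sum_n (fun j => A j * rGamma (RtoC kappa * s + theta' + INR j)) (M - 1)
        + rho s * rGamma (RtoC kappa * s + theta' + INR M)))%C
    /\ Cmod (rho s) <= K.

(* Main.v *)
Require Import Defs.
From Stdlib Require Import Lra Lia Psatz.

(* Both the inverse factorial expansion and Psi are governed by the same saddle point. For real [N] and
   [x > 0], the series of [x^s Gamma (sigma s + delta) / Gamma (1 + s)] over [s = N, N + 1, ...] is the
   integral of [t^(delta - 1) exp (- t + x t^sigma)] over the half line up to a relatively exponentially
   small error, while inserting Hankel's integral for 1/Gamma in the series of Psi gives the integral of
   [t^(delta - 1) exp (t - x t^sigma)] over a Hankel contour. In the variable [ln (t / c)], with [c] the
   saddle point, the first path crosses the saddle along the real axis and the second one along the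
   imaginary axis, so that Laplace's method produces the same coefficients, multiplied by [(-1)^j] in the
   second case. It remains to see that the first series produces the [A j]: inserting the inverse factorial
   expansion in it gives sums of [X^(kappa s) / Gamma (kappa s + theta' + j)], whose integrals over a shift
   of [N] by [r] in [0, 1] are integrals over a half line of [X^u / Gamma (u + theta' + j)], and these are
   averages of series with step 1, that is, of exponential type. Uniqueness of asymptotic expansions then
   identifies the coefficients. All integrals are taken in logarithmic variables, so that the integrands
   are entire. *)

(** * Complex-valued functions of a real variable *)

(** Gamma is given only through Gauss's product for 1/Gamma, so Hankel's integral has to be
    recovered before it can be inserted. By its recurrence, the Hankel integral at [z] equals
    Gauss's quotient times [n! n^z] times the Hankel integral at [z + n + 1]; Laplace's method at
    the saddle of [G0], along the real line for [n!] and along the Hankel contour for the last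
    factor, shows that the product of the factors other than the quotient tends to 1. Contours are
    moved without Cauchy's theorem: the integrands are uniform limits on rectangles of sums of
    exponentials, which have explicit primitives. The saddle [c = sigma X / kappa] satisfies
    [c = sigma x c^sigma], so that the exponent has the critical value
    [x c^sigma - c = c / sigma - c = X]; the phase [Gs] is normalised to second derivative -1, which
    makes [sigma X] the large parameter and explains the powers of [sigma] in the formula for the
    [A j]. In the averaged sums the number of terms tends to infinity first, at fixed [X]; only then
    does [X] grow. *)

Lemma C_eq (z w : C) : Re z = Re w -> Im z = Im w -> z = w.
Proof. intros; apply injective_projections; assumption. Qed.

Lemma Re_plus z w : Re (z + w)%C = Re z + Re w. Proof. reflexivity. Qed.
Lemma Im_plus z w : Im (z + w)%C = Im z + Im w. Proof. reflexivity. Qed.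
Lemma Re_opp z : Re (- z)%C = - Re z. Proof. reflexivity. Qed.
Lemma Im_opp z : Im (- z)%C = - Im z. Proof. reflexivity. Qed.
Lemma Re_minus z w : Re (z - w)%C = Re z - Re w. Proof. reflexivity. Qed.
Lemma Im_minus z w : Im (z - w)%C = Im z - Im w. Proof. reflexivity. Qed.
Lemma Re_mult z w : Re (z * w)%C = Re z * Re w - Im z * Im w. Proof. reflexivity. Qed.
Lemma Im_mult z w : Im (z * w)%C = Re z * Im w + Im z * Re w. Proof. reflexivity. Qed.
Lemma Re_RtoC x : Re (RtoC x) = x. Proof. reflexivity. Qed.
Lemma Im_RtoC x : Im (RtoC x) = 0. Proof. reflexivity. Qed.
Lemma Re_Ci : Re Ci = 0. Proof. reflexivity. Qed.
Lemma Im_Ci : Im Ci = 1. Proof. reflexivity. Qed.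

Ltac Csimpl := rewrite ?Re_plus, ?Im_plus, ?Re_minus, ?Im_minus, ?Re_mult, ?Im_mult,
  ?Re_opp, ?Im_opp, ?Re_RtoC, ?Im_RtoC, ?Re_Ci, ?Im_Ci.
Ltac Ceq := apply C_eq; repeat progress Csimpl.

Lemma Im_le_Cmod (z : C) : Rabs (Im z) <= Cmod z.
Proof.
  apply Rle_trans with (2 := Rmax_Cmod z). apply Rmax_r.
Qed.

Lemma Cmod_le_Re_Im (z : C) : Cmod z <= Rabs (Re z) + Rabs (Im z).
Proof.
  replace z with (RtoC (Re z) + Ci * RtoC (Im z))%C at 1 by (Ceq; ring).
  eapply Rle_trans; [apply Cmod_triangle|].
  rewrite Cmod_mult, Cmod_Ci, !Cmod_R. lra.
Qed.

Lemma Cmod_minus_le (z w : C) : Cmod (z - w) <= Cmod z + Cmod w.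
Proof. unfold Cminus. rewrite <- (Cmod_opp w). apply Cmod_triangle. Qed.

Lemma Cmod_minus_sym (z w : C) : Cmod (z - w) = Cmod (w - z).
Proof. rewrite <- Cmod_opp. f_equal. ring. Qed.

Lemma Cmod_triangle_sub (z w : C) : Cmod z <= Cmod w + Cmod (z - w).
Proof. replace z with (w + (z - w))%C at 1 by ring. apply Cmod_triangle. Qed.

Lemma Cmod_dist_triangle (x y z : C) : Cmod (x - z) <= Cmod (x - y) + Cmod (y - z).
Proof. replace (x - z)%C with ((x - y) + (y - z))%C by ring. apply Cmod_triangle. Qed.

Lemma Cexp_add (z w : C) : Cexp (z + w) = (Cexp z * Cexp w)%C.
Proof.
  unfold Cexp. rewrite Re_plus, Im_plus, exp_plus, cos_plus, sin_plus.
  apply C_eq; unfold Cmult, Re, Im; simpl; ring.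
Qed.

Lemma Cexp_RtoC (x : R) : Cexp (RtoC x) = RtoC (exp x).
Proof.
  unfold Cexp. rewrite Re_RtoC, Im_RtoC, cos_0, sin_0.
  apply C_eq; unfold RtoC, Re, Im; simpl; ring.
Qed.

Lemma Cexp_0 : Cexp 0 = RtoC 1.
Proof. rewrite Cexp_RtoC, exp_0. reflexivity. Qed.

Lemma Cmod_Cexp (z : C) : Cmod (Cexp z) = exp (Re z).
Proof.
  unfold Cexp, Cmod; simpl fst; simpl snd.
  replace ((exp (Re z) * cos (Im z)) ^ 2 + (exp (Re z) * sin (Im z)) ^ 2)
    with (Rsqr (exp (Re z)) * (Rsqr (sin (Im z)) + Rsqr (cos (Im z)))) by (unfold Rsqr; ring).
  rewrite sin2_cos2, Rmult_1_r, sqrt_Rsqr; auto. left; apply exp_pos.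
Qed.

Lemma Cexp_neq_0 (z : C) : Cexp z <> RtoC 0.
Proof. apply Cmod_gt_0. rewrite Cmod_Cexp. apply exp_pos. Qed.

Lemma Cexp_opp (z : C) : Cexp (- z) = (/ Cexp z)%C.
Proof.
  assert (H : (Cexp (- z) * Cexp z = 1)%C).
  { rewrite <- Cexp_add. replace (- z + z)%C with (RtoC 0) by ring. apply Cexp_0. }
  replace (/ Cexp z)%C with (Cexp (- z) * Cexp z * / Cexp z)%C.
  - field. apply Cexp_neq_0.
  - rewrite H. ring.
Qed.

Lemma Cexp_INR_mult (z : C) (n : nat) : Cexp (INR n * z) = (Cexp z ^ n)%C.
Proof.
  induction n.
  - simpl. replace (0 * z)%C with (RtoC 0) by ring. apply Cexp_0.
  - rewrite S_INR, RtoC_plus. replace ((INR n + 1) * z)%C with (INR n * z + z)%C by ring.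
    rewrite Cexp_add, IHn. simpl. ring.
Qed.

Definition Ccont (f : R -> C) : Prop :=
  forall y, continuous (fun u => Re (f u)) y /\ continuous (fun u => Im (f u)) y.

Definition Cderiv (f df : R -> C) : Prop :=
  forall y, is_derive (fun u => Re (f u)) y (Re (df y)) /\
            is_derive (fun u => Im (f u)) y (Im (df y)).

Lemma Ccont_ext f g : (forall y, f y = g y) -> Ccont f -> Ccont g.
Proof.
  intros E H y. destruct (H y). split.
  - eapply continuous_ext; [|apply H0]. intros; simpl. now rewrite E.
  - eapply continuous_ext; [|apply H1]. intros; simpl. now rewrite E.
Qed.

Lemma Ccont_const c : Ccont (fun _ => c).
Proof. intro y; split; apply continuous_const. Qed.

Lemma Ccont_RtoC (f : R -> R) : (forall y, continuous f y) -> Ccont (fun y => RtoC (f y)).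
Proof. intros H y; split; [apply H|apply continuous_const]. Qed.

Lemma Ccont_id : Ccont (fun y => RtoC y).
Proof. apply Ccont_RtoC. intro; apply continuous_id. Qed.

Lemma Ccont_plus f g : Ccont f -> Ccont g -> Ccont (fun y => f y + g y)%C.
Proof.
  intros Hf Hg y. destruct (Hf y), (Hg y).
  split; [apply (continuous_plus (fun u => Re (f u)) (fun u => Re (g u)))
         |apply (continuous_plus (fun u => Im (f u)) (fun u => Im (g u)))]; assumption.
Qed.

Lemma Ccont_opp f : Ccont f -> Ccont (fun y => - f y)%C.
Proof.
  intros Hf y. destruct (Hf y).
  split; [apply (continuous_opp (fun u => Re (f u)))
         |apply (continuous_opp (fun u => Im (f u)))]; assumption.
Qed.

Lemma Ccont_minus f g : Ccont f -> Ccont g -> Ccont (fun y => f y - g y)%C.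
Proof. intros. apply Ccont_plus; [|apply Ccont_opp]; assumption. Qed.

Lemma Ccont_mult f g : Ccont f -> Ccont g -> Ccont (fun y => f y * g y)%C.
Proof.
  intros Hf Hg y. destruct (Hf y), (Hg y).
  split.
  - apply (continuous_minus (fun u => Re (f u) * Re (g u)) (fun u => Im (f u) * Im (g u)));
      apply (continuous_mult (K := R_AbsRing)); assumption.
  - apply (continuous_plus (fun u => Re (f u) * Im (g u)) (fun u => Im (f u) * Re (g u)));
      apply (continuous_mult (K := R_AbsRing)); assumption.
Qed.

Lemma continuous_R (f : R -> R) y : continuity_pt f y -> continuous f y.
Proof. apply continuity_pt_filterlim. Qed.

Lemma Ccont_Cexp f : Ccont f -> Ccont (fun y => Cexp (f y)).
Proof.
  intros Hf y. destruct (Hf y) as [H1 H2].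
  assert (He : continuous (fun u => exp (Re (f u))) y)
    by (apply (continuous_comp (fun u => Re (f u)) exp); [assumption|];
        apply continuous_R, derivable_continuous_pt, derivable_pt_exp).
  split; apply (continuous_mult (K := R_AbsRing)); try exact He.
  - apply (continuous_comp (fun u => Im (f u)) cos); [assumption|].
    apply continuous_R, continuity_cos.
  - apply (continuous_comp (fun u => Im (f u)) sin); [assumption|].
    apply continuous_R, continuity_sin.
Qed.

Lemma Ccont_pow f n : Ccont f -> Ccont (fun y => f y ^ n)%C.
Proof.
  intros Hf. induction n; simpl; [apply Ccont_const|apply Ccont_mult; assumption].
Qed.

Lemma Ccont_comp f (g : R -> R) :
  Ccont f -> (forall y, continuous g y) -> Ccont (fun y => f (g y)).
Proof.
  intros Hf Hg y. destruct (Hf (g y)).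
  split; [apply (continuous_comp g (fun u => Re (f u)))
         |apply (continuous_comp g (fun u => Im (f u)))]; auto.
Qed.

Lemma Cderiv_cont f df : Cderiv f df -> Ccont f.
Proof.
  intros H y. destruct (H y) as [H1 H2].
  split; apply (ex_derive_continuous (K := R_AbsRing) (V := R_NormedModule)).
  - exists (Re (df y)); exact H1.
  - exists (Im (df y)); exact H2.
Qed.

Lemma Cderiv_ext f g df dg :
  (forall y, f y = g y) -> (forall y, df y = dg y) -> Cderiv f df -> Cderiv g dg.
Proof.
  intros E E' H y. destruct (H y) as [H1 H2]. rewrite <- E'. split.
  - eapply is_derive_ext; [|apply H1]. intros; simpl. now rewrite E.
  - eapply is_derive_ext; [|apply H2]. intros; simpl. now rewrite E.
Qed.

Lemma Cderiv_const c : Cderiv (fun _ => c) (fun _ => RtoC 0).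
Proof. intro y; split.
  - apply (is_derive_const (V := R_NormedModule) (Re c)).
  - apply (is_derive_const (V := R_NormedModule) (Im c)). Qed.

Lemma Cderiv_id : Cderiv (fun y => RtoC y) (fun _ => RtoC 1).
Proof.
  intro y; split.
  - apply (is_derive_id (K := R_AbsRing)).
  - apply (is_derive_const (V := R_NormedModule) 0).
Qed.

Lemma Cderiv_plus f df g dg :
  Cderiv f df -> Cderiv g dg -> Cderiv (fun y => f y + g y)%C (fun y => df y + dg y)%C.
Proof.
  intros Hf Hg y. destruct (Hf y), (Hg y).
  split; [apply (is_derive_plus (V := R_NormedModule) (fun u => Re (f u)) (fun u => Re (g u)))
         |apply (is_derive_plus (V := R_NormedModule) (fun u => Im (f u)) (fun u => Im (g u)))]; assumption.
Qed.

Lemma is_derive_eq (f : R -> R) x l l' : is_derive f x l -> l = l' -> is_derive f x l'.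
Proof. intros; subst; assumption. Qed.

Lemma Cderiv_mult f df g dg :
  Cderiv f df -> Cderiv g dg ->
  Cderiv (fun y => f y * g y)%C (fun y => df y * g y + f y * dg y)%C.
Proof.
  intros Hf Hg y. destruct (Hf y) as [F1 F2], (Hg y) as [G1 G2].
  split; simpl.
  - eapply is_derive_eq.
    + apply (is_derive_minus (V := R_NormedModule) (fun u => Re (f u) * Re (g u)) (fun u => Im (f u) * Im (g u)));
      (eapply (is_derive_mult (K := R_AbsRing)); [eassumption|eassumption|intros; apply Rmult_comm]).
    + unfold minus, plus, opp, mult; simpl. unfold Re, Im in *. ring.
  - eapply is_derive_eq.
    + apply (is_derive_plus (V := R_NormedModule) (fun u => Re (f u) * Im (g u)) (fun u => Im (f u) * Re (g u)));
      (eapply (is_derive_mult (K := R_AbsRing)); [eassumption|eassumption|intros; apply Rmult_comm]).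
    + unfold minus, plus, opp, mult; simpl. unfold Re, Im in *. ring.
Qed.

Lemma Cderiv_scal c f df :
  Cderiv f df -> Cderiv (fun y => c * f y)%C (fun y => c * df y)%C.
Proof.
  intros H. eapply Cderiv_ext; [| |apply Cderiv_mult; [apply (Cderiv_const c)|apply H]].
  - reflexivity.
  - intros; simpl. ring.
Qed.

Lemma Cderiv_Cexp f df :
  Cderiv f df -> Cderiv (fun y => Cexp (f y)) (fun y => df y * Cexp (f y))%C.
Proof.
  intros Hf y. destruct (Hf y) as [F1 F2].
  assert (E : is_derive (fun u => exp (Re (f u))) y (Re (df y) * exp (Re (f y)))).
  { apply (is_derive_comp exp (fun u => Re (f u))); [|assumption].
    apply is_derive_Reals, derivable_pt_lim_exp. }
  assert (Co : is_derive (fun u => cos (Im (f u))) y (Im (df y) * - sin (Im (f y)))).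
  { apply (is_derive_comp cos (fun u => Im (f u))); [|assumption].
    apply is_derive_Reals, derivable_pt_lim_cos. }
  assert (Si : is_derive (fun u => sin (Im (f u))) y (Im (df y) * cos (Im (f y)))).
  { apply (is_derive_comp sin (fun u => Im (f u))); [|assumption].
    apply is_derive_Reals, derivable_pt_lim_sin. }
  split; simpl.
  - eapply is_derive_eq.
    + eapply (is_derive_mult (K := R_AbsRing)); [apply E|apply Co|intros; apply Rmult_comm].
    + unfold plus, mult; simpl. unfold Re, Im. ring.
  - eapply is_derive_eq.
    + eapply (is_derive_mult (K := R_AbsRing)); [apply E|apply Si|intros; apply Rmult_comm].
    + unfold plus, mult; simpl. unfold Re, Im. ring.
Qed.

Lemma Cderiv_pow f df n :
  Cderiv f df -> Cderiv (fun y => f y ^ S n)%C (fun y => INR (S n) * df y * f y ^ n)%C.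
Proof.
  intros H. induction n.
  - eapply Cderiv_ext; [| |apply H]; intros; simpl; ring.
  - eapply Cderiv_ext; [| |apply Cderiv_mult; [apply H|apply IHn]].
    + reflexivity.
    + intros. cbv beta. rewrite (S_INR (S n)), RtoC_plus. simpl Cpow. ring.
Qed.

(** * Integrals over segments *)

Definition CI (f : R -> C) (a b : R) : C :=
  (RInt (fun y => Re (f y)) a b, RInt (fun y => Im (f y)) a b).

Lemma Ccont_ex_Re f a b : Ccont f -> ex_RInt (fun y => Re (f y)) a b.
Proof. intros H. apply (ex_RInt_continuous (V := R_CompleteNormedModule)). intros; apply H. Qed.

Lemma Ccont_ex_Im f a b : Ccont f -> ex_RInt (fun y => Im (f y)) a b.
Proof. intros H. apply (ex_RInt_continuous (V := R_CompleteNormedModule)). intros; apply H. Qed.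

#[global] Hint Resolve Ccont_ex_Re Ccont_ex_Im : ccont.

Lemma CI_ext f g a b :
  (forall y, Rmin a b <= y <= Rmax a b -> f y = g y) -> CI f a b = CI g a b.
Proof.
  intros H. unfold CI. f_equal; apply RInt_ext; intros; rewrite H; auto; lra.
Qed.

Lemma CI_plus f g a b : Ccont f -> Ccont g ->
  CI (fun y => f y + g y)%C a b = (CI f a b + CI g a b)%C.
Proof.
  intros Hf Hg. unfold CI, Cplus; simpl. f_equal.
  - apply (RInt_plus (V := R_CompleteNormedModule) (fun y => Re (f y)) (fun y => Re (g y))); auto with ccont.
  - apply (RInt_plus (V := R_CompleteNormedModule) (fun y => Im (f y)) (fun y => Im (g y))); auto with ccont.
Qed.

Lemma CI_scal c f a b : Ccont f -> CI (fun y => c * f y)%C a b = (c * CI f a b)%C.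
Proof.
  intros Hf.
  assert (Er : forall k : R, ex_RInt (fun y => scal k (Re (f y))) a b)
    by (intro; apply (ex_RInt_scal (V := R_NormedModule)); auto with ccont).
  assert (Ei : forall k : R, ex_RInt (fun y => scal k (Im (f y))) a b)
    by (intro; apply (ex_RInt_scal (V := R_NormedModule)); auto with ccont).
  assert (Sr : forall k : R, RInt (fun y => scal k (Re (f y))) a b = k * Re (CI f a b))
    by (intro; apply (RInt_scal (V := R_CompleteNormedModule)); auto with ccont).
  assert (Si : forall k : R, RInt (fun y => scal k (Im (f y))) a b = k * Im (CI f a b))
    by (intro; apply (RInt_scal (V := R_CompleteNormedModule)); auto with ccont).
  Ceq.
  - rewrite <- Sr, <- Si.
    etransitivity; [|apply (RInt_minus (V := R_CompleteNormedModule) _ _ _ _ (Er _) (Ei _))].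
    reflexivity.
  - rewrite <- Sr, <- Si.
    etransitivity; [|apply (RInt_plus (V := R_CompleteNormedModule) _ _ _ _ (Ei _) (Er _))].
    reflexivity.
Qed.

Lemma CI_opp f a b : Ccont f -> CI (fun y => - f y)%C a b = (- CI f a b)%C.
Proof.
  intros H. rewrite (CI_ext _ (fun y => - (1) * f y)%C) by (intros; ring).
  rewrite CI_scal by assumption. ring.
Qed.

Lemma CI_minus f g a b : Ccont f -> Ccont g ->
  CI (fun y => f y - g y)%C a b = (CI f a b - CI g a b)%C.
Proof.
  intros Hf Hg. unfold Cminus. rewrite CI_plus, CI_opp; auto. apply Ccont_opp; auto.
Qed.

Lemma CI_Chasles f a b c : Ccont f -> (CI f a b + CI f b c)%C = CI f a c.
Proof.
  intros Hf. unfold CI, Cplus; simpl.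
  f_equal; apply (RInt_Chasles (V := R_CompleteNormedModule)); auto with ccont.
Qed.

Lemma CI_point f a : CI f a a = RtoC 0.
Proof. unfold CI. rewrite !RInt_point. reflexivity. Qed.

Lemma CI_FTC F f a b : Cderiv F f -> Ccont f -> CI f a b = (F b - F a)%C.
Proof.
  intros HF Hf. unfold CI. apply C_eq; simpl.
  - apply is_RInt_unique. apply (is_RInt_derive (fun y => Re (F y)) (fun y => Re (f y))).
    + intros; apply HF. + intros; apply Hf.
  - apply is_RInt_unique. apply (is_RInt_derive (fun y => Im (F y)) (fun y => Im (f y))).
    + intros; apply HF. + intros; apply Hf.
Qed.

(* Integrating [Re (conj I * f)], where [I] is the integral, loses no constant. *)
Lemma CI_bound f g a b : a <= b -> Ccont f -> (forall y, continuous g y) ->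
  (forall y, a <= y <= b -> Cmod (f y) <= g y) -> Cmod (CI f a b) <= RInt g a b.
Proof.
  intros Hab Hf Hg H. set (I := CI f a b).
  destruct (Req_dec (Cmod I) 0) as [E|E].
  { rewrite E. apply RInt_ge_0; auto.
    - apply (ex_RInt_continuous (V := R_CompleteNormedModule)); auto.
    - intros. eapply Rle_trans; [apply Cmod_ge_0|apply H; lra]. }
  assert (HI : 0 < Cmod I) by (pose proof (Cmod_ge_0 I); lra).
  apply Rmult_le_reg_l with (1 := HI).
  replace (Cmod I * Cmod I) with (Re (Cconj I * I)%C).
  2:{ pose proof (Cmod2_alt I). Csimpl. unfold Cconj; simpl. simpl in H0. unfold Re, Im in *; simpl. lra. }
  unfold I at 2. rewrite <- CI_scal by auto. unfold CI; simpl fst.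
  change (Re (?x, ?y)) with x.
  change (Cmod I * RInt g a b) with (scal (Cmod I) (RInt g a b)).
  rewrite <- (RInt_scal (V := R_CompleteNormedModule)) by (apply (ex_RInt_continuous (V := R_CompleteNormedModule)); auto).
  apply RInt_le; auto.
  - apply Ccont_ex_Re. apply Ccont_mult; auto. apply Ccont_const.
  - apply (ex_RInt_scal (V := R_NormedModule)). apply (ex_RInt_continuous (V := R_CompleteNormedModule)); auto.
  - intros x Hx. eapply Rle_trans; [apply Rle_abs|].
    eapply Rle_trans; [apply re_le_Cmod|]. rewrite Cmod_mult, Cmod_conj.
    apply Rmult_le_compat_l; [lra|]. apply H; lra.
Qed.

Lemma CI_bound_const f B a b : a <= b -> Ccont f ->
  (forall y, a <= y <= b -> Cmod (f y) <= B) -> Cmod (CI f a b) <= B * (b - a).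
Proof.
  intros. eapply Rle_trans; [apply (CI_bound f (fun _ => B)); auto|].
  - intros; apply continuous_const.
  - rewrite RInt_const. unfold scal; simpl; unfold mult; simpl. lra.
Qed.

Lemma CI_comp_lin f (u v a b : R) : Ccont f ->
  (u * CI (fun y => f (u * y + v)%R) a b)%C = CI f (u * a + v) (u * b + v).
Proof.
  intros Hf.
  assert (Hc : Ccont (fun y => f (u * y + v))).
  { apply (Ccont_comp f (fun y => u * y + v)); auto. intro y.
    apply continuous_R. reg. }
  rewrite <- CI_scal by auto.
  unfold CI. f_equal.
  - rewrite <- (RInt_comp_lin (V := R_CompleteNormedModule) (fun y => Re (f y))) by auto with ccont.
    apply RInt_ext. intros. Csimpl. unfold scal; simpl; unfold mult; simpl. ring.
  - rewrite <- (RInt_comp_lin (V := R_CompleteNormedModule) (fun y => Im (f y))) by auto with ccont.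
    apply RInt_ext. intros. Csimpl. unfold scal; simpl; unfold mult; simpl. ring.
Qed.

Lemma CI_shift f v a b : Ccont f -> CI (fun y => f (y + v)) a b = CI f (a + v) (b + v).
Proof.
  intros Hf. generalize (CI_comp_lin f 1 v a b Hf). rewrite !Rmult_1_l, Cmult_1_l.
  intros <-. apply CI_ext. intros. now rewrite Rmult_1_l.
Qed.

(** * Limits of complex sequences *)

Definition Clim (u : nat -> C) (l : C) : Prop :=
  is_lim_seq (fun n => Cmod (u n - l)) 0.

Lemma is_lim_seq_real_eq (u : nat -> R) (l l' : R) : is_lim_seq u l -> l = l' -> is_lim_seq u l'.
Proof. intros H <-; exact H. Qed.

Lemma is_lim_seq_le0 (u v : nat -> R) :
  eventually (fun n => 0 <= u n <= v n) -> is_lim_seq v 0 -> is_lim_seq u 0.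
Proof.
  intros H Hv. apply is_lim_seq_le_le_loc with (fun _ => 0) v; auto. apply is_lim_seq_const.
Qed.

Lemma Clim_squeeze u l (e : nat -> R) :
  eventually (fun n => Cmod (u n - l) <= e n) -> is_lim_seq e 0 -> Clim u l.
Proof.
  intros [N H] He. apply is_lim_seq_le0 with e; auto.
  exists N. intros n Hn. split; [apply Cmod_ge_0|auto].
Qed.

Lemma Clim_ext u v l : (forall n, u n = v n) -> Clim u l -> Clim v l.
Proof. intros E. apply is_lim_seq_ext. intros; now rewrite E. Qed.

Lemma Clim_ext_loc u v l : eventually (fun n => u n = v n) -> Clim u l -> Clim v l.
Proof.
  intros [N E] H. apply Clim_squeeze with (2 := H). exists N.
  intros n Hn. rewrite E; auto. apply Rle_refl.
Qed.

Lemma Clim_const c : Clim (fun _ => c) c.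
Proof.
  unfold Clim. eapply is_lim_seq_ext; [|apply is_lim_seq_const].
  intros; simpl. replace (c - c)%C with (RtoC 0) by ring. now rewrite Cmod_0.
Qed.

Lemma Clim_eventually u l eps : 0 < eps -> Clim u l -> eventually (fun n => Cmod (u n - l) < eps).
Proof.
  intros He H. apply is_lim_seq_spec in H. destruct (H (mkposreal _ He)) as [N HN].
  exists N. intros n Hn. specialize (HN n Hn). simpl in HN.
  rewrite Rminus_0_r, Rabs_pos_eq in HN; auto. apply Cmod_ge_0.
Qed.

Lemma Clim_le u l c D : Clim u l -> eventually (fun n => Cmod (u n - c) <= D) -> Cmod (l - c) <= D.
Proof.
  intros H [N HN]. apply le_epsilon. intros eps He.
  destruct (Clim_eventually u l eps He H) as [N' HN'].
  eapply Rle_trans; [apply (Cmod_dist_triangle _ (u (N + N')%nat))|].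
  rewrite Cmod_minus_sym, Rplus_comm. apply Rplus_le_compat.
  - apply HN; lia. - left; apply HN'; lia.
Qed.

Lemma Clim_unique u l l' : Clim u l -> Clim u l' -> l = l'.
Proof.
  intros H H'. assert (E : Cmod (l - l') <= 0).
  { apply le_epsilon. intros eps He. rewrite Rplus_0_l. apply Clim_le with u; auto.
    destruct (Clim_eventually u l' eps He H') as [N HN]. exists N. intros; left; auto. }
  assert (E' : (l - l')%C = 0) by (apply Cmod_eq_0; pose proof (Cmod_ge_0 (l - l')); lra).
  replace l with (l - l' + l')%C by ring. rewrite E'. ring.
Qed.

Lemma Clim_plus u v l m : Clim u l -> Clim v m -> Clim (fun n => u n + v n)%C (l + m)%C.
Proof.
  intros H H'. eapply Clim_squeeze.
  - exists O. intros n _. replace (u n + v n - (l + m))%C with ((u n - l) + (v n - m))%C by ring.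
    apply Cmod_triangle.
  - eapply is_lim_seq_real_eq; [apply is_lim_seq_plus'; [apply H|apply H']|]. ring.
Qed.

Lemma Clim_mult u v l m : Clim u l -> Clim v m -> Clim (fun n => u n * v n)%C (l * m)%C.
Proof.
  intros H H'. eapply Clim_squeeze.
  - exists O. intros n _.
    replace (u n * v n - l * m)%C with ((u n - l) * (v n - m) + (l * (v n - m) + (u n - l) * m))%C by ring.
    eapply Rle_trans; [apply Cmod_triangle|]. rewrite Cmod_mult.
    apply Rplus_le_compat_l. eapply Rle_trans; [apply Cmod_triangle|].
    rewrite !Cmod_mult. apply Rle_refl.
  - eapply is_lim_seq_real_eq.
    + apply is_lim_seq_plus'; [apply is_lim_seq_mult'; [apply H|apply H']|].
      apply is_lim_seq_plus'; apply is_lim_seq_mult';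
      try apply is_lim_seq_const; [apply H'|apply H].
    + ring.
Qed.

Lemma Clim_scal c u l : Clim u l -> Clim (fun n => c * u n)%C (c * l)%C.
Proof. intros. apply Clim_mult; auto. apply Clim_const. Qed.

Lemma Clim_minus u v l m : Clim u l -> Clim v m -> Clim (fun n => u n - v n)%C (l - m)%C.
Proof.
  intros. apply Clim_ext with (fun n => u n + (- (1)) * v n)%C; [intros; ring|].
  replace (l - m)%C with (l + (- (1)) * m)%C by ring.
  apply Clim_plus; auto. apply Clim_scal; auto.
Qed.

Lemma Clim_inv u l : l <> RtoC 0 -> Clim u l -> Clim (fun n => / u n)%C (/ l)%C.
Proof.
  intros Hl H. apply Cmod_gt_0 in Hl.
  assert (Hl2 : 0 < Cmod l / 2) by lra.
  destruct (Clim_eventually _ _ _ Hl2 H) as [N HN].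
  apply Clim_squeeze with (fun n => Cmod (u n - l) * (2 / (Cmod l * Cmod l))).
  - exists N. intros n Hn. specialize (HN n Hn).
    pose proof (Cmod_triangle_sub l (u n)). rewrite Cmod_minus_sym in H0.
    assert (Hu : Cmod l / 2 < Cmod (u n)) by lra.
    assert (u n <> 0) by (apply Cmod_gt_0; lra).
    assert (l <> 0) by (apply Cmod_gt_0; lra).
    replace (/ u n - / l)%C with ((l - u n) / (u n * l))%C by (field; auto).
    rewrite Cmod_div by (apply Cmult_neq_0; auto).
    rewrite Cmod_minus_sym, Cmod_mult. apply Rmult_le_compat_l; [apply Cmod_ge_0|].
    apply Rmult_le_reg_r with (Cmod (u n) * Cmod l). { apply Rmult_lt_0_compat; lra. }
    field_simplify; try lra. apply Rmult_le_reg_r with (Cmod l); auto. field_simplify; lra.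
  - eapply is_lim_seq_real_eq; [apply is_lim_seq_mult'; [apply H|apply is_lim_seq_const]|]. ring.
Qed.

Lemma Clim_S u l : Clim u l -> Clim (fun n => u (S n)) l.
Proof. intros. apply (is_lim_seq_incr_1 (fun n => Cmod (u n - l))). exact H. Qed.

Lemma Clim_Re u l : Clim u l -> is_lim_seq (fun n => Re (u n)) (Re l).
Proof.
  intros H. apply is_lim_seq_spec. intro eps.
  destruct (Clim_eventually u l eps (cond_pos eps) H) as [N HN]. exists N. intros n Hn.
  eapply Rle_lt_trans; [|apply (HN n Hn)]. rewrite <- Re_minus. apply re_le_Cmod.
Qed.

Lemma Clim_Im u l : Clim u l -> is_lim_seq (fun n => Im (u n)) (Im l).
Proof.
  intros H. apply is_lim_seq_spec. intro eps.
  destruct (Clim_eventually u l eps (cond_pos eps) H) as [N HN]. exists N. intros n Hn.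
  eapply Rle_lt_trans; [|apply (HN n Hn)]. rewrite <- Im_minus. apply Im_le_Cmod.
Qed.

Lemma Clim_of_Re_Im u (x y : R) :
  is_lim_seq (fun n => Re (u n)) x -> is_lim_seq (fun n => Im (u n)) y -> Clim u (x, y).
Proof.
  intros Hx Hy. apply Clim_squeeze with (fun n => Rabs (Re (u n) - x) + Rabs (Im (u n) - y)).
  - exists O. intros n _. eapply Rle_trans; [apply Cmod_le_Re_Im|]. apply Rle_refl.
  - eapply is_lim_seq_real_eq.
    + apply is_lim_seq_plus'.
      * apply (is_lim_seq_abs _ (Finite (x - x))). apply is_lim_seq_minus'; [apply Hx|apply is_lim_seq_const].
      * apply (is_lim_seq_abs _ (Finite (y - y))). apply is_lim_seq_minus'; [apply Hy|apply is_lim_seq_const].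
    + unfold Rminus. rewrite !Rplus_opp_r, Rabs_R0. ring.
Qed.

Lemma Clim_seq_eq u l : Clim u l -> Clim_seq u = l.
Proof.
  intros H. unfold Clim_seq. apply C_eq; simpl.
  - now rewrite (is_lim_seq_unique _ _ (Clim_Re _ _ H)).
  - now rewrite (is_lim_seq_unique _ _ (Clim_Im _ _ H)).
Qed.

Lemma Clim_Cauchy (u : nat -> C) (e : nat -> R) :
  is_lim_seq e 0 -> (forall n m, (n <= m)%nat -> Cmod (u m - u n) <= e n) ->
  exists l, Clim u l.
Proof.
  intros He H.
  assert (A : forall P : C -> R, (forall z w, P (z - w)%C = P z - P w) -> (forall z, Rabs (P z) <= Cmod z) ->
    ex_finite_lim_seq (fun n => P (u n))).
  { intros P HP HP'. apply ex_lim_seq_cauchy_corr. intro eps.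
    apply is_lim_seq_spec in He. destruct (He eps) as [N HN]. exists N.
    assert (HN' : forall n, (N <= n)%nat -> e n < eps).
    { intros n Hn. specialize (HN n Hn). rewrite Rminus_0_r in HN. apply Rle_lt_trans with (2 := HN). apply Rle_abs. }
    intros n m Hn Hm. rewrite <- HP. eapply Rle_lt_trans; [apply HP'|].
    destruct (Nat.le_ge_cases n m).
    - rewrite Cmod_minus_sym. eapply Rle_lt_trans; [apply H; auto|auto].
    - eapply Rle_lt_trans; [apply H; auto|auto]. }
  destruct (A Re) as [x Hx]; [reflexivity|apply re_le_Cmod|].
  destruct (A Im) as [y Hy]; [reflexivity|apply Im_le_Cmod|].
  exists (x, y). now apply Clim_of_Re_Im.
Qed.

Lemma is_lim_seq_exp_opp : is_lim_seq (fun n => exp (- INR n)) 0.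
Proof.
  apply (is_lim_comp_seq exp (fun n => - INR n) m_infty (Finite 0)).
  - apply is_lim_exp_m.
  - exists O. intros; discriminate.
  - apply (is_lim_seq_opp INR p_infty). apply is_lim_seq_INR.
Qed.

(** * Integrals over the half line and the line *)

Definition Int0 (f : R -> C) : C := Clim_seq (fun n => CI f 0 (INR n)).

(** The rate of decay is fixed to 1, so that the single constant [B] bounds the integral and, times
    [exp (- b)], its tail beyond [b]. *)
Definition dec0 (B : R) (f : R -> C) : Prop :=
  Ccont f /\ forall y, 0 <= y -> Cmod (f y) <= B * exp (- y).

Lemma RInt_exp_opp B a b : RInt (fun y => B * exp (- y)) a b = B * (exp (- a) - exp (- b)).
Proof.
  apply is_RInt_unique.
  assert (H : is_RInt (fun y => B * exp (- y)) a b (minus (- B * exp (- b)) (- B * exp (- a)))).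
  { apply (is_RInt_derive (V := R_CompleteNormedModule) (fun y => - B * exp (- y))).
    - intros. auto_derive; auto. ring.
    - intros. apply continuous_R. reg. }
  replace (B * (exp (- a) - exp (- b))) with (minus (- B * exp (- b)) (- B * exp (- a))); auto.
  unfold minus, plus, opp; simpl; ring.
Qed.

Lemma continuous_exp_opp B : forall y, continuous (fun u => B * exp (- u)) y.
Proof. intro. apply continuous_R. reg. Qed.

Lemma dec0_segment B f a b : dec0 B f -> 0 <= a <= b -> Cmod (CI f a b) <= B * (exp (- a) - exp (- b)).
Proof.
  intros [Hc Hf] Hab. rewrite <- RInt_exp_opp. apply CI_bound; auto; try tauto.
  - apply continuous_exp_opp.
  - intros; apply Hf; lra.
Qed.

Lemma dec0_pos B f : dec0 B f -> 0 <= B.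
Proof.
  intros [_ H]. specialize (H 0 (Rle_refl 0)). rewrite Ropp_0, exp_0, Rmult_1_r in H.
  apply Rle_trans with (2 := H). apply Cmod_ge_0.
Qed.

Lemma CI_minus_Chasles f a b c : Ccont f -> (CI f a c - CI f a b)%C = CI f b c.
Proof. intros. rewrite <- (CI_Chasles f a b c) by auto. ring. Qed.

Lemma Int0_correct B f : dec0 B f -> Clim (fun n => CI f 0 (INR n)) (Int0 f).
Proof.
  intros H.
  destruct (Clim_Cauchy (fun n => CI f 0 (INR n)) (fun n => B * exp (- INR n))) as [l Hl].
  - eapply is_lim_seq_real_eq; [apply is_lim_seq_mult'; [apply is_lim_seq_const|apply is_lim_seq_exp_opp]|]. ring.
  - intros n m Hnm. rewrite CI_minus_Chasles by apply H.
    eapply Rle_trans; [apply (dec0_segment B); auto|].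
    + split; [apply pos_INR|apply le_INR; auto].
    + pose proof (dec0_pos _ _ H). pose proof (exp_pos (- INR m)).
      apply Rmult_le_compat_l; lra.
  - unfold Int0. rewrite (Clim_seq_eq _ _ Hl). exact Hl.
Qed.

Lemma Int0_tail B f b : dec0 B f -> 0 <= b -> Cmod (Int0 f - CI f 0 b) <= B * exp (- b).
Proof.
  intros H Hb. apply Clim_le with (1 := Int0_correct _ _ H).
  destruct (nfloor_ex b Hb) as [n [_ Hn]]. exists (S n). intros m Hm.
  assert (b <= INR m). { apply le_INR in Hm. rewrite S_INR in Hm. lra. }
  rewrite CI_minus_Chasles by apply H.
  eapply Rle_trans; [apply (dec0_segment B); auto|].
  pose proof (dec0_pos _ _ H). pose proof (exp_pos (- INR m)). apply Rmult_le_compat_l; lra.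
Qed.

Lemma Int0_bound B f : dec0 B f -> Cmod (Int0 f) <= B.
Proof.
  intros H. pose proof (Int0_tail B f 0 H (Rle_refl 0)) as E.
  rewrite CI_point, Ropp_0, exp_0, Rmult_1_r in E.
  now replace (Int0 f - 0)%C with (Int0 f) in E by ring.
Qed.

Lemma Int0_unique f l : Clim (fun n => CI f 0 (INR n)) l -> Int0 f = l.
Proof. apply Clim_seq_eq. Qed.

Lemma dec0_plus B B' f g : dec0 B f -> dec0 B' g -> dec0 (B + B') (fun y => f y + g y)%C.
Proof.
  intros [Hc Hf] [Hc' Hg]. split; [apply Ccont_plus; auto|].
  intros y Hy. eapply Rle_trans; [apply Cmod_triangle|]. rewrite Rmult_plus_distr_r.
  apply Rplus_le_compat; auto.
Qed.

Lemma dec0_scal B c f : dec0 B f -> dec0 (Cmod c * B) (fun y => c * f y)%C.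
Proof.
  intros [Hc Hf]. split; [apply Ccont_mult; auto; apply Ccont_const|].
  intros y Hy. rewrite Cmod_mult, Rmult_assoc. apply Rmult_le_compat_l; auto. apply Cmod_ge_0.
Qed.

Lemma dec0_opp B f : dec0 B f -> dec0 B (fun y => - f y)%C.
Proof.
  intros [Hc Hf]. split; [apply Ccont_opp; auto|]. intros. rewrite Cmod_opp; auto.
Qed.

Lemma dec0_minus B B' f g : dec0 B f -> dec0 B' g -> dec0 (B + B') (fun y => f y - g y)%C.
Proof. intros. apply dec0_plus; auto. apply dec0_opp; auto. Qed.

Lemma dec0_le B B' f : B <= B' -> dec0 B f -> dec0 B' f.
Proof.
  intros HB [Hc Hf]. split; auto. intros y Hy. eapply Rle_trans; [apply Hf; auto|].
  apply Rmult_le_compat_r; auto. left; apply exp_pos.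
Qed.

Lemma Int0_plus B B' f g : dec0 B f -> dec0 B' g ->
  Int0 (fun y => f y + g y)%C = (Int0 f + Int0 g)%C.
Proof.
  intros Hf Hg. apply Int0_unique.
  apply Clim_ext with (fun n => CI f 0 (INR n) + CI g 0 (INR n))%C.
  - intros. symmetry. apply CI_plus; [apply Hf|apply Hg].
  - apply Clim_plus; eapply Int0_correct; eassumption.
Qed.

Lemma Int0_scal B c f : dec0 B f -> Int0 (fun y => c * f y)%C = (c * Int0 f)%C.
Proof.
  intros Hf. apply Int0_unique.
  apply Clim_ext with (fun n => c * CI f 0 (INR n))%C.
  - intros. symmetry. apply CI_scal; apply Hf.
  - apply Clim_scal; eapply Int0_correct; eassumption.
Qed.

Lemma Int0_minus B B' f g : dec0 B f -> dec0 B' g ->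
  Int0 (fun y => f y - g y)%C = (Int0 f - Int0 g)%C.
Proof.
  intros Hf Hg. apply Int0_unique.
  apply Clim_ext with (fun n => CI f 0 (INR n) - CI g 0 (INR n))%C.
  - intros. symmetry. apply CI_minus; [apply Hf|apply Hg].
  - apply Clim_minus; eapply Int0_correct; eassumption.
Qed.

Lemma Int0_ext f g : (forall y, 0 <= y -> f y = g y) -> Int0 f = Int0 g.
Proof.
  intros H. unfold Int0, Clim_seq. f_equal; f_equal; apply Lim_seq_ext; intros n;
  (rewrite (CI_ext f g); [reflexivity|]); intros y Hy; apply H; pose proof (pos_INR n);
  rewrite Rmin_left in Hy by lra; lra.
Qed.

Lemma Int0_FTC B F f : Cderiv F f -> Ccont f -> dec0 B F -> Int0 f = (- F 0%R)%C.
Proof.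
  intros HF Hf [_ Hd]. apply Int0_unique.
  apply Clim_squeeze with (fun n => B * exp (- INR n)).
  - exists O. intros n _. rewrite (CI_FTC F f) by auto.
    replace (F (INR n) - F 0%R - - F 0%R)%C with (F (INR n)) by ring. apply Hd, pos_INR.
  - eapply is_lim_seq_real_eq; [apply is_lim_seq_mult'; [apply is_lim_seq_const|apply is_lim_seq_exp_opp]|]. ring.
Qed.

Definition unif_on (a b : R) (fn : nat -> R -> C) (f : R -> C) : Prop :=
  forall eps, 0 < eps -> eventually (fun n => forall y, a <= y <= b -> Cmod (fn n y - f y) <= eps).

Lemma CI_lim fn f a b : a <= b -> (forall n, Ccont (fn n)) -> Ccont f -> unif_on a b fn f ->
  Clim (fun n => CI (fn n) a b) (CI f a b).
Proof.
  intros Hab Hn Hf H. apply is_lim_seq_spec. intro eps.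
  assert (He : 0 < eps / (b - a + 1)) by (apply Rdiv_lt_0_compat; [apply cond_pos|lra]).
  destruct (H _ He) as [N HN]. exists N. intros n HnN.
  rewrite Rminus_0_r, Rabs_pos_eq by apply Cmod_ge_0.
  rewrite <- CI_minus by auto. eapply Rle_lt_trans.
  - apply (CI_bound_const _ (eps / (b - a + 1))); auto. apply Ccont_minus; auto.
  - apply Rmult_lt_reg_r with (b - a + 1); [lra|]. field_simplify; [|lra].
    pose proof (cond_pos eps). nra.
Qed.

(** A common exponential bound takes the place of dominated convergence: it makes the tails
    uniformly small, and uniform convergence settles the remaining segment. *)
Lemma Int0_lim B fn f : (forall n, dec0 B (fn n)) -> dec0 B f ->
  (forall b, 0 <= b -> unif_on 0 b fn f) -> Clim (fun n => Int0 (fn n)) (Int0 f).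
Proof.
  intros Hn Hf H. apply is_lim_seq_spec. intro eps.
  pose proof (dec0_pos _ _ Hf) as HB. pose proof (cond_pos eps) as He.
  (* The two tails beyond [b] cost [2 B exp (- b)], less than half of [eps]; the segment gets the
     other half. *)
  assert (Hb : exists b, 0 <= b /\ 4 * B * exp (- b) < eps).
  { assert (L : is_lim_seq (fun n => 4 * B * exp (- INR n)) 0).
    { eapply is_lim_seq_real_eq; [apply is_lim_seq_mult'; [apply is_lim_seq_const|apply is_lim_seq_exp_opp]|]. ring. }
    apply is_lim_seq_spec in L. destruct (L eps) as [N HN]. exists (INR N). split; [apply pos_INR|].
    specialize (HN N (le_n _)). rewrite Rminus_0_r in HN. eapply Rle_lt_trans; [apply Rle_abs|apply HN]. }
  destruct Hb as [b [Hb0 Hb]].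
  assert (L := CI_lim fn f 0 b Hb0 (fun n => proj1 (Hn n)) (proj1 Hf) (H b Hb0)).
  assert (He2 : 0 < eps / 2) by lra.
  destruct (Clim_eventually _ _ _ He2 L) as [N HN]. exists N. intros n Hn'.
  rewrite Rminus_0_r, Rabs_pos_eq by apply Cmod_ge_0. specialize (HN n Hn').
  pose proof (Int0_tail B (fn n) b (Hn n) Hb0). pose proof (Int0_tail B f b Hf Hb0).
  pose proof (Cmod_dist_triangle (Int0 (fn n)) (CI (fn n) 0 b) (Int0 f)).
  pose proof (Cmod_dist_triangle (CI (fn n) 0 b) (CI f 0 b) (Int0 f)).
  rewrite (Cmod_minus_sym (CI f 0 b)) in H3. lra.
Qed.

Lemma Int0_shift B f v : 0 <= v -> dec0 B f -> Int0 (fun y => f (y + v)) = (Int0 f - CI f 0 v)%C.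
Proof.
  intros Hv H. apply Int0_unique.
  apply Clim_squeeze with (fun n => B * exp (- INR n)).
  - exists O. intros n _. rewrite CI_shift by apply H.
    rewrite Rplus_0_l. rewrite <- (CI_minus_Chasles f 0 v) by apply H.
    replace (CI f 0 (INR n + v) - CI f 0 v - (Int0 f - CI f 0 v))%C
      with (- (Int0 f - CI f 0 (INR n + v)))%C by ring.
    rewrite Cmod_opp. pose proof (pos_INR n).
    eapply Rle_trans; [apply (Int0_tail B); auto; lra|].
    apply Rmult_le_compat_l; [eapply dec0_pos; eassumption|].
    destruct Hv; [left; apply exp_increasing; lra|right; f_equal; lra].
  - eapply is_lim_seq_real_eq; [apply is_lim_seq_mult'; [apply is_lim_seq_const|apply is_lim_seq_exp_opp]|]. ring.
Qed.

Definition IntR (f : R -> C) : C := (Int0 f + Int0 (fun y => f (- y)%R))%C.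

Definition decR (B : R) (f : R -> C) : Prop :=
  Ccont f /\ forall y, Cmod (f y) <= B * exp (- Rabs y).

Lemma decR_dec0 B f : decR B f -> dec0 B f.
Proof.
  intros [Hc Hf]. split; auto. intros y Hy. rewrite <- (Rabs_pos_eq y) at 2 by auto. auto.
Qed.

Lemma decR_neg B f : decR B f -> decR B (fun y => f (- y)%R).
Proof.
  intros [Hc Hf]. split.
  - apply (Ccont_comp f Ropp); auto. intro; apply continuous_R; reg.
  - intros. rewrite <- Rabs_Ropp. auto.
Qed.

Lemma CI_neg f b : Ccont f -> CI (fun y => f (- y)%R) 0 b = CI f (- b) 0.
Proof.
  intros Hf. generalize (CI_comp_lin f (-1) 0 0 b Hf).
  rewrite <- (CI_minus_Chasles f 0 (- b) 0) by auto. rewrite CI_point.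
  replace (-1 * 0 + 0) with 0 by ring. replace (-1 * b + 0) with (- b) by ring.
  intros <-. rewrite (CI_ext (fun y => f (- y)%R) (fun y => f (-1 * y + 0))).
  - replace (RtoC (-1)) with (- RtoC 1)%C by (Ceq; ring). ring.
  - intros. f_equal. ring.
Qed.

Lemma IntR_tail B f a b : decR B f -> a <= 0 <= b ->
  Cmod (IntR f - CI f a b) <= B * (exp a + exp (- b)).
Proof.
  intros H Hab. rewrite <- (CI_Chasles f a 0 b) by apply H. unfold IntR.
  replace a with (- - a) at 1 by ring. rewrite <- CI_neg by apply H.
  replace (Int0 f + Int0 (fun y => f (- y)%R) - (CI (fun y => f (- y)%R) 0 (- a) + CI f 0 b))%C
    with ((Int0 (fun y => f (- y)%R) - CI (fun y => f (- y)%R) 0 (- a)) + (Int0 f - CI f 0 b))%C by ring.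
  eapply Rle_trans; [apply Cmod_triangle|]. rewrite Rmult_plus_distr_l. apply Rplus_le_compat.
  - replace a with (- - a) at 2 by ring. apply Int0_tail; [apply decR_dec0, decR_neg; auto|lra].
  - apply Int0_tail; [apply decR_dec0; auto|lra].
Qed.

Lemma IntR_unique B f l : decR B f -> Clim (fun n => CI f (- INR n) (INR n)) l -> IntR f = l.
Proof.
  intros H Hl. apply Clim_unique with (2 := Hl).
  apply Clim_squeeze with (fun n => B * (exp (- INR n) + exp (- INR n))).
  - exists O. intros n _. rewrite Cmod_minus_sym. apply IntR_tail; auto. pose proof (pos_INR n); lra.
  - eapply is_lim_seq_real_eq; [apply is_lim_seq_mult'; [apply is_lim_seq_const|apply is_lim_seq_plus'; apply is_lim_seq_exp_opp]|]. ring.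
Qed.

Lemma IntR_lim B fn f : (forall n, decR B (fn n)) -> decR B f ->
  (forall b, 0 <= b -> unif_on (- b) b fn f) -> Clim (fun n => IntR (fn n)) (IntR f).
Proof.
  intros Hn Hf H. apply Clim_plus; apply Int0_lim with B; intros;
  try apply decR_dec0; try apply decR_neg; auto.
  - intros eps He. destruct (H b H0 eps He) as [N HN]. exists N. intros; apply HN; auto. lra.
  - intros eps He. destruct (H b H0 eps He) as [N HN]. exists N. intros; apply HN; auto. lra.
Qed.

Lemma IntR_plus B B' f g : decR B f -> decR B' g ->
  IntR (fun y => f y + g y)%C = (IntR f + IntR g)%C.
Proof.
  intros Hf Hg. unfold IntR.
  rewrite (Int0_plus B B' f g) by (apply decR_dec0; auto).
  rewrite (Int0_plus B B' (fun y => f (- y)%R) (fun y => g (- y)%R)) by (apply decR_dec0, decR_neg; auto).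
  ring.
Qed.

Lemma IntR_scal B c f : decR B f -> IntR (fun y => c * f y)%C = (c * IntR f)%C.
Proof.
  intros Hf. unfold IntR.
  rewrite (Int0_scal B c f) by (apply decR_dec0; auto).
  rewrite (Int0_scal B c (fun y => f (- y)%R)) by (apply decR_dec0, decR_neg; auto).
  ring.
Qed.

Lemma IntR_ext f g : (forall y, f y = g y) -> IntR f = IntR g.
Proof. intros H. unfold IntR. f_equal; apply Int0_ext; auto. Qed.

Lemma decR_pos B f : decR B f -> 0 <= B.
Proof. intros H. eapply dec0_pos, decR_dec0, H. Qed.

Lemma decR_shift B f v : decR B f -> decR (B * exp (Rabs v)) (fun y => f (y + v)).
Proof.
  intros H. pose proof (decR_pos _ _ H) as HB. destruct H as [Hc Hf]. split.
  - apply (Ccont_comp f (fun y => y + v)); auto. intro; apply continuous_R; reg.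
  - intros y. eapply Rle_trans; [apply Hf|]. rewrite Rmult_assoc, <- exp_plus.
    apply Rmult_le_compat_l; auto. pose proof (Rabs_triang (y + v) (- v)).
    rewrite Rabs_Ropp in H. replace (y + v + - v) with y in H by ring.
    assert (E : - Rabs (y + v) <= Rabs v + - Rabs y) by lra.
    destruct E as [E|E]; [left; apply exp_increasing; auto|right; f_equal; auto].
Qed.

Lemma exp_le_exp a b : a <= b -> exp a <= exp b.
Proof. intros [H|H]; [left; apply exp_increasing; auto|right; f_equal; auto]. Qed.

Lemma IntR_shift B f v : decR B f -> IntR (fun y => f (y + v)) = IntR f.
Proof.
  intros H. pose proof (decR_pos _ _ H) as HB.
  apply IntR_unique with (B * exp (Rabs v)); [apply decR_shift; auto|].
  apply Clim_squeeze with (fun n => B * exp (Rabs v) * (exp (- INR n) + exp (- INR n))).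
  - destruct (nfloor_ex (Rabs v) (Rabs_pos v)) as [N [_ HN]]. exists (S N). intros n Hn.
    apply le_INR in Hn. rewrite S_INR in Hn.
    assert (Hv := Rle_abs v). assert (Hv' := Rle_abs (- v)). rewrite Rabs_Ropp in Hv'.
    rewrite CI_shift by apply H. rewrite Cmod_minus_sym.
    eapply Rle_trans; [apply (IntR_tail B); auto; lra|]. rewrite Rmult_assoc.
    apply Rmult_le_compat_l; auto. rewrite Rmult_plus_distr_l, <- !exp_plus.
    apply Rplus_le_compat; apply exp_le_exp; lra.
  - eapply is_lim_seq_real_eq; [apply is_lim_seq_mult'; [apply is_lim_seq_const|apply is_lim_seq_plus'; apply is_lim_seq_exp_opp]|]. ring.
Qed.

(** * Finite sums and partial sums of the exponential series *)

Fixpoint csum (n : nat) (a : nat -> C) : C :=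
  match n with O => RtoC 0 | S m => (csum m a + a m)%C end.

Lemma csum_ext n a b : (forall k, (k < n)%nat -> a k = b k) -> csum n a = csum n b.
Proof.
  induction n; intros H; simpl; auto. rewrite IHn by (intros; apply H; lia). rewrite H by lia. auto.
Qed.

Lemma csum_shift n a : csum (S n) a = (a O + csum n (fun k => a (S k)))%C.
Proof.
  induction n; [simpl; ring|]. cbn [csum] in *. rewrite IHn. ring.
Qed.

Lemma csum_scal n c a : csum n (fun k => c * a k)%C = (c * csum n a)%C.
Proof. induction n; simpl; [ring|]. rewrite IHn. ring. Qed.

Lemma csum_plus n a b : csum n (fun k => a k + b k)%C = (csum n a + csum n b)%C.
Proof. induction n; simpl; [ring|]. rewrite IHn. ring. Qed.

Lemma csum_sum_n n a : csum (S n) a = sum_n a n.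
Proof.
  induction n.
  - rewrite sum_O. simpl. ring.
  - rewrite sum_Sn. change (csum (S (S n)) a) with (csum (S n) a + a (S n))%C. rewrite IHn. reflexivity.
Qed.

Lemma Ccont_csum n (a : nat -> R -> C) : (forall k, Ccont (a k)) -> Ccont (fun y => csum n (fun k => a k y)).
Proof.
  intros H. induction n; simpl; [apply Ccont_const|]. apply Ccont_plus; auto.
Qed.

Definition exp_sum (m : nat) (w : C) : C := csum m (fun k => w ^ k / INR (fact k))%C.

Lemma C_fact_neq_0 k : RtoC (INR (fact k)) <> RtoC 0.
Proof. intros E. apply (INR_fact_neq_0 k). now apply RtoC_inj. Qed.

Lemma Cderiv_exp_sum w m :
  Cderiv (fun s => exp_sum (S m) (s * w)) (fun s => w * exp_sum m (s * w))%C.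
Proof.
  induction m.
  - unfold exp_sum; simpl. eapply Cderiv_ext; [| |apply (Cderiv_const 1)].
    + intros; simpl. field.
    + intros; cbv beta. now rewrite Cmult_0_r.
  - assert (Hw : Cderiv (fun s => s * w)%C (fun _ => w)).
    { eapply Cderiv_ext; [| |apply Cderiv_mult; [apply Cderiv_id|apply (Cderiv_const w)]]; intros; simpl; ring. }
    eapply Cderiv_ext.
    3:{ apply Cderiv_plus; [apply IHm|]. apply (Cderiv_scal (/ INR (fact (S m))) _ _ (Cderiv_pow _ _ m Hw)). }
    + intros y. unfold exp_sum. cbn [csum]. unfold Cdiv. ring.
    + intros y. unfold exp_sum. cbn [csum]. rewrite fact_simpl, mult_INR, RtoC_mult.
      pose proof (C_fact_neq_0 m).
      assert (RtoC (INR (S m)) <> RtoC 0) by (intros E; apply (not_0_INR (S m)); [lia|now apply RtoC_inj]).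
      field. auto.
Qed.

(** Along the ray [t * w] the derivative of the remainder of order [m + 1] is [w] times the
    remainder of order [m], so the bound follows by integrating the previous one. *)
Lemma exp_sum_rem_ray w m s : 0 <= s ->
  Cmod (Cexp (s * w) - exp_sum m (s * w)) <= (s * Cmod w) ^ m / INR (fact m) * exp (s * Cmod w).
Proof.
  revert s. induction m; intros s Hs.
  - unfold exp_sum; simpl. replace (Cexp (s * w) - 0)%C with (Cexp (s * w)) by ring.
    rewrite Cmod_Cexp. replace (1 / 1 * exp (s * Cmod w)) with (exp (s * Cmod w)) by field.
    apply exp_le_exp. replace (s * Cmod w) with (Cmod (s * w)).
    + apply Rle_trans with (2 := re_le_Cmod _). apply Rle_abs.
    + rewrite Cmod_mult, Cmod_R, Rabs_pos_eq; auto.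
  - set (r := fun k t => (Cexp (RtoC t * w) - exp_sum k (RtoC t * w))%C).
    assert (Hw : Cderiv (fun s => s * w)%C (fun _ => w)).
    { eapply Cderiv_ext; [| |apply Cderiv_mult; [apply Cderiv_id|apply (Cderiv_const w)]]; intros; simpl; ring. }
    assert (Hr : Cderiv (r (S m)) (fun t => w * r m t)%C).
    { unfold r. eapply Cderiv_ext.
      3:{ apply Cderiv_plus; [apply Cderiv_Cexp, Hw|apply (Cderiv_scal (- (1))%C _ _ (Cderiv_exp_sum w m))]. }
      - intros; cbv beta; ring. - intros; cbv beta; ring. }
    assert (Hc : Ccont (fun t => w * r m t)%C).
    { apply Ccont_mult; [apply Ccont_const|]. unfold r. 
      apply Ccont_minus; [apply Ccont_Cexp; eapply Cderiv_cont, Hw|].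
      unfold exp_sum. apply Ccont_csum. intros k. apply Ccont_mult; [|apply Ccont_const].
      apply Ccont_pow. eapply Cderiv_cont, Hw. }
    assert (E : r (S m) s = CI (fun t => w * r m t)%C 0 s).
    { rewrite (CI_FTC _ _ _ _ Hr Hc). unfold r at 3.
      replace (RtoC 0 * w)%C with (RtoC 0) by ring. rewrite Cexp_0.
      unfold exp_sum. rewrite csum_shift. simpl (0 ^ 0)%C.
      rewrite (csum_ext _ _ (fun k => 0 * 1)%C), csum_scal.
      - simpl fact. simpl INR. field.
      - intros k _. unfold Cdiv. simpl. ring. }
    fold (r (S m) s). rewrite E.
    (* With the exponential frozen at its value at [s], the majorant below is the exact derivative
       of a monomial. *)
    set (c := exp (s * Cmod w)). set (W := Cmod w) in *.
    assert (HW : 0 <= W) by apply Cmod_ge_0.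
    eapply Rle_trans; [apply (CI_bound _ (fun t => c * W * (t * W) ^ m / INR (fact m))); auto|].
    + intro; apply continuous_R; reg.
    + intros y Hy. rewrite Cmod_mult. fold W.
      apply Rle_trans with (W * ((y * W) ^ m / INR (fact m) * exp (y * W))).
      * apply Rmult_le_compat_l; auto. apply IHm; lra.
      * replace (c * W * (y * W) ^ m / INR (fact m)) with (W * ((y * W) ^ m / INR (fact m) * c))
          by (unfold Rdiv; ring).
        apply Rmult_le_compat_l; auto. apply Rmult_le_compat_l.
        -- apply Rmult_le_pos; [apply pow_le; nra|left; apply Rinv_0_lt_compat, INR_fact_lt_0].
        -- apply exp_le_exp. apply Rmult_le_compat_r; lra.
    + right. apply is_RInt_unique.
      assert (HI : is_RInt (fun t => c * W * (t * W) ^ m / INR (fact m)) 0 s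
        (minus ((s * W) ^ S m / INR (fact (S m)) * c) ((0 * W) ^ S m / INR (fact (S m)) * c))).
      { apply (is_RInt_derive (V := R_CompleteNormedModule) (fun t => (t * W) ^ S m / INR (fact (S m)) * c)).
        - intros t _. rewrite fact_simpl, mult_INR.
          pose proof (INR_fact_neq_0 m). pose proof (not_0_INR (S m) ltac:(lia)) as HS.
          rewrite S_INR in HS |- *. set (q := INR (fact m)) in *.
          eapply is_derive_eq; [auto_derive; auto|].
          match goal with |- @eq _ ?a ?b => change (@eq R a b) end.
          assert (Hm : match m with O => 1 | S _ => INR m + 1 end = INR m + 1) by (clear; destruct m; [simpl; ring|reflexivity]).
          rewrite Hm. field. auto.
        - intros. apply continuous_R. reg. }
      replace ((s * W) ^ S m / INR (fact (S m)) * c) with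
        (minus ((s * W) ^ S m / INR (fact (S m)) * c) ((0 * W) ^ S m / INR (fact (S m)) * c)); auto.
      unfold minus, plus, opp; simpl. unfold Rdiv. ring.
Qed.

Lemma exp_sum_rem m w :
  Cmod (Cexp w - exp_sum m w) <= Cmod w ^ m / INR (fact m) * exp (Cmod w).
Proof.
  generalize (exp_sum_rem_ray w m 1 Rle_0_1). now rewrite Cmult_1_l, Rmult_1_l.
Qed.

Lemma exp_sum_rem_weak m w :
  Cmod (Cexp w - exp_sum m w) <= Cmod w ^ m * exp (Cmod w).
Proof.
  eapply Rle_trans; [apply exp_sum_rem|]. apply Rmult_le_compat_r; [left; apply exp_pos|].
  assert (1 <= INR (fact m)) by (apply (le_INR 1), lt_O_fact).
  pose proof (pow_le (Cmod w) m (Cmod_ge_0 w)).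
  apply Rmult_le_reg_r with (INR (fact m)); [lra|]. field_simplify; [|lra]. nra.
Qed.

Lemma is_lim_seq_pow_fact W : is_lim_seq (fun n => W ^ n / INR (fact n)) 0.
Proof. apply is_lim_seq_Reals, cv_speed_pow_fact. Qed.

Lemma exp_sum_unif W eps : 0 < eps -> 0 <= W ->
  eventually (fun n => forall w, Cmod w <= W -> Cmod (exp_sum n w - Cexp w) <= eps).
Proof.
  intros He HW.
  assert (L : is_lim_seq (fun n => W ^ n / INR (fact n) * exp W) 0).
  { eapply is_lim_seq_real_eq; [apply is_lim_seq_mult'; [apply is_lim_seq_pow_fact|apply is_lim_seq_const]|]. ring. }
  apply is_lim_seq_spec in L. destruct (L (mkposreal _ He)) as [N HN]. exists N. intros n Hn w Hw.
  specialize (HN n Hn). simpl in HN. rewrite Rminus_0_r in HN.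
  rewrite Cmod_minus_sym. eapply Rle_trans; [apply exp_sum_rem|].
  eapply Rle_trans; [|left; apply Rle_lt_trans with (2 := HN), Rle_abs].
  assert (0 < / INR (fact n)) by apply Rinv_0_lt_compat, INR_fact_lt_0.
  pose proof (Cmod_ge_0 w).
  apply Rmult_le_compat; [apply Rmult_le_pos; [apply pow_le; auto|lra]|left; apply exp_pos| |apply exp_le_exp; auto].
  apply Rmult_le_compat_r; [lra|]. apply pow_incr; auto.
Qed.

(** * Taylor expansions of all orders on the unit disc *)

(** Taylor expansion to order [K] in the form of iterated quotients: [h1] is the quotient of
    [h - h 0] by [z], and the last quotient is only asked to be bounded. No derivative occurs, and
    sums and multiples are handled by induction. *)
Fixpoint jet (K : nat) (h : C -> C) : Prop :=
  match K with
  | O => exists B, forall z, Cmod z <= 1 -> Cmod (h z) <= B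
  | S K' => exists h0 h1, jet K' h1 /\ forall z, Cmod z <= 1 -> h z = (h0 + z * h1 z)%C
  end.

Lemma jet_plus K f g : jet K f -> jet K g -> jet K (fun z => f z + g z)%C.
Proof.
  revert f g. induction K; intros f g; simpl.
  - intros [B H] [B' H']. exists (B + B'). intros. eapply Rle_trans; [apply Cmod_triangle|].
    apply Rplus_le_compat; auto.
  - intros (f0 & f1 & F & E) (g0 & g1 & G & E').
    exists (f0 + g0)%C, (fun z => f1 z + g1 z)%C. split; auto.
    intros. rewrite E, E' by auto. ring.
Qed.

Lemma jet_scal K c f : jet K f -> jet K (fun z => c * f z)%C.
Proof.
  revert f. induction K; intros f; simpl.
  - intros [B H]. exists (Cmod c * B). intros. rewrite Cmod_mult.
    apply Rmult_le_compat_l; auto. apply Cmod_ge_0.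
  - intros (f0 & f1 & F & E). exists (c * f0)%C, (fun z => c * f1 z)%C. split; auto.
    intros. rewrite E by auto. ring.
Qed.

Lemma jet_ext K f g : (forall z, Cmod z <= 1 -> f z = g z) -> jet K f -> jet K g.
Proof.
  destruct K; simpl; intros E.
  - intros [B H]. exists B. intros. rewrite <- E; auto.
  - intros (f0 & f1 & F & E'). exists f0, f1. split; auto. intros; rewrite <- E; auto.
Qed.

(** The entire function with Taylor coefficients [1 / (m + k)!], that is, the remainder of order [m]
    of the exponential divided by [w ^ m]; the first branch fills in its value at 0. *)
Definition exp_tail (m : nat) (w : C) : C :=
  if Ceq_dec w 0 then (/ INR (fact m))%C else ((Cexp w - exp_sum m w) / w ^ m)%C.

Lemma exp_tail_0 w : exp_tail 0 w = Cexp w.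
Proof.
  unfold exp_tail. destruct (Ceq_dec w 0) as [->|H].
  - rewrite Cexp_0. simpl. field.
  - unfold exp_sum; simpl. field.
Qed.

Lemma exp_tail_S m w : exp_tail m w = (/ INR (fact m) + w * exp_tail (S m) w)%C.
Proof.
  unfold exp_tail. destruct (Ceq_dec w 0) as [->|H].
  - ring.
  - unfold exp_sum. cbn [csum]. simpl Cpow. pose proof (C_fact_neq_0 m).
    assert (w ^ m <> 0)%C by (apply Cpow_nz; auto). field. auto.
Qed.

Lemma exp_tail_bound m w : Cmod (exp_tail m w) <= exp (Cmod w).
Proof.
  unfold exp_tail. destruct (Ceq_dec w 0) as [->|H].
  - rewrite Cmod_0, exp_0, Cmod_inv by apply C_fact_neq_0.
    rewrite Cmod_R, Rabs_pos_eq by apply pos_INR.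
    rewrite <- Rinv_1. apply Rinv_le_contravar; [lra|]. apply (le_INR 1), lt_O_fact.
  - rewrite Cmod_div by (apply Cpow_nz; auto). rewrite Cmod_pow.
    assert (0 < Cmod w ^ m) by (apply pow_lt, Cmod_gt_0; auto).
    apply Rmult_le_reg_r with (Cmod w ^ m); auto. unfold Rdiv. rewrite Rmult_assoc, Rinv_l, Rmult_1_r by lra.
    rewrite Rmult_comm. apply exp_sum_rem_weak.
Qed.

Lemma jet_exp_tail K m c : jet K (fun z => exp_tail m (c * z)).
Proof.
  revert m. induction K; intro m; simpl.
  - exists (exp (Cmod c)). intros. eapply Rle_trans; [apply exp_tail_bound|].
    apply exp_le_exp. rewrite Cmod_mult. pose proof (Cmod_ge_0 c). nra.
  - exists (/ INR (fact m))%C, (fun z => c * exp_tail (S m) (c * z))%C. split.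
    + apply jet_scal; auto.
    + intros. rewrite exp_tail_S. ring.
Qed.

Lemma jet_Cexp K c : jet K (fun z => Cexp (c * z)).
Proof.
  apply jet_ext with (2 := jet_exp_tail K 0 c). intros. apply exp_tail_0.
Qed.

(** * Laplace's method along a line *)

Definition poly_bound (B : R) (L : nat) (z : R) : R := B * (1 + Rabs z) ^ L.

Lemma pow_1_Rabs L z : 1 <= (1 + Rabs z) ^ L.
Proof. apply pow_R1_Rle. pose proof (Rabs_pos z); lra. Qed.

Lemma poly_bound_le B B' L L' z : 0 <= B -> B <= B' -> (L <= L')%nat ->
  poly_bound B L z <= poly_bound B' L' z.
Proof.
  intros HB H HL. unfold poly_bound. apply Rmult_le_compat; auto.
  - pose proof (pow_1_Rabs L z); lra.
  - apply Rle_pow; auto. pose proof (Rabs_pos z); lra.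
Qed.

Definition signed (s : bool) (c : C) : C := if s then (- c)%C else c.

(** The flag is the parity, [true] for odd. It is carried along because odd functions integrate to 0
    against the Gaussian, which removes the half-integral powers of [X]. *)
Definition nice (s : bool) (p : R -> C) : Prop :=
  Ccont p /\ (forall z, p (- z)%R = signed s (p z)) /\
  exists B L, 0 <= B /\ forall z, Cmod (p z) <= poly_bound B L z.

Lemma nice_0 s : nice s (fun _ => RtoC 0).
Proof.
  split; [apply Ccont_const|split].
  - intros. destruct s; simpl; ring.
  - exists 0, O. split; [lra|]. intros. rewrite Cmod_0. unfold poly_bound. lra.
Qed.

Lemma nice_monomial c l : nice (Nat.odd l) (fun z => c * z ^ l)%C.
Proof.
  split; [|split].
  - apply Ccont_mult; [apply Ccont_const|apply Ccont_pow, Ccont_id].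
  - intros z. induction l.
    + simpl. reflexivity.
    + rewrite Nat.odd_succ, <- Nat.negb_odd. simpl Cpow.
      replace (c * (RtoC (- z) * RtoC (- z) ^ l))%C with (RtoC (- z) * (c * RtoC (- z) ^ l))%C by ring.
      rewrite IHl. rewrite RtoC_opp. destruct (Nat.odd l); simpl; ring.
  - exists (Cmod c), l. split; [apply Cmod_ge_0|]. intros z.
    rewrite Cmod_mult, Cmod_pow, Cmod_R. apply Rmult_le_compat_l; [apply Cmod_ge_0|].
    apply pow_incr. pose proof (Rabs_pos z); lra.
Qed.

Lemma nice_plus s p q : nice s p -> nice s q -> nice s (fun z => p z + q z)%C.
Proof.
  intros (C1 & P1 & B & L & HB & H) (C2 & P2 & B' & L' & HB' & H'). split; [|split].
  - apply Ccont_plus; auto.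
  - intros. rewrite P1, P2. destruct s; simpl; ring.
  - exists (B + B'), (L + L')%nat. split; [lra|]. intros z.
    eapply Rle_trans; [apply Cmod_triangle|].
    unfold poly_bound. rewrite Rmult_plus_distr_r. apply Rplus_le_compat.
    + eapply Rle_trans; [apply H|apply poly_bound_le; auto; [lra|lia]].
    + eapply Rle_trans; [apply H'|apply poly_bound_le; auto; [lra|lia]].
Qed.

Lemma nice_mult s t p q : nice s p -> nice t q -> nice (xorb s t) (fun z => p z * q z)%C.
Proof.
  intros (C1 & P1 & B & L & HB & H) (C2 & P2 & B' & L' & HB' & H'). split; [|split].
  - apply Ccont_mult; auto.
  - intros. rewrite P1, P2. destruct s, t; simpl; ring.
  - exists (B * B'), (L + L')%nat. split; [nra|]. intros z.
    rewrite Cmod_mult. unfold poly_bound. rewrite pow_add.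
    replace (B * B' * ((1 + Rabs z) ^ L * (1 + Rabs z) ^ L'))
      with (poly_bound B L z * poly_bound B' L' z) by (unfold poly_bound; ring).
    apply Rmult_le_compat; auto; apply Cmod_ge_0.
Qed.

(* [e] is the small parameter [1 / sqrt X], or [i] times it, and [z] the rescaled variable. *)
Definition dom (eta : R) (e : C) (z : R) : Prop :=
  0 < Cmod e <= 1 /\ Cmod (e * z) <= eta.

Definition ord0 (eta : R) (Q : C -> R -> C) : Prop :=
  exists B L, 0 <= B /\ forall e z, dom eta e z -> Cmod (Q e z) <= poly_bound B L z.

(* An expansion in powers of [e] whose [k]-th coefficient has the parity of [k] (shifted by [s]). *)
Fixpoint hasexp (eta : R) (s : bool) (K : nat) (Q : C -> R -> C) : Prop :=
  match K with
  | O => ord0 eta Q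
  | S K' => exists p Q1, nice s p /\ hasexp eta (negb s) K' Q1 /\
              forall e z, dom eta e z -> Q e z = (p z + e * Q1 e z)%C
  end.

Lemma ord0_plus eta P Q : ord0 eta P -> ord0 eta Q -> ord0 eta (fun e z => P e z + Q e z)%C.
Proof.
  intros (B & L & HB & H) (B' & L' & HB' & H').
  exists (B + B'), (L + L')%nat. split; [lra|]. intros e z Hd.
  eapply Rle_trans; [apply Cmod_triangle|].
  unfold poly_bound. rewrite Rmult_plus_distr_r. apply Rplus_le_compat.
  - eapply Rle_trans; [apply H; auto|apply poly_bound_le; auto; [lra|lia]].
  - eapply Rle_trans; [apply H'; auto|apply poly_bound_le; auto; [lra|lia]].
Qed.

Lemma ord0_mult eta P Q : ord0 eta P -> ord0 eta Q -> ord0 eta (fun e z => P e z * Q e z)%C.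
Proof.
  intros (B & L & HB & H) (B' & L' & HB' & H').
  exists (B * B'), (L + L')%nat. split; [nra|]. intros e z Hd.
  rewrite Cmod_mult. unfold poly_bound. rewrite pow_add.
  replace (B * B' * ((1 + Rabs z) ^ L * (1 + Rabs z) ^ L'))
    with (poly_bound B L z * poly_bound B' L' z) by (unfold poly_bound; ring).
  apply Rmult_le_compat; auto; apply Cmod_ge_0.
Qed.

Lemma ord0_e eta P : ord0 eta P -> ord0 eta (fun e z => e * P e z)%C.
Proof.
  intros (B & L & HB & H). exists B, L. split; auto. intros e z Hd.
  rewrite Cmod_mult. specialize (H e z Hd). destruct Hd as [[H1 H2] _].
  pose proof (Cmod_ge_0 (P e z)). nra.
Qed.

Lemma ord0_nice eta s p : nice s p -> ord0 eta (fun _ z => p z).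
Proof. intros (_ & _ & B & L & HB & H). exists B, L. auto. Qed.

Lemma hasexp_ext eta s K P Q : (forall e z, dom eta e z -> P e z = Q e z) ->
  hasexp eta s K P -> hasexp eta s K Q.
Proof.
  destruct K; simpl; intros E.
  - intros (B & L & HB & H). exists B, L. split; auto. intros. rewrite <- E; auto.
  - intros (p & Q1 & H1 & H2 & H3). exists p, Q1. split; [|split]; auto. intros. rewrite <- E; auto.
Qed.

Lemma hasexp_ord0 eta s K Q : hasexp eta s K Q -> ord0 eta Q.
Proof.
  revert s Q. induction K; intros s Q; simpl; auto.
  intros (p & Q1 & H1 & H2 & H3).
  apply (hasexp_ext eta s 0 (fun e z => p z + e * Q1 e z)%C).
  - intros; symmetry; auto.
  - apply ord0_plus; [eapply ord0_nice, H1|apply ord0_e; eauto].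
Qed.

Lemma hasexp_S eta s K Q : hasexp eta s (S K) Q -> hasexp eta s K Q.
Proof.
  revert s Q. induction K; intros s Q H.
  - apply hasexp_ord0 in H. exact H.
  - destruct H as (p & Q1 & H1 & H2 & H3). exists p, Q1. split; [|split]; auto.
Qed.

Lemma hasexp_nice eta s K p : nice s p -> hasexp eta s K (fun _ z => p z).
Proof.
  revert s p. induction K; intros s p H; [apply ord0_nice with s; auto|].
  exists p, (fun _ _ => RtoC 0). split; [|split]; auto.
  - apply (IHK (negb s) (fun _ => RtoC 0)), nice_0.
  - intros; ring.
Qed.

Lemma hasexp_plus eta s K P Q : hasexp eta s K P -> hasexp eta s K Q ->
  hasexp eta s K (fun e z => P e z + Q e z)%C.
Proof.
  revert s P Q. induction K; intros s P Q; [apply ord0_plus|].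
  intros (p & P1 & H1 & H2 & H3) (q & Q1 & G1 & G2 & G3).
  exists (fun z => p z + q z)%C, (fun e z => P1 e z + Q1 e z)%C. split; [|split]; auto.
  - apply nice_plus; auto.
  - intros. rewrite H3, G3 by auto. ring.
Qed.

(** With [P = p + e P1] and [Q = q + e Q1], the product is [p q + e (P1 Q + p Q1)]: keeping [Q]
    whole in the first cross term avoids a term in [e ^ 2]. This is why [Q] is also needed at the
    lower order [K]. *)
Lemma hasexp_mult eta s t K P Q : hasexp eta s K P -> hasexp eta t K Q ->
  hasexp eta (xorb s t) K (fun e z => P e z * Q e z)%C.
Proof.
  revert s t P Q. induction K; intros s t P Q; [apply ord0_mult|].
  intros HP HQ. pose proof (hasexp_S _ _ _ _ HQ) as HQ'.
  destruct HP as (p & P1 & H1 & H2 & H3). destruct HQ as (q & Q1 & G1 & G2 & G3).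
  exists (fun z => p z * q z)%C, (fun e z => P1 e z * Q e z + p z * Q1 e z)%C. split; [|split].
  - apply nice_mult; auto.
  - apply hasexp_plus.
    + replace (negb (xorb s t)) with (xorb (negb s) t) by (destruct s, t; auto). auto.
    + replace (negb (xorb s t)) with (xorb s (negb t)) by (destruct s, t; auto).
      apply IHK; auto. apply hasexp_nice; auto.
  - intros. rewrite H3 at 1 by auto. rewrite (G3 e z) at 1 by auto. rewrite (G3 e z) by auto. ring.
Qed.

Lemma hasexp_scal eta s K c Q : hasexp eta s K Q -> hasexp eta s K (fun e z => c * Q e z)%C.
Proof.
  intros H. apply (hasexp_mult eta false s K (fun _ _ => c)); auto.
  apply (hasexp_nice eta false K (fun _ => c)).
  destruct (nice_monomial c 0) as (H1 & H2 & H3).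
  split; [apply Ccont_const|split]; auto.
  destruct H3 as (B & L & HB & H3). exists B, L. split; auto.
  intros z. specialize (H3 z). simpl in H3. now rewrite Cmult_1_r in H3.
Qed.

Lemma hasexp_e eta s K Q : hasexp eta (negb s) K Q -> hasexp eta s K (fun e z => e * Q e z)%C.
Proof.
  intros H. apply hasexp_S. exists (fun _ => RtoC 0), Q. split; [|split]; auto.
  - apply nice_0.
  - intros; ring.
Qed.

(** Each Taylor quotient trades a power of [e] for a power of [z], so the coefficient of [e ^ k] is
    a multiple of [z ^ (k + l)] and has its parity. *)
Lemma hasexp_jet eta K h l : eta <= 1 -> jet K h ->
  hasexp eta (Nat.odd l) K (fun e z => z ^ l * h (e * z))%C.
Proof.
  intros Heta. revert h l. induction K; intros h l H.
  - destruct H as [B H]. exists (Rabs B), l. split; [apply Rabs_pos|]. intros e z [_ Hd].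
    rewrite Cmod_mult, Cmod_pow, Cmod_R, Rmult_comm. unfold poly_bound.
    apply Rmult_le_compat; [apply Cmod_ge_0|apply pow_le, Rabs_pos| |].
    + apply Rle_trans with B; [apply H; lra|apply Rle_abs].
    + apply pow_incr. pose proof (Rabs_pos z); lra.
  - destruct H as (h0 & h1 & H1 & H2).
    exists (fun z => h0 * z ^ l)%C, (fun e z => z ^ S l * h1 (e * z))%C. split; [|split].
    + apply nice_monomial.
    + rewrite Nat.negb_odd, <- Nat.odd_succ. auto.
    + intros e z [_ Hd]. rewrite H2 by lra. simpl. ring.
Qed.

Lemma hasexp_pow eta K Q m : hasexp eta false K Q -> hasexp eta false K (fun e z => Q e z ^ m)%C.
Proof.
  intros H. induction m; simpl.
  - apply (hasexp_nice eta false K (fun _ => RtoC 1)).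
    destruct (nice_monomial 1 0) as (H1 & H2 & H3).
    split; [apply Ccont_const|split]; auto.
    exists 1, O. split; [lra|]. intros. rewrite Cmod_1. unfold poly_bound; simpl; lra.
  - apply (hasexp_mult eta false false); auto.
Qed.

Lemma hasexp_csum eta s K n (Q : nat -> C -> R -> C) : (forall k, hasexp eta s K (Q k)) ->
  hasexp eta s K (fun e z => csum n (fun k => Q k e z)).
Proof.
  intros H. induction n; cbn [csum].
  - apply (hasexp_nice eta s K (fun _ => RtoC 0)), nice_0.
  - apply hasexp_plus; auto.
Qed.

Lemma hasexp_expand eta s K Q : hasexp eta s K Q ->
  exists p : nat -> R -> C, (forall k, nice (xorb s (Nat.odd k)) (p k)) /\
    exists B L, 0 <= B /\ forall e z, dom eta e z ->
      Cmod (Q e z - csum K (fun k => e ^ k * p k z)%C) <= Cmod e ^ K * poly_bound B L z.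
Proof.
  revert s Q. induction K; intros s Q H.
  - destruct H as (B & L & HB & H). exists (fun _ _ => RtoC 0). split; [intro; apply nice_0|].
    exists B, L. split; auto. intros e z Hd. simpl. rewrite Rmult_1_l.
    replace (Q e z - 0)%C with (Q e z) by ring. auto.
  - destruct H as (p0 & Q1 & H1 & H2 & H3). destruct (IHK _ _ H2) as (p & Hp & B & L & HB & H).
    exists (fun k => match k with O => p0 | S k' => p k' end). split.
    + intros [|k].
      * simpl. destruct s; exact H1.
      * rewrite Nat.odd_succ, <- Nat.negb_odd.
        replace (xorb s (negb (Nat.odd k))) with (xorb (negb s) (Nat.odd k)) by (destruct s, (Nat.odd k); auto). auto.
    + exists B, L. split; auto. intros e z Hd. rewrite csum_shift, H3 by auto.
      rewrite (csum_ext _ _ (fun k => e * (e ^ k * p k z))%C) by (intros; simpl; ring).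
      rewrite csum_scal. simpl (e ^ 0)%C.
      replace (p0 z + e * Q1 e z - (1 * p0 z + e * csum K (fun k => e ^ k * p k z)))%C
        with (e * (Q1 e z - csum K (fun k => e ^ k * p k z)))%C by ring.
      rewrite Cmod_mult. simpl. rewrite Rmult_assoc. apply Rmult_le_compat_l; [apply Cmod_ge_0|]. auto.
Qed.

(** * Gaussian weights *)

Lemma pow_le_fact_exp u L : 0 <= u -> u ^ L <= INR (fact L) * exp u.
Proof.
  intros Hu. pose proof (INR_fact_lt_0 L).
  assert (H1 : u ^ L / INR (fact L) <= exp u).
  { pose proof (exp_ge_taylor u L Hu). 
    destruct L; [simpl in *; lra|]. rewrite tech5 in H0. 
    assert (0 <= sum_f_R0 (fun k => u ^ k / INR (fact k)) L).
    { apply cond_pos_sum. intros. apply Rmult_le_pos; [apply pow_le; auto|]. left. apply Rinv_0_lt_compat, INR_fact_lt_0. }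
    lra. }
  apply Rmult_le_compat_r with (r := INR (fact L)) in H1; [|lra].
  unfold Rdiv in H1. rewrite Rmult_assoc, Rinv_l in H1 by lra. lra.
Qed.

Definition gauss (z : R) : R := exp (- (z * z / 2)).

Lemma continuous_gauss : forall z, continuous gauss z.
Proof. intro. apply continuous_R. unfold gauss. reg. Qed.

Lemma gauss_poly_decay B L : 0 <= B -> exists B', 0 <= B' /\
  forall z, exp (- (z * z / 4)) * poly_bound B L z <= B' * exp (- Rabs z).
Proof.
  (* Completing the square, [1 + 2 |z| - z^2 / 4 <= 5]. *)
  intros HB. exists (B * (INR (fact L) * exp 5)).
  pose proof (INR_fact_lt_0 L). pose proof (exp_pos 5). split; [apply Rmult_le_pos; auto; nra|].
  intros z. unfold poly_bound.
  pose proof (Rabs_pos z). pose proof (pow_le_fact_exp (1 + Rabs z) L ltac:(lra)).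
  replace (exp (- (z * z / 4)) * (B * (1 + Rabs z) ^ L)) with (B * ((1 + Rabs z) ^ L * exp (- (z * z / 4)))) by ring.
  rewrite !Rmult_assoc. apply Rmult_le_compat_l; auto. rewrite <- exp_plus.
  eapply Rle_trans; [apply Rmult_le_compat_r; [left; apply exp_pos|apply H2]|].
  rewrite Rmult_assoc, <- exp_plus. apply Rmult_le_compat_l; [lra|]. apply exp_le_exp.
  replace (z * z) with (Rabs z * Rabs z) by (unfold Rabs; destruct (Rcase_abs z); ring).
  pose proof (Rle_0_sqr (Rabs z / 2 - 2)). unfold Rsqr in *. lra.
Qed.

Lemma gauss_le z : gauss z <= exp (- (z * z / 4)).
Proof. apply exp_le_exp. pose proof (Rle_0_sqr z). unfold Rsqr in *. lra. Qed.

Lemma decR_gauss_nice s p : nice s p -> exists B, 0 <= B /\ decR B (fun z => gauss z * p z)%C.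
Proof.
  intros (Hc & _ & B & L & HB & H). destruct (gauss_poly_decay B L HB) as (B' & HB' & H').
  exists B'. split; [auto|split].
  - apply Ccont_mult; auto. apply Ccont_RtoC, continuous_gauss.
  - intros z. eapply Rle_trans; [|apply H']. rewrite Cmod_mult, Cmod_R.
    rewrite Rabs_pos_eq by (left; apply exp_pos).
    apply Rmult_le_compat; [left; apply exp_pos|apply Cmod_ge_0|apply gauss_le|apply H].
Qed.

Lemma IntR_odd B f : decR B f -> (forall y, f (- y)%R = (- f y)%C) -> IntR f = RtoC 0.
Proof.
  intros H Ho. unfold IntR.
  rewrite (Int0_ext (fun y => f (- y)%R) (fun y => - (1) * f y)%C) by (intros; rewrite Ho; ring).
  rewrite (Int0_scal B) by (apply decR_dec0; auto). ring.
Qed.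

Lemma CI_decay_bound B f T : 0 <= T -> 0 <= B -> Ccont f ->
  (forall z, Rabs z <= T -> Cmod (f z) <= B * exp (- Rabs z)) -> Cmod (CI f (- T) T) <= 2 * B.
Proof.
  intros HT HB Hc H. rewrite <- (CI_Chasles f (- T) 0 T), <- CI_neg by auto.
  assert (A : forall g, Ccont g -> (forall z, Rabs z <= T -> Cmod (g z) <= B * exp (- Rabs z)) -> Cmod (CI g 0 T) <= B).
  { intros g Hg Hb. eapply Rle_trans; [apply (CI_bound g (fun y => B * exp (- y))); auto|].
    - apply continuous_exp_opp.
    - intros y Hy. rewrite <- (Rabs_pos_eq y) at 2 by lra. apply Hb. rewrite Rabs_pos_eq; lra.
    - rewrite RInt_exp_opp, Ropp_0, exp_0. pose proof (exp_pos (- T)). nra. }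
  eapply Rle_trans; [apply Cmod_triangle|]. replace (2 * B) with (B + B) by ring.
  apply Rplus_le_compat; apply A; auto.
  - apply (Ccont_comp f Ropp); auto. intro; apply continuous_R; reg.
  - intros. rewrite <- Rabs_Ropp. apply H. now rewrite Rabs_Ropp.
Qed.

Lemma CI_csum n (a : nat -> R -> C) x y : (forall k, Ccont (a k)) ->
  CI (fun z => csum n (fun k => a k z)) x y = csum n (fun k => CI (a k) x y).
Proof.
  intros H. induction n; cbn [csum].
  - rewrite (CI_ext _ (fun _ => 0 * 1)%C) by (intros; ring). rewrite CI_scal; [ring|apply Ccont_const].
  - rewrite CI_plus; auto; [now rewrite IHn|]. apply Ccont_csum; auto.
Qed.

Lemma csum_bound n (a : nat -> C) : exists D, 0 <= D /\ forall e t, Cmod e <= 1 -> 0 <= t ->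
  forall b : nat -> C, (forall k, Cmod (b k) <= t * Cmod (a k)) ->
  Cmod (csum n (fun k => e ^ k * b k)%C) <= D * t.
Proof.
  induction n.
  - exists 0. split; [lra|]. intros. simpl. rewrite Cmod_0. lra.
  - destruct IHn as (D & HD & H). exists (D + Cmod (a n)). pose proof (Cmod_ge_0 (a n)). split; [lra|].
    intros e t He Ht b Hb. cbn [csum]. eapply Rle_trans; [apply Cmod_triangle|].
    rewrite Rmult_plus_distr_r. apply Rplus_le_compat; [auto|].
    rewrite Cmod_mult, Cmod_pow. specialize (Hb n).
    assert (Cmod e ^ n <= 1). { rewrite <- (pow1 n). apply pow_incr. split; auto. apply Cmod_ge_0. }
    pose proof (pow_le (Cmod e) n (Cmod_ge_0 e)). pose proof (Cmod_ge_0 (b n)). nra.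
Qed.

Lemma Cmod_small_0 c D e0 : 0 < e0 -> (forall e, 0 < e <= e0 -> Cmod c <= e * D) -> c = RtoC 0.
Proof.
  intros He H. apply Cmod_eq_0. apply Rle_antisym; [|apply Cmod_ge_0].
  apply le_epsilon. intros eps Heps. rewrite Rplus_0_l.
  assert (Hd : 0 < Rmin e0 (eps / (Rabs D + 1))).
  { apply Rmin_glb_lt; auto. apply Rdiv_lt_0_compat; auto. pose proof (Rabs_pos D); lra. }
  eapply Rle_trans; [apply H; split; [apply Hd|apply Rmin_l]|].
  pose proof (Rmin_r e0 (eps / (Rabs D + 1))). pose proof (Rle_abs D). pose proof (Rabs_pos D).
  apply Rle_trans with (eps / (Rabs D + 1) * Rabs D).
  - eapply Rle_trans; [apply Rmult_le_compat_l; [lra|apply H1]|]. apply Rmult_le_compat_r; auto.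
  - apply Rmult_le_reg_r with (Rabs D + 1); [lra|]. field_simplify; [|lra]. nra.
Qed.

(** * Expansion of the perturbed Gaussian integrand *)

Lemma csum_even M e (m : nat -> C) : (forall k, Nat.odd k = true -> m k = RtoC 0) ->
  csum (2 * M) (fun k => e ^ k * m k)%C = csum M (fun j => (e * e) ^ j * m (2 * j)%nat)%C.
Proof.
  intros H. induction M; [reflexivity|].
  replace (2 * S M)%nat with (S (S (2 * M))) by lia. cbn [csum]. rewrite IHM.
  rewrite (H (S (2 * M))).
  - replace (e ^ (2 * M))%C with ((e * e) ^ M)%C; [ring|].
    rewrite Cpow_mult_r. f_equal. simpl. ring.
  - rewrite Nat.odd_succ, Nat.even_mul. reflexivity.
Qed.

(** With [e = w / sqrt X] and [y = z / sqrt X], the integrand [exp (X w^2 G (w y)) f (w y)] is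
    [gauss z] times this function, because [X w^2 e^2 = w^4 = 1]. *)
Definition laplace_pert (h f : C -> C) (e : C) (z : R) : C :=
  (Cexp (e * (z ^ 3 * h (e * z))) * f (e * z))%C.

Lemma laplace_exponent_bound h eta B3 e z : eta <= 1 ->
  (forall x, Cmod x <= 1 -> Cmod (h x) <= B3) -> eta * B3 <= 1 / 4 -> dom eta e z ->
  Cmod (e * (z ^ 3 * h (e * z)))%C <= Cmod e * (B3 * Rabs z ^ 3) /\
  Cmod (e * (z ^ 3 * h (e * z)))%C <= z * z / 4.
Proof.
  intros He Hh HB [[H1 H2] H3]. specialize (Hh (e * z)%C ltac:(lra)).
  rewrite !Cmod_mult, Cmod_pow, Cmod_R. rewrite Cmod_mult, Cmod_R in H3.
  pose proof (Rabs_pos z). pose proof (Cmod_ge_0 (h (e * z)%C)). split.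
  - apply Rmult_le_compat_l; [lra|]. rewrite Rmult_comm. apply Rmult_le_compat_r; auto. apply pow_le; auto.
  - replace (z * z) with (Rabs z * Rabs z) by (unfold Rabs; destruct (Rcase_abs z); ring).
    simpl. replace (Cmod e * (Rabs z * (Rabs z * (Rabs z * 1)) * Cmod (h (e * z)%C)))
      with ((Cmod e * Rabs z) * Cmod (h (e * z)%C) * (Rabs z * Rabs z)) by ring.
    assert ((Cmod e * Rabs z) * Cmod (h (e * z)%C) <= 1 / 4).
    { apply Rle_trans with (2 := HB). apply Rmult_le_compat; auto. nra. }
    nra.
Qed.

(** The exponent carries a factor [e], so replacing the exponential by [exp_sum K] costs only
    [Cmod e ^ K]; what remains is built from jets by sums and products. The factor [exp (z * z / 4)]
    in the error uses up half of the Gaussian exponent, which is why [eta] has to keep the exponent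
    below [z * z / 4]. *)
Lemma laplace_pointwise h f eta B3 K : eta <= 1 ->
  (forall x, Cmod x <= 1 -> Cmod (h x) <= B3) -> eta * B3 <= 1 / 4 ->
  jet K h -> jet K f -> jet 0 f ->
  exists p : nat -> R -> C, (forall k, nice (Nat.odd k) (p k)) /\
  exists B L, 0 <= B /\ forall e z, dom eta e z ->
    Cmod (laplace_pert h f e z - csum K (fun k => e ^ k * p k z)%C)
      <= Cmod e ^ K * (poly_bound B L z * exp (z * z / 4)).
Proof.
  intros He Hh HB Jh Jf [Bf Hf].
  set (W := fun (e : C) (z : R) => (e * (z ^ 3 * h (e * z)))%C).
  assert (HW : hasexp eta false K W).
  { apply (hasexp_e eta false K). apply (hasexp_jet eta K h 3); auto. }
  assert (HQ : hasexp eta false K (fun e z => exp_sum K (W e z) * f (e * z))%C).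
  { apply (hasexp_mult eta false false).
    - apply hasexp_csum. intros k.
      apply hasexp_ext with (fun e z => / INR (fact k) * W e z ^ k)%C.
      + intros; unfold Cdiv; ring.
      + apply hasexp_scal, hasexp_pow; auto.
    - apply hasexp_ext with (fun e z => z ^ 0 * f (e * z))%C.
      + intros; simpl; ring.
      + apply (hasexp_jet eta K f 0); auto. }
  destruct (hasexp_expand _ _ _ _ HQ) as (p & Hp & B & L & HB0 & H).
  exists p. split; [exact Hp|].
  pose proof (Rabs_pos Bf) as HBf. pose proof (Rabs_pos B3) as HB3.
  assert (HB3' : 0 <= Rabs B3 ^ K) by (apply pow_le; auto).
  exists (Rabs Bf * Rabs B3 ^ K + B), (3 * K + L)%nat. split; [nra|].
  intros e z Hd. specialize (H e z Hd).
  destruct (laplace_exponent_bound h eta B3 e z He Hh HB Hd) as [W1 W2]. fold (W e z) in W1, W2.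
  specialize (Hf (e * z)%C ltac:(destruct Hd; lra)).
  unfold laplace_pert. fold (W e z).
  eapply Rle_trans; [apply (Cmod_dist_triangle _ (exp_sum K (W e z) * f (e * z))%C)|].
  assert (E1 : 1 <= exp (z * z / 4)).
  { rewrite <- exp_0. apply exp_le_exp. pose proof (Rle_0_sqr z); unfold Rsqr in *; lra. }
  assert (He0 : 0 <= Cmod e ^ K) by (apply pow_le, Cmod_ge_0).
  replace (Cmod e ^ K * (poly_bound (Rabs Bf * Rabs B3 ^ K + B) (3 * K + L) z * exp (z * z / 4)))
    with (Cmod e ^ K * (poly_bound (Rabs Bf * Rabs B3 ^ K) (3 * K + L) z * exp (z * z / 4)) +
          Cmod e ^ K * (poly_bound B (3 * K + L) z * exp (z * z / 4))) by (unfold poly_bound; ring).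
  apply Rplus_le_compat.
  - replace (Cexp (W e z) * f (e * z) - exp_sum K (W e z) * f (e * z))%C
      with (f (e * z) * (Cexp (W e z) - exp_sum K (W e z)))%C by ring.
    rewrite Cmod_mult.
    apply Rle_trans with (Rabs Bf * ((Cmod e ^ K * (Rabs B3 ^ K * (1 + Rabs z) ^ (3 * K + L))) * exp (z * z / 4))).
    + apply Rmult_le_compat; try apply Cmod_ge_0.
      * apply Rle_trans with (1 := Hf), Rle_abs.
      * eapply Rle_trans; [apply exp_sum_rem_weak|].
        apply Rmult_le_compat; [apply pow_le, Cmod_ge_0|left; apply exp_pos| |apply exp_le_exp; auto].
        apply Rle_trans with ((Cmod e * (Rabs B3 * (1 + Rabs z) ^ 3)) ^ K).
        -- apply pow_incr. split; [apply Cmod_ge_0|]. apply Rle_trans with (1 := W1).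
           apply Rmult_le_compat_l; [apply Cmod_ge_0|].
           apply Rmult_le_compat; [|apply pow_le, Rabs_pos|apply Rle_abs|].
           ++ apply Rle_trans with (2 := Hh 0%C ltac:(rewrite Cmod_0; lra)). apply Cmod_ge_0.
           ++ apply pow_incr. pose proof (Rabs_pos z); lra.
        -- rewrite !Rpow_mult_distr, <- pow_mult. apply Rmult_le_compat_l; auto.
           apply Rmult_le_compat_l; auto. apply Rle_pow; [pose proof (Rabs_pos z); lra|lia].
    + right. unfold poly_bound. ring.
  - apply Rle_trans with (1 := H). apply Rmult_le_compat_l; auto.
    pose proof (poly_bound_le B B L (3 * K + L) z HB0 (Rle_refl _) ltac:(lia)).
    assert (0 <= poly_bound B L z) by (unfold poly_bound; pose proof (pow_1_Rabs L z); nra).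
    nra.
Qed.

(** The functions [p] are known only through the estimate, so the leading one is recovered by
    letting [e] tend to 0 along the positive reals at fixed [z]. *)
Lemma laplace_leading_coeff h f eta B3 K (p : nat -> R -> C) B L : 0 < eta <= 1 ->
  (forall x, Cmod x <= 1 -> Cmod (h x) <= B3) -> eta * B3 <= 1 / 4 -> jet 1 f ->
  (forall e z, dom eta e z ->
    Cmod (laplace_pert h f e z - csum (S K) (fun k => e ^ k * p k z)%C)
      <= Cmod e ^ (S K) * (poly_bound B L z * exp (z * z / 4))) ->
  forall z, p O z = f 0.
Proof.
  intros He Hh HB (f0 & f1 & [Bf Hf1] & Hf) H z.
  assert (E0 : f 0 = f0). { rewrite Hf by (rewrite Cmod_0; lra). ring. }
  destruct (csum_bound K (fun k => p (S k) z)) as (D & HD & HDb).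
  (* For [e] up to this value the point stays in the domain: [e <= 1] and [e |z| <= eta]. *)
  assert (Hez : 0 < Rmin 1 (eta / (Rabs z + 1))).
  { apply Rmin_glb_lt; [lra|]. apply Rdiv_lt_0_compat; [lra|]. pose proof (Rabs_pos z); lra. }
  set (ez := Rmin 1 (eta / (Rabs z + 1))) in *.
  set (Ex := exp (z * z / 4)). assert (HEx : 0 < Ex) by apply exp_pos.
  set (Bf' := Rabs Bf). assert (HBf : 0 <= Bf') by apply Rabs_pos.
  set (PB := poly_bound (Rabs B) L z).
  assert (HPB : 0 <= PB). { unfold PB, poly_bound. pose proof (pow_1_Rabs L z). pose proof (Rabs_pos B). nra. }
  enough (E : (p O z - f 0)%C = 0) by (replace (p O z) with (p O z - f 0 + f 0)%C by ring; rewrite E; ring).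
  apply Cmod_small_0 with (D := D + PB * Ex + (Bf' * Rabs z + (Rabs B3 * Rabs z ^ 3) * Ex * (Cmod f0 + Bf'))) (e0 := ez); auto.
  intros e [Hepos Hele].
  assert (He1 : e <= 1) by (apply Rle_trans with (1 := Hele); apply Rmin_l).
  assert (Hme : Cmod (RtoC e) = e) by (rewrite Cmod_R, Rabs_pos_eq; lra).
  assert (Hez2 : e * Rabs z <= eta).
  { apply Rle_trans with (eta / (Rabs z + 1) * Rabs z).
    - apply Rmult_le_compat_r; [apply Rabs_pos|]. apply Rle_trans with (1 := Hele); apply Rmin_r.
    - pose proof (Rabs_pos z). apply Rmult_le_reg_r with (Rabs z + 1); [lra|]. field_simplify; [|lra]. nra. }
  assert (Hd : dom eta e z).
  { split; [lra|]. rewrite Cmod_mult, Hme, Cmod_R. auto. }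
  specialize (H _ _ Hd). rewrite Hme in H.
  destruct (laplace_exponent_bound h eta B3 e z ltac:(lra) Hh HB Hd) as [W1 W2]. rewrite Hme in W1.
  unfold laplace_pert in H. set (W := (RtoC e * (RtoC z ^ 3 * h (RtoC e * RtoC z)))%C) in *.
  rewrite csum_shift in H.
  assert (Hmez : Cmod (RtoC e * RtoC z) <= 1) by (rewrite Cmod_mult, Hme, Cmod_R; lra).
  rewrite (Hf (RtoC e * RtoC z)%C Hmez) in H. specialize (Hf1 _ Hmez).
  set (g1 := f1 (RtoC e * RtoC z)%C) in *. rewrite E0.
  assert (Hg1 : Cmod g1 <= Bf') by (apply Rle_trans with (1 := Hf1), Rle_abs).
  set (S0 := csum K (fun k => RtoC e ^ S k * p (S k) z)%C) in *.
  assert (HS0 : Cmod S0 <= D * e).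
  { unfold S0. rewrite (csum_ext _ _ (fun k => RtoC e ^ k * (RtoC e * p (S k) z))%C) by (intros; simpl; ring).
    apply HDb; [lra|lra|]. intros k. rewrite Cmod_mult, Hme. apply Rle_refl. }
  replace (p O z - f0)%C with (- (Cexp W * (f0 + RtoC e * RtoC z * g1) - (RtoC e ^ 0 * p O z + S0)) - S0
     + (RtoC e * RtoC z * g1 + (Cexp W - 1) * (f0 + RtoC e * RtoC z * g1)))%C by (simpl; ring).
  eapply Rle_trans; [apply Cmod_triangle|]. rewrite Rmult_plus_distr_l. apply Rplus_le_compat.
  - eapply Rle_trans; [apply Cmod_minus_le|]. rewrite Cmod_opp.
    rewrite Rmult_plus_distr_l, Rplus_comm. apply Rplus_le_compat; [lra|].
    apply Rle_trans with (1 := H). apply Rle_trans with (e ^ S K * (PB * Ex)).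
    + apply Rmult_le_compat_l; [apply pow_le; lra|]. apply Rmult_le_compat_r; [lra|].
      unfold PB, poly_bound. apply Rmult_le_compat_r; [|apply Rle_abs].
      pose proof (pow_1_Rabs L z); lra.
    + apply Rmult_le_compat_r; [nra|]. simpl.
      assert (e ^ K <= 1) by (rewrite <- (pow1 K); apply pow_incr; lra).
      nra.
  - eapply Rle_trans; [apply Cmod_triangle|]. rewrite Rmult_plus_distr_l. apply Rplus_le_compat.
    + rewrite !Cmod_mult, Hme, Cmod_R, Rmult_assoc. apply Rmult_le_compat_l; [lra|].
      rewrite Rmult_comm. apply Rmult_le_compat_r; [apply Rabs_pos|auto].
    + rewrite Cmod_mult.
      replace (e * (Rabs B3 * Rabs z ^ 3 * Ex * (Cmod f0 + Bf')))
        with (e * (Rabs B3 * Rabs z ^ 3) * Ex * (Cmod f0 + Bf')) by ring.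
      apply Rmult_le_compat; try apply Cmod_ge_0.
      * pose proof (exp_sum_rem_weak 1 W). unfold exp_sum in H0. simpl in H0.
        replace (0 + 1 / 1)%C with (RtoC 1) in H0 by field. rewrite Rmult_1_r in H0.
        apply Rle_trans with (1 := H0). apply Rmult_le_compat; [apply Cmod_ge_0|left; apply exp_pos| |apply exp_le_exp; auto].
        apply Rle_trans with (1 := W1). apply Rmult_le_compat_l; [lra|].
        apply Rmult_le_compat_r; [apply pow_le, Rabs_pos|apply Rle_abs].
      * eapply Rle_trans; [apply Cmod_triangle|]. apply Rplus_le_compat_l.
        rewrite Cmod_mult. rewrite Cmod_mult, Hme, Cmod_R in *. 
        pose proof (Cmod_ge_0 g1). pose proof (Rabs_pos z). assert (0 <= e * Rabs z <= 1) by nra. nra.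
Qed.

(* For [G z = - z^2 / 2 + ...], both [w = 1] and [w = i] are directions of steepest descent of [exp (X w^2 G)]. *)
Definition laplace_int (G f : C -> C) (eta : R) (w : C) (X : R) : C :=
  CI (fun y => Cexp (X * (w * w) * G (w * y)) * f (w * y))%C (- eta) eta.

Definition direction (w : C) : Prop := w = RtoC 1 \/ w = Ci.

Lemma direction_mod w : direction w -> Cmod w = 1.
Proof. intros [-> | ->]; [apply Cmod_1|apply Cmod_Ci]. Qed.

Lemma direction_pow4 w : direction w -> (w * w * (w * w) = 1)%C.
Proof. intros [-> | ->]; Ceq; ring. Qed.

Lemma exp_opp_pow_bound K T : 0 < T -> exp (- T) <= INR (fact K) / T ^ K.
Proof.
  intros HT. pose proof (pow_le_fact_exp T K ltac:(lra)). pose proof (pow_lt T K HT). pose proof (exp_pos T).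
  rewrite exp_Ropp. apply Rmult_le_reg_r with (T ^ K * exp T); [nra|]. field_simplify; lra.
Qed.

Lemma csum_bound_unif n (P : nat -> R -> C) (phi : R -> R) : (forall T, 0 <= phi T) ->
  (forall k, exists B, 0 <= B /\ forall T, 0 <= T -> Cmod (P k T) <= B * phi T) ->
  exists D, 0 <= D /\ forall e T, Cmod e <= 1 -> 0 <= T -> Cmod (csum n (fun k => e ^ k * P k T)%C) <= D * phi T.
Proof.
  intros Hphi H. induction n.
  - exists 0. split; [lra|]. intros. simpl. rewrite Cmod_0. lra.
  - destruct IHn as (D & HD & IH). destruct (H n) as (B & HB & Hn). exists (D + B). split; [lra|].
    intros e T He HT. cbn [csum]. eapply Rle_trans; [apply Cmod_triangle|].
    rewrite Rmult_plus_distr_r. apply Rplus_le_compat; [auto|].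
    rewrite Cmod_mult, Cmod_pow. specialize (Hn T HT). specialize (Hphi T).
    assert (Cmod e ^ n <= 1). { rewrite <- (pow1 n). apply pow_incr. split; auto. apply Cmod_ge_0. }
    pose proof (pow_le (Cmod e) n (Cmod_ge_0 e)). pose proof (Cmod_ge_0 (P n T)). nra.
Qed.

Lemma csum_pow_minus K (e : C) (a m : nat -> C) :
  csum K (fun k => e ^ k * (a k - m k))%C =
  (csum K (fun k => e ^ k * a k) - csum K (fun k => e ^ k * m k))%C.
Proof. induction K; cbn [csum]; [ring|]. rewrite IHK. ring. Qed.

Lemma decR_gauss : decR (exp 1) (fun z => RtoC (gauss z)).
Proof.
  split; [apply Ccont_RtoC, continuous_gauss|]. intros y.
  rewrite Cmod_R, Rabs_pos_eq by (left; apply exp_pos). unfold gauss. rewrite <- exp_plus. apply exp_le_exp.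
  replace (y * y) with (Rabs y * Rabs y) by (unfold Rabs; destruct (Rcase_abs y); ring).
  pose proof (Rle_0_sqr (Rabs y - 1)). unfold Rsqr in *. lra.
Qed.

(** Rescaling by [sqrt X] turns the segment into [[- T, T]] with [T = eta * sqrt X], on which the
    expansion of [laplace_pert] is integrated term by term. The Gaussian moments over this segment
    differ from those over the line by [O(exp (- T))], smaller than any power of [1 / X]. The
    coefficients [m] are chosen before [w], so both directions share them. *)
Lemma laplace_local_at (G h f : C -> C) (eta B3 : R) (K : nat) :
  (forall v, Ccont (fun y => G (v * y)%C)) -> (forall v, Ccont (fun y => f (v * y)%C)) ->
  (forall z, Cmod z <= 1 -> G z = (- (z * z / 2) + z ^ 3 * h z)%C) ->
  (forall K, jet K h) -> (forall K, jet K f) ->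
  0 < eta <= 1 -> (forall x, Cmod x <= 1 -> Cmod (h x) <= B3) -> eta * B3 <= 1 / 4 -> (0 < K)%nat ->
  exists (m : nat -> C) (D : R), 0 <= D /\ m O = (f 0 * IntR (fun z => RtoC (gauss z)))%C /\
   (forall k, Nat.odd k = true -> m k = RtoC 0) /\
   forall w X, direction w -> 1 <= X ->
   Cmod (sqrt X * laplace_int G f eta w X - csum K (fun k => (w * / sqrt X) ^ k * m k))%C <= D * (/ sqrt X) ^ K.
Proof.
  intros HcG Hcf HG Jh Jf He Hh HB HK.
  destruct (laplace_pointwise h f eta B3 K) as (p & Hp & B & L & HB0 & H); auto; try lra.
  destruct (gauss_poly_decay B L HB0) as (B' & HB' & Hg).
  set (m := fun k => IntR (fun z => gauss z * p k z)%C).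
  assert (Hdec : forall k, exists B, 0 <= B /\ decR B (fun z => gauss z * p k z)%C)
    by (intros k; eapply decR_gauss_nice, Hp).
  destruct (csum_bound_unif K (fun k T => CI (fun z => gauss z * p k z)%C (- T) T - m k)%C (fun T => exp (- T)))
    as (D & HD & Htail).
  { intros; left; apply exp_pos. }
  { intros k. destruct (Hdec k) as (Bk & HBk & Hk). exists (2 * Bk). split; [lra|]. intros T HT.
    rewrite Cmod_minus_sym. eapply Rle_trans; [apply (IntR_tail Bk); auto; lra|]. lra. }
  assert (HetaK : 0 < eta ^ K) by (apply pow_lt; lra).
  (* The first term bounds the integrated pointwise error; the second is the cost of completing the
     moments to the whole line, by [exp (- T) <= K! / T ^ K]. *)
  exists m, (2 * B' + D * (INR (fact K) / eta ^ K)).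
  split; [|split; [|split]].
  - pose proof (INR_fact_lt_0 K). assert (0 < INR (fact K) / eta ^ K) by (apply Rdiv_lt_0_compat; auto). nra.
  - unfold m. rewrite <- (IntR_scal (exp 1)).
    + apply IntR_ext. intros z. destruct K as [|K']; [lia|].
      rewrite (laplace_leading_coeff h f eta B3 K' p B L); auto. ring.
    + apply decR_gauss.
  - intros k Hk. destruct (Hdec k) as (Bk & HBk & Hk'). apply (IntR_odd Bk); auto.
    intros y. destruct (Hp k) as (_ & Hs & _). rewrite Hs, Hk. simpl. unfold gauss.
    replace (- y * - y) with (y * y) by ring. ring.
  - intros w X Hw HX.
    assert (HsX : 1 <= sqrt X) by (rewrite <- sqrt_1; apply sqrt_le_1_alt; auto).
    assert (HsX2 : sqrt X * sqrt X = X) by (apply sqrt_sqrt; lra).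
    set (ep := / sqrt X). assert (Hep : 0 < ep <= 1).
    { split; [apply Rinv_0_lt_compat; lra|]. unfold ep. rewrite <- Rinv_1. apply Rinv_le_contravar; lra. }
    set (T := eta * sqrt X). assert (HT : 0 < T) by (unfold T; nra).
    assert (HeT : ep * T = eta) by (unfold ep, T; field; lra).
    pose proof (direction_mod w Hw) as Hmw.
    assert (Hme : Cmod (w * / sqrt X) = ep).
    { rewrite Cmod_mult, Hmw, <- RtoC_inv by lra. fold ep. rewrite Cmod_R, Rabs_pos_eq by lra. ring. }
    set (F := fun y => (Cexp (X * (w * w) * G (w * RtoC y)) * f (w * RtoC y))%C).
    assert (HF : Ccont F).
    { apply Ccont_mult; auto. apply Ccont_Cexp, Ccont_mult; auto. apply Ccont_const. }
    assert (HFe : Ccont (fun z => F (ep * z)%R)).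
    { apply (Ccont_comp F (fun z => ep * z)); auto. intro; apply continuous_R; reg. }
    assert (EJ : (sqrt X * laplace_int G f eta w X)%C = CI (fun z => F (ep * z)%R) (- T) T).
    { unfold laplace_int. fold F. replace (- eta) with (ep * - T + 0) by (rewrite <- HeT; ring).
      replace eta with (ep * T + 0) by (rewrite <- HeT; ring). rewrite <- CI_comp_lin by auto.
      rewrite Cmult_assoc, <- RtoC_mult. unfold ep at 1. rewrite Rinv_r, Cmult_1_l by lra.
      apply CI_ext. intros. now rewrite Rplus_0_r. }
    rewrite EJ.
    set (e := (w * / sqrt X)%C) in *.
    assert (Hcp : forall k, Ccont (fun z => e ^ k * (gauss z * p k z))%C).
    { intros k. apply Ccont_mult; [apply Ccont_const|]. destruct (Hdec k) as (Bk & _ & [Hk _]). exact Hk. }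
    assert (Ee : (X * (w * w) * (e * e) = 1)%C).
    { unfold e. replace (X * (w * w) * (w * / sqrt X * (w * / sqrt X)))%C
        with ((w * w * (w * w)) * (X * / (sqrt X * sqrt X)))%C.
      - rewrite direction_pow4 by auto. rewrite <- RtoC_mult, HsX2. rewrite <- RtoC_inv, <- RtoC_mult, Rinv_r by lra. ring.
      - field. intros E; apply RtoC_inj in E; lra. }
    assert (EF : forall z, Rabs z <= T -> F (ep * z)%R = (gauss z * laplace_pert h f e z)%C /\ dom eta e z).
    { intros z Hz.
      assert (Hwz : (w * RtoC (ep * z) = e * z)%C). { unfold e, ep. rewrite RtoC_mult, RtoC_inv by lra. ring. }
      assert (Hd : dom eta e z).
      { split; [lra|]. rewrite Cmod_mult, Hme, Cmod_R. rewrite <- HeT. apply Rmult_le_compat_l; lra. }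
      split; auto. unfold F. rewrite Hwz, HG by (destruct Hd; lra). unfold laplace_pert, gauss.
      rewrite <- Cexp_RtoC, (Cmult_assoc (Cexp _) (Cexp _)), <- Cexp_add. f_equal. f_equal.
      rewrite RtoC_opp, RtoC_div, RtoC_mult by lra.
      replace (X * (w * w) * (- (e * z * (e * z) / 2) + (e * z) ^ 3 * h (e * z)))%C
        with ((X * (w * w) * (e * e)) * (- (z * z / 2) + e * (z ^ 3 * h (e * z))))%C by (simpl; field).
      rewrite Ee. ring. }
    set (a := fun k => CI (fun z => gauss z * p k z)%C (- T) T).
    replace (CI (fun z => F (ep * z)%R) (- T) T - csum K (fun k => e ^ k * m k))%C
      with ((CI (fun z => F (ep * z)%R) (- T) T - csum K (fun k => e ^ k * a k)) +
            csum K (fun k => e ^ k * (a k - m k)))%C.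
    2:{ rewrite (csum_pow_minus K e a m). ring. }
    eapply Rle_trans; [apply Cmod_triangle|]. rewrite Rmult_plus_distr_r. apply Rplus_le_compat.
    + replace (csum K (fun k => e ^ k * a k)%C) with (CI (fun z => csum K (fun k => e ^ k * (gauss z * p k z))%C) (- T) T).
      2:{ rewrite (CI_csum K (fun k z => e ^ k * (gauss z * p k z))%C) by auto. apply csum_ext. intros k _.
          unfold a. apply CI_scal. destruct (Hdec k) as (Bk & _ & [Hk _]). exact Hk. }
      assert (Hcs : Ccont (fun z => csum K (fun k => e ^ k * (gauss z * p k z))%C)) by (apply Ccont_csum; auto).
      rewrite <- CI_minus by auto. rewrite Rmult_assoc.
      replace (2 * (B' * ep ^ K)) with (2 * (B' * ep ^ K)) by ring.
      assert (HepK : 0 <= ep ^ K) by (apply pow_le; lra).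
      apply CI_decay_bound; [lra|nra|apply Ccont_minus; auto|].
      intros z Hz. destruct (EF z Hz) as [E Hd]. rewrite E. specialize (H e z Hd).
      rewrite (csum_ext K _ (fun k => gauss z * (e ^ k * p k z))%C) by (intros; ring). rewrite csum_scal.
      replace (gauss z * laplace_pert h f e z - gauss z * csum K (fun k => e ^ k * p k z))%C
        with (gauss z * (laplace_pert h f e z - csum K (fun k => e ^ k * p k z)))%C by ring.
      rewrite Cmod_mult, Cmod_R, Rabs_pos_eq by (left; apply exp_pos).
      eapply Rle_trans; [apply Rmult_le_compat_l; [left; apply exp_pos|apply H]|]. rewrite Hme. unfold gauss.
      replace (exp (- (z * z / 2)) * (ep ^ K * (poly_bound B L z * exp (z * z / 4))))
        with (ep ^ K * ((exp (- (z * z / 2)) * exp (z * z / 4)) * poly_bound B L z)) by ring.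
      rewrite <- exp_plus. replace (- (z * z / 2) + z * z / 4) with (- (z * z / 4)) by field.
      rewrite (Rmult_comm B'), Rmult_assoc. apply Rmult_le_compat_l; auto.
    + eapply Rle_trans; [apply (Htail e T); lra|]. rewrite Rmult_assoc. apply Rmult_le_compat_l; auto.
      eapply Rle_trans; [apply (exp_opp_pow_bound K T HT)|]. right. unfold T, ep.
      rewrite Rpow_mult_distr, pow_inv. field. split; [apply pow_nonzero; lra|lra].
Qed.

(** * The Gaussian integral *)

Definition gauss_prim (x : R) : R := RInt gauss 0 x.

(** The auxiliary function of the classical evaluation by differentiation under the integral sign:
    the derivative in [x] of its integral over [0, 1] is opposite to that of the square of
    [gauss_prim x]. *)
Definition gauss_aux (x t : R) : R := 2 * exp (- (x * x * (1 + t * t) / 2)) / (1 + t * t).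

Lemma gauss_aux_derive (t x : R) :
  is_derive (fun u => gauss_aux u t) x (- 2 * x * exp (- (x * x * (1 + t * t) / 2))).
Proof.
  unfold gauss_aux. assert (0 < 1 + t * t) by (pose proof (Rle_0_sqr t); unfold Rsqr in *; lra).
  auto_derive; [lra|]. unfold Rdiv. field. lra.
Qed.

Lemma continuous_gauss_aux x : forall t, continuous (gauss_aux x) t.
Proof.
  intros t. apply continuous_R. unfold gauss_aux. reg.
  pose proof (Rle_0_sqr t); unfold Rsqr in *; lra.
Qed.

Lemma gauss_energy (x : R) :
  is_derive (fun x => gauss_prim x * gauss_prim x + RInt (gauss_aux x) 0 1) x 0.
Proof.
  assert (HP : is_derive gauss_prim x (gauss x)).
  { apply is_derive_RInt with 0.
    - apply filter_forall. intros y. apply (RInt_correct (V := R_CompleteNormedModule) gauss 0 y), (ex_RInt_continuous (V := R_CompleteNormedModule)).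
      intros; apply continuous_gauss.
    - apply continuous_gauss. }
  assert (HA : is_derive (fun x => RInt (gauss_aux x) 0 1) x
    (RInt (fun t => Derive (fun u => gauss_aux u t) x) 0 1)).
  { apply is_derive_RInt_param.
    - apply filter_forall. intros y t _. eexists. apply gauss_aux_derive.
    - intros t _. apply continuity_2d_pt_ext with (fun u v => - 2 * u * exp (- (u * u * (1 + v * v) / 2))).
      + intros u v. symmetry. apply is_derive_unique, gauss_aux_derive.
      + apply continuity_2d_pt_mult.
        * apply continuity_2d_pt_mult; [apply continuity_2d_pt_const|apply continuity_2d_pt_id1].
        * apply (continuity_1d_2d_pt_comp exp).
          -- apply derivable_continuous_pt, derivable_pt_exp.
          -- apply continuity_2d_pt_opp. unfold Rdiv.
             repeat first [apply continuity_2d_pt_mult | apply continuity_2d_pt_plus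
                          | apply continuity_2d_pt_const | apply continuity_2d_pt_id1 | apply continuity_2d_pt_id2].
    - apply filter_forall. intros y. apply (ex_RInt_continuous (V := R_CompleteNormedModule)).
      intros; apply continuous_gauss_aux. }
  eapply is_derive_eq.
  - apply (is_derive_plus (V := R_NormedModule) (fun x => gauss_prim x * gauss_prim x)); [|apply HA].
    apply (is_derive_mult (K := R_AbsRing) gauss_prim gauss_prim); [apply HP|apply HP|intros; apply Rmult_comm].
  (* The substitution [u = x t] turns the integral over [0, 1] into [gauss_prim x], with the sign
     that cancels the derivative of the square. *)
  - rewrite (RInt_ext _ (fun t => scal (- 2 * gauss x) (scal x (gauss (x * t + 0))))).
    + rewrite (RInt_scal (V := R_CompleteNormedModule)).
      * rewrite (RInt_comp_lin (V := R_CompleteNormedModule)).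
        -- replace (x * 0 + 0) with 0 by ring. replace (x * 1 + 0) with x by ring.
           fold (gauss_prim x). unfold plus, scal, mult; simpl. unfold mult; simpl. match goal with |- @eq _ ?a ?b => change (@eq R a b) end. ring.
        -- apply (ex_RInt_continuous (V := R_CompleteNormedModule)). intros; apply continuous_gauss.
      * apply (ex_RInt_continuous (V := R_CompleteNormedModule)). intros t _.
        apply continuous_R. unfold scal; simpl; unfold mult; simpl. unfold gauss. reg.
    + intros t _. etransitivity; [apply is_derive_unique, gauss_aux_derive|].
      unfold scal; simpl; unfold mult; simpl. unfold gauss.
      transitivity (- 2 * x * (exp (- (x * x / 2)) * exp (- ((x * t + 0) * (x * t + 0) / 2)))); [|ring].
      rewrite <- exp_plus. f_equal. f_equal. field.
Qed.

Lemma gauss_energy_const x : gauss_prim x * gauss_prim x + RInt (gauss_aux x) 0 1 = PI / 2.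
Proof.
  set (E := fun x => gauss_prim x * gauss_prim x + RInt (gauss_aux x) 0 1).
  assert (E0 : E 0 = PI / 2).
  { unfold E, gauss_prim. rewrite RInt_point. unfold zero; simpl. rewrite Rmult_0_l, Rplus_0_l.
    apply is_RInt_unique.
    assert (H : is_RInt (gauss_aux 0) 0 1 (minus (2 * atan 1) (2 * atan 0))).
    { apply (is_RInt_derive (V := R_CompleteNormedModule) (fun t => 2 * atan t)).
      - intros t _. unfold gauss_aux. replace (- (0 * 0 * (1 + t * t) / 2)) with 0 by field. rewrite exp_0.
        eapply is_derive_eq; [apply is_derive_scal, is_derive_Reals, derivable_pt_lim_atan|].
        match goal with |- @eq _ ?a ?b => change (@eq R a b) end. unfold Rsqr. field. pose proof (Rle_0_sqr t); unfold Rsqr in *; lra.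
      - intros; apply continuous_gauss_aux. }
    replace (PI / 2) with (minus (2 * atan 1) (2 * atan 0)); auto.
    rewrite atan_0, atan_1. unfold minus, plus, opp; simpl. field. }
  rewrite <- E0. change (E x = E 0).
  destruct (MVT_gen E 0 x (fun _ => 0)) as (c & _ & Hc).
  - intros y _. apply gauss_energy.
  - intros y _. apply continuity_pt_filterlim.
    apply (ex_derive_continuous (K := R_AbsRing) (V := R_NormedModule)). eexists. apply gauss_energy.
  - lra.
Qed.

Lemma IntR_gauss : IntR (fun z => RtoC (gauss z)) = RtoC (sqrt (2 * PI)).
Proof.
  pose proof decR_gauss as Hd. pose proof (Int0_correct _ _ (decR_dec0 _ _ Hd)) as HL.
  set (L := Int0 (fun z => RtoC (gauss z))) in *.
  assert (EI : forall n, CI (fun z => RtoC (gauss z)) 0 (INR n) = RtoC (gauss_prim (INR n))).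
  { intros n. unfold CI. apply C_eq; simpl; [reflexivity|].
    unfold Im; simpl. rewrite RInt_const. unfold scal; simpl; unfold mult; simpl. ring. }
  assert (HRe := Clim_Re _ _ HL). assert (HIm := Clim_Im _ _ HL).
  apply (is_lim_seq_ext _ (fun n => gauss_prim (INR n))) in HRe; [|intros; now rewrite EI].
  apply (is_lim_seq_ext _ (fun n => 0)) in HIm; [|intros; now rewrite EI].
  assert (Im0 : Im L = 0).
  { apply is_lim_seq_unique in HIm. rewrite Lim_seq_const in HIm. now injection HIm. }
  assert (HA : is_lim_seq (fun n => RInt (gauss_aux (INR n)) 0 1) 0).
  { apply is_lim_seq_le0 with (fun n => 2 * exp (- INR n)).
    - exists 2%nat. intros n Hn. apply le_INR in Hn. simpl in Hn. split.
      + apply RInt_ge_0; [lra| |].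
        * apply (ex_RInt_continuous (V := R_CompleteNormedModule)). intros; apply continuous_gauss_aux.
        * intros t _. unfold gauss_aux. apply Rmult_le_pos; [pose proof (exp_pos (- (INR n * INR n * (1 + t * t) / 2))); lra|].
          left. apply Rinv_0_lt_compat. pose proof (Rle_0_sqr t); unfold Rsqr in *; lra.
      + apply Rle_trans with (RInt (fun _ => 2 * exp (- INR n)) 0 1).
        * apply RInt_le; [lra| | |].
          -- apply (ex_RInt_continuous (V := R_CompleteNormedModule)). intros; apply continuous_gauss_aux.
          -- apply ex_RInt_const.
          -- intros t _. unfold gauss_aux. assert (Ht : 0 <= t * t) by apply Rle_0_sqr.
             pose proof (exp_pos (- (INR n * INR n * (1 + t * t) / 2))) as H1.
             assert (H2 : exp (- (INR n * INR n * (1 + t * t) / 2)) <= exp (- INR n)).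
             { apply exp_le_exp. apply Ropp_le_contravar.
               assert (2 * INR n <= INR n * INR n) by nra. nra. }
             apply Rmult_le_reg_r with (1 + t * t); [lra|]. unfold Rdiv.
             rewrite Rmult_assoc, Rinv_l, Rmult_1_r by lra. pose proof (exp_pos (- INR n)). nra.
        * rewrite RInt_const. unfold scal; simpl; unfold mult; simpl. lra.
    - eapply is_lim_seq_real_eq; [apply is_lim_seq_mult'; [apply is_lim_seq_const|apply is_lim_seq_exp_opp]|]. ring. }
  assert (Hsq : Re L * Re L = PI / 2).
  { assert (H1 := is_lim_seq_plus' _ _ _ _ (is_lim_seq_mult' _ _ _ _ HRe HRe) HA).
    apply (is_lim_seq_ext _ (fun _ => PI / 2)) in H1; [|intros; apply gauss_energy_const].
    apply is_lim_seq_unique in H1. rewrite Lim_seq_const in H1. revert H1. generalize (Re L). intros l H1. injection H1. intros E. lra. }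
  assert (Hpos : 0 <= Re L).
  { apply (is_lim_seq_le (fun _ => 0) (fun n => gauss_prim (INR n)) 0 (Re L)); auto; [|apply is_lim_seq_const].
    intros n. apply RInt_ge_0; [apply pos_INR| |].
    - apply (ex_RInt_continuous (V := R_CompleteNormedModule)). intros; apply continuous_gauss.
    - intros; left; apply exp_pos. }
  assert (HIR : IntR (fun z => RtoC (gauss z)) = (L + L)%C).
  { unfold IntR. fold L. f_equal. unfold L. apply Int0_ext. intros. unfold gauss.
    now replace (- y * - y) with (y * y) by ring. }
  rewrite HIR. apply C_eq; Csimpl; [|lra].
  symmetry. rewrite <- (sqrt_Rsqr (Re L + Re L)) by lra. f_equal. unfold Rsqr. lra.
Qed.

(** Order [2 * M] is used and the odd moments vanish, so only the powers
    [e ^ (2 * j) = (w * w) ^ j / X ^ j] remain. The [D j] are chosen before the direction, which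
    enters through the sign [w * w] alone; the alternating signs of the final expansion come from
    here. The first conclusion serves to bound the integrands away from the saddle. *)
Lemma laplace_local (G h : C -> C) :
  (forall v, Ccont (fun y => G (v * y)%C)) ->
  (forall z, Cmod z <= 1 -> G z = (- (z * z / 2) + z ^ 3 * h z)%C) -> (forall K, jet K h) ->
  exists eta0, 0 < eta0 <= 1 /\ forall eta, 0 < eta <= eta0 ->
  (forall w y, direction w -> Rabs y <= eta -> Re (w * w * G (w * y)%C) <= - (y * y / 4)) /\
  forall f, (forall v, Ccont (fun y => f (v * y)%C)) -> (forall K, jet K f) ->
  forall M, (0 < M)%nat -> exists (D : nat -> C) (B : R), 0 <= B /\
    D O = (f 0 * sqrt (2 * PI))%C /\
    forall w X, direction w -> 1 <= X ->
    Cmod (sqrt X * laplace_int G f eta w X - csum M (fun j => (w * w) ^ j * D j * / X ^ j))%C <= B * / X ^ M.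
Proof.
  intros Hc HG Jh. destruct (Jh 0%nat) as [B3 Hh].
  (* With this choice [eta * Rabs B3 <= 1 / 4], so the cubic term costs at most half of the
     quadratic one. *)
  exists (/ (4 * (Rabs B3 + 1))). pose proof (Rabs_pos B3) as HB3.
  assert (Hi : 4 * (Rabs B3 + 1) >= 4) by lra.
  assert (Hpos : 0 < / (4 * (Rabs B3 + 1))) by (apply Rinv_0_lt_compat; lra).
  assert (Hle : / (4 * (Rabs B3 + 1)) * (4 * (Rabs B3 + 1)) = 1) by (apply Rinv_l; lra).
  set (q := / (4 * (Rabs B3 + 1))) in *. split; [nra|].
  intros eta Heta. assert (HeB : eta * Rabs B3 <= 1 / 4) by nra.
  assert (Hh' : forall x, Cmod x <= 1 -> Cmod (h x) <= Rabs B3).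
  { intros x Hx. apply Rle_trans with (1 := Hh x Hx), Rle_abs. }
  assert (Heta1 : eta <= 1) by nra.
  split.
  - intros w y Hw Hy. pose proof (direction_mod w Hw) as Hmw.
    assert (Hm : Cmod (w * y) = Rabs y) by (rewrite Cmod_mult, Hmw, Cmod_R; ring).
    rewrite HG by lra.
    replace (w * w * (- (w * y * (w * y) / 2) + (w * y) ^ 3 * h (w * y)))%C
      with ((w * w * (w * w)) * (- (y * y / 2)) + w * w * ((w * y) ^ 3 * h (w * y)))%C by (simpl; field).
    rewrite direction_pow4 by auto. rewrite Cmult_1_l, Re_plus.
    replace (- (y * y / 2))%C with (RtoC (- (y * y / 2))).
    2:{ rewrite RtoC_opp, RtoC_div, RtoC_mult by lra. reflexivity. }
    rewrite Re_RtoC.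
    assert (Re (w * w * ((w * y) ^ 3 * h (w * y)%C)) <= y * y / 4); [|lra].
    apply Rle_trans with (1 := Rle_abs _). apply Rle_trans with (1 := re_le_Cmod _).
    rewrite !Cmod_mult, Cmod_pow, Hmw, Hm. specialize (Hh' (w * y)%C ltac:(lra)).
    replace (y * y) with (Rabs y * Rabs y) by (unfold Rabs; destruct (Rcase_abs y); ring).
    pose proof (Rabs_pos y). pose proof (Cmod_ge_0 (h (w * y)%C)).
    replace (1 * 1 * (Rabs y ^ 3 * Cmod (h (w * y)%C))) with (Rabs y * Rabs y * (Rabs y * Cmod (h (w * y)%C))) by ring.
    assert (Rabs y * Cmod (h (w * y)%C) <= 1 / 4).
    { apply Rle_trans with (2 := HeB). apply Rmult_le_compat; auto. }
    nra.
  - intros f Hcf Jf M HM.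
    destruct (laplace_local_at G h f eta (Rabs B3) (2 * M)) as (m & D & HD & Hm0 & Hodd & H); auto; try lra; try lia.
    exists (fun j => m (2 * j)%nat), D. split; [auto|split].
    + simpl. rewrite Hm0, IntR_gauss. reflexivity.
    + intros w X Hw HX. specialize (H w X Hw HX).
      assert (HsX : 0 < sqrt X) by (apply sqrt_lt_R0; lra).
      assert (HsX2 : sqrt X * sqrt X = X) by (apply sqrt_sqrt; lra).
      rewrite csum_even in H by auto.
      rewrite (csum_ext M _ (fun j => (w * w) ^ j * m (2 * j)%nat * / X ^ j)%C) in H.
      * apply Rle_trans with (1 := H). right. f_equal.
        rewrite pow_mult, <- pow_inv. f_equal.
        transitivity (/ (sqrt X * sqrt X)); [simpl; field; lra|now rewrite HsX2].
      * intros j _. assert (RtoC (sqrt X) <> 0) by (intros E; apply RtoC_inj in E; lra).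
        assert (RtoC X <> 0) by (intros E; apply RtoC_inj in E; lra).
        replace (w * / sqrt X * (w * / sqrt X))%C with (w * w * / X)%C.
        -- rewrite Cpow_mult_l, Cpow_inv by auto. ring.
        -- rewrite <- HsX2 at 1. rewrite RtoC_mult. field. auto.
Qed.

Lemma exp_ge_sq l : 0 <= l -> l * l / 2 <= exp l.
Proof.
  intros Hl. pose proof (pow_le_fact_exp l 2 Hl). simpl in H. lra.
Qed.

(** Half of [k * exp l] absorbs the lower exponential, whose rate [s] is below 1, and the other half
    absorbs the linear term. *)
Lemma exp_growth k A m s : 0 < k -> 0 <= A -> s < 1 ->
  exists B, forall l, 0 <= l -> - k * exp l + A * exp (s * l) + m * l <= B.
Proof.
  intros Hk HA Hs.
  assert (Hl0 : exists l0, 0 <= l0 /\ forall l, l0 <= l -> A * exp (s * l) <= k / 2 * exp l).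
  { exists (A / (k / 2) / (1 - s)). assert (H0 : 0 <= A / (k / 2)) by (apply Rdiv_le_0_compat; lra).
    split; [apply Rdiv_le_0_compat; lra|]. intros l Hl.
    replace (exp l) with (exp (s * l) * exp ((1 - s) * l)) by (rewrite <- exp_plus; f_equal; ring).
    assert (A / (k / 2) <= (1 - s) * l).
    { replace (A / (k / 2)) with ((1 - s) * (A / (k / 2) / (1 - s))) by (field; lra).
      apply Rmult_le_compat_l; lra. }
    assert (A / (k / 2) <= exp ((1 - s) * l)).
    { apply Rle_trans with (1 := H). pose proof (exp_ineq1_le ((1 - s) * l)). lra. }
    assert (A <= k / 2 * exp ((1 - s) * l)).
    { replace A with (k / 2 * (A / (k / 2))) at 1 by (field; lra). apply Rmult_le_compat_l; lra. }
    pose proof (exp_pos (s * l)). nra. }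
  (* The first term covers [l < l0], where the lower exponential may exceed its share; the second is
     the maximum of [m * l - k * l ^ 2 / 4]. *)
  destruct Hl0 as (l0 & Hl0 & Hl). exists (A * exp (Rabs s * l0) + m * m / k).
  intros l Hl'.
  assert (H1 : A * exp (s * l) <= k / 2 * exp l + A * exp (Rabs s * l0)).
  { pose proof (exp_pos l). pose proof (exp_pos (Rabs s * l0)). destruct (Rle_dec l0 l).
    - specialize (Hl l r). nra.
    - assert (exp (s * l) <= exp (Rabs s * l0)).
      { apply exp_le_exp. pose proof (Rle_abs s). pose proof (Rabs_pos s). nra. }
      nra. }
  assert (H2 : m * l <= k / 2 * exp l + m * m / k).
  { pose proof (exp_ge_sq l Hl'). pose proof (Rle_0_sqr (m - k * l / 2)). unfold Rsqr in H0.
    apply Rmult_le_reg_l with k; auto. field_simplify; [|lra]. 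
    assert (k * k * (l * l / 2) <= k * k * exp l) by (apply Rmult_le_compat_l; nra). nra. }
  lra.
Qed.

(** * Integrals along U-shaped paths *)

(** The number of modulus [exp l] and argument [phi], in the logarithmic variable: horizontal lines
    stand for rays, vertical segments for arcs. *)
Definition ray (phi l : R) : C := (l + Ci * phi)%C.

Lemma Re_ray phi l : Re (ray phi l) = l.
Proof. unfold ray. Csimpl. ring. Qed.

Lemma Im_ray phi l : Im (ray phi l) = phi.
Proof. unfold ray. Csimpl. ring. Qed.

Lemma Ccont_ray phi : Ccont (ray phi).
Proof. apply Ccont_plus; [apply Ccont_id|apply Ccont_const]. Qed.

Lemma Re_Cexp_mult (c : R) (z : C) : Re (c * Cexp z) = c * (exp (Re z) * cos (Im z)).
Proof. Csimpl. change (Re (Cexp z)) with (exp (Re z) * cos (Im z)). ring. Qed.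

Lemma Re_mult_ray b phi l : Re (b * ray phi l) <= Re b * l + Rabs (Im b) * Rabs phi.
Proof.
  rewrite Re_mult, Re_ray, Im_ray. pose proof (Rle_abs (- (Im b * phi))).
  rewrite Rabs_Ropp, Rabs_mult in H. lra.
Qed.

(** The form [exp (c t) t^b dt / t] in the variable [z = ln t]; with [c = 1] and [b = 1 - w] it is
    the integrand of Hankel's integral for 1/Gamma(w), up to the factor [1 / (2 PI i)]. *)
Definition hankel_fun (c : R) (b : C) (z : C) : C := Cexp (c * Cexp z + b * z).

Lemma Ccont_hankel_fun c b f : Ccont f -> Ccont (fun y => hankel_fun c b (f y)).
Proof.
  intros Hf. apply Ccont_Cexp, Ccont_plus; apply Ccont_mult; auto; try apply Ccont_const.
  apply Ccont_Cexp; auto.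
Qed.

Lemma dec0_hankel_ray c b phi : 0 < c -> cos phi < 0 ->
  exists B, dec0 B (fun l => hankel_fun c b (ray phi l)).
Proof.
  intros Hc Hphi. destruct (exp_growth (- (c * cos phi)) 0 (Re b + 1) 0) as [B HB]; [nra|lra|lra|].
  exists (exp (B + Rabs (Im b) * Rabs phi)). split; [apply Ccont_hankel_fun, Ccont_ray|].
  intros l Hl. unfold hankel_fun. rewrite Cmod_Cexp, <- exp_plus. apply exp_le_exp.
  rewrite Re_plus, Re_Cexp_mult, Re_ray, Im_ray. pose proof (Re_mult_ray b phi l). specialize (HB l Hl). lra.
Qed.

(* The integral along [+oo - i psi -> - i psi -> i psi -> +oo + i psi], the image under the logarithm
   of a Hankel contour. *)
Definition HU (psi : R) (E : C -> C) : C :=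
  (Ci * CI (fun t => E (ray t 0)) (- psi) psi + Int0 (fun l => E (ray psi l) - E (ray (- psi) l)))%C.

(** Continuity and, below, primitives are tested along real affine lines, which is all that paths
    made of segments and half lines require. *)
Definition continuous_along (E : C -> C) : Prop := forall v w, Ccont (fun y => E (v + w * y)%C).

Lemma continuous_along_ray E phi : continuous_along E -> Ccont (fun l => E (ray phi l)).
Proof.
  intros H. apply Ccont_ext with (2 := H (Ci * phi)%C (RtoC 1)).
  intros. f_equal. unfold ray. ring.
Qed.

Lemma continuous_along_arc E a : continuous_along E -> Ccont (fun t => E (ray t a)).
Proof. intros H. apply (H (RtoC a) Ci). Qed.

Lemma continuous_along_hankel c b : continuous_along (hankel_fun c b).
Proof.
  intros v w. apply Ccont_hankel_fun, Ccont_plus; [apply Ccont_const|apply Ccont_mult; [apply Ccont_const|apply Ccont_id]].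
Qed.

Definition dec_rays (B psi : R) (E : C -> C) : Prop :=
  dec0 B (fun l => E (ray psi l)) /\ dec0 B (fun l => E (ray (- psi) l)).

Lemma dec_rays_hankel c b psi : 0 < c -> cos psi < 0 -> exists B, dec_rays B psi (hankel_fun c b).
Proof.
  intros Hc Hp. destruct (dec0_hankel_ray c b psi Hc Hp) as [B HB].
  destruct (dec0_hankel_ray c b (- psi) Hc) as [B' HB']; [now rewrite cos_neg|].
  exists (Rmax B B'). split; [apply dec0_le with B|apply dec0_le with B']; auto; [apply Rmax_l|apply Rmax_r].
Qed.

Lemma HU_scal B psi c E : continuous_along E -> dec_rays B psi E ->
  HU psi (fun z => c * E z)%C = (c * HU psi E)%C.
Proof.
  intros Hc [H1 H2]. unfold HU. rewrite CI_scal by (apply continuous_along_arc; auto).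
  rewrite (Int0_ext _ (fun l => c * (E (ray psi l) - E (ray (- psi) l)))%C) by (intros; ring).
  rewrite (Int0_scal (B + B)) by (apply dec0_minus; auto). ring.
Qed.

Lemma HU_minus B B' psi E F : continuous_along E -> continuous_along F -> dec_rays B psi E -> dec_rays B' psi F ->
  HU psi (fun z => E z - F z)%C = (HU psi E - HU psi F)%C.
Proof.
  intros Hc Hc' [H1 H2] [H3 H4]. unfold HU. rewrite CI_minus by (apply continuous_along_arc; auto).
  rewrite (Int0_ext _ (fun l => (E (ray psi l) - E (ray (- psi) l)) - (F (ray psi l) - F (ray (- psi) l)))%C)
    by (intros; ring).
  rewrite (Int0_minus (B + B) (B' + B')) by (apply dec0_minus; auto). ring.
Qed.

Lemma HU_ext psi E F : (forall z, E z = F z) -> HU psi E = HU psi F.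
Proof.
  intros H. unfold HU. f_equal.
  - f_equal. apply CI_ext. intros; auto.
  - apply Int0_ext. intros; now rewrite !H.
Qed.

Definition primitive (F E : C -> C) : Prop :=
  forall v w, Cderiv (fun y => F (v + w * y)%C) (fun y => w * E (v + w * y))%C.

Lemma primitive_ray F E phi : primitive F E -> Cderiv (fun l => F (ray phi l)) (fun l => E (ray phi l)).
Proof.
  intros H. eapply Cderiv_ext; [| |apply (H (Ci * phi)%C (RtoC 1))].
  - intros; cbv beta; f_equal; unfold ray; ring.
  - intros; cbv beta. rewrite Cmult_1_l. f_equal. unfold ray; ring.
Qed.

Lemma primitive_arc F E a : primitive F E -> Cderiv (fun t => F (ray t a)) (fun t => Ci * E (ray t a))%C.
Proof. intros H. apply (H (RtoC a) Ci). Qed.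

Lemma arc_FTC F E psi a : primitive F E -> continuous_along E ->
  (Ci * CI (fun t => E (ray t a)) (- psi) psi = F (ray psi a) - F (ray (- psi) a))%C.
Proof.
  intros HF HE. pose proof (continuous_along_arc E a HE). rewrite <- CI_scal by auto.
  apply (CI_FTC (fun t => F (ray t a))); [apply primitive_arc; auto|].
  apply Ccont_mult; auto. apply Ccont_const.
Qed.

Lemma HU_primitive B psi F E : primitive F E -> continuous_along E -> dec_rays B psi F -> HU psi E = RtoC 0.
Proof.
  intros HF HE [H1 H2]. unfold HU. rewrite (arc_FTC F) by auto.
  rewrite (Int0_FTC (B + B) (fun l => F (ray psi l) - F (ray (- psi) l))%C).
  - ring.
  - pose proof (primitive_ray F E psi HF) as D1. pose proof (primitive_ray F E (- psi) HF) as D2.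
    eapply Cderiv_ext; [| |apply Cderiv_plus; [apply D1|apply (Cderiv_scal (- (1))%C _ _ D2)]];
      intros; cbv beta; ring.
  - apply Ccont_minus; apply continuous_along_ray; auto.
  - apply dec0_minus; auto.
Qed.

(** The integral around the rectangle with real parts from 0 to [a] and imaginary parts from [- psi]
    to [psi]; where it vanishes, the vertical side of the U-shaped path can be moved from 0 to
    [a]. *)
Definition rect (psi : R) (E : C -> C) (a : R) : C :=
  (Ci * CI (fun t => E (ray t a)) (- psi) psi - Ci * CI (fun t => E (ray t 0)) (- psi) psi
   - CI (fun l => E (ray psi l) - E (ray (- psi) l)) 0 a)%C.

Lemma rect_ext psi E F a : (forall z, E z = F z) -> rect psi E a = rect psi F a.
Proof.
  intros H. unfold rect.
  rewrite (CI_ext (fun t => E (ray t a)) (fun t => F (ray t a))) by auto.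
  rewrite (CI_ext (fun t => E (ray t 0)) (fun t => F (ray t 0))) by auto.
  rewrite (CI_ext (fun l => E (ray psi l) - E (ray (- psi) l))%C (fun l => F (ray psi l) - F (ray (- psi) l))%C)
    by (intros; now rewrite !H). reflexivity.
Qed.

Lemma rect_primitive psi F E a : primitive F E -> continuous_along E -> rect psi E a = RtoC 0.
Proof.
  intros HF HE. unfold rect. rewrite !(arc_FTC F E) by auto.
  rewrite CI_minus by (apply continuous_along_ray; auto).
  rewrite (CI_FTC (fun l => F (ray psi l)) (fun l => E (ray psi l)))
    by (first [apply primitive_ray|apply continuous_along_ray]; auto).
  rewrite (CI_FTC (fun l => F (ray (- psi) l)) (fun l => E (ray (- psi) l)))
    by (first [apply primitive_ray|apply continuous_along_ray]; auto). ring.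
Qed.

Lemma primitive_exp b : exists F, primitive F (fun z => Cexp (b * z)).
Proof.
  assert (L : forall v w, Cderiv (fun y => v + w * y)%C (fun _ => w)).
  { intros v w. eapply Cderiv_ext; [| |apply Cderiv_plus; [apply (Cderiv_const v)|apply (Cderiv_scal w _ _ Cderiv_id)]];
    intros; cbv beta; ring. }
  destruct (Ceq_dec b 0) as [->|Hb].
  - exists (fun z => z). intros v w. eapply Cderiv_ext; [| |apply L].
    + reflexivity.
    + intros; cbv beta. rewrite Cmult_0_l, Cexp_0. ring.
  - exists (fun z => / b * Cexp (b * z))%C. intros v w.
    eapply Cderiv_ext; [| |apply (Cderiv_scal (/ b)%C _ _ (Cderiv_Cexp _ _ (Cderiv_scal b _ _ (L v w))))].
    + reflexivity.
    + intros; cbv beta. field. auto.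
Qed.

Lemma rect_csum psi (E : nat -> C -> C) n a : (forall k, continuous_along (E k)) ->
  (forall k, rect psi (E k) a = RtoC 0) -> rect psi (fun z => csum n (fun k => E k z)) a = RtoC 0.
Proof.
  intros Hc H. induction n.
  - apply (rect_primitive psi (fun _ => RtoC 0)).
    + intros v w. eapply Cderiv_ext; [| |apply (Cderiv_const 0)]; intros; cbn [csum]; ring.
    + intros v w. apply (Ccont_const (RtoC 0)).
  - assert (Hcs : continuous_along (fun z => csum n (fun k => E k z))).
    { intros v w. apply (Ccont_csum n (fun k y => E k (v + w * y)%C)). intros k; apply Hc. }
    unfold rect in *. cbn [csum].
    rewrite !CI_plus by (first [apply (continuous_along_arc (E n))|apply (continuous_along_arc _ _ Hcs)]; auto).
    rewrite (CI_ext (fun l => csum n (fun k => E k (ray psi l)) + E n (ray psi l) - (csum n (fun k => E k (ray (- psi) l)) + E n (ray (- psi) l)))%C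
      (fun l => (csum n (fun k => E k (ray psi l)) - csum n (fun k => E k (ray (- psi) l))) + (E n (ray psi l) - E n (ray (- psi) l)))%C)
      by (intros; ring).
    rewrite (CI_plus (fun l => csum n (fun k => E k (ray psi l)) - csum n (fun k => E k (ray (- psi) l)))%C).
    + specialize (H n).
      match goal with H1 : ?A = RtoC 0, H2 : ?B = RtoC 0 |- _ =>
        transitivity (A + B)%C; [ring|rewrite H1, H2; ring] end.
    + apply Ccont_minus; apply (continuous_along_ray _ _ Hcs).
    + apply Ccont_minus; apply (continuous_along_ray _ _ (Hc n)).
Qed.

(** Cauchy's theorem for a rectangle by approximation: with [exp (c exp z)] replaced by its Taylor
    polynomial in [exp z], the integrand is a sum of multiples of [exp ((b + k) z)], each with an
    explicit primitive, and the convergence is uniform on the rectangle. *)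
Lemma rect_hankel psi c b a : 0 <= psi -> 0 <= c -> 0 <= a -> rect psi (hankel_fun c b) a = RtoC 0.
Proof.
  intros Hpsi Hc Ha.
  set (En := fun n z => (Cexp (b * z) * exp_sum n (c * Cexp z))%C).
  assert (HEn : forall n, continuous_along (En n)).
  { intros n v w. apply Ccont_mult.
    - apply Ccont_Cexp, Ccont_mult; [apply Ccont_const|].
      apply Ccont_plus; [apply Ccont_const|apply Ccont_mult; [apply Ccont_const|apply Ccont_id]].
    - unfold exp_sum. apply Ccont_csum. intros k. apply Ccont_mult; [|apply Ccont_const]. apply Ccont_pow.
      apply Ccont_mult; [apply Ccont_const|]. apply Ccont_Cexp.
      apply Ccont_plus; [apply Ccont_const|apply Ccont_mult; [apply Ccont_const|apply Ccont_id]]. }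
  assert (Hr : forall n, rect psi (En n) a = RtoC 0).
  { intros n.
    set (term := fun k z => (c ^ k / INR (fact k) * Cexp ((b + INR k) * z))%C).
    assert (HcE : forall k, continuous_along (fun z => Cexp ((b + INR k) * z))).
    { intros k v w. apply Ccont_Cexp, Ccont_mult; [apply Ccont_const|].
      apply Ccont_plus; [apply Ccont_const|apply Ccont_mult; [apply Ccont_const|apply Ccont_id]]. }
    assert (E : forall z, En n z = csum n (fun k => term k z)).
    { intros z. unfold En, exp_sum. rewrite <- csum_scal. apply csum_ext. intros k _. unfold term.
      replace ((b + INR k) * z)%C with (b * z + INR k * z)%C by ring.
      rewrite Cexp_add, Cexp_INR_mult, Cpow_mult_l. unfold Cdiv. ring. }
    assert (Ht : forall k, continuous_along (term k)).
    { intros k v w. apply Ccont_mult; [apply Ccont_const|apply (HcE k v w)]. }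
    transitivity (rect psi (fun z => csum n (fun k => term k z)) a).
    - apply rect_ext; auto.
    - apply rect_csum; auto. intros k. destruct (primitive_exp (b + INR k)) as [F HF].
      apply (rect_primitive psi (fun z => c ^ k / INR (fact k) * F z)%C).
      + intros v w. eapply Cderiv_ext; [| |apply (Cderiv_scal (c ^ k / INR (fact k))%C _ _ (HF v w))].
        * reflexivity.
        * intros; cbv beta. unfold term. ring.
      + apply Ht. }
  set (W := c * exp a).
  assert (HW : 0 <= W) by (pose proof (exp_pos a); unfold W; nra).
  set (Bb := exp (Rabs (Re b) * a + Rabs (Im b) * psi)).
  assert (HBb : 0 < Bb) by apply exp_pos.
  assert (Hunif : forall eps, 0 < eps -> eventually (fun n => forall x phi, 0 <= x <= a -> - psi <= phi <= psi ->
     Cmod (En n (ray phi x) - hankel_fun c b (ray phi x)) <= eps)).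
  { intros eps Heps. destruct (exp_sum_unif W (eps / Bb)) as [N HN]; auto; [apply Rdiv_lt_0_compat; auto|].
    exists N. intros n Hn x phi Hx Hphi. unfold En, hankel_fun. rewrite Cexp_add.
    replace (Cexp (b * ray phi x) * exp_sum n (c * Cexp (ray phi x)) - Cexp (c * Cexp (ray phi x)) * Cexp (b * ray phi x))%C
      with (Cexp (b * ray phi x) * (exp_sum n (c * Cexp (ray phi x)) - Cexp (c * Cexp (ray phi x))))%C by ring.
    rewrite Cmod_mult. replace eps with (Bb * (eps / Bb)) by (field; lra).
    apply Rmult_le_compat; try apply Cmod_ge_0.
    - rewrite Cmod_Cexp. apply exp_le_exp. apply Rle_trans with (1 := Re_mult_ray b phi x).
      assert (Rabs phi <= psi) by (apply Rabs_le; lra).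
      pose proof (Rabs_pos (Im b)). pose proof (Rabs_pos (Re b)). pose proof (Rle_abs (Re b)). nra.
    - apply HN; auto. rewrite Cmod_mult, Cmod_R, Cmod_Cexp, Re_ray, Rabs_pos_eq by auto.
      apply Rmult_le_compat_l; auto. apply exp_le_exp; lra. }
  pose proof (continuous_along_hankel c b) as HcE.
  assert (L1 : Clim (fun n => CI (fun t => En n (ray t a)) (- psi) psi) (CI (fun t => hankel_fun c b (ray t a)) (- psi) psi)).
  { apply CI_lim; [lra|intros; apply continuous_along_arc; auto|apply continuous_along_arc; auto|].
    intros eps He. destruct (Hunif eps He) as [N HN]. exists N. intros; apply HN; auto; lra. }
  assert (L2 : Clim (fun n => CI (fun t => En n (ray t 0)) (- psi) psi) (CI (fun t => hankel_fun c b (ray t 0)) (- psi) psi)).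
  { apply CI_lim; [lra|intros; apply continuous_along_arc; auto|apply continuous_along_arc; auto|].
    intros eps He. destruct (Hunif eps He) as [N HN]. exists N. intros; apply HN; auto; lra. }
  assert (L3 : Clim (fun n => CI (fun l => En n (ray psi l) - En n (ray (- psi) l))%C 0 a)
     (CI (fun l => hankel_fun c b (ray psi l) - hankel_fun c b (ray (- psi) l))%C 0 a)).
  { apply CI_lim; [lra|intros; apply Ccont_minus; apply continuous_along_ray; auto|apply Ccont_minus; apply continuous_along_ray; auto|].
    intros eps He. destruct (Hunif (eps / 2) ltac:(lra)) as [N HN]. exists N. intros n Hn y Hy.
    replace (En n (ray psi y) - En n (ray (- psi) y) - (hankel_fun c b (ray psi y) - hankel_fun c b (ray (- psi) y)))%C
      with ((En n (ray psi y) - hankel_fun c b (ray psi y)) - (En n (ray (- psi) y) - hankel_fun c b (ray (- psi) y)))%C by ring.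
    eapply Rle_trans; [apply Cmod_minus_le|].
    pose proof (HN n Hn y psi Hy ltac:(lra)). pose proof (HN n Hn y (- psi) Hy ltac:(lra)). lra. }
  apply Clim_unique with (fun n => rect psi (En n) a).
  - unfold rect. apply Clim_minus; auto. apply Clim_minus; apply Clim_scal; auto.
  - apply Clim_ext with (fun _ => RtoC 0); [intros; now rewrite Hr|apply Clim_const].
Qed.

Lemma ray_shift phi l a : (ray phi l + RtoC a)%C = ray phi (l + a).
Proof. unfold ray. rewrite RtoC_plus. ring. Qed.

Lemma HU_shift B psi E a : 0 <= a -> continuous_along E -> dec_rays B psi E -> rect psi E a = RtoC 0 ->
  HU psi (fun z => E (z + RtoC a)%C) = HU psi E.
Proof.
  intros Ha Hc [H1 H2] Hr. unfold HU.
  rewrite (CI_ext (fun t => E (ray t 0 + RtoC a)%C) (fun t => E (ray t a))).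
  2:{ intros. now rewrite ray_shift, Rplus_0_l. }
  rewrite (Int0_ext _ (fun l => (fun x => E (ray psi x) - E (ray (- psi) x))%C (l + a))).
  2:{ intros. now rewrite !ray_shift. }
  rewrite (Int0_shift (B + B) (fun x => E (ray psi x) - E (ray (- psi) x))%C a) by (auto; apply dec0_minus; auto).
  unfold rect in Hr.
  match type of Hr with ?A = _ => match goal with |- ?L = ?R => replace L with (A + R)%C by ring; rewrite Hr; ring end end.
Qed.

Definition hankel (psi : R) (z : C) : C := (HU psi (hankel_fun 1 (1 - z)) / (2 * PI * Ci))%C.

Lemma C_2PI_neq_0 : (2 * PI * Ci)%C <> RtoC 0.
Proof.
  pose proof PI_RGT_0. apply Cmod_gt_0. rewrite !Cmod_mult, Cmod_Ci, !Cmod_R, !Rabs_pos_eq; lra.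
Qed.

(** Substituting [c t] for [t] is a translation by [ln c] in the logarithmic variable, compensated
    by moving the vertical side of the path; [1 <= c] makes it a move to the right. *)
Lemma hankel_scale psi c z : 0 <= psi -> cos psi < 0 -> 1 <= c ->
  hankel psi z = (Rcpow c (1 - z) * HU psi (hankel_fun c (1 - z)) / (2 * PI * Ci))%C.
Proof.
  intros Hpsi Hcos Hc. unfold hankel. f_equal.
  assert (Hln : 0 <= ln c) by (rewrite <- ln_1; destruct Hc as [Hc|Hc]; [left; apply ln_increasing; lra|right; f_equal; auto]).
  destruct (dec_rays_hankel 1 (1 - z) psi ltac:(lra) Hcos) as [B HB].
  destruct (dec_rays_hankel c (1 - z) psi ltac:(lra) Hcos) as [B' HB'].
  rewrite <- (HU_shift B psi _ (ln c)); auto.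
  - rewrite <- (HU_scal B') by (auto; apply continuous_along_hankel). apply HU_ext. intros x.
    unfold hankel_fun, Rcpow. rewrite <- Cexp_add. f_equal. rewrite Cexp_add, Cexp_RtoC, exp_ln by lra. ring.
  - apply continuous_along_hankel.
  - apply rect_hankel; lra.
Qed.

(** Integration by parts: the derivative of [exp t t^(- z)] with respect to [ln t] is
    [exp t t^(1 - z) - z exp t t^(- z)], and the boundary terms vanish at the ends of both rays. *)
Lemma hankel_rec psi z : 0 <= psi -> cos psi < 0 -> hankel psi z = (z * hankel psi (z + 1))%C.
Proof.
  intros Hpsi Hcos. unfold hankel.
  destruct (dec_rays_hankel 1 (1 - z) psi ltac:(lra) Hcos) as [B HB].
  destruct (dec_rays_hankel 1 (- z) psi ltac:(lra) Hcos) as [B' HB'].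
  pose proof (continuous_along_hankel 1 (1 - z)) as Hc.
  pose proof (continuous_along_hankel 1 (- z)) as Hc'.
  assert (HzF : continuous_along (fun x => z * hankel_fun 1 (- z) x)%C).
  { intros v w. apply Ccont_mult; [apply Ccont_const|apply Hc']. }
  assert (HdF : dec_rays (Cmod z * B') psi (fun x => z * hankel_fun 1 (- z) x)%C).
  { split; apply dec0_scal; apply HB'. }
  assert (E0 : HU psi (fun x => hankel_fun 1 (1 - z) x - z * hankel_fun 1 (- z) x)%C = RtoC 0).
  { apply HU_primitive with B' (hankel_fun 1 (- z)); auto.
    - intros v w.
      assert (L : Cderiv (fun y => v + w * y)%C (fun _ => w)).
      { eapply Cderiv_ext; [| |apply Cderiv_plus; [apply (Cderiv_const v)|apply (Cderiv_scal w _ _ Cderiv_id)]];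
        intros; cbv beta; ring. }
      eapply Cderiv_ext; [| |apply Cderiv_Cexp, Cderiv_plus;
         [apply (Cderiv_scal 1 _ _ (Cderiv_Cexp _ _ L))|apply (Cderiv_scal (- z)%C _ _ L)]].
      + reflexivity.
      + intros y. cbv beta. unfold hankel_fun.
        replace (1 * Cexp (v + w * y) + (1 - z) * (v + w * y))%C
          with ((v + w * y) + (1 * Cexp (v + w * y) + - z * (v + w * y)))%C by ring.
        rewrite (Cexp_add (v + w * y)). ring.
    - intros v w. apply Ccont_minus; [apply Hc|apply HzF]. }
  rewrite (HU_minus B (Cmod z * B')) in E0 by auto.
  rewrite (HU_scal B') in E0 by auto.
  replace (HU psi (hankel_fun 1 (1 - z))) with (z * HU psi (hankel_fun 1 (- z)))%C.
  - replace (1 - (z + 1))%C with (- z)%C by ring. unfold Cdiv. ring.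
  - match type of E0 with (?a - ?b)%C = _ => replace a with (a - b + b)%C by ring; rewrite E0; ring end.
Qed.

Lemma hankel_Crising psi z n : 0 <= psi -> cos psi < 0 ->
  hankel psi z = (Crising z n * hankel psi (z + INR n))%C.
Proof.
  intros Hpsi Hcos. induction n.
  - simpl. rewrite Cplus_0_r. ring.
  - rewrite IHn at 1. rewrite hankel_rec by auto. rewrite S_INR, RtoC_plus. simpl.
    replace (z + INR n + 1)%C with (z + (INR n + 1))%C by ring. ring.
Qed.

(** * The Gamma function *)

(** Euler's integrand [t^z exp (- c t) dt / t] in the variable [ln t]. Since [decR] asks for decay
    at rate 1 in both directions, its integrals are handled for [1 <= Re z]. *)
Definition Gam_fun (c : R) (z : C) (t : R) : C := Cexp (z * t - c * exp t)%C.

Definition Gam (z : C) : C := IntR (Gam_fun 1 z).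

Lemma Ccont_Gam_fun c z : Ccont (Gam_fun c z).
Proof.
  apply Ccont_Cexp, Ccont_minus; apply Ccont_mult; try apply Ccont_const; [apply Ccont_id|].
  apply Ccont_RtoC. intro. apply continuous_R. reg.
Qed.

Lemma Cmod_Gam_fun c z t : Cmod (Gam_fun c z t) = exp (Re z * t - c * exp t).
Proof. unfold Gam_fun. rewrite Cmod_Cexp. f_equal. Csimpl. ring. Qed.

Lemma decR_Gam_fun c z : 0 < c -> 1 <= Re z -> exists B, decR B (Gam_fun c z).
Proof.
  intros Hc Hz. destruct (exp_growth c 0 (Re z + 1) 0 Hc) as [B HB]; [lra|lra|].
  exists (exp (Rabs B)). split; [apply Ccont_Gam_fun|]. intros t.
  rewrite Cmod_Gam_fun, <- exp_plus. apply exp_le_exp.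
  pose proof (Rle_abs B). pose proof (Rabs_pos B). destruct (Rle_dec 0 t).
  - rewrite (Rabs_pos_eq t) by auto. specialize (HB t r). lra.
  - rewrite (Rabs_left t) by lra. pose proof (exp_pos t). nra.
Qed.

Lemma Cderiv_Gam_fun c z : Cderiv (Gam_fun c z) (fun t => (z - c * exp t) * Gam_fun c z t)%C.
Proof.
  assert (L : Cderiv (fun t => RtoC (exp t)) (fun t => RtoC (exp t))).
  { intro y. split; simpl.
    - apply is_derive_Reals, derivable_pt_lim_exp.
    - apply (is_derive_const (V := R_NormedModule) 0). }
  eapply Cderiv_ext; [| |apply Cderiv_Cexp, Cderiv_plus; [apply (Cderiv_scal z _ _ Cderiv_id)|apply (Cderiv_scal (- c)%C _ _ L)]].
  - intros; cbv beta. unfold Gam_fun. f_equal. ring.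
  - intros y; cbv beta. unfold Gam_fun.
    replace (z * y + - c * exp y)%C with (z * y - c * exp y)%C by ring. ring.
Qed.

Lemma Gam_fun_exp c z t : (exp t * Gam_fun c z t)%C = Gam_fun c (z + 1) t.
Proof.
  unfold Gam_fun. rewrite <- Cexp_RtoC, <- Cexp_add. f_equal. ring.
Qed.

Lemma IntR_limits B F f l : decR B f -> Cderiv F f -> Clim (fun n => F (INR n) - F (- INR n)%R)%C l -> IntR f = l.
Proof.
  intros H HF Hl. apply IntR_unique with B; auto.
  apply Clim_ext with (2 := Hl). intros n. symmetry. apply CI_FTC; auto. apply H.
Qed.

Lemma Gam_rec z : 1 <= Re z -> Gam (z + 1) = (z * Gam z)%C.
Proof.
  intros Hz. destruct (decR_Gam_fun 1 z ltac:(lra) Hz) as [B HB].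
  destruct (decR_Gam_fun 1 (z + 1) ltac:(lra)) as [B' HB']; [rewrite Re_plus, Re_RtoC; lra|].
  assert (HzB : decR (Cmod z * B) (fun t => z * Gam_fun 1 z t)%C).
  { split; [apply Ccont_mult; [apply Ccont_const|apply HB]|]. intros. rewrite Cmod_mult, Rmult_assoc.
    apply Rmult_le_compat_l; [apply Cmod_ge_0|apply HB]. }
  assert (HB'' : decR (Cmod (- (1)) * B') (fun t => - (1) * Gam_fun 1 (z + 1) t)%C).
  { split; [apply Ccont_mult; [apply Ccont_const|apply HB']|]. intros. rewrite Cmod_mult, Rmult_assoc.
    apply Rmult_le_compat_l; [apply Cmod_ge_0|apply HB']. }
  assert (E : IntR (fun t => z * Gam_fun 1 z t + - (1) * Gam_fun 1 (z + 1) t)%C = RtoC 0).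
  { apply IntR_limits with (Cmod z * B + Cmod (- (1)) * B') (Gam_fun 1 z).
    - split; [apply Ccont_plus; [apply HzB|apply HB'']|].
      intros. eapply Rle_trans; [apply Cmod_triangle|]. rewrite Rmult_plus_distr_r.
      apply Rplus_le_compat; [apply HzB|apply HB''].
    - eapply Cderiv_ext; [| |apply Cderiv_Gam_fun]; [reflexivity|].
      intros y; cbv beta. rewrite <- Gam_fun_exp. ring.
    - apply Clim_squeeze with (fun n => 2 * B * exp (- INR n)).
      + exists O. intros n _. replace (Gam_fun 1 z (INR n) - Gam_fun 1 z (- INR n)%R - 0)%C
          with (Gam_fun 1 z (INR n) - Gam_fun 1 z (- INR n)%R)%C by ring.
        eapply Rle_trans; [apply Cmod_minus_le|].
        destruct HB as [_ HB]. pose proof (HB (INR n)). pose proof (HB (- INR n)).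
        rewrite Rabs_Ropp in H0. rewrite Rabs_pos_eq in * by apply pos_INR. lra.
      + eapply is_lim_seq_real_eq; [apply is_lim_seq_mult'; [apply is_lim_seq_const|apply is_lim_seq_exp_opp]|]. ring. }
  rewrite (IntR_plus (Cmod z * B) (Cmod (- (1)) * B')) in E by auto.
  rewrite (IntR_scal B), (IntR_scal B') in E by auto. fold (Gam z) (Gam (z + 1)) in E.
  replace (Gam (z + 1)) with (z * Gam z - (z * Gam z + - (1) * Gam (z + 1)))%C by ring. rewrite E. ring.
Qed.

Lemma Gam_1 : Gam 1 = RtoC 1.
Proof.
  destruct (decR_Gam_fun 1 1 ltac:(lra)) as [B HB]; [rewrite Re_RtoC; lra|].
  apply IntR_limits with B (fun t => - (1) * Gam_fun 1 0 t)%C; auto.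
  - eapply Cderiv_ext; [| |apply (Cderiv_scal (- (1))%C _ _ (Cderiv_Gam_fun 1 0))]; [reflexivity|].
    intros y; cbv beta. replace (Gam_fun 1 1 y) with (Gam_fun 1 (0 + 1) y) by (f_equal; ring).
    rewrite <- Gam_fun_exp. ring.
  - apply Clim_ext with (fun n => RtoC (exp (- exp (- INR n)) - exp (- exp (INR n)))).
    + intros n. assert (E : forall t, Gam_fun 1 0 t = RtoC (exp (- exp t))).
      { intros t. unfold Gam_fun. rewrite <- (Cexp_RtoC (- exp t)). f_equal. rewrite RtoC_opp. ring. }
      rewrite !E, RtoC_minus. ring.
    + apply (Clim_of_Re_Im _ 1 0); [|apply is_lim_seq_const].
      apply (is_lim_seq_ext (fun n => exp (- exp (- INR n)) - exp (- exp (INR n)))); [reflexivity|].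
      eapply is_lim_seq_real_eq; [apply is_lim_seq_minus'|].
      * apply (is_lim_seq_continuous (fun x => exp (- x)) _ 0); [|apply is_lim_seq_exp_opp].
        reg.
      * apply is_lim_seq_le0 with (fun n => exp (- INR n)); [|apply is_lim_seq_exp_opp].
        exists O. intros n _. split; [left; apply exp_pos|]. apply exp_le_exp.
        pose proof (exp_ineq1_le (INR n)). lra.
      * rewrite Ropp_0, exp_0. ring.
Qed.

Lemma Gam_fact n : Gam (INR n + 1) = RtoC (INR (fact n)).
Proof.
  induction n.
  - simpl. replace (0 + 1)%C with (RtoC 1) by ring. apply Gam_1.
  - rewrite S_INR, RtoC_plus, Gam_rec.
    + rewrite IHn, fact_simpl, mult_INR, S_INR, RtoC_mult, RtoC_plus. reflexivity.
    + rewrite Re_plus, !Re_RtoC. pose proof (pos_INR n). lra.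
Qed.

Lemma Gam_Crising z n : 1 <= Re z -> Gam (z + INR n) = (Crising z n * Gam z)%C.
Proof.
  intros Hz. induction n.
  - simpl. rewrite Cplus_0_r. ring.
  - rewrite S_INR, RtoC_plus, Cplus_assoc, Gam_rec.
    + rewrite IHn. simpl. ring.
    + rewrite Re_plus, Re_RtoC. pose proof (pos_INR n). lra.
Qed.

Lemma Gam_scale c z : 0 < c -> 1 <= Re z -> Gam z = (Rcpow c z * IntR (Gam_fun c z))%C.
Proof.
  intros Hc Hz. destruct (decR_Gam_fun 1 z ltac:(lra) Hz) as [B HB]. destruct (decR_Gam_fun c z Hc Hz) as [B' HB'].
  unfold Gam. rewrite <- (IntR_shift B _ (ln c)) by auto. rewrite <- (IntR_scal B') by auto.
  apply IntR_ext. intros t. unfold Gam_fun, Rcpow. rewrite <- Cexp_add. f_equal.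
  rewrite exp_plus, exp_ln, RtoC_plus, RtoC_mult by auto. ring.
Qed.

(** * Contributions away from the saddle point *)

Lemma Int0_outer B b f eta : 0 <= eta -> dec0 B f ->
  (forall y, eta <= y -> Cmod (f y) <= b * exp (- y)) -> Cmod (Int0 f - CI f 0 eta) <= b.
Proof.
  intros He Hf Hb. rewrite <- (Int0_shift B) by auto. apply Int0_bound. split.
  - apply (Ccont_comp f (fun y => y + eta)); [apply Hf|]. intro; apply continuous_R; reg.
  - intros y Hy. eapply Rle_trans; [apply Hb; lra|].
    assert (0 <= b).
    { assert (0 <= b * exp (- eta)) by (apply Rle_trans with (2 := Hb eta (Rle_refl _)), Cmod_ge_0).
      pose proof (exp_pos (- eta)). nra. }
    apply Rmult_le_compat_l; auto. apply exp_le_exp. lra.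
Qed.

Lemma IntR_outer B b f eta : 0 <= eta -> decR B f ->
  (forall y, eta <= Rabs y -> Cmod (f y) <= b * exp (- Rabs y)) -> Cmod (IntR f - CI f (- eta) eta) <= 2 * b.
Proof.
  intros He Hf Hb. rewrite <- (CI_Chasles f (- eta) 0 eta), <- CI_neg by apply Hf. unfold IntR.
  replace (Int0 f + Int0 (fun y => f (- y)%R) - (CI (fun y => f (- y)%R) 0 eta + CI f 0 eta))%C
    with ((Int0 f - CI f 0 eta) + (Int0 (fun y => f (- y)%R) - CI (fun y => f (- y)%R) 0 eta))%C by ring.
  eapply Rle_trans; [apply Cmod_triangle|]. replace (2 * b) with (b + b) by ring.
  apply Rplus_le_compat; apply (Int0_outer B); auto.
  - apply decR_dec0; auto.
  - intros y Hy. rewrite <- (Rabs_pos_eq y) at 2 by lra. apply Hb. rewrite Rabs_pos_eq; lra.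
  - apply decR_dec0, decR_neg; auto.
  - intros y Hy. replace (exp (- y)) with (exp (- Rabs (- y))) by (rewrite Rabs_Ropp, Rabs_pos_eq by lra; auto).
    apply Hb. rewrite Rabs_Ropp, Rabs_pos_eq; lra.
Qed.

Lemma continuous_along_Cexp b : continuous_along (fun z => Cexp (b * z)).
Proof.
  intros v w. apply Ccont_Cexp, Ccont_mult; [apply Ccont_const|].
  apply Ccont_plus; [apply Ccont_const|apply Ccont_mult; [apply Ccont_const|apply Ccont_id]].
Qed.

Lemma continuous_along_0 E : continuous_along E -> forall v, Ccont (fun y => E (v * y)%C).
Proof. intros H v. apply Ccont_ext with (2 := H (RtoC 0) v). intros. f_equal. ring. Qed.

Lemma Cmod_Cexp_ray b phi l : Cmod (Cexp (b * ray phi l)) <= exp (Re b * l + Rabs (Im b) * Rabs phi).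
Proof. rewrite Cmod_Cexp. apply exp_le_exp, Re_mult_ray. Qed.

Definition saddle_fun (G : C -> C) (b : C) (X : R) (z : C) : C := (Cexp (- X * G z) * Cexp (b * z))%C.

(** Everything except the segment of length [2 * eta] through the saddle contributes
    [O(exp (- c1 * X))]: the rest of the arc because the real part of [G] is at least [c1] there,
    the rays because it also grows linearly. The sign [w * w = - 1] of [laplace_int] along [Ci]
    matches the minus sign of [saddle_fun]. *)
Lemma HU_laplace G b eta psi c1 c2 : continuous_along G -> 0 < eta <= psi -> 0 < c1 -> 0 < c2 ->
  (forall t, eta <= Rabs t <= psi -> c1 <= Re (G (ray t 0))) ->
  (forall phi l, Rabs phi = psi -> 0 <= l -> c1 + c2 * l <= Re (G (ray phi l))) ->
  exists B X0, 0 <= B /\ forall X, X0 <= X ->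
    (exists B', dec_rays B' psi (saddle_fun G b X)) /\
    Cmod (HU psi (saddle_fun G b X) - Ci * laplace_int G (fun z => Cexp (b * z)) eta Ci X)
      <= B * exp (- c1 * X).
Proof.
  intros Hc Heta Hc1 Hc2 Harc Hray.
  set (A := exp (Rabs (Im b) * psi)). assert (HA : 0 < A) by apply exp_pos.
  (* From this threshold on, the linear growth on the rays beats [exp (Re b * l)] and leaves the
     factor [exp (- l)] required by [dec0]. *)
  exists (2 * psi * A + 2 * A), (Rmax 0 ((Re b + 1) / c2)). split; [nra|]. intros X HX.
  assert (HX0 : 0 <= X) by (apply Rle_trans with (2 := HX), Rmax_l).
  assert (HX2 : Re b + 1 <= c2 * X).
  { replace (Re b + 1) with (c2 * ((Re b + 1) / c2)) by (field; lra). apply Rmult_le_compat_l; [lra|].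
    apply Rle_trans with (2 := HX), Rmax_r. }
  assert (HcE : continuous_along (saddle_fun G b X)).
  { intros v w. apply Ccont_mult; [|apply continuous_along_Cexp].
    apply Ccont_Cexp, Ccont_mult; [apply Ccont_const|apply Hc]. }
  assert (HE : forall phi l, Cmod (saddle_fun G b X (ray phi l)) <= exp (- X * Re (G (ray phi l)) + (Re b * l + Rabs (Im b) * Rabs phi))).
  { intros phi l. unfold saddle_fun. rewrite Cmod_mult, exp_plus.
    apply Rmult_le_compat; try apply Cmod_ge_0; [|apply Cmod_Cexp_ray].
    rewrite Cmod_Cexp. apply exp_le_exp. right. Csimpl. ring. }
  assert (Hd : forall phi, Rabs phi = psi -> dec0 (A * exp (- c1 * X)) (fun l => saddle_fun G b X (ray phi l))).
  { intros phi Hphi. split; [apply continuous_along_ray; auto|]. intros l Hl.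
    eapply Rle_trans; [apply HE|]. unfold A. rewrite <- !exp_plus. apply exp_le_exp.
    specialize (Hray phi l Hphi Hl). rewrite Hphi.
    assert (X * (c1 + c2 * l) <= X * Re (G (ray phi l))) by (apply Rmult_le_compat_l; auto).
    assert ((Re b + 1) * l <= c2 * X * l) by (apply Rmult_le_compat_r; auto). lra. }
  assert (Hd1 := Hd psi ltac:(apply Rabs_pos_eq; lra)).
  assert (Hd2 := Hd (- psi) ltac:(rewrite Rabs_Ropp; apply Rabs_pos_eq; lra)).
  split; [exists (A * exp (- c1 * X)); split; auto|].
  unfold HU.
  replace (laplace_int G (fun z => Cexp (b * z)) eta Ci X) with (CI (fun t => saddle_fun G b X (ray t 0)) (- eta) eta).
  2:{ unfold laplace_int. apply CI_ext. intros t _. unfold saddle_fun, ray.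
      replace (0 + Ci * t)%C with (Ci * t)%C by ring. f_equal. f_equal.
      replace (Ci * Ci)%C with (- (1))%C by (Ceq; ring). ring. }
  set (g := fun t => saddle_fun G b X (ray t 0)).
  assert (Hg : Ccont g) by (apply continuous_along_arc; auto).
  rewrite <- (CI_Chasles g (- psi) (- eta) psi), <- (CI_Chasles g (- eta) eta psi) by auto.
  match goal with |- Cmod ?L <= _ => replace L with
    ((Ci * CI g (- psi) (- eta) + Ci * CI g eta psi) + Int0 (fun l => saddle_fun G b X (ray psi l) - saddle_fun G b X (ray (- psi) l)))%C by ring end.
  assert (Hgb : forall t, eta <= Rabs t <= psi -> Cmod (g t) <= A * exp (- c1 * X)).
  { intros t Ht. unfold g. eapply Rle_trans; [apply HE|]. unfold A. rewrite <- exp_plus. apply exp_le_exp.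
    specialize (Harc t Ht). assert (X * c1 <= X * Re (G (ray t 0))) by (apply Rmult_le_compat_l; auto).
    assert (Rabs (Im b) * Rabs t <= Rabs (Im b) * psi) by (apply Rmult_le_compat_l; [apply Rabs_pos|lra]). lra. }
  assert (Hpos : 0 < A * exp (- c1 * X)) by (apply Rmult_lt_0_compat; [auto|apply exp_pos]).
  eapply Rle_trans; [apply Cmod_triangle|]. rewrite Rmult_plus_distr_r. apply Rplus_le_compat.
  - eapply Rle_trans; [apply Cmod_triangle|]. rewrite !Cmod_mult, Cmod_Ci, !Rmult_1_l.
    replace (2 * psi * A * exp (- c1 * X)) with (A * exp (- c1 * X) * psi + A * exp (- c1 * X) * psi) by ring.
    apply Rplus_le_compat.
    + eapply Rle_trans; [apply (CI_bound_const g (A * exp (- c1 * X))); auto; [lra|]|].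
      * intros t Ht. apply Hgb. rewrite Rabs_left by lra. lra.
      * apply Rmult_le_compat_l; lra.
    + eapply Rle_trans; [apply (CI_bound_const g (A * exp (- c1 * X))); auto; [lra|]|].
      * intros t Ht. apply Hgb. rewrite Rabs_pos_eq by lra. lra.
      * apply Rmult_le_compat_l; lra.
  - eapply Rle_trans; [apply Int0_bound with (B := A * exp (- c1 * X) + A * exp (- c1 * X)); apply dec0_minus; auto|]. lra.
Qed.

Lemma pow_exp_bound a K X : 0 < a -> 0 <= X -> X ^ K * exp (- a * X) <= INR (fact K) / a ^ K.
Proof.
  intros Ha HX. assert (HaK : 0 < a ^ K) by (apply pow_lt; auto).
  pose proof (pow_le_fact_exp (a * X) K ltac:(nra)). rewrite Rpow_mult_distr in H.
  replace (- a * X) with (- (a * X)) by ring. rewrite exp_Ropp. pose proof (exp_pos (a * X)).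
  apply Rmult_le_reg_r with (a ^ K * exp (a * X)); [nra|]. field_simplify; lra.
Qed.

(** * The reciprocal Gamma function as a Hankel integral *)

(** The common phase of Euler's and Hankel's integrals at [z + n + 1]: the substitution
    [t = n exp u] puts the saddle of both at [u = 0] with large parameter [n], and the two exponents
    have opposite signs. *)
Definition G0 (z : C) : C := (z - Cexp z + 1)%C.

Lemma exp_taylor2 z : Cexp z = (1 + z + z * z / 2 + z ^ 3 * exp_tail 3 z)%C.
Proof.
  rewrite <- exp_tail_0, (exp_tail_S 0), (exp_tail_S 1), (exp_tail_S 2).
  change (INR (fact 0)) with 1. change (INR (fact 1)) with 1. change (INR (fact 2)) with 2.
  simpl Cpow. field.
Qed.

Lemma continuous_along_G0 : continuous_along G0.
Proof.
  intros v w. assert (L : Ccont (fun y => v + w * y)%C).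
  { apply Ccont_plus; [apply Ccont_const|apply Ccont_mult; [apply Ccont_const|apply Ccont_id]]. }
  apply Ccont_plus; [apply Ccont_minus; [auto|apply Ccont_Cexp; auto]|apply Ccont_const].
Qed.

Lemma Re_G0 z : Re (G0 z) = Re z - exp (Re z) * cos (Im z) + 1.
Proof. reflexivity. Qed.

Lemma is_lim_seq_inv_INR : is_lim_seq (fun n => / INR n) 0.
Proof. apply (is_lim_seq_inv INR p_infty); [apply is_lim_seq_INR|discriminate]. Qed.

Lemma is_lim_seq_INR_exp a : 0 < a -> is_lim_seq (fun n => sqrt (INR n) * exp (- a * INR n)) 0.
Proof.
  intros Ha. apply is_lim_seq_le0 with (fun n => (INR (fact 2) / a ^ 2) * / INR n).
  - exists 1%nat. intros n Hn. apply le_INR in Hn. simpl in Hn.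
    assert (Hs : sqrt (INR n) <= INR n).
    { rewrite <- (sqrt_Rsqr (INR n)) at 2 by lra. apply sqrt_le_1_alt. unfold Rsqr. nra. }
    pose proof (sqrt_pos (INR n)). pose proof (exp_pos (- a * INR n)). split; [nra|].
    pose proof (pow_exp_bound a 2 (INR n) Ha ltac:(lra)).
    apply Rmult_le_reg_r with (INR n); [lra|]. rewrite (Rmult_assoc _ (/ INR n)), Rinv_l, Rmult_1_r by lra.
    apply Rle_trans with (2 := H1). simpl.
    assert (0 <= (INR n - sqrt (INR n)) * (exp (- a * INR n) * INR n))
      by (apply Rmult_le_pos; [lra|apply Rmult_le_pos; lra]). lra.
  - eapply is_lim_seq_real_eq.
    + apply is_lim_seq_mult'; [apply is_lim_seq_const|].
      apply is_lim_seq_inv_INR.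
    + ring.
Qed.

Lemma G0_real_decay eta : 0 < eta <= 1 -> exists c, 0 < c /\ forall t, eta <= Rabs t -> t - exp t + 1 <= - c * Rabs t.
Proof.
  intros He. set (d := 1 - exp (- eta)).
  assert (Hd : 0 < d). { unfold d. assert (exp (- eta) < exp 0) by (apply exp_increasing; lra). rewrite exp_0 in H. lra. }
  set (q := exp (- eta) - 1 + eta).
  assert (Hq : 0 < q). { unfold q. pose proof (exp_ineq1 (- eta) ltac:(lra)) as Hi. lra. }
  (* To the right, [exp t >= 1 + t + t^2 / 2] gives the slope [eta / 2]. To the left, the tangent of
     [exp] at [- eta] gives the bound [- q] at [- eta] and the slope [d] beyond it; [c * eta <= q]
     and [c <= d] then suffice. *)
  exists (Rmin (eta / 2) (Rmin d (q / eta))). split.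
  { apply Rmin_glb_lt; [lra|]. apply Rmin_glb_lt; auto. apply Rdiv_lt_0_compat; lra. }
  set (c := Rmin (eta / 2) (Rmin d (q / eta))).
  assert (Hc1 : c <= eta / 2) by apply Rmin_l.
  assert (Hc2 : c <= d) by (eapply Rle_trans; [apply Rmin_r|apply Rmin_l]).
  assert (Hc3 : c * eta <= q).
  { replace q with (q / eta * eta) by (field; lra). apply Rmult_le_compat_r; [lra|].
    eapply Rle_trans; [apply Rmin_r|apply Rmin_r]. }
  intros t Ht. destruct (Rle_dec 0 t).
  - rewrite Rabs_pos_eq in * by auto. pose proof (exp_ge_taylor t 2 r). simpl in H. nra.
  - rewrite Rabs_left in * by lra. set (u := - t) in *. replace t with (- u) by (unfold u; ring).
    assert (exp (- u) >= exp (- eta) * (1 - (u - eta))).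
    { replace (- u) with (- eta + - (u - eta)) by ring. rewrite exp_plus. apply Rle_ge, Rmult_le_compat_l; [left; apply exp_pos|].
      pose proof (exp_ineq1_le (- (u - eta))). lra. }
    assert (c * (u - eta) <= d * (u - eta)) by (apply Rmult_le_compat_r; lra).
    unfold d, q in *. nra.
Qed.

(** Stirling's formula in two forms: Euler's integral crosses the saddle along the real line,
    Hankel's along the imaginary axis. The factors [exp ((1 + z) t)] and [exp (- z t)] equal 1 at
    the saddle, so the limits do not depend on [z]. *)
Lemma G0_asymptotics psi : PI / 2 < psi < PI -> forall z,
  Clim (fun n => sqrt (INR n) * IntR (fun t => Cexp (INR n * G0 t) * Cexp ((1 + z) * t)))%C (sqrt (2 * PI)) /\
  Clim (fun n => sqrt (INR n) * HU psi (saddle_fun G0 (- z) (INR n)))%C (Ci * sqrt (2 * PI)).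
Proof.
  intros Hpsi z.
  destruct (laplace_local G0 (fun x => - (1) * exp_tail 3 (1 * x))%C) as (eta & Heta & H).
  { apply continuous_along_0, continuous_along_G0. }
  { intros x _. unfold G0. rewrite exp_taylor2, Cmult_1_l. ring. }
  { intros K. apply jet_scal, jet_exp_tail. }
  destruct (H eta ltac:(lra)) as [Hloc HJ]. clear H.
  assert (Hn : forall N : R, eventually (fun n => N <= INR n /\ 1 <= INR n)).
  { intros N. destruct (nfloor_ex (Rmax N 0) (Rmax_r _ _)) as [k [_ Hk]]. exists (S k). intros n Hn.
    apply le_INR in Hn. rewrite S_INR in Hn. pose proof (Rmax_l N 0). pose proof (pos_INR k). lra. }
  split.
  - destruct (HJ (fun x => Cexp ((1 + z) * x))) with (M := 1%nat) as (D & B & HB & HD & HJ1); auto.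
    { intros v; apply (continuous_along_0 _ (continuous_along_Cexp _) v). } { intros; apply jet_Cexp. }
    destruct (G0_real_decay eta Heta) as (c & Hc & Hdec).
    set (m := Rabs (1 + Re z)).
    set (F := fun n t => (Cexp (RtoC (INR n) * G0 (RtoC t)) * Cexp ((1 + z) * RtoC t))%C).
    assert (HF : forall n t, Cmod (F n t) <= exp (INR n * (t - exp t + 1) + m * Rabs t)).
    { intros n t. unfold F. rewrite Cmod_mult, !Cmod_Cexp, <- exp_plus. apply exp_le_exp.
      replace (Re (INR n * G0 t)) with (INR n * (t - exp t + 1)).
      2:{ Csimpl. rewrite Re_G0. Csimpl. rewrite cos_0. ring. }
      apply Rplus_le_compat_l. Csimpl. unfold m. rewrite <- Rabs_mult. rewrite Rmult_0_r, Rminus_0_r. apply Rle_abs. }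
    assert (HFc : forall n, Ccont (F n)).
    { intros n. apply Ccont_mult; apply Ccont_Cexp; apply Ccont_mult; try apply Ccont_const; try apply Ccont_id.
      apply Ccont_ext with (2 := continuous_along_G0 (RtoC 0) (RtoC 1)). intros; f_equal; ring. }
    apply Clim_squeeze with (fun n => 2 * exp ((m + 1) * eta) * (sqrt (INR n) * exp (- (c * eta) * INR n)) + B * / INR n).
    + destruct (Hn ((m + 1) / c)) as [N HN]. exists N. intros n HnN. destruct (HN n HnN) as [Hn1 Hn2].
      assert (Hnc : m + 1 <= c * INR n).
      { replace (m + 1) with (c * ((m + 1) / c)) by (field; lra). apply Rmult_le_compat_l; lra. }
      (* The constant grows with [n]; this only gives the convergence of the integral. The
         quantitative estimate is [Hout], which needs the decay outside [[- eta, eta]] alone. *)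
      assert (HdF : decR (exp (INR n * c * eta)) (F n)).
      { split; auto. intros t. eapply Rle_trans; [apply HF|]. rewrite <- exp_plus. apply exp_le_exp.
        pose proof (Rabs_pos t). assert (0 <= (c * INR n - m - 1) * Rabs t) by (apply Rmult_le_pos; lra).
        assert (t - exp t + 1 <= - c * Rabs t + c * eta).
        { destruct (Rle_dec eta (Rabs t)) as [h|h]; [specialize (Hdec t h); nra|].
          pose proof (exp_ineq1_le t). assert (c * Rabs t <= c * eta) by (apply Rmult_le_compat_l; lra). lra. }
        assert (INR n * (t - exp t + 1) <= INR n * (- c * Rabs t + c * eta)) by (apply Rmult_le_compat_l; lra). lra. }
      assert (Hout := IntR_outer (exp (INR n * c * eta)) (exp (- (c * INR n - m - 1) * eta)) (F n) eta ltac:(lra) HdF).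
      lapply Hout.
      2:{ intros t Ht. eapply Rle_trans; [apply HF|]. rewrite <- exp_plus. apply exp_le_exp.
        assert ((c * INR n - m - 1) * eta <= (c * INR n - m - 1) * Rabs t) by (apply Rmult_le_compat_l; lra).
        specialize (Hdec t Ht). assert (INR n * (t - exp t + 1) <= INR n * (- c * Rabs t)) by (apply Rmult_le_compat_l; lra). lra. }
      clear Hout; intros Hout. fold (F n).
      specialize (HJ1 (RtoC 1) (INR n) (or_introl eq_refl) Hn2).
      assert (EJ : laplace_int G0 (fun x => Cexp ((1 + z) * x)) eta 1 (INR n) = CI (F n) (- eta) eta).
      { unfold laplace_int. apply CI_ext. intros t _. unfold F. rewrite !Cmult_1_l, Cmult_1_r. reflexivity. }
      rewrite EJ in HJ1. simpl csum in HJ1. rewrite HD, Cmult_0_r, Cexp_0 in HJ1.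
      simpl in HJ1. rewrite !Rmult_1_r in HJ1.
      match type of HJ1 with Cmod ?L <= _ => replace L with (sqrt (INR n) * CI (F n) (- eta) eta - sqrt (2 * PI))%C in HJ1 by field end.
      eapply Rle_trans; [apply (Cmod_dist_triangle _ (sqrt (INR n) * CI (F n) (- eta) eta)%C)|].
      apply Rplus_le_compat; auto.
      change (fun t : R => (Cexp (INR n * G0 t) * Cexp ((1 + z) * t))%C) with (F n).
      replace (sqrt (INR n) * IntR (F n) - sqrt (INR n) * CI (F n) (- eta) eta)%C
        with (sqrt (INR n) * (IntR (F n) - CI (F n) (- eta) eta))%C by ring.
      rewrite Cmod_mult, Cmod_R, Rabs_pos_eq by apply sqrt_pos.
      replace (2 * exp ((m + 1) * eta) * (sqrt (INR n) * exp (- (c * eta) * INR n)))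
        with (sqrt (INR n) * (2 * (exp ((m + 1) * eta) * exp (- (c * eta) * INR n)))) by ring.
      apply Rmult_le_compat_l; [apply sqrt_pos|]. apply Rle_trans with (1 := Hout). right. f_equal.
      rewrite <- exp_plus. f_equal. ring.
    + eapply is_lim_seq_real_eq.
      * apply is_lim_seq_plus'; apply is_lim_seq_mult'; try apply is_lim_seq_const.
        -- apply is_lim_seq_INR_exp. nra.
        -- apply is_lim_seq_inv_INR.
      * ring.
  - destruct (HJ (fun x => Cexp (- z * x))) with (M := 1%nat) as (D & B & HB & HD & HJ1); auto.
    { intros v; apply (continuous_along_0 _ (continuous_along_Cexp _) v). } { intros; apply jet_Cexp. }
    pose proof PI_RGT_0. pose proof PI2_3_2.
    assert (Hcospsi : cos psi < 0) by (apply cos_lt_0; lra).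
    (* On the rays [cos psi < 0] makes the real part at least [1 + l]. On the arc it is [1 - cos t],
       which grows with [|t|] from its value at [eta], at least [eta ^ 2 / 4] by the local estimate
       at [Ci * eta]. *)
    set (c1 := Rmin 1 (eta * eta / 4)).
    assert (Hc1 : 0 < c1) by (apply Rmin_glb_lt; nra).
    assert (Hcoseta : eta * eta / 4 <= 1 - cos eta).
    { specialize (Hloc Ci eta (or_intror eq_refl) ltac:(rewrite Rabs_pos_eq; lra)).
      replace (Ci * Ci * G0 (Ci * eta))%C with (- G0 (Ci * eta))%C in Hloc.
      2:{ replace (Ci * Ci)%C with (- (1))%C by (Ceq; ring). ring. }
      rewrite Re_opp, Re_G0 in Hloc. replace (Re (Ci * eta)) with 0 in Hloc by (Csimpl; ring).
      replace (Im (Ci * eta)) with eta in Hloc by (Csimpl; ring). rewrite exp_0 in Hloc. lra. }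
    destruct (HU_laplace G0 (- z) eta psi c1 1) as (C & X0 & HC & HH); auto; try lra.
    { apply continuous_along_G0. }
    { intros t Ht. rewrite Re_G0, Re_ray, Im_ray, exp_0. apply Rle_trans with (1 := Rmin_r _ _).
      replace (cos t) with (cos (Rabs t)) by (unfold Rabs; destruct (Rcase_abs t); auto; apply cos_neg).
      pose proof (cos_decr_1 eta (Rabs t) ltac:(lra) ltac:(lra) ltac:(lra) ltac:(lra) ltac:(lra)). lra. }
    { intros phi l Hphi Hl. rewrite Re_G0, Re_ray, Im_ray.
      replace (cos phi) with (cos psi) by (rewrite <- Hphi; unfold Rabs; destruct (Rcase_abs phi); auto; apply cos_neg).
      pose proof (Rmin_l 1 (eta * eta / 4)). fold c1 in H1. pose proof (exp_pos l). nra. }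
    apply Clim_squeeze with (fun n => C * (sqrt (INR n) * exp (- c1 * INR n)) + B * / INR n).
    + destruct (Hn X0) as [N HN]. exists N. intros n HnN. destruct (HN n HnN) as [Hn1 Hn2].
      destruct (HH (INR n) Hn1) as [_ HHn].
      specialize (HJ1 Ci (INR n) (or_intror eq_refl) Hn2).
      simpl csum in HJ1. rewrite HD, Cmult_0_r, Cexp_0 in HJ1. simpl in HJ1. rewrite !Rmult_1_r in HJ1.
      set (J := laplace_int G0 (fun x => Cexp (- z * x)) eta Ci (INR n)) in *.
      match type of HJ1 with Cmod ?L <= _ => replace L with (sqrt (INR n) * J - sqrt (2 * PI))%C in HJ1 by field end.
      eapply Rle_trans; [apply (Cmod_dist_triangle _ (sqrt (INR n) * (Ci * J))%C)|].
      apply Rplus_le_compat.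
      * match goal with |- Cmod (?a * ?b - ?a * ?d)%C <= _ => replace (a * b - a * d)%C with (a * (b - d))%C by ring end.
        rewrite Cmod_mult, Cmod_R, Rabs_pos_eq by apply sqrt_pos.
        apply Rle_trans with (sqrt (INR n) * (C * exp (- c1 * INR n))); [|right; ring].
        apply Rmult_le_compat_l; [apply sqrt_pos|auto].
      * replace (sqrt (INR n) * (Ci * J) - Ci * sqrt (2 * PI))%C with (Ci * (sqrt (INR n) * J - sqrt (2 * PI)))%C by ring.
        rewrite Cmod_mult, Cmod_Ci. lra.
    + eapply is_lim_seq_real_eq.
      * apply is_lim_seq_plus'; apply is_lim_seq_mult'; try apply is_lim_seq_const.
        -- apply is_lim_seq_INR_exp. auto.
        -- apply is_lim_seq_inv_INR.
      * ring.
Qed.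

(** * Complex powers and the limit of Gauss's product *)

Lemma Rcpow_add x z w : Rcpow x (z + w) = (Rcpow x z * Rcpow x w)%C.
Proof. unfold Rcpow. rewrite <- Cexp_add. f_equal. ring. Qed.

Lemma Rcpow_RtoC x (a : R) : Rcpow x a = RtoC (Rpower x a).
Proof. unfold Rcpow, Rpower. rewrite <- RtoC_mult. apply Cexp_RtoC. Qed.

Lemma Rcpow_1 x : 0 < x -> Rcpow x 1 = RtoC x.
Proof. intros. rewrite Rcpow_RtoC, Rpower_1; auto. Qed.

Lemma Rcpow_neq_0 x z : Rcpow x z <> RtoC 0.
Proof. apply Cexp_neq_0. Qed.

Lemma Rcpow_opp x z : Rcpow x (- z) = (/ Rcpow x z)%C.
Proof. unfold Rcpow. rewrite <- Cexp_opp. f_equal. ring. Qed.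

Lemma Cmod_Rcpow x z : Cmod (Rcpow x z) = Rpower x (Re z).
Proof. unfold Rcpow, Rpower. rewrite Cmod_Cexp. f_equal. Csimpl. ring. Qed.

Lemma Clim_quotient (u v : nat -> C) h : Clim v 1 -> (forall n, (1 <= n)%nat -> (u n * v n = h)%C) -> Clim u h.
Proof.
  intros Hv H. destruct (Clim_eventually v 1 (1/2) ltac:(lra) Hv) as [N HN].
  apply Clim_ext_loc with (fun n => h * / v n)%C.
  - exists (S N). intros n Hn. rewrite <- (H n) by lia. specialize (HN n ltac:(lia)).
    assert (v n <> 0).
    { intros E. rewrite E in HN. replace (0 - 1)%C with (- RtoC 1)%C in HN by ring. rewrite Cmod_opp, Cmod_1 in HN. lra. }
    field. auto.
  - assert (H1 : RtoC 1 <> 0) by (intros E; apply RtoC_inj in E; lra).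
    assert (L := Clim_scal h _ _ (Clim_inv v _ H1 Hv)).
    now replace (h * / 1)%C with h in L by field.
Qed.

Definition I0 (n : nat) (z : C) : C := IntR (fun t => Cexp (INR n * G0 t) * Cexp ((1 + z) * t))%C.

Lemma Gam_I0 n z : (1 <= n)%nat -> 0 <= Re z ->
  Gam (z + INR (S n)) = (Rcpow (INR n) (z + INR (S n)) * (exp (- INR n) * I0 n z))%C.
Proof.
  intros Hn Hz. apply le_INR in Hn; simpl in Hn.
  assert (Hre : 1 <= Re (z + INR (S n))) by (rewrite Re_plus, Re_RtoC, S_INR; pose proof (pos_INR n); lra).
  rewrite (Gam_scale (INR n)) by (auto; lra). f_equal.
  destruct (decR_Gam_fun (INR n) (z + INR (S n)) ltac:(lra) Hre) as [B HB].
  unfold I0.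
  rewrite (IntR_ext (fun t => Cexp (INR n * G0 t) * Cexp ((1 + z) * t))%C
     (fun t => exp (INR n) * Gam_fun (INR n) (z + INR (S n)) t)%C).
  - rewrite (IntR_scal B) by auto. rewrite Cmult_assoc, <- RtoC_mult, <- exp_plus.
    replace (- INR n + INR n) with 0 by ring. rewrite exp_0. ring.
  - intros t. unfold Gam_fun, G0. rewrite <- (Cexp_RtoC (INR n)), <- !Cexp_add. f_equal.
    rewrite S_INR, RtoC_plus, Cexp_RtoC. ring.
Qed.

Lemma fact_I0 n : (1 <= n)%nat ->
  RtoC (INR (fact n)) = (Rcpow (INR n) (INR (S n)) * (exp (- INR n) * I0 n 0))%C.
Proof.
  intros Hn. rewrite <- Gam_fact. replace (INR n + 1)%C with (0 + INR (S n))%C.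
  - rewrite Gam_I0 by (auto; rewrite Re_RtoC; lra). do 2 f_equal. ring.
  - rewrite S_INR, RtoC_plus. ring.
Qed.

Lemma hankel_saddle psi n z : 0 <= psi -> cos psi < 0 -> (1 <= n)%nat ->
  hankel psi (z + INR (S n)) =
  (Rcpow (INR n) (1 - (z + INR (S n))) * (exp (INR n) * HU psi (saddle_fun G0 (- z) (INR n))) / (2 * PI * Ci))%C.
Proof.
  intros Hpsi Hcos Hn. apply le_INR in Hn; simpl in Hn.
  rewrite (hankel_scale psi (INR n)) by auto. f_equal. f_equal.
  destruct (dec_rays_hankel (INR n) (1 - (z + INR (S n))) psi ltac:(lra) Hcos) as [B HB].
  rewrite (HU_ext psi (saddle_fun G0 (- z) (INR n)) (fun x => exp (- INR n) * hankel_fun (INR n) (1 - (z + INR (S n))) x)%C).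
  - rewrite (HU_scal B) by (auto; apply continuous_along_hankel).
    rewrite Cmult_assoc, <- RtoC_mult, <- exp_plus.
    replace (INR n + - INR n) with 0 by ring. rewrite exp_0. ring.
  - intros x. unfold saddle_fun, hankel_fun, G0. rewrite <- Cexp_RtoC, <- !Cexp_add. f_equal.
    rewrite S_INR, RtoC_plus, RtoC_opp. ring.
Qed.

Lemma C_sqrt_sqrt x : 0 <= x -> (RtoC (sqrt x) * RtoC (sqrt x))%C = RtoC x.
Proof. intros. rewrite <- RtoC_mult, sqrt_sqrt; auto. Qed.

(** Gauss's quotient times [n! n^z hankel (z + n + 1)] is [hankel z] by the recurrence. The second
    factor tends to 1: the two saddle point integrals contribute [sqrt (2 PI)] and
    [Ci * sqrt (2 PI)], against the divisor [2 PI Ci]. *)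
Lemma gauss_product_hankel psi z : PI / 2 < psi < PI ->
  Clim (fun n => Crising z (S n) / (INR (fact n) * Rcpow (INR n) z))%C (hankel psi z).
Proof.
  intros Hpsi. pose proof PI_RGT_0.
  assert (Hcos : cos psi < 0) by (apply cos_lt_0; lra).
  apply Clim_quotient with
    (fun n => (sqrt (INR n) * I0 n 0) * ((sqrt (INR n) * HU psi (saddle_fun G0 (- z) (INR n))) * / (2 * PI * Ci)))%C.
  - replace (RtoC 1) with (RtoC (sqrt (2 * PI)) * ((Ci * RtoC (sqrt (2 * PI))) * / (2 * PI * Ci)))%C.
    + apply Clim_mult; [apply (G0_asymptotics psi Hpsi 0)|]. apply Clim_mult; [|apply Clim_const].
      apply (G0_asymptotics psi Hpsi z).
    + replace (RtoC (sqrt (2 * PI)) * ((Ci * RtoC (sqrt (2 * PI))) * / (2 * PI * Ci)))%C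
        with ((RtoC (sqrt (2 * PI)) * RtoC (sqrt (2 * PI))) * Ci * / (2 * PI * Ci))%C by ring.
      rewrite C_sqrt_sqrt by lra. rewrite RtoC_mult. pose proof C_2PI_neq_0. field.
      split; [intros E; rewrite E in H0; apply H0; ring|].
      intros E; apply RtoC_inj in E; lra.
  - intros n Hn. rewrite (hankel_Crising psi z (S n)) by lra.
    assert (Hf : RtoC (INR (fact n)) <> 0) by apply C_fact_neq_0.
    assert (HR := Rcpow_neq_0 (INR n) z).
    assert (E : (INR (fact n) * Rcpow (INR n) z * hankel psi (z + INR (S n)) =
      (sqrt (INR n) * I0 n 0) * ((sqrt (INR n) * HU psi (saddle_fun G0 (- z) (INR n))) * / (2 * PI * Ci)))%C).
    { rewrite hankel_saddle by (auto; lra). rewrite fact_I0 by auto.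
      set (K := HU psi (saddle_fun G0 (- z) (INR n))).
      transitivity ((Rcpow (INR n) (INR (S n)) * Rcpow (INR n) z * Rcpow (INR n) (1 - (z + INR (S n))))
         * (exp (- INR n) * exp (INR n)) * I0 n 0 * K * / (2 * PI * Ci))%C; [unfold Cdiv; ring|].
      rewrite <- !Rcpow_add, <- RtoC_mult, <- exp_plus.
      replace (- INR n + INR n) with 0 by ring. rewrite exp_0.
      replace (INR (S n) + z + (1 - (z + INR (S n))))%C with (RtoC 1) by ring.
      apply le_INR in Hn; simpl in Hn. rewrite Rcpow_1 by lra.
      rewrite <- (C_sqrt_sqrt (INR n)) at 1 by lra. ring. }
    rewrite <- E. field. auto.
Qed.

Lemma rGamma_hankel psi z : PI / 2 < psi < PI -> rGamma z = hankel psi z.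
Proof. intros H. apply Clim_seq_eq, gauss_product_hankel, H. Qed.

Definition psi0 : R := 3 * PI / 4.

Lemma psi0_bounds : PI / 2 < psi0 < PI.
Proof. unfold psi0. pose proof PI_RGT_0. lra. Qed.

Lemma gauss_product_rGamma z :
  Clim (fun n => Crising z (S n) / (INR (fact n) * Rcpow (INR n) z))%C (rGamma z).
Proof. rewrite (rGamma_hankel psi0) by apply psi0_bounds. apply gauss_product_hankel, psi0_bounds. Qed.

Lemma rGamma_rec z : rGamma z = (z * rGamma (z + 1))%C.
Proof.
  pose proof psi0_bounds. pose proof PI_RGT_0. rewrite !(rGamma_hankel psi0) by auto.
  apply hankel_rec; [lra|apply cos_lt_0; lra].
Qed.

Lemma rGamma_Crising z n : rGamma z = (Crising z n * rGamma (z + INR n))%C.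
Proof.
  pose proof psi0_bounds. pose proof PI_RGT_0. rewrite !(rGamma_hankel psi0) by auto.
  apply hankel_Crising; [lra|apply cos_lt_0; lra].
Qed.

(** Gauss's quotient times [Gam z] equals [I0 n z / I0 n 0], and both integrals have the leading
    term [sqrt (2 PI / n)]. *)
Lemma Gam_rGamma z : 1 <= Re z -> (Gam z * rGamma z)%C = RtoC 1.
Proof.
  intros Hz. pose proof PI_RGT_0.
  destruct (G0_asymptotics psi0 psi0_bounds 0) as [L0 _].
  destruct (G0_asymptotics psi0 psi0_bounds z) as [Lz _].
  assert (Hs : RtoC (sqrt (2 * PI)) <> 0).
  { intros E; apply RtoC_inj in E. assert (0 < sqrt (2 * PI)) by (apply sqrt_lt_R0; lra). lra. }
  assert (E : (Gam z * rGamma z * sqrt (2 * PI) = sqrt (2 * PI))%C).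
  { apply Clim_unique with (fun n => sqrt (INR n) * I0 n z)%C; [|apply Lz].
    apply Clim_ext_loc with (fun n => Gam z * (Crising z (S n) / (INR (fact n) * Rcpow (INR n) z)) * (sqrt (INR n) * I0 n 0))%C.
    - exists 1%nat. intros n Hn.
      assert (E : (Crising z (S n) * Gam z * I0 n 0 = INR (fact n) * Rcpow (INR n) z * I0 n z)%C).
      { rewrite <- Gam_Crising by auto. rewrite Gam_I0, fact_I0 by (auto; lra). rewrite Rcpow_add. ring. }
      pose proof (C_fact_neq_0 n). pose proof (Rcpow_neq_0 (INR n) z).
      transitivity (sqrt (INR n) * (Crising z (S n) * Gam z * I0 n 0) / (INR (fact n) * Rcpow (INR n) z))%C; [field; auto|].
      rewrite E. field; auto.
    - apply Clim_mult; auto. apply Clim_scal, gauss_product_rGamma. }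
  replace (Gam z * rGamma z)%C with (Gam z * rGamma z * sqrt (2 * PI) / sqrt (2 * PI))%C by (field; auto).
  rewrite E. field. auto.
Qed.

Lemma CGamma_Gam z : 1 <= Re z -> CGamma z = Gam z.
Proof.
  intros Hz. pose proof (Gam_rGamma z Hz) as H. unfold CGamma.
  assert (Hr : rGamma z <> 0).
  { intros E. rewrite E, Cmult_0_r in H. apply RtoC_inj in H. lra. }
  replace (/ rGamma z)%C with (Gam z * rGamma z * / rGamma z)%C by (rewrite H; ring). field. auto.
Qed.

(** * Complex series and limits along U-shaped paths *)

Lemma Lim_seq_real_eq (u : nat -> R) (l : R) : is_lim_seq u l -> real (Lim_seq u) = l.
Proof. intros H. now rewrite (is_lim_seq_unique _ _ H). Qed.

Lemma Re_csum n u : Re (csum (S n) u) = sum_n (fun k => Re (u k)) n.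
Proof.
  induction n.
  - rewrite sum_O. cbn [csum]. now rewrite Cplus_0_l.
  - rewrite sum_Sn, <- IHn. reflexivity.
Qed.

Lemma Im_csum n u : Im (csum (S n) u) = sum_n (fun k => Im (u k)) n.
Proof.
  induction n.
  - rewrite sum_O. cbn [csum]. now rewrite Cplus_0_l.
  - rewrite sum_Sn, <- IHn. reflexivity.
Qed.

Lemma CSeries_eq u l : Clim (fun n => csum n u) l -> CSeries u = l.
Proof.
  (* [csum n] has [n] terms, the [n]-th partial sum of [Series] has [n + 1]. *)
  intros H. apply Clim_S in H. unfold CSeries, Series. apply C_eq; simpl; apply Lim_seq_real_eq.
  - apply is_lim_seq_ext with (2 := Clim_Re _ _ H). intros; apply Re_csum.
  - apply is_lim_seq_ext with (2 := Clim_Im _ _ H). intros; apply Im_csum.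
Qed.

Lemma exp_sum_bound n w : Cmod (exp_sum n w) <= exp (Cmod w).
Proof.
  assert (H : forall x, 0 <= x -> forall n, Re (exp_sum (S n) x) <= exp x).
  { intros x Hx m. unfold exp_sum. rewrite Re_csum.
    rewrite (sum_n_ext _ (fun k => x ^ k / INR (fact k))).
    - rewrite sum_n_Reals. apply exp_ge_taylor; auto.
    - intros k. rewrite <- RtoC_pow, <- RtoC_div, Re_RtoC; auto. apply INR_fact_neq_0. }
  assert (A : Cmod (exp_sum n w) <= Re (exp_sum n (Cmod w))).
  { unfold exp_sum. induction n; cbn [csum].
    - rewrite Cmod_0, Re_RtoC. lra.
    - eapply Rle_trans; [apply Cmod_triangle|]. rewrite Re_plus. apply Rplus_le_compat; auto.
      rewrite <- RtoC_pow, <- RtoC_div, Re_RtoC by apply INR_fact_neq_0.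
      rewrite Cmod_div by apply C_fact_neq_0. rewrite Cmod_pow, (Cmod_R (INR _)), (Rabs_pos_eq (INR _)) by apply pos_INR. lra. }
  apply Rle_trans with (1 := A). destruct n; [|apply H, Cmod_ge_0].
  unfold exp_sum; simpl. left; apply exp_pos.
Qed.

Lemma dec_rays_scal B psi c E : dec_rays B psi E -> dec_rays (Cmod c * B) psi (fun z => c * E z)%C.
Proof. intros [H1 H2]. split; apply dec0_scal; auto. Qed.

Lemma HU_plus B B' psi E F : continuous_along E -> continuous_along F -> dec_rays B psi E -> dec_rays B' psi F ->
  HU psi (fun z => E z + F z)%C = (HU psi E + HU psi F)%C.
Proof.
  intros Hc Hc' HE HF.
  assert (Hc2 : continuous_along (fun z => - (1) * F z)%C).
  { intros v w. apply Ccont_mult; [apply Ccont_const|apply Hc']. }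
  rewrite (HU_ext _ _ (fun z => E z - (- (1) * F z))%C) by (intros; ring).
  rewrite (HU_minus B (Cmod (- (1)) * B')); auto; [|apply dec_rays_scal; auto].
  rewrite (HU_scal B') by auto. ring.
Qed.

Lemma HU_lim B psi En E : 0 <= psi -> (forall n, continuous_along (En n)) -> continuous_along E ->
  (forall n, dec_rays B psi (En n)) -> dec_rays B psi E ->
  (forall b eps, 0 <= b -> 0 < eps -> eventually (fun n => forall x phi, 0 <= x <= b -> - psi <= phi <= psi ->
      Cmod (En n (ray phi x) - E (ray phi x)) <= eps)) ->
  Clim (fun n => HU psi (En n)) (HU psi E).
Proof.
  intros Hpsi Hcn Hc Hdn Hd Hunif. unfold HU. apply Clim_plus.
  - apply Clim_scal. apply CI_lim; [lra|intros; apply continuous_along_arc; auto|apply continuous_along_arc; auto|].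
    intros eps He. destruct (Hunif 0 eps (Rle_refl 0) He) as [N HN]. exists N. intros; apply HN; auto; lra.
  - apply Int0_lim with (B + B).
    + intros n. apply dec0_minus; apply Hdn.
    + apply dec0_minus; apply Hd.
    + intros b Hb eps He. destruct (Hunif b (eps / 2) Hb ltac:(lra)) as [N HN]. exists N. intros n Hn y Hy.
      replace (En n (ray psi y) - En n (ray (- psi) y) - (E (ray psi y) - E (ray (- psi) y)))%C
        with ((En n (ray psi y) - E (ray psi y)) - (En n (ray (- psi) y) - E (ray (- psi) y)))%C by ring.
      eapply Rle_trans; [apply Cmod_minus_le|].
      pose proof (HN n Hn y psi Hy ltac:(lra)). pose proof (HN n Hn y (- psi) Hy ltac:(lra)). lra.
Qed.

(** * The Wright function as an integral through its saddle point *)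

(* [sigma X Gs] is [- t + x t^sigma] minus its maximum, in the variable [ln (t / c)] where [c] is the
   saddle point; the factor is chosen so that the second derivative at the saddle is -1. *)
Definition Gs (s : R) (z : C) : C := (/ (1 - s) * ((Cexp (s * z) - 1) / s - (Cexp z - 1)))%C.

Lemma continuous_along_Gs s : continuous_along (Gs s).
Proof.
  intros v w. assert (L : Ccont (fun y => v + w * y)%C).
  { apply Ccont_plus; [apply Ccont_const|apply Ccont_mult; [apply Ccont_const|apply Ccont_id]]. }
  apply Ccont_mult; [apply Ccont_const|]. apply Ccont_minus.
  - apply Ccont_mult; [|apply Ccont_const]. apply Ccont_minus; [|apply Ccont_const].
    apply Ccont_Cexp, Ccont_mult; auto. apply Ccont_const.
  - apply Ccont_minus; [|apply Ccont_const]. apply Ccont_Cexp; auto.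
Qed.

Lemma Gs_taylor s z : 0 < s < 1 ->
  Gs s z = (- (z * z / 2) + z ^ 3 * (/ (1 - s) * (s * s * exp_tail 3 (s * z) + - (1) * exp_tail 3 (1 * z))))%C.
Proof.
  intros Hs. unfold Gs. rewrite (exp_taylor2 (s * z)), (exp_taylor2 z), Cmult_1_l. 
  assert (RtoC s <> 0) by (intros E; apply RtoC_inj in E; lra).
  assert ((1 - s)%C <> 0) by (rewrite <- RtoC_minus; intros E; apply RtoC_inj in E; lra).
  simpl Cpow. field. auto.
Qed.

Lemma Re_Gs s z : 0 < s < 1 ->
  Re (Gs s z) = / (1 - s) * ((exp (s * Re z) * cos (s * Im z) - 1) / s - (exp (Re z) * cos (Im z) - 1)).
Proof.
  intros Hs. unfold Gs, Cdiv. rewrite <- RtoC_minus, <- !RtoC_inv by lra.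
  assert (E : forall (a : R) w, Re (a * w)%C = a * Re w) by (intros; Csimpl; ring).
  assert (E' : forall (a : R) w, Re (w * a)%C = a * Re w) by (intros; Csimpl; ring).
  rewrite E, !Re_minus, E', !Re_minus, Re_RtoC.
  change (Re (Cexp z)) with (exp (Re z) * cos (Im z)).
  change (Re (Cexp (s * z))) with (exp (Re (s * z)) * cos (Im (s * z))).
  rewrite E. replace (Im (s * z)) with (s * Im z) by (Csimpl; ring). unfold Rdiv. ring.
Qed.

(** The angle with [s psi = PI - psi]. Up to it [sin t >= sin (s t)], so the real part of [Gs]
    increases along the arc; at it [cos psi < 0 < cos (s psi)], so both exponentials increase the
    real part along the rays. *)
Definition psis (s : R) : R := PI / (1 + s).

Lemma psis_bounds s : 0 < s < 1 -> PI / 2 < psis s < PI.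
Proof.
  intros Hs. pose proof PI_RGT_0. unfold psis. split.
  - apply Rmult_lt_compat_l; auto. apply Rinv_lt_contravar; nra.
  - rewrite <- (Rmult_1_r PI) at 2. apply Rmult_lt_compat_l; auto. rewrite <- Rinv_1 at 2. apply Rinv_lt_contravar; lra.
Qed.

(** The derivative [sin t - sin (s t)] is [2 cos ((1 + s) t / 2) sin ((1 - s) t / 2)], nonnegative
    as long as [(1 + s) t <= PI]: this is what determines [psis]. *)
Lemma Gs_arc_mono s t u : 0 < s < 1 -> 0 <= t <= u -> u <= psis s ->
  (cos (s * t) - 1) / s - (cos t - 1) <= (cos (s * u) - 1) / s - (cos u - 1).
Proof.
  intros Hs Ht Hu. pose proof (psis_bounds s Hs). pose proof PI_RGT_0.
  destruct (MVT_gen (fun t => (cos (s * t) - 1) / s - (cos t - 1)) t u (fun t => sin t - sin (s * t))) as (c & Hc & E).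
  - intros y _. auto_derive; auto. field; lra.
  - intros y _. reg.
  - rewrite Rmin_left, Rmax_right in Hc by lra.
    assert (0 <= sin c - sin (s * c)).
    { rewrite form4. apply Rmult_le_pos; [apply Rmult_le_pos; [lra|]|].
      - apply cos_ge_0; [nra|].
        assert ((1 + s) * psis s = PI) by (unfold psis; field; lra). nra.
      - apply sin_ge_0; nra. }
    nra.
Qed.

Lemma cos_Rabs t : cos (Rabs t) = cos t.
Proof. unfold Rabs. destruct (Rcase_abs t); auto. apply cos_neg. Qed.

Lemma Gs_HU s b eta : 0 < s < 1 -> 0 < eta <= 1 ->
  (forall w y, direction w -> Rabs y <= eta -> Re (w * w * Gs s (w * y)%C) <= - (y * y / 4)) ->
  exists c1 B X0, 0 < c1 /\ 0 <= B /\ forall X, X0 <= X ->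
    (exists B', dec_rays B' (psis s) (saddle_fun (Gs s) b X)) /\
    Cmod (HU (psis s) (saddle_fun (Gs s) b X) - Ci * laplace_int (Gs s) (fun z => Cexp (b * z)) eta Ci X)
      <= B * exp (- c1 * X).
Proof.
  intros Hs Heta Hloc. pose proof (psis_bounds s Hs) as Hpsi. pose proof PI2_3_2. pose proof PI_RGT_0.
  assert (Hk : 0 < / (1 - s)) by (apply Rinv_0_lt_compat; lra).
  assert (Hcos : cos (psis s) < 0) by (apply cos_lt_0; lra).
  assert (Hcoss : 0 <= cos (s * psis s)).
  { apply cos_ge_0; [nra|]. replace (s * psis s) with (PI - psis s) by (unfold psis; field; lra). lra. }
  assert (Harc : forall t, eta <= Rabs t <= psis s -> eta * eta / 4 <= Re (Gs s (ray t 0))).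
  { intros t Ht. rewrite Re_Gs, Re_ray, Im_ray, Rmult_0_r, exp_0, !Rmult_1_l by auto.
    specialize (Hloc Ci eta (or_intror eq_refl) ltac:(rewrite Rabs_pos_eq; lra)).
    replace (Ci * Ci * Gs s (Ci * eta))%C with (- Gs s (Ci * eta))%C in Hloc.
    2:{ replace (Ci * Ci)%C with (- (1))%C by (Ceq; ring). ring. }
    rewrite Re_opp, Re_Gs in Hloc by auto. replace (Re (Ci * eta)) with 0 in Hloc by (Csimpl; ring).
    replace (Im (Ci * eta)) with eta in Hloc by (Csimpl; ring). rewrite Rmult_0_r, exp_0, !Rmult_1_l in Hloc.
    rewrite <- (cos_Rabs t), <- (cos_Rabs (s * t)), Rabs_mult, (Rabs_pos_eq s) by lra.
    pose proof (Gs_arc_mono s eta (Rabs t) Hs ltac:(lra) ltac:(lra)). nra. }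
  exists (eta * eta / 4).
  (* The slope on the rays comes from [exp l >= 1 + l] in the term with [cos (psis s)]; by [Hcoss]
     the other exponential only increases the real part. *)
  destruct (HU_laplace (Gs s) b eta (psis s) (eta * eta / 4) (/ (1 - s) * - cos (psis s))) as (B & X0 & HB & H1).
  - apply continuous_along_Gs.
  - lra.
  - nra.
  - nra.
  - auto.
  - intros phi l Hphi Hl. specialize (Harc phi ltac:(lra)).
    rewrite Re_Gs, Re_ray, Im_ray in * by auto. rewrite Rmult_0_r, exp_0, !Rmult_1_l in Harc.
    rewrite <- (cos_Rabs phi), <- (cos_Rabs (s * phi)), Rabs_mult, (Rabs_pos_eq s), Hphi in * by lra.
    apply Rle_trans with (/ (1 - s) * ((cos (s * psis s) - 1) / s - (cos (psis s) - 1)) + / (1 - s) * - cos (psis s) * l); [lra|].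
    replace (/ (1 - s) * ((cos (s * psis s) - 1) / s - (cos (psis s) - 1)) + / (1 - s) * - cos (psis s) * l)
      with (/ (1 - s) * ((cos (s * psis s) - 1) / s - (cos (psis s) - 1) + - cos (psis s) * l)) by ring.
    apply Rmult_le_compat_l; [lra|].
    pose proof (exp_ineq1_le l). pose proof (exp_ineq1_le (s * l)).
    assert (/ s > 0) by (apply Rinv_0_lt_compat; lra).
    assert ((cos (s * psis s) - 1) / s <= (exp (s * l) * cos (s * psis s) - 1) / s).
    { apply Rmult_le_compat_r; [lra|]. assert (0 <= s * l) by nra. nra. }
    nra.
  - exists B, X0. split; [nra|]. auto.
Qed.

(** With [t = c exp z] and [x c^s = c / s], this is the form [exp (t - x t^s) t^(- b) dt] up to a
    power of [c]. Expanding [exp (- x t^s)] produces Hankel integrals for 1/Gamma(b - s n), hence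
    the series of Psi. *)
Definition wright_fun (c s : R) (b z : C) : C := (hankel_fun c (1 - b) z * Cexp (- (c / s)%R * Cexp (s * z)))%C.

Definition wright_partial (c s : R) (b : C) (n : nat) (z : C) : C :=
  (hankel_fun c (1 - b) z * exp_sum n (- (c / s)%R * Cexp (s * z)))%C.

Lemma continuous_along_wright_partial c s b n : continuous_along (wright_partial c s b n).
Proof.
  intros v w. apply Ccont_mult; [apply continuous_along_hankel|].
  unfold exp_sum. apply Ccont_csum. intros k. apply Ccont_mult; [|apply Ccont_const].
  apply Ccont_pow. apply Ccont_mult; [apply Ccont_const|]. apply continuous_along_Cexp.
Qed.

Lemma continuous_along_wright c s b : continuous_along (wright_fun c s b).
Proof.
  intros v w. apply Ccont_mult; [apply continuous_along_hankel|].
  apply Ccont_Cexp. apply Ccont_mult; [apply Ccont_const|]. apply continuous_along_Cexp.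
Qed.

Lemma Cmod_wright_arg c s phi l : 0 < c -> 0 < s ->
  Cmod (- (c / s)%R * Cexp (s * ray phi l)) = c / s * exp (s * l).
Proof.
  intros Hc Hs. assert (0 < c / s) by (apply Rdiv_lt_0_compat; auto).
  rewrite Cmod_mult, Cmod_opp, Cmod_R, Cmod_Cexp, Rabs_pos_eq by lra. do 2 f_equal.
  rewrite Re_mult, Re_ray, Re_RtoC, Im_RtoC. ring.
Qed.

Lemma Cmod_hankel_ray c b phi l :
  Cmod (hankel_fun c b (ray phi l)) <= exp (c * cos phi * exp l + Re b * l + Rabs (Im b) * Rabs phi).
Proof.
  unfold hankel_fun. rewrite Cmod_Cexp. apply exp_le_exp.
  rewrite Re_plus, Re_Cexp_mult, Re_ray, Im_ray. pose proof (Re_mult_ray b phi l). lra.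
Qed.

(** One constant serves all partial sums: each is bounded by the exponential of the modulus
    [c / s * exp (s * l)], which loses against [exp (c cos psi exp l)] because [s < 1]. *)
Lemma dec_rays_wright c s b psi : 0 < c -> 0 < s < 1 -> 0 <= psi -> cos psi < 0 ->
  exists B, dec_rays B psi (wright_fun c s b) /\ forall n, dec_rays B psi (wright_partial c s b n).
Proof.
  intros Hc Hs Hpsi Hcos. assert (Hcs : 0 < c / s) by (apply Rdiv_lt_0_compat; lra).
  destruct (exp_growth (- (c * cos psi)) (c / s) (Re (1 - b)%C + 1) s) as [B HB]; [nra|lra|lra|].
  set (B' := exp (B + Rabs (Im (1 - b)%C) * psi)).
  assert (A : forall phi l t, 0 <= l -> cos phi = cos psi -> Rabs phi = psi -> Cmod t <= exp (c / s * exp (s * l)) ->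
    Cmod (hankel_fun c (1 - b) (ray phi l) * t) <= B' * exp (- l)).
  { intros phi l t Hl E1 E2 Ht. rewrite Cmod_mult.
    eapply Rle_trans; [apply Rmult_le_compat; [apply Cmod_ge_0|apply Cmod_ge_0|apply Cmod_hankel_ray|apply Ht]|].
    unfold B'. rewrite <- !exp_plus, E1, E2. apply exp_le_exp. specialize (HB l Hl). lra. }
  assert (E : forall phi l, Cmod (Cexp (- (c / s)%R * Cexp (s * ray phi l))) <= exp (c / s * exp (s * l))).
  { intros. rewrite Cmod_Cexp. apply exp_le_exp. rewrite <- (Cmod_wright_arg c s phi l) by lra.
    apply Rle_trans with (1 := Rle_abs _), re_le_Cmod. }
  assert (E' : forall n phi l, Cmod (exp_sum n (- (c / s)%R * Cexp (s * ray phi l))) <= exp (c / s * exp (s * l))).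
  { intros. rewrite <- (Cmod_wright_arg c s phi l) by lra. apply exp_sum_bound. }
  assert (R1 : Rabs psi = psi) by (apply Rabs_pos_eq; auto).
  assert (R2 : Rabs (- psi) = psi) by (rewrite Rabs_Ropp; auto).
  exists B'. split; [|intros n]; split; split.
  - apply continuous_along_ray, continuous_along_wright.
  - intros l Hl. apply (A psi l _ Hl eq_refl R1 (E psi l)).
  - apply continuous_along_ray, continuous_along_wright.
  - intros l Hl. apply (A (- psi) l _ Hl (cos_neg psi) R2 (E (- psi) l)).
  - apply continuous_along_ray, continuous_along_wright_partial.
  - intros l Hl. apply (A psi l _ Hl eq_refl R1 (E' n psi l)).
  - apply continuous_along_ray, continuous_along_wright_partial.
  - intros l Hl. apply (A (- psi) l _ Hl (cos_neg psi) R2 (E' n (- psi) l)).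
Qed.

(** Hankel's integral for 1/Gamma(b - s n) is scaled by [c]; the factor [c^(s n)] from the scaling
    and [x^n] combine to [(c / s)^n] by the saddle equation for [c], which is the last
    hypothesis. *)
Lemma wright_series_terms s b c x n : 0 < s < 1 -> 1 <= c -> x * Rpower c s = c / s ->
  csum n (fun n => (RtoC (- x)) ^ n * rGamma (RtoC (- s) * INR n + b) / INR (fact n))%C =
  (Rcpow c (1 - b) / (2 * PI * Ci) * HU (psis s) (wright_partial c s b n))%C.
Proof.
  intros Hs Hc Hx. pose proof (psis_bounds s Hs) as Hpsi. pose proof PI_RGT_0.
  assert (Hcos : cos (psis s) < 0) by (apply cos_lt_0; lra).
  destruct (dec_rays_wright c s b (psis s)) as (B & _ & HB); auto; try lra.
  induction n.
  - cbn [csum]. rewrite (HU_ext _ _ (fun z => 0 * hankel_fun c (1 - b) z)%C).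
    + destruct (dec_rays_hankel c (1 - b) (psis s) ltac:(lra) Hcos) as [B1 HB1].
      rewrite (HU_scal B1) by (auto; apply continuous_along_hankel). ring.
    + intros z. unfold wright_partial, exp_sum. cbn [csum]. ring.
  - cbn [csum]. rewrite IHn.
    set (q := RtoC (- (c / s))).
    assert (Eq : (RtoC (- x) * RtoC (Rpower c s) = q)%C).
    { unfold q. rewrite <- RtoC_mult. f_equal. rewrite <- Hx. ring. }
    rewrite (HU_ext _ (wright_partial c s b (S n))
      (fun z => wright_partial c s b n z + (q ^ n / INR (fact n)) * hankel_fun c (1 - b + s * INR n) z)%C).
    2:{ intros z. unfold wright_partial, exp_sum. cbn [csum]. unfold q.
        rewrite RtoC_opp.
        assert (E : hankel_fun c (1 - b + s * INR n) z = (hankel_fun c (1 - b) z * Cexp (s * z) ^ n)%C).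
        { unfold hankel_fun. rewrite <- Cexp_INR_mult, <- Cexp_add. f_equal. ring. }
        rewrite E, Cpow_mult_l. unfold Cdiv. ring. }
    destruct (dec_rays_hankel c (1 - b + s * INR n) (psis s) ltac:(lra) Hcos) as [B1 HB1].
    pose proof (continuous_along_hankel c (1 - b + s * INR n)) as Hc1.
    rewrite (HU_plus B (Cmod (q ^ n / INR (fact n)) * B1)).
    + rewrite (HU_scal B1) by auto. rewrite (rGamma_hankel (psis s)) by auto.
      rewrite (hankel_scale (psis s) c) by (auto; lra).
      replace (1 - (RtoC (- s) * INR n + b))%C with (1 - b + s * INR n)%C by (rewrite RtoC_opp; ring).
      rewrite Rcpow_add.
      assert (E : Rcpow c (s * INR n) = (RtoC (Rpower c s) ^ n)%C).
      { rewrite <- Rcpow_RtoC. unfold Rcpow. rewrite <- Cexp_INR_mult. f_equal. ring. }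
      rewrite E, <- Eq, Cpow_mult_l. unfold Cdiv. ring.
    + apply continuous_along_wright_partial.
    + intros v w. apply Ccont_mult; [apply Ccont_const|apply Hc1].
    + apply HB.
    + apply dec_rays_scal; auto.
Qed.

Lemma wright_saddle s b c z : 0 < s < 1 ->
  saddle_fun (Gs s) (1 - b) ((1 - s) * c) z = (exp ((1 - s) * c / s) * wright_fun c s b z)%C.
Proof.
  intros Hs. unfold saddle_fun, wright_fun, hankel_fun, Gs. rewrite <- Cexp_RtoC, <- !Cexp_add. f_equal.
  assert (RtoC s <> 0) by (intros E; apply RtoC_inj in E; lra).
  assert ((1 - s)%C <> 0) by (rewrite <- RtoC_minus; intros E; apply RtoC_inj in E; lra).
  rewrite !RtoC_div, !RtoC_mult, RtoC_minus by lra. field. auto.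
Qed.

(** The critical value of the exponent supplies [exp (- ((1 - s) * c / s))], which is [exp (- X)]
    for [c = s X / (1 - s)]. Series and integral are exchanged by the common bound of
    [dec_rays_wright]. *)
Lemma Psi_saddle s b c x : 0 < s < 1 -> 1 <= c -> x * Rpower c s = c / s ->
  Psi01 (- s) b (RtoC (- x)) =
  (Rcpow c (1 - b) * exp (- ((1 - s) * c / s)) / (2 * PI * Ci) *
   HU (psis s) (saddle_fun (Gs s) (1 - b) ((1 - s) * c)))%C.
Proof.
  intros Hs Hc Hx. pose proof (psis_bounds s Hs) as Hpsi. pose proof PI_RGT_0.
  assert (Hcos : cos (psis s) < 0) by (apply cos_lt_0; lra).
  destruct (dec_rays_wright c s b (psis s)) as (B & HB0 & HB); auto; try lra.
  pose proof (continuous_along_wright c s b) as Hcw.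
  rewrite (HU_ext _ _ _ (fun z => wright_saddle s b c z Hs)), (HU_scal B) by auto.
  transitivity (Rcpow c (1 - b) / (2 * PI * Ci) * HU (psis s) (wright_fun c s b))%C.
  2:{ transitivity (Rcpow c (1 - b) * (exp (- ((1 - s) * c / s)) * exp ((1 - s) * c / s)) / (2 * PI * Ci) * HU (psis s) (wright_fun c s b))%C;
      [|unfold Cdiv; ring].
      rewrite <- (RtoC_mult (exp _) (exp _)), <- exp_plus. replace (- ((1 - s) * c / s) + (1 - s) * c / s) with 0 by ring.
      rewrite exp_0, Cmult_1_r. reflexivity. }
  apply CSeries_eq.
  apply Clim_ext with (fun n => Rcpow c (1 - b) / (2 * PI * Ci) * HU (psis s) (wright_partial c s b n))%C.
  - intros n. symmetry. apply wright_series_terms; auto.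
  - apply Clim_scal. apply HU_lim with B; auto; try lra.
    + intros; apply continuous_along_wright_partial.
    + intros r eps Hr He.
      set (W := c / s * exp (s * r)).
      assert (0 < c / s) by (apply Rdiv_lt_0_compat; lra).
      assert (HW : 0 <= W) by (pose proof (exp_pos (s * r)); unfold W; nra).
      set (A := exp (c * exp r + Rabs (Re (1 - b)%C) * r + Rabs (Im (1 - b)%C) * psis s)).
      assert (HA : 0 < A) by apply exp_pos.
      destruct (exp_sum_unif W (eps / A)) as [N HN]; auto; [apply Rdiv_lt_0_compat; auto|].
      exists N. intros n Hn y phi Hy Hphi. unfold wright_partial, wright_fun.
      match goal with |- Cmod (?a * ?b - ?a * ?d)%C <= _ => replace (a * b - a * d)%C with (a * (b - d))%C by ring end.
      rewrite Cmod_mult. replace eps with (A * (eps / A)) by (field; lra).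
      apply Rmult_le_compat; try apply Cmod_ge_0.
      * eapply Rle_trans; [apply Cmod_hankel_ray|]. unfold A. apply exp_le_exp.
        assert (exp y <= exp r) by (apply exp_le_exp; lra).
        pose proof (COS_bound phi). pose proof (exp_pos y).
        assert (Rabs phi <= psis s) by (apply Rabs_le; lra).
        pose proof (Rabs_pos (Im (1 - b)%C)). pose proof (Rabs_pos (Re (1 - b)%C)). pose proof (Rle_abs (Re (1 - b)%C)).
        assert (c * cos phi <= c) by nra.
        assert (c * cos phi * exp y <= c * exp y) by (apply Rmult_le_compat_r; lra).
        assert (c * exp y <= c * exp r) by (apply Rmult_le_compat_l; lra).
        assert (Re (1 - b)%C * y <= Rabs (Re (1 - b)%C) * r) by nra.
        assert (Rabs (Im (1 - b)%C) * Rabs phi <= Rabs (Im (1 - b)%C) * psis s) by nra. lra.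
      * apply HN; auto. rewrite Cmod_wright_arg by lra. unfold W. apply Rmult_le_compat_l; [lra|].
        apply exp_le_exp. nra.
Qed.

Lemma Cderiv_CI f a : Ccont f -> Cderiv (fun x => CI f a x) f.
Proof.
  intros Hf x. split; simpl.
  - apply (is_derive_RInt (V := R_NormedModule) (fun y => Re (f y)) _ a); [|apply Hf].
    apply filter_forall. intros y. apply (RInt_correct (V := R_CompleteNormedModule)), Ccont_ex_Re, Hf.
  - apply (is_derive_RInt (V := R_NormedModule) (fun y => Im (f y)) _ a); [|apply Hf].
    apply filter_forall. intros y. apply (RInt_correct (V := R_CompleteNormedModule)), Ccont_ex_Im, Hf.
Qed.

(** * Incomplete Gamma functions *)

(** [L] is the logarithm of the point at which Euler's integral is cut. *)
Definition gamma_lower (z : C) (L : R) : C := (Int0 (fun u => Gam_fun 1 z (- u)%R) + CI (Gam_fun 1 z) 0 L)%C.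
Definition gamma_upper (z : C) (L : R) : C := (Int0 (Gam_fun 1 z) - CI (Gam_fun 1 z) 0 L)%C.

Lemma gamma_lower_upper z L : (gamma_lower z L + gamma_upper z L)%C = Gam z.
Proof. unfold gamma_lower, gamma_upper, Gam, IntR. ring. Qed.

Lemma Ccont_gamma_lower z : Ccont (gamma_lower z).
Proof.
  apply Ccont_plus; [apply Ccont_const|]. eapply Cderiv_cont, Cderiv_CI, Ccont_Gam_fun.
Qed.

Lemma gamma_lower_rec z L : 1 <= Re z -> gamma_lower (z + 1) L = (z * gamma_lower z L - Gam_fun 1 z L)%C.
Proof.
  intros Hz. destruct (decR_Gam_fun 1 z ltac:(lra) Hz) as [B HB].
  destruct (decR_Gam_fun 1 (z + 1) ltac:(lra)) as [B' HB']; [rewrite Re_plus, Re_RtoC; lra|].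
  pose proof (decR_dec0 _ _ (decR_neg _ _ HB)) as D1. pose proof (decR_dec0 _ _ (decR_neg _ _ HB')) as D2.
  assert (HcF : Ccont (fun t => z * Gam_fun 1 z t)%C) by (apply Ccont_mult; [apply Ccont_const|apply HB]).
  assert (HD : Cderiv (Gam_fun 1 z) (fun t => z * Gam_fun 1 z t - Gam_fun 1 (z + 1) t)%C).
  { eapply Cderiv_ext; [| |apply Cderiv_Gam_fun]; [reflexivity|].
    intros y; cbv beta. rewrite <- Gam_fun_exp. ring. }
  assert (E1 : CI (fun t => z * Gam_fun 1 z t - Gam_fun 1 (z + 1) t)%C 0 L = (Gam_fun 1 z L - Gam_fun 1 z 0)%C).
  { apply CI_FTC; auto. apply Ccont_minus; auto. apply HB'. }
  rewrite CI_minus, CI_scal in E1 by (auto; first [apply HB|apply HB']).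
  assert (E2 : Int0 (fun u => z * Gam_fun 1 z (- u)%R - Gam_fun 1 (z + 1) (- u)%R)%C = Gam_fun 1 z 0).
  { rewrite (Int0_FTC B (fun u => - Gam_fun 1 z (- u)%R)%C).
    - rewrite Ropp_0. ring.
    - intros y. destruct (HD (- y)) as [R1 I1].
      assert (No : is_derive (fun u => - u) y (-1)) by (auto_derive; auto; ring).
      split; simpl.
      + eapply is_derive_eq; [apply (is_derive_opp (V := R_NormedModule) (fun u => Re (Gam_fun 1 z (- u)%R)));
          apply (is_derive_comp (fun u => Re (Gam_fun 1 z u)) Ropp y); [apply R1|apply No]|].
        unfold opp, scal; simpl; unfold mult; simpl. unfold Re. simpl. ring.
      + eapply is_derive_eq; [apply (is_derive_opp (V := R_NormedModule) (fun u => Im (Gam_fun 1 z (- u)%R)));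
          apply (is_derive_comp (fun u => Im (Gam_fun 1 z u)) Ropp y); [apply I1|apply No]|].
        unfold opp, scal; simpl; unfold mult; simpl. unfold Im. simpl. ring.
    - apply Ccont_minus; [apply Ccont_mult; [apply Ccont_const|apply D1]|apply D2].
    - apply dec0_opp; auto. }
  rewrite (Int0_minus (Cmod z * B) B') in E2 by (auto; apply dec0_scal; auto).
  rewrite (Int0_scal B) in E2 by auto. unfold gamma_lower.
  replace (CI (Gam_fun 1 (z + 1)) 0 L) with (z * CI (Gam_fun 1 z) 0 L - (z * CI (Gam_fun 1 z) 0 L - CI (Gam_fun 1 (z + 1)) 0 L))%C by ring.
  rewrite E1, <- E2. ring.
Qed.

Lemma gamma_lower_bound z L : 1 <= Re z -> Cmod (gamma_lower z L) <= exp (Re z * L).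
Proof.
  intros Hz. destruct (decR_Gam_fun 1 z ltac:(lra) Hz) as [B HB].
  assert (Hl : Clim (fun n => CI (Gam_fun 1 z) (- INR n) L) (gamma_lower z L)).
  { apply Clim_ext with (fun n => CI (fun u => Gam_fun 1 z (- u)%R) 0 (INR n) + CI (Gam_fun 1 z) 0 L)%C.
    - intros n. rewrite CI_neg by apply HB. apply CI_Chasles, HB.
    - apply Clim_plus; [|apply Clim_const]. apply Int0_correct with B, decR_dec0, decR_neg, HB. }
  replace (gamma_lower z L) with (gamma_lower z L - 0)%C by ring. apply Clim_le with (1 := Hl).
  destruct (nfloor_ex (Rabs L) (Rabs_pos L)) as [N [_ HN]]. exists (S N). intros n Hn.
  apply le_INR in Hn. rewrite S_INR in Hn. pose proof (Rle_abs (- L)). rewrite Rabs_Ropp in H.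
  replace (CI (Gam_fun 1 z) (- INR n) L - 0)%C with (CI (Gam_fun 1 z) (- INR n) L) by ring.
  eapply Rle_trans; [apply (CI_bound _ (fun t => exp (Re z * L) * exp (t - L))); [lra|apply HB| |]|].
  - intros t. apply continuous_R. reg.
  - intros t Ht. rewrite Cmod_Gam_fun, <- exp_plus. apply exp_le_exp. pose proof (exp_pos t). nra.
  - assert (HI : is_RInt (fun t => exp (Re z * L) * exp (t - L)) (- INR n) L
      (minus (exp (Re z * L) * exp (L - L)) (exp (Re z * L) * exp (- INR n - L)))).
    { apply (is_RInt_derive (V := R_CompleteNormedModule) (fun t => exp (Re z * L) * exp (t - L))).
      - intros. auto_derive; auto. unfold Rminus. ring.
      - intros. apply continuous_R. reg. }
    eapply Rle_trans; [right; apply is_RInt_unique, HI|]. unfold minus, plus, opp; simpl.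
    replace (L - L) with 0 by ring. rewrite exp_0. pose proof (exp_pos (Re z * L)). pose proof (exp_pos (- INR n - L)). nra.
Qed.

Lemma gamma_upper_bound a1 : exists B, 0 <= B /\ forall z L, 1 <= Re z <= a1 -> 0 <= L ->
  Cmod (gamma_upper z L) <= B * exp (Re z * L - exp L).
Proof.
  destruct (exp_growth 1 0 (a1 + 1) 0) as [B0 HB0]; try lra.
  (* For [u = t - L], the inequality [exp L >= 1] allows [exp L (exp u - 1)] to be replaced by
     [exp u - 1], whose constant term is the 1 added here. *)
  exists (exp (B0 + 1)). split; [left; apply exp_pos|]. intros z L Hz HL.
  destruct (decR_Gam_fun 1 z ltac:(lra) (proj1 Hz)) as [B HB].
  assert (Hl : Clim (fun n => CI (Gam_fun 1 z) L (INR n)) (gamma_upper z L)).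
  { apply Clim_ext with (fun n => CI (Gam_fun 1 z) 0 (INR n) - CI (Gam_fun 1 z) 0 L)%C.
    - intros n. apply CI_minus_Chasles, HB.
    - apply Clim_minus; [|apply Clim_const]. apply Int0_correct with B, decR_dec0, HB. }
  replace (gamma_upper z L) with (gamma_upper z L - 0)%C by ring. apply Clim_le with (1 := Hl).
  destruct (nfloor_ex L HL) as [N [_ HN]]. exists (S N). intros n Hn.
  apply le_INR in Hn. rewrite S_INR in Hn.
  replace (CI (Gam_fun 1 z) L (INR n) - 0)%C with (CI (Gam_fun 1 z) L (INR n)) by ring.
  set (D := exp (B0 + 1) * exp (Re z * L - exp L)).
  assert (HD : 0 < D) by (apply Rmult_lt_0_compat; apply exp_pos).
  eapply Rle_trans; [apply (CI_bound _ (fun t => (D * exp L) * exp (- t))); [lra|apply HB| |]|].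
  - apply continuous_exp_opp.
  - intros t Ht. rewrite Cmod_Gam_fun. unfold D. rewrite <- !exp_plus. apply exp_le_exp.
    specialize (HB0 (t - L) ltac:(lra)).
    assert (E : exp t = exp L * exp (t - L)) by (rewrite <- exp_plus; f_equal; ring).
    rewrite E. pose proof (exp_ineq1_le L). pose proof (exp_ineq1_le (t - L)).
    assert (Re z * (t - L) <= a1 * (t - L)) by (apply Rmult_le_compat_r; lra). nra.
  - rewrite RInt_exp_opp, Rmult_assoc, Rmult_minus_distr_l, <- !exp_plus.
    replace (L + - L) with 0 by ring. rewrite exp_0. pose proof (exp_pos (L + - INR n)). nra.
Qed.

Lemma Cmod_ge_Re z : Re z <= Cmod z.
Proof. apply Rle_trans with (1 := Rle_abs _), re_le_Cmod. Qed.

Lemma Crising_ge z n : 1 <= Re z -> INR (fact n) <= Cmod (Crising z n).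
Proof.
  intros Hz. induction n.
  - simpl. rewrite Cmod_1. lra.
  - cbn [Crising]. rewrite Cmod_mult, fact_simpl, mult_INR, Rmult_comm.
    apply Rmult_le_compat; auto using pos_INR.
    apply Rle_trans with (2 := Cmod_ge_Re _). rewrite Re_plus, Re_RtoC, S_INR. lra.
Qed.

Lemma rGamma_shift_bound z n : 1 <= Re z -> Cmod (rGamma (z + INR n)) <= Cmod (rGamma z) / INR (fact n).
Proof.
  intros Hz.
  pose proof (rGamma_Crising z n) as E. apply (f_equal Cmod) in E. rewrite Cmod_mult in E.
  pose proof (Crising_ge z n Hz). pose proof (INR_fact_lt_0 n). pose proof (Cmod_ge_0 (rGamma (z + INR n))).
  apply Rmult_le_reg_r with (INR (fact n)); auto. unfold Rdiv. rewrite Rmult_assoc, Rinv_l, Rmult_1_r by lra.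
  rewrite E. nra.
Qed.

(** With [y = exp L], a partial sum of the series of [y^(z + k) / Gamma (z + k + 1)], the
    exponential series with shifted exponents; [frac_exp] below is its sum, [exp y] times the lower
    incomplete Gamma function divided by Gamma. *)
Definition frac_exp_sum (n : nat) (z : C) (L : R) : C :=
  csum n (fun k => Cexp ((z + INR k) * L) * rGamma (z + 1 + INR k))%C.

Definition frac_exp (z : C) (L : R) : C := (exp (exp L) * (rGamma z * gamma_lower z L))%C.

(** Iteration of the recurrence of the lower incomplete Gamma function, one integration by parts per
    term. *)
Lemma frac_exp_split n z L : 1 <= Re z ->
  frac_exp z L = (frac_exp_sum n z L + exp (exp L) * (rGamma (z + INR n) * gamma_lower (z + INR n) L))%C.
Proof.
  intros Hz. induction n.
  - unfold frac_exp_sum, frac_exp. simpl csum. simpl INR. rewrite Cplus_0_r. ring.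
  - rewrite IHn. unfold frac_exp_sum. cbn [csum].
    assert (Hzn : 1 <= Re (z + INR n)) by (rewrite Re_plus, Re_RtoC; pose proof (pos_INR n); lra).
    rewrite (rGamma_rec (z + INR n)).
    replace (z + INR (S n))%C with (z + INR n + 1)%C by (rewrite S_INR, RtoC_plus; ring).
    rewrite (gamma_lower_rec (z + INR n)) by auto. unfold Gam_fun.
    replace (Cexp ((z + INR n) * L)) with (exp (exp L) * Cexp ((z + INR n) * L - 1 * exp L))%C.
    + replace (z + 1 + INR n)%C with (z + INR n + 1)%C by ring. ring.
    + rewrite <- (Cexp_RtoC (exp L)), <- Cexp_add. f_equal. ring.
Qed.

Lemma frac_exp_sum_rem n z L : 1 <= Re z ->
  Cmod (frac_exp z L - frac_exp_sum n z L) <= exp (exp L) * (Cmod (rGamma z) * exp (Re z * L)) * (exp L ^ n / INR (fact n)).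
Proof.
  intros Hz. rewrite (frac_exp_split n) by auto.
  replace (frac_exp_sum n z L + exp (exp L) * (rGamma (z + INR n) * gamma_lower (z + INR n) L) - frac_exp_sum n z L)%C
    with (exp (exp L) * (rGamma (z + INR n) * gamma_lower (z + INR n) L))%C by ring.
  rewrite !Cmod_mult, Cmod_R, Rabs_pos_eq by (left; apply exp_pos). rewrite Rmult_assoc.
  apply Rmult_le_compat_l; [left; apply exp_pos|].
  assert (Hzn : 1 <= Re (z + INR n)) by (rewrite Re_plus, Re_RtoC; pose proof (pos_INR n); lra).
  replace (Cmod (rGamma z) * exp (Re z * L) * (exp L ^ n / INR (fact n)))
    with (Cmod (rGamma z) / INR (fact n) * (exp (Re z * L) * exp L ^ n)) by (unfold Rdiv; ring).
  apply Rmult_le_compat; try apply Cmod_ge_0; [apply rGamma_shift_bound; auto|].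
  eapply Rle_trans; [apply gamma_lower_bound; auto|]. right.
  rewrite Re_plus, Re_RtoC, Rmult_plus_distr_r, exp_plus. f_equal.
  clear. induction n; [simpl; rewrite Rmult_0_l; apply exp_0|].
  rewrite S_INR. simpl. rewrite <- IHn, <- exp_plus. f_equal. ring.
Qed.

Lemma frac_exp_sum_lim z L : 1 <= Re z -> Clim (fun n => frac_exp_sum n z L) (frac_exp z L).
Proof.
  intros Hz. apply Clim_squeeze with
    (fun n => exp (exp L) * (Cmod (rGamma z) * exp (Re z * L)) * (exp L ^ n / INR (fact n))).
  - exists O. intros n _. rewrite Cmod_minus_sym. apply frac_exp_sum_rem; auto.
  - eapply is_lim_seq_real_eq; [apply is_lim_seq_mult'; [apply is_lim_seq_const|apply is_lim_seq_pow_fact]|]. ring.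
Qed.

Definition Rexp_sum (n : nat) (y : R) : R := Re (exp_sum n y).

Lemma Rexp_sum_S n y : Rexp_sum (S n) y = Rexp_sum n y + y ^ n / INR (fact n).
Proof.
  unfold Rexp_sum, exp_sum. cbn [csum]. rewrite Re_plus. f_equal.
  rewrite <- RtoC_pow, <- RtoC_div, Re_RtoC; auto. apply INR_fact_neq_0.
Qed.

Lemma frac_exp_sum_diff n m z L : 1 <= Re z -> 
  Cmod (frac_exp_sum (n + m) z L - frac_exp_sum n z L) <= exp (Re z * L) * Cmod (rGamma (z + 1)) * (Rexp_sum (n + m) (exp L) - Rexp_sum n (exp L)).
Proof.
  intros Hz. induction m.
  - rewrite Nat.add_0_r. unfold Rminus. rewrite Rplus_opp_r, Rmult_0_r.
    replace (frac_exp_sum n z L - frac_exp_sum n z L)%C with (RtoC 0) by ring. rewrite Cmod_0. lra.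
  - rewrite Nat.add_succ_r, Rexp_sum_S.
    assert (E : frac_exp_sum (S (n + m)) z L = (frac_exp_sum (n + m) z L + Cexp ((z + INR (n + m)) * L) * rGamma (z + 1 + INR (n + m)))%C) by reflexivity.
    rewrite E. set (k := (n + m)%nat) in *.
    replace (frac_exp_sum k z L + Cexp ((z + INR k) * L) * rGamma (z + 1 + INR k) - frac_exp_sum n z L)%C
      with ((frac_exp_sum k z L - frac_exp_sum n z L) + Cexp ((z + INR k) * L) * rGamma (z + 1 + INR k))%C by ring.
    eapply Rle_trans; [apply Cmod_triangle|].
    replace (exp (Re z * L) * Cmod (rGamma (z + 1)) * (Rexp_sum k (exp L) + exp L ^ k / INR (fact k) - Rexp_sum n (exp L)))
      with (exp (Re z * L) * Cmod (rGamma (z + 1)) * (Rexp_sum k (exp L) - Rexp_sum n (exp L)) +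
            (exp (Re z * L) * exp L ^ k) * (Cmod (rGamma (z + 1)) / INR (fact k))) by (unfold Rdiv; ring).
    apply Rplus_le_compat; auto. rewrite Cmod_mult.
    apply Rmult_le_compat; try apply Cmod_ge_0.
    + rewrite Cmod_Cexp. right.
      replace (Re ((z + INR k) * L)) with (Re z * L + INR k * L) by (repeat progress Csimpl; ring).
      rewrite exp_plus. f_equal. clear. induction k; [simpl; rewrite Rmult_0_l; apply exp_0|].
      rewrite S_INR. simpl. rewrite <- IHk, <- exp_plus. f_equal. ring.
    + apply rGamma_shift_bound. rewrite Re_plus, Re_RtoC. lra.
Qed.

(** In contrast to [frac_exp_sum_rem], the bound involves the remainder of the exponential series of
    [exp L] itself: it decreases with [n] and stays below [exp (exp L)], so that integrals in [L]
    can be dominated uniformly in [n]. *)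
Lemma frac_exp_sum_tail n z L : 1 <= Re z ->
  Cmod (frac_exp z L - frac_exp_sum n z L) <= exp (Re z * L) * Cmod (rGamma (z + 1)) * (exp (exp L) - Rexp_sum n (exp L)).
Proof.
  intros Hz. apply Clim_le with (1 := frac_exp_sum_lim z L Hz).
  exists n. intros m Hm. replace m with (n + (m - n))%nat by lia.
  eapply Rle_trans; [apply frac_exp_sum_diff; auto|].
  apply Rmult_le_compat_l; [apply Rmult_le_pos; [left; apply exp_pos|apply Cmod_ge_0]|].
  assert (Rexp_sum (n + (m - n)) (exp L) <= exp (exp L)); [|lra].
  unfold Rexp_sum. apply Rle_trans with (1 := Cmod_ge_Re _).
  apply Rle_trans with (1 := exp_sum_bound _ _). right. f_equal. rewrite Cmod_R, Rabs_pos_eq; auto. left; apply exp_pos.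
Qed.

Lemma frac_exp_bound z L : 1 <= Re z -> Cmod (frac_exp z L) <= exp (Re z * L) * Cmod (rGamma (z + 1)) * exp (exp L).
Proof.
  intros Hz. pose proof (frac_exp_sum_tail 0 z L Hz) as H. unfold frac_exp_sum, Rexp_sum, exp_sum in H. cbn [csum] in H.
  rewrite Re_RtoC, Rminus_0_r in H. now replace (frac_exp z L - 0)%C with (frac_exp z L) in H by ring.
Qed.

(** The defect is [exp (exp L) * gamma_upper z L] divided by Gamma, and the upper incomplete Gamma
    function contains the factor [exp (- exp L)] that cancels the exponential. Only a power of
    [exp L] remains. *)
Lemma frac_exp_approx a1 : exists B, 0 <= B /\ forall z L, 1 <= Re z <= a1 -> 0 <= L ->
  Cmod (frac_exp z L - exp (exp L)) <= B * Cmod (rGamma z) * exp (Re z * L).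
Proof.
  destruct (gamma_upper_bound a1) as (B & HB & H). exists B. split; auto. intros z L Hz HL.
  replace (frac_exp z L - exp (exp L))%C with (- (exp (exp L) * (rGamma z * gamma_upper z L)))%C.
  - rewrite Cmod_opp, !Cmod_mult, Cmod_R, Rabs_pos_eq by (left; apply exp_pos).
    specialize (H z L Hz HL). unfold Rminus in H. rewrite exp_plus, exp_Ropp in H.
    pose proof (exp_pos (exp L)).
    apply Rle_trans with (exp (exp L) * (Cmod (rGamma z) * (B * (exp (Re z * L) * / exp (exp L))))).
    + apply Rmult_le_compat_l; [lra|]. apply Rmult_le_compat_l; [apply Cmod_ge_0|auto].
    + right. field. lra.
  - unfold frac_exp. replace (gamma_lower z L) with (Gam z - gamma_upper z L)%C by (rewrite <- (gamma_lower_upper z L); ring).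
    replace (exp (exp L) * (rGamma z * (Gam z - gamma_upper z L)) - exp (exp L))%C
      with (exp (exp L) * (Gam z * rGamma z) - exp (exp L) - exp (exp L) * (rGamma z * gamma_upper z L))%C by ring.
    rewrite Gam_rGamma by apply Hz. ring.
Qed.

Lemma Ccont_frac_exp z : Ccont (frac_exp z).
Proof.
  apply Ccont_mult.
  - apply Ccont_RtoC. intro. apply continuous_R. reg.
  - apply Ccont_mult; [apply Ccont_const|apply Ccont_gamma_lower].
Qed.

(** * Regularity of 1/Gamma and comparison with the real axis *)

Lemma Cexp_minus_1 w : Cmod (Cexp w - 1) <= Cmod w * exp (Cmod w).
Proof.
  pose proof (exp_sum_rem_weak 1 w) as H. unfold exp_sum in H. cbn [csum] in H. simpl in H.
  replace (0 + 1 / 1)%C with (RtoC 1) in H by field. now rewrite Rmult_1_r in H.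
Qed.

Lemma Cmod_ray phi l : 0 <= l -> Cmod (ray phi l) <= l + Rabs phi.
Proof.
  intros Hl. unfold ray. eapply Rle_trans; [apply Cmod_triangle|].
  rewrite Cmod_mult, Cmod_Ci, !Cmod_R, (Rabs_pos_eq l) by auto. lra.
Qed.

(** Continuity of 1/Gamma, needed to integrate over the shift of the summation points, is read off
    Hankel's integral: changing [z] by [h] multiplies the integrand by [exp (- h u)]. *)
Lemma rGamma_lipschitz R0 : exists K, 0 <= K /\ forall z h, Cmod z <= R0 -> Cmod h <= 1 ->
  Cmod (rGamma (z + h) - rGamma z) <= K * Cmod h.
Proof.
  pose proof psi0_bounds as Hp. pose proof PI_RGT_0 as HPI.
  assert (Hcos : cos psi0 < 0) by (apply cos_lt_0; lra).
  (* [Rabs R0 + 1] bounds [1 - z], the factor [exp (- h u) - 1] costs 2 more through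
     [x exp x <= exp (2 x)], and [dec0] asks for 1 more. *)
  destruct (exp_growth (- cos psi0) 0 (Rabs R0 + 4) 0) as [B HB]; try lra.
  set (K1 := exp (B + (Rabs R0 + 3) * psi0)).
  set (K2 := exp (1 + (Rabs R0 + 3) * psi0)).
  assert (HK1 : 0 < K1) by apply exp_pos. assert (HK2 : 0 < K2) by apply exp_pos.
  exists ((K2 * (psi0 - - psi0) + (K1 + K1)) / (2 * PI)). split; [apply Rdiv_le_0_compat; nra|].
  intros z h Hz Hh. rewrite !(rGamma_hankel psi0) by auto. unfold hankel.
  pose proof (continuous_along_hankel 1 (1 - (z + h))) as C1. pose proof (continuous_along_hankel 1 (1 - z)) as C2.
  destruct (dec_rays_hankel 1 (1 - (z + h)) psi0 ltac:(lra) Hcos) as [B1 D1].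
  destruct (dec_rays_hankel 1 (1 - z) psi0 ltac:(lra) Hcos) as [B2 D2].
  replace (HU psi0 (hankel_fun 1 (1 - (z + h))) / (2 * PI * Ci) - HU psi0 (hankel_fun 1 (1 - z)) / (2 * PI * Ci))%C
    with (HU psi0 (fun x => hankel_fun 1 (1 - (z + h)) x - hankel_fun 1 (1 - z) x)%C / (2 * PI * Ci))%C.
  2:{ rewrite (HU_minus B1 B2) by auto. unfold Cdiv. ring. }
  rewrite Cmod_div by apply C_2PI_neq_0.
  replace (Cmod (2 * PI * Ci)) with (2 * PI) by (rewrite !Cmod_mult, Cmod_Ci, !Cmod_R, !Rabs_pos_eq; lra).
  set (D := fun x => (hankel_fun 1 (1 - (z + h)) x - hankel_fun 1 (1 - z) x)%C).
  assert (HD : forall phi l, 0 <= l -> Rabs phi <= psi0 ->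
    Cmod (D (ray phi l)) <= Cmod h * exp (cos phi * exp l + (Rabs R0 + 3) * (l + psi0))).
  { intros phi l Hl Hphi. unfold D.
    replace (hankel_fun 1 (1 - (z + h)) (ray phi l)) with (hankel_fun 1 (1 - z) (ray phi l) * Cexp (- h * ray phi l))%C.
    2:{ unfold hankel_fun. rewrite <- Cexp_add. f_equal. ring. }
    replace (hankel_fun 1 (1 - z) (ray phi l) * Cexp (- h * ray phi l) - hankel_fun 1 (1 - z) (ray phi l))%C
      with (hankel_fun 1 (1 - z) (ray phi l) * (Cexp (- h * ray phi l) - 1))%C by ring.
    rewrite Cmod_mult. pose proof (Cmod_ray phi l Hl) as Hr. pose proof (Cmod_ge_0 h) as Hh0.
    pose proof (Cmod_ge_0 (ray phi l)) as Hr0.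
    assert (Hw : Cmod (- h * ray phi l) <= Cmod h * (l + psi0)).
    { rewrite Cmod_mult, Cmod_opp. apply Rmult_le_compat_l; auto. lra. }
    assert (Hw2 : Cmod (- h * ray phi l) <= l + psi0) by nra.
    assert (E2 : Cmod (Cexp (- h * ray phi l) - 1) <= Cmod h * exp (2 * (l + psi0))).
    { eapply Rle_trans; [apply Cexp_minus_1|].
      apply Rle_trans with ((Cmod h * (l + psi0)) * exp (l + psi0)).
      - apply Rmult_le_compat; [apply Cmod_ge_0|left; apply exp_pos|auto|apply exp_le_exp; auto].
      - rewrite Rmult_assoc. apply Rmult_le_compat_l; auto.
        replace (exp (2 * (l + psi0))) with (exp (l + psi0) * exp (l + psi0)) by (rewrite <- exp_plus; f_equal; ring).
        apply Rmult_le_compat_r; [left; apply exp_pos|]. pose proof (exp_ineq1_le (l + psi0)). lra. }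
    assert (E1 : Cmod (hankel_fun 1 (1 - z) (ray phi l)) <= exp (cos phi * exp l + (Rabs R0 + 1) * (l + psi0))).
    { eapply Rle_trans; [apply Cmod_hankel_ray|]. apply exp_le_exp.
      assert (Hb : Cmod (1 - z) <= Rabs R0 + 1).
      { eapply Rle_trans; [apply Cmod_minus_le|]. rewrite Cmod_1. pose proof (Rle_abs R0). lra. }
      pose proof (Cmod_ge_Re (1 - z)). pose proof (Im_le_Cmod (1 - z)).
      assert (Re (1 - z)%C * l <= (Rabs R0 + 1) * l) by (apply Rmult_le_compat_r; lra).
      assert (Rabs (Im (1 - z)%C) * Rabs phi <= (Rabs R0 + 1) * psi0) by (apply Rmult_le_compat; try apply Rabs_pos; lra).
      lra. }
    eapply Rle_trans; [apply Rmult_le_compat; [apply Cmod_ge_0|apply Cmod_ge_0|apply E1|apply E2]|].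
    replace (exp (cos phi * exp l + (Rabs R0 + 3) * (l + psi0)))
      with (exp (cos phi * exp l + (Rabs R0 + 1) * (l + psi0)) * exp (2 * (l + psi0))) by (rewrite <- exp_plus; f_equal; ring).
    right; ring. }
  assert (HcD : continuous_along D) by (intros v w; apply Ccont_minus; [apply C1|apply C2]).
  assert (HR : forall phi, cos phi = cos psi0 -> Rabs phi <= psi0 -> dec0 (Cmod h * K1) (fun l => D (ray phi l))).
  { intros phi Hc Hphi. split; [apply continuous_along_ray; auto|]. intros l Hl.
    eapply Rle_trans; [apply HD; auto|]. rewrite Rmult_assoc. apply Rmult_le_compat_l; [apply Cmod_ge_0|].
    unfold K1. rewrite <- exp_plus, Hc. apply exp_le_exp. specialize (HB l Hl). lra. }
  unfold Rdiv at 1. unfold Rdiv. rewrite (Rmult_comm (_ * / _)), <- Rmult_assoc, (Rmult_comm (Cmod h)).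
  apply Rmult_le_compat_r; [left; apply Rinv_0_lt_compat; lra|].
  fold D. unfold HU. eapply Rle_trans; [apply Cmod_triangle|]. rewrite Rmult_plus_distr_r. apply Rplus_le_compat.
  - rewrite Cmod_mult, Cmod_Ci, Rmult_1_l.
    replace (K2 * (psi0 - - psi0) * Cmod h) with ((Cmod h * K2) * (psi0 - - psi0)) by ring.
    apply CI_bound_const; [lra|apply continuous_along_arc; auto|].
    intros t Ht. eapply Rle_trans; [apply HD; [lra|apply Rabs_le; lra]|].
    apply Rmult_le_compat_l; [apply Cmod_ge_0|]. unfold K2. apply exp_le_exp. rewrite exp_0. pose proof (COS_bound t). lra.
  - eapply Rle_trans; [apply (Int0_bound (Cmod h * K1 + Cmod h * K1)); apply dec0_minus; apply HR|].
    + auto. + rewrite Rabs_pos_eq; lra. + apply cos_neg. + rewrite Rabs_Ropp, Rabs_pos_eq; lra.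
    + right; ring.
Qed.

Lemma Ccont_lipschitz (f : R -> C) :
  (forall y, exists K, 0 <= K /\ forall h, Rabs h <= 1 -> Cmod (f (y + h) - f y) <= K * Rabs h) -> Ccont f.
Proof.
  intros H y. destruct (H y) as (K & HK & Hy).
  assert (A : forall P : C -> R, (forall z w, P (z - w)%C = P z - P w) -> (forall z, Rabs (P z) <= Cmod z) ->
    continuous (fun u => P (f u)) y).
  { intros P HP HP'. apply continuous_R. intros eps Heps.
    exists (Rmin 1 (eps / (K + 1))). split.
    { apply Rmin_glb_lt; [lra|]. apply Rdiv_lt_0_compat; lra. }
    intros x [_ Hx]. simpl in *. unfold R_dist in *.
    pose proof (Rmin_l 1 (eps / (K + 1))). pose proof (Rmin_r 1 (eps / (K + 1))).
    specialize (Hy (x - y) ltac:(lra)). replace (y + (x - y)) with x in Hy by ring.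
    rewrite <- HP. eapply Rle_lt_trans; [apply HP'|]. eapply Rle_lt_trans; [apply Hy|].
    apply Rle_lt_trans with (K * (eps / (K + 1))).
    - apply Rmult_le_compat_l; lra.
    - apply Rmult_lt_reg_r with (K + 1); [lra|]. field_simplify; [|lra]. nra. }
  split; apply A; auto using re_le_Cmod, Im_le_Cmod; reflexivity.
Qed.

Lemma Ccont_rGamma b : Ccont (fun u => rGamma (RtoC u + b)).
Proof.
  apply Ccont_lipschitz. intros y. destruct (rGamma_lipschitz (Cmod (y + b))) as (K & HK & H).
  exists K. split; auto. intros h Hh.
  replace (RtoC (y + h) + b)%C with (y + b + h)%C by (rewrite RtoC_plus; ring).
  rewrite <- Cmod_R. apply H; [apply Rle_refl|now rewrite Cmod_R].
Qed.

Lemma rGamma_segment_bound z : exists B, 0 <= B /\ forall r, 0 <= r <= 1 -> Cmod (rGamma (z + r)) <= B.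
Proof.
  destruct (rGamma_lipschitz (Cmod z)) as (K & HK & H). exists (Cmod (rGamma z) + K).
  pose proof (Cmod_ge_0 (rGamma z)). split; [lra|]. intros r Hr.
  assert (Er : Cmod (RtoC r) = r) by (rewrite Cmod_R, Rabs_pos_eq; lra).
  specialize (H z r (Rle_refl _) ltac:(lra)). rewrite Er in H.
  pose proof (Cmod_triangle_sub (rGamma (z + r)) (rGamma z)). nra.
Qed.

Lemma Crising_real (a : R) n : 0 < a -> exists c, 0 < c /\ Crising (RtoC a) n = RtoC c.
Proof.
  intros Ha. induction n.
  - exists 1. split; [lra|reflexivity].
  - destruct IHn as (c & Hc & E). exists (c * (a + INR n)). split.
    + apply Rmult_lt_0_compat; auto. pose proof (pos_INR n); lra.
    + cbn [Crising]. rewrite E, RtoC_mult, RtoC_plus. reflexivity.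
Qed.

Lemma rGamma_real (a : R) : 0 < a -> rGamma (RtoC a) = RtoC (Re (rGamma (RtoC a))) /\ 0 <= Re (rGamma (RtoC a)).
Proof.
  intros Ha. pose proof (gauss_product_rGamma (RtoC a)) as L.
  assert (Hn : forall n, (1 <= n)%nat -> exists c, 0 <= c /\ (Crising (RtoC a) (S n) / (INR (fact n) * Rcpow (INR n) (RtoC a)))%C = RtoC c).
  { intros n Hn. destruct (Crising_real a (S n) Ha) as (c & Hc & E). rewrite E, Rcpow_RtoC.
    pose proof (INR_fact_lt_0 n). assert (0 < Rpower (INR n) a) by apply exp_pos.
    exists (c / (INR (fact n) * Rpower (INR n) a)). split.
    - apply Rdiv_le_0_compat; [lra|apply Rmult_lt_0_compat; auto].
    - rewrite RtoC_div, RtoC_mult; auto. apply Rgt_not_eq, Rmult_lt_0_compat; auto. }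
  split.
  - apply C_eq; [reflexivity|]. rewrite Im_RtoC.
    assert (L2 := Clim_Im _ _ L). apply is_lim_seq_unique in L2.
    rewrite (Lim_seq_ext_loc _ (fun _ => 0)), Lim_seq_const in L2.
    + now injection L2.
    + exists 1%nat. intros n Hnn. destruct (Hn n Hnn) as (c & _ & E). now rewrite E.
  - apply (is_lim_seq_le_loc (fun _ => 0) (fun n => Re (Crising (RtoC a) (S n) / (INR (fact n) * Rcpow (INR n) (RtoC a)))%C) 0 (Re (rGamma (RtoC a)))).
    + exists 1%nat. intros n Hnn. destruct (Hn n Hnn) as (c & Hc & E). rewrite E. exact Hc.
    + apply is_lim_seq_const.
    + apply (Clim_Re _ _ L).
Qed.

(** Each factor satisfies [|x + i t| <= x exp (t^2 / x^2)], and [2 - 1 / (n + 1)] is the telescoping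
    upper bound for the sum of [1 / (k + 1)^2], in the form in which the induction passes. *)
Lemma Crising_vertical (a t : R) n : 1 <= a ->
  Cmod (Crising (a + Ci * t) (S n)) <= Cmod (Crising a (S n)) * exp (t * t * (2 - / INR (S n))).
Proof.
  intros Ha.
  assert (step : forall k, Cmod (a + Ci * t + INR k) <= Cmod (a + INR k) * exp (t * t * / ((1 + INR k) * (1 + INR k)))).
  { intros k. pose proof (pos_INR k). set (x := a + INR k).
    replace (a + INR k)%C with (RtoC x) by (unfold x; apply RtoC_plus).
    replace (a + Ci * t + INR k)%C with ((x, t) : C) by (unfold x; Ceq; unfold Re, Im; simpl; ring).
    rewrite Cmod_R, Rabs_pos_eq by (unfold x; lra).
    assert (Hx : 1 + INR k <= x) by (unfold x; lra).
    unfold Cmod; simpl fst; simpl snd.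
    assert (E : exp (t * t * / ((1 + INR k) * (1 + INR k))) >= 1 + t * t * / (x * x)).
    { apply Rle_ge. eapply Rle_trans; [|apply exp_ineq1_le]. apply Rplus_le_compat_l.
      apply Rmult_le_compat_l; [apply Rle_0_sqr|]. apply Rinv_le_contravar; nra. }
    set (e := exp (t * t * / ((1 + INR k) * (1 + INR k)))) in *.
    assert (He : 1 <= e). { assert (0 <= t * t * / (x * x)) by (apply Rmult_le_pos; [apply Rle_0_sqr|left; apply Rinv_0_lt_compat; nra]). lra. }
    rewrite <- (sqrt_Rsqr (x * e)) by nra. apply sqrt_le_1_alt. unfold Rsqr.
    assert (Ht : x * x * (t * t * / (x * x)) = t * t) by (field; lra).
    assert (H1 : x * x + t * t <= x * x * e) by nra.
    assert (H2 : x * x * e <= x * x * (e * e)) by (apply Rmult_le_compat_l; nra). simpl. nra. }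
  induction n.
  - specialize (step 0%nat). cbn [Crising]. rewrite !Cmult_1_l. simpl INR in *.
    replace (2 - / 1) with (/ ((1 + 0) * (1 + 0))) by field. exact step.
  - specialize (step (S n)).
    change (Crising (a + Ci * t) (S (S n))) with (Crising (a + Ci * t) (S n) * (a + Ci * t + INR (S n)))%C.
    change (Crising a (S (S n))) with (Crising a (S n) * (a + INR (S n)))%C.
    rewrite !Cmod_mult.
    eapply Rle_trans; [apply Rmult_le_compat; [apply Cmod_ge_0|apply Cmod_ge_0|apply IHn|apply step]|].
    set (x := INR (S n)) in *. assert (Hx : 1 <= x) by (unfold x; rewrite S_INR; pose proof (pos_INR n); lra).
    replace (INR (S (S n))) with (x + 1) by (unfold x; rewrite (S_INR (S n)); ring).
    match goal with |- ?A * ?e1 * (?B * ?e2) <= _ => replace (A * e1 * (B * e2)) with (A * B * (e1 * e2)) by ring end.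
    apply Rmult_le_compat_l; [apply Rmult_le_pos; apply Cmod_ge_0|]. rewrite <- exp_plus. apply exp_le_exp.
    rewrite <- Rmult_plus_distr_l. apply Rmult_le_compat_l; [apply Rle_0_sqr|].
    assert (/ ((1 + x) * (1 + x)) <= / x - / (x + 1)); [|lra].
    replace (/ x - / (x + 1)) with (/ (x * (x + 1))) by (field; lra). apply Rinv_le_contravar; nra.
Qed.

(** The remainder of the inverse factorial expansion is estimated by a sum of moduli. Comparison
    with the real axis, where 1/Gamma is nonnegative, turns it into a sum of the same kind as the
    main terms, which can be evaluated again. *)
Lemma rGamma_vertical b : exists B, 0 <= B /\ forall u, 1 <= u + Re b ->
  Cmod (rGamma (RtoC u + b)) <= B * Re (rGamma (RtoC (u + Re b))).
Proof.
  exists (exp (Im b * Im b * 2)). split; [left; apply exp_pos|]. intros u Hu. set (a := u + Re b) in *.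
  replace (RtoC u + b)%C with (RtoC a + Ci * Im b)%C by (unfold a; Ceq; ring).
  destruct (rGamma_real a ltac:(lra)) as [E0 H0].
  set (t := Im b). replace (Re (rGamma a)) with (Cmod (rGamma a)) by (rewrite E0 at 1; rewrite Cmod_R, Rabs_pos_eq; auto).
  assert (L1 := gauss_product_rGamma (a + Ci * t)). assert (L2 := gauss_product_rGamma a).
  assert (Lm : forall v l, Clim v l -> is_lim_seq (fun n => Cmod (v n)) (Cmod l)).
  { intros v l H. apply is_lim_seq_spec. intros eps. destruct (Clim_eventually v l eps (cond_pos eps) H) as [N HN].
    exists N. intros n Hn. specialize (HN n Hn). apply Rle_lt_trans with (2 := HN).
    apply Rabs_le. pose proof (Cmod_triangle_sub (v n) l). pose proof (Cmod_triangle_sub l (v n)).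
    rewrite (Cmod_minus_sym l) in H2. lra. }
  apply Lm in L1. apply Lm in L2.
  match type of L1 with is_lim_seq ?f _ => match type of L2 with is_lim_seq ?g _ =>
    apply (is_lim_seq_le_loc f (fun n => exp (t * t * 2) * g n)
      (Cmod (rGamma (a + Ci * t)%C)) (exp (t * t * 2) * Cmod (rGamma a))) end end.
  2: exact L1.
  2: apply is_lim_seq_mult'; [apply is_lim_seq_const|exact L2].
  exists O. intros n _.
  assert (Hd : forall z, (INR (fact n) * Rcpow (INR n) z)%C <> RtoC 0).
  { intros z. apply Cmult_neq_0; [apply C_fact_neq_0|apply Rcpow_neq_0]. }
  rewrite !Cmod_div by apply Hd. rewrite !Cmod_mult, !Cmod_Rcpow.
  replace (Re (a + Ci * t)%C) with a by (Csimpl; ring). rewrite Re_RtoC.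
  unfold Rdiv. rewrite <- Rmult_assoc. apply Rmult_le_compat_r.
  { left. apply Rinv_0_lt_compat, Rmult_lt_0_compat; [|apply exp_pos]. apply Cmod_gt_0, C_fact_neq_0. }
  eapply Rle_trans; [apply Crising_vertical; auto|]. rewrite Rmult_comm.
  apply Rmult_le_compat_r; [apply Cmod_ge_0|]. apply exp_le_exp. apply Rmult_le_compat_l; [apply Rle_0_sqr|].
  assert (0 < / INR (S n)) by (apply Rinv_0_lt_compat; rewrite S_INR; pose proof (pos_INR n); lra). lra.
Qed.

(** * Series of reciprocal Gamma values *)

Definition pow_rGamma (b : C) (L u : R) : C := (Cexp (u * L) * rGamma (u + b))%C.

Lemma Ccont_pow_rGamma b L : Ccont (pow_rGamma b L).
Proof.
  apply Ccont_mult; [|apply Ccont_rGamma].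
  apply Ccont_Cexp, Ccont_mult; [apply Ccont_id|apply Ccont_const].
Qed.

Lemma CI_unit_steps f u0 m : Ccont f ->
  CI f u0 (u0 + INR m) = CI (fun r => csum m (fun k => f (u0 + INR k + r))) 0 1.
Proof.
  intros Hf. rewrite (CI_csum m (fun k r => f (u0 + INR k + r))).
  2:{ intros k. apply (Ccont_comp f (fun r => u0 + INR k + r)); auto. intro; apply continuous_R; reg. }
  induction m.
  - simpl. rewrite Rplus_0_r. apply CI_point.
  - cbn [csum]. rewrite <- IHm. rewrite S_INR.
    rewrite (CI_ext (fun r => f (u0 + INR m + r)) (fun r => f (r + (u0 + INR m)))) by (intros; f_equal; ring).
    rewrite CI_shift by auto. rewrite Rplus_0_l. replace (1 + (u0 + INR m)) with (u0 + (INR m + 1)) by ring.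
    symmetry. apply CI_Chasles; auto.
Qed.

Lemma exp_INR_mult L n : exp (INR n * L) = exp L ^ n.
Proof.
  induction n; [simpl; rewrite Rmult_0_l; apply exp_0|].
  rewrite S_INR. simpl. rewrite <- IHn, <- exp_plus. f_equal. ring.
Qed.

(** For [U] an integer the integral is an average over [r] in [0, 1] of sums with step 1, each of
    which is [exp ((1 - b) L)] times [frac_exp_sum] at [z = u0 + b - 1 + r]; the hypothesis gives
    [1 <= Re z]. [B] does not depend on [L], as it must survive [X] tending to infinity. *)
Lemma CI_pow_rGamma b u0 : 2 <= u0 + Re b -> exists B, 0 <= B /\ forall L, 0 <= L -> forall eps, 0 < eps ->
  exists U0, forall U, U0 <= U ->
  Cmod (CI (pow_rGamma b L) u0 (u0 + U) - Cexp ((1 - b) * L) * exp (exp L)) <= B * exp ((u0 + 1) * L) + eps.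
Proof.
  intros Hu0.
  destruct (rGamma_segment_bound (u0 + b - 1)) as (Bg & HBg & Hg).
  destruct (rGamma_segment_bound (u0 + b)) as (B2 & HB2 & Hg2).
  destruct (frac_exp_approx (u0 + Re b)) as (B1 & HB1 & HS).
  exists (B1 * Bg). split; [nra|]. intros L HL eps Heps.
  set (y := exp L). set (Q := exp ((u0 + 1) * L)).
  assert (HQ : 0 < Q) by apply exp_pos. assert (Hy : 0 < exp y) by apply exp_pos.
  (* [U] is cut at its integral part [m]: the remainder of the sums with step 1 gives the part with
     [Bg], the incomplete last step the part with [B2], both times [y ^ m / m!]. *)
  set (K := Q * (exp y * Bg + B2)). assert (HK : 0 <= K) by (unfold K; apply Rmult_le_pos; [lra|]; apply Rplus_le_le_0_compat; [apply Rmult_le_pos; lra|lra]).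
  assert (Hlim : is_lim_seq (fun m => K * (y ^ m / INR (fact m))) 0).
  { eapply is_lim_seq_real_eq; [apply is_lim_seq_mult'; [apply is_lim_seq_const|apply is_lim_seq_pow_fact]|]. ring. }
  apply is_lim_seq_spec in Hlim. destruct (Hlim (mkposreal _ Heps)) as [N HN]. simpl in HN.
  exists (INR N + 1). intros U HU. pose proof (pos_INR N) as HN0.
  destruct (nfloor_ex U ltac:(lra)) as [m Hm].
  assert (HmN : (N <= m)%nat). { apply INR_le. lra. }
  specialize (HN m HmN). rewrite Rminus_0_r in HN.
  assert (Hym : 0 <= y ^ m / INR (fact m)).
  { apply Rmult_le_pos; [apply pow_le; left; apply exp_pos|left; apply Rinv_0_lt_compat, INR_fact_lt_0]. }
  assert (HN' : K * (y ^ m / INR (fact m)) <= eps) by (pose proof (Rle_abs (K * (y ^ m / INR (fact m)))); lra).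
  pose proof (Ccont_pow_rGamma b L) as Hc.
  rewrite <- (CI_Chasles (pow_rGamma b L) u0 (u0 + INR m)) by auto.
  set (E := (Cexp ((1 - b) * L) * exp y)%C).
  replace (CI (pow_rGamma b L) u0 (u0 + INR m) + CI (pow_rGamma b L) (u0 + INR m) (u0 + U) - E)%C
    with ((CI (pow_rGamma b L) u0 (u0 + INR m) - E) + CI (pow_rGamma b L) (u0 + INR m) (u0 + U))%C by ring.
  eapply Rle_trans; [apply Cmod_triangle|].
  apply Rle_trans with ((B1 * Bg * Q + Q * exp y * Bg * (y ^ m / INR (fact m))) + Q * B2 * (y ^ m / INR (fact m)));
    [|unfold K in HN'; lra].
  apply Rplus_le_compat.
  - rewrite CI_unit_steps by auto.
    assert (EE : E = CI (fun _ => E) 0 1).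
    { rewrite (CI_FTC (fun y => y * E)%C (fun _ => E)); [rewrite Cmult_0_l, Cmult_1_l; ring| |apply Ccont_const].
      eapply Cderiv_ext; [| |apply Cderiv_mult; [apply Cderiv_id|apply (Cderiv_const E)]]; intros; cbv beta; ring. }
    rewrite EE. assert (Hcs : Ccont (fun r => csum m (fun k => pow_rGamma b L (u0 + INR k + r)))).
    { apply (Ccont_csum m (fun k r => pow_rGamma b L (u0 + INR k + r))). intros k.
      apply (Ccont_comp (pow_rGamma b L) (fun r => u0 + INR k + r)); auto. intro; apply continuous_R; reg. }
    rewrite <- CI_minus by (auto; apply Ccont_const).
    replace (B1 * Bg * Q + Q * exp y * Bg * (y ^ m / INR (fact m))) with
      ((B1 * Bg * Q + Q * exp y * Bg * (y ^ m / INR (fact m))) * (1 - 0)) by ring.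
    apply CI_bound_const; [lra|apply Ccont_minus; auto; apply Ccont_const|].
    intros r Hr. set (z := (u0 + b - 1 + r)%C).
    assert (Hz : Re z = u0 + Re b - 1 + r) by (unfold z; repeat progress Csimpl; ring).
    replace (csum m (fun k => pow_rGamma b L (u0 + INR k + r))) with (Cexp ((1 - b) * L) * frac_exp_sum m z L)%C.
    2:{ unfold frac_exp_sum. rewrite <- csum_scal. apply csum_ext. intros k _. unfold pow_rGamma.
        rewrite Cmult_assoc, <- Cexp_add. unfold z. f_equal; f_equal; rewrite !RtoC_plus; ring. }
    unfold E. replace (Cexp ((1 - b) * L) * frac_exp_sum m z L - Cexp ((1 - b) * L) * exp y)%C
      with (Cexp ((1 - b) * L) * (frac_exp_sum m z L - exp y))%C by ring.
    rewrite Cmod_mult, Cmod_Cexp.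
    replace (Re ((1 - b) * L)) with ((1 - Re b) * L) by (repeat progress Csimpl; ring).
    specialize (Hg r Hr). fold z in Hg. specialize (HS z L ltac:(lra) HL).
    pose proof (frac_exp_sum_rem m z L ltac:(lra)) as HR. rewrite Cmod_minus_sym in HR.
    pose proof (Cmod_dist_triangle (frac_exp_sum m z L) (frac_exp z L) (exp (exp L))) as HT. fold y in HT, HS, HR |- *.
    set (x := exp (Re z * L)) in *. assert (Hx : 0 < x) by apply exp_pos.
    assert (Hxq : exp ((1 - Re b) * L) * x <= Q).
    { unfold x, Q. rewrite <- exp_plus. apply exp_le_exp. rewrite Hz. nra. }
    assert (P0 : 0 < exp ((1 - Re b) * L)) by apply exp_pos.
    pose proof (Cmod_ge_0 (rGamma z)).
    assert (H1 : Cmod (frac_exp_sum m z L - exp y) <= x * (B1 * Bg + exp y * Bg * (y ^ m / INR (fact m)))).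
    { eapply Rle_trans; [apply HT|]. rewrite Rmult_plus_distr_l, Rplus_comm. apply Rplus_le_compat.
      - eapply Rle_trans; [apply HS|]. rewrite (Rmult_comm x). apply Rmult_le_compat_r; [lra|]. apply Rmult_le_compat_l; lra.
      - eapply Rle_trans; [apply HR|].
        replace (x * (exp y * Bg * (y ^ m / INR (fact m)))) with (exp y * (Bg * x) * (y ^ m / INR (fact m))) by ring.
        apply Rmult_le_compat_r; auto. apply Rmult_le_compat_l; [lra|].
        apply Rmult_le_compat_r; lra. }
    apply Rle_trans with (exp ((1 - Re b) * L) * (x * (B1 * Bg + exp y * Bg * (y ^ m / INR (fact m))))).
    + apply Rmult_le_compat_l; lra.
    + rewrite <- Rmult_assoc. replace (B1 * Bg * Q + Q * exp y * Bg * (y ^ m / INR (fact m)))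
        with (Q * (B1 * Bg + exp y * Bg * (y ^ m / INR (fact m)))) by ring.
      apply Rmult_le_compat_r; auto. apply Rplus_le_le_0_compat; [nra|]. apply Rmult_le_pos; auto. nra.
  - eapply Rle_trans; [apply (CI_bound_const _ (Q * B2 * (y ^ m / INR (fact m)))); auto; [lra|]|].
    + intros u Hu. set (r := u - u0 - INR m). assert (Hr : 0 <= r <= 1) by (unfold r; lra).
      unfold pow_rGamma. rewrite Cmod_mult, Cmod_Cexp.
      replace (Re (u * L)) with (u * L) by (Csimpl; ring).
      replace (u + b)%C with (u0 + b + r + INR m)%C.
      2:{ unfold r. rewrite !RtoC_minus. ring. }
      assert (Hre : 1 <= Re (u0 + b + r)%C) by (repeat progress Csimpl; lra).
      specialize (Hg2 r Hr). pose proof (rGamma_shift_bound _ m Hre).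
      replace (Q * B2 * (y ^ m / INR (fact m))) with ((Q * y ^ m) * (B2 / INR (fact m))) by (unfold Rdiv; ring).
      apply Rmult_le_compat; [left; apply exp_pos|apply Cmod_ge_0| |].
      * unfold Q, y. rewrite <- exp_INR_mult, <- exp_plus. apply exp_le_exp. unfold r in Hr. nra.
      * apply Rle_trans with (1 := H). apply Rmult_le_compat_r; auto. left; apply Rinv_0_lt_compat, INR_fact_lt_0.
    + assert (0 <= Q * B2 * (y ^ m / INR (fact m))) by (apply Rmult_le_pos; auto; nra). nra.
Qed.

(** As [r] runs through [0, 1], the points [k * (N + r + INR j)] sweep adjacent intervals of length
    [k]: averaging over the shift makes an integral of a sum with any step. *)
Lemma CI_csum_steps f (k N : R) n : Ccont f ->
  CI (fun r => csum n (fun j => k * f (k * (N + r + INR j))%R)%C) 0 1 = CI f (k * N) (k * N + k * INR n).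
Proof.
  intros Hf.
  assert (Hc : forall j, Ccont (fun r => f (k * (N + r + INR j)))).
  { intros j. apply (Ccont_comp f (fun r => k * (N + r + INR j))); auto. intro; apply continuous_R; reg. }
  rewrite (CI_csum n (fun j r => k * f (k * (N + r + INR j))%R)%C).
  2:{ intros j. apply Ccont_mult; auto. apply Ccont_const. }
  induction n.
  - simpl. rewrite Rmult_0_r, Rplus_0_r, CI_point. reflexivity.
  - cbn [csum]. rewrite IHn. rewrite CI_scal by auto.
    rewrite (CI_ext (fun r => f (k * (N + r + INR n))) (fun r => f (k * r + k * (N + INR n)))) by (intros; f_equal; ring).
    rewrite CI_comp_lin by auto. rewrite S_INR.
    replace (k * 0 + k * (N + INR n)) with (k * N + k * INR n) by ring.
    replace (k * 1 + k * (N + INR n)) with (k * N + k * (INR n + 1)) by ring.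
    apply CI_Chasles; auto.
Qed.

(** * Exchange of the series with Euler's integral *)

Lemma Clim_Cmod u l : Clim u l -> is_lim_seq (fun n => Cmod (u n)) (Cmod l).
Proof.
  intros H. apply is_lim_seq_spec. intros eps. destruct (Clim_eventually u l eps (cond_pos eps) H) as [N HN].
  exists N. intros n Hn. specialize (HN n Hn). apply Rle_lt_trans with (2 := HN).
  apply Rabs_le. pose proof (Cmod_triangle_sub (u n) l). pose proof (Cmod_triangle_sub l (u n)).
  rewrite (Cmod_minus_sym l) in H1. lra.
Qed.

Lemma IntR_correct B f : decR B f -> Clim (fun n => CI f (- INR n) (INR n)) (IntR f).
Proof.
  intros H. apply Clim_squeeze with (fun n => B * (exp (- INR n) + exp (- INR n))).
  - exists O. intros n _. rewrite Cmod_minus_sym. apply IntR_tail; auto. pose proof (pos_INR n); lra.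
  - eapply is_lim_seq_real_eq; [apply is_lim_seq_mult'; [apply is_lim_seq_const|apply is_lim_seq_plus'; apply is_lim_seq_exp_opp]|]. ring.
Qed.

Lemma IntR_le B B' f (g : R -> R) : decR B f -> decR B' (fun t => RtoC (g t)) ->
  (forall t, Cmod (f t) <= g t) -> Cmod (IntR f) <= Re (IntR (fun t => RtoC (g t))).
Proof.
  intros Hf Hg H. apply (is_lim_seq_le (fun n => Cmod (CI f (- INR n) (INR n)))
    (fun n => Re (CI (fun t => RtoC (g t)) (- INR n) (INR n))) (Cmod (IntR f)) (Re (IntR (fun t => RtoC (g t))))).
  - intros n. apply CI_bound; auto; [pose proof (pos_INR n); lra|apply Hf|].
    intros t. apply (proj1 (proj1 Hg t)).
  - apply Clim_Cmod. eapply IntR_correct, Hf.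
  - apply Clim_Re. eapply IntR_correct, Hg.
Qed.

Lemma decR_plus B B' f g : decR B f -> decR B' g -> decR (B + B') (fun y => f y + g y)%C.
Proof.
  intros [Hc Hf] [Hc' Hg]. split; [apply Ccont_plus; auto|].
  intros y. eapply Rle_trans; [apply Cmod_triangle|]. rewrite Rmult_plus_distr_r. apply Rplus_le_compat; auto.
Qed.

Lemma decR_scal B c f : decR B f -> decR (Cmod c * B) (fun y => c * f y)%C.
Proof.
  intros [Hc Hf]. split; [apply Ccont_mult; auto; apply Ccont_const|].
  intros y. rewrite Cmod_mult, Rmult_assoc. apply Rmult_le_compat_l; auto. apply Cmod_ge_0.
Qed.

Lemma csum_Gam_rGamma_IntR (s : R) d (c x q : R) z n : 0 < s -> 0 < c -> ln x + s * ln c = q -> 1 <= s * Re z + Re d -> 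
  (exists B, decR B (fun t => Gam_fun c d t * frac_exp_sum n z (q + s * t))%C) /\
  csum n (fun k => Rcpow x (z + INR k) * Gam (s * (z + INR k) + d) * rGamma (z + 1 + INR k))%C =
  (Rcpow c d * IntR (fun t => Gam_fun c d t * frac_exp_sum n z (q + s * t)%R))%C.
Proof.
  intros Hs Hc Hq Hz. induction n as [|n [[B HB] IH]].
  - split.
    + exists 0. split; [|intros; unfold frac_exp_sum; cbn [csum]; rewrite Cmult_0_r, Cmod_0; lra].
      apply Ccont_ext with (fun _ => RtoC 0); [intros; unfold frac_exp_sum; cbn [csum]; ring|apply Ccont_const].
    + cbn [csum]. rewrite (IntR_ext _ (fun t => 0 * gauss t)%C) by (intros; unfold frac_exp_sum; cbn [csum]; ring).
      rewrite (IntR_scal _ _ _ decR_gauss). ring.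
  - set (w := (s * (z + INR n) + d)%C).
    assert (Hw : 1 <= Re w).
    { unfold w. repeat progress Csimpl. pose proof (pos_INR n). nra. }
    destruct (decR_Gam_fun c w Hc Hw) as [B1 HB1].
    set (K := (Cexp ((z + INR n) * q) * rGamma (z + 1 + INR n))%C).
    assert (E : forall t, (Gam_fun c d t * frac_exp_sum (S n) z (q + s * t)%R = Gam_fun c d t * frac_exp_sum n z (q + s * t)%R + K * Gam_fun c w t)%C).
    { intros t. unfold frac_exp_sum, K, w, Gam_fun. cbn [csum].
      replace (s * (z + INR n) + d)%C with (d + s * (z + INR n))%C by ring.
      replace ((d + s * (z + INR n)) * t - c * exp t)%C with ((d * t - c * exp t) + (z + INR n) * (s * t))%C by ring.
      rewrite (Cexp_add (d * t - c * exp t)). rewrite RtoC_plus, RtoC_mult.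
      replace ((z + INR n) * (q + s * t))%C with ((z + INR n) * q + (z + INR n) * (s * t))%C by ring.
      rewrite (Cexp_add ((z + INR n) * q)). ring. }
    pose proof (decR_plus _ _ _ _ HB (decR_scal _ K _ HB1)) as HD.
    split.
    + exists (B + Cmod K * B1). destruct HD as [H1 H2]. split.
      * apply Ccont_ext with (2 := H1). intros; symmetry; apply E.
      * intros t. rewrite E. apply H2.
    + cbn [csum]. rewrite IH. rewrite (IntR_ext _ _ E).
      rewrite (IntR_plus B (Cmod K * B1)) by (auto; apply decR_scal; auto).
      rewrite (IntR_scal B1) by auto.
      fold w. rewrite (Gam_scale c w) by auto.
      assert (E2 : (Rcpow x (z + INR n) * Rcpow c w = Rcpow c d * Cexp ((z + INR n) * q))%C).
      { unfold Rcpow, w. rewrite <- !Cexp_add. f_equal. rewrite <- Hq, RtoC_plus, RtoC_mult. ring. }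
      transitivity (Rcpow c d * IntR (fun t => Gam_fun c d t * frac_exp_sum n z (q + s * t)%R)
         + (Rcpow x (z + INR n) * Rcpow c w) * IntR (Gam_fun c w) * rGamma (z + 1 + INR n))%C; [ring|].
      rewrite E2. unfold K. ring.
Qed.

(** Majorant of [Gam_fun] times the tail of [frac_exp_sum], uniform in the shift [N + r]: the two
    exponentials cover every exponent between [N] and [N + 1] for both signs of [q + s * t], and [B]
    bounds 1/Gamma. *)
Definition tail_majorant (s : R) (d : C) (c q N B : R) (n : nat) (t : R) : R :=
  exp (Re d * t - c * exp t) * (exp (N * (q + s * t)) + exp ((N + 1) * (q + s * t))) * B *
  (exp (exp (q + s * t)) - Rexp_sum n (exp (q + s * t))).

Lemma Rexp_sum_bounds n y : 0 <= y -> 0 <= Rexp_sum n y <= exp y.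
Proof.
  intros Hy. split.
  - induction n; [unfold Rexp_sum, exp_sum; cbn [csum]; rewrite Re_RtoC; lra|]. rewrite Rexp_sum_S.
    assert (0 <= y ^ n / INR (fact n)); [|lra].
    apply Rmult_le_pos; [apply pow_le; auto|left; apply Rinv_0_lt_compat, INR_fact_lt_0].
  - unfold Rexp_sum. apply Rle_trans with (1 := Cmod_ge_Re _). apply Rle_trans with (1 := exp_sum_bound _ _).
    right. f_equal. rewrite Cmod_R, Rabs_pos_eq; auto.
Qed.

Lemma exp_between a N L : N <= a <= N + 1 -> exp (a * L) <= exp (N * L) + exp ((N + 1) * L).
Proof.
  intros Ha. pose proof (exp_pos (N * L)). pose proof (exp_pos ((N + 1) * L)). destruct (Rle_dec 0 L).
  - assert (exp (a * L) <= exp ((N + 1) * L)) by (apply exp_le_exp, Rmult_le_compat_r; lra). lra.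
  - assert (exp (a * L) <= exp (N * L)) by (apply exp_le_exp; nra). lra.
Qed.

Lemma continuous_tail_majorant s d c q N B n : forall t, continuous (tail_majorant s d c q N B n) t.
Proof.
  intros t. unfold tail_majorant. apply (continuous_mult (K := R_AbsRing)
    (fun t => exp (Re d * t - c * exp t) * (exp (N * (q + s * t)) + exp ((N + 1) * (q + s * t))) * B)).
  - apply continuous_R. reg.
  - apply (continuous_minus (V := R_NormedModule) (fun t => exp (exp (q + s * t))) (fun t => Rexp_sum n (exp (q + s * t)))).
    + apply continuous_R. reg.
    + assert (Hc : Ccont (fun t => exp_sum n (RtoC (exp (q + s * t))))).
      { unfold exp_sum. apply (Ccont_csum n (fun k t => (RtoC (exp (q + s * t)) ^ k / INR (fact k))%C)).
        intros k. apply Ccont_mult; [|apply Ccont_const]. apply Ccont_pow, Ccont_RtoC. intro; apply continuous_R; reg. }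
      apply (Hc t).
Qed.

Lemma tail_majorant_pos s d c q N B n t : 0 <= B -> 0 <= tail_majorant s d c q N B n t.
Proof.
  intros HB. unfold tail_majorant. pose proof (Rexp_sum_bounds n (exp (q + s * t)) ltac:(left; apply exp_pos)).
  pose proof (exp_pos (N * (q + s * t))). pose proof (exp_pos ((N + 1) * (q + s * t))). pose proof (exp_pos (Re d * t - c * exp t)).
  apply Rmult_le_pos; [|lra]. apply Rmult_le_pos; auto. apply Rmult_le_pos; lra.
Qed.

Lemma decR_tail_majorant s d c q N B : 0 < s < 1 -> 0 < c -> 0 <= B -> 0 <= N -> 1 <= s * N + Re d ->
  exists B', forall n, decR B' (fun t => RtoC (tail_majorant s d c q N B n t)).
Proof.
  intros Hs Hc HB HN Hd.
  assert (A : forall a, N <= a -> exists B', forall t, exp (Re d * t - c * exp t + a * (q + s * t) + exp (q + s * t)) <= B' * exp (- Rabs t)).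
  { intros a Ha. destruct (exp_growth c (exp q) (Re d + a * s + 1) s) as [B1 HB1]; try lra; [left; apply exp_pos|].
    exists (exp (Rmax (a * q + B1) (a * q + exp q))). intros t. rewrite <- exp_plus. apply exp_le_exp.
    pose proof (Rmax_l (a * q + B1) (a * q + exp q)). pose proof (Rmax_r (a * q + B1) (a * q + exp q)).
    assert (E : exp (q + s * t) = exp q * exp (s * t)) by apply exp_plus. rewrite E.
    destruct (Rle_dec 0 t).
    - rewrite Rabs_pos_eq by auto. specialize (HB1 t r). lra.
    - rewrite Rabs_left by lra. pose proof (exp_pos t). pose proof (exp_pos q).
      assert (exp (s * t) <= 1) by (rewrite <- exp_0; apply exp_le_exp; nra).
      assert (exp q * exp (s * t) <= exp q) by nra.
      assert ((Re d + a * s) * t <= t). { assert (s * N <= s * a) by (apply Rmult_le_compat_l; lra). nra. }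
      assert (0 < c * exp t) by (apply Rmult_lt_0_compat; lra). lra. }
  destruct (A N ltac:(lra)) as [B1 HB1]. destruct (A (N + 1) ltac:(lra)) as [B2 HB2].
  exists (B * (B1 + B2)). intros n. split; [apply Ccont_RtoC, continuous_tail_majorant|].
  intros t. rewrite Cmod_R, Rabs_pos_eq by (apply tail_majorant_pos; auto).
  unfold tail_majorant. set (L := q + s * t). pose proof (Rexp_sum_bounds n (exp L) ltac:(left; apply exp_pos)).
  specialize (HB1 t). specialize (HB2 t). fold L in HB1, HB2. rewrite !exp_plus in HB1, HB2.
  set (g := exp (Re d * t - c * exp t)) in *. assert (0 < g) by apply exp_pos.
  pose proof (exp_pos (N * L)). pose proof (exp_pos ((N + 1) * L)).
  apply Rle_trans with (g * (exp (N * L) + exp ((N + 1) * L)) * B * exp (exp L)).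
  - apply Rmult_le_compat_l; [|lra]. apply Rmult_le_pos; auto. apply Rmult_le_pos; lra.
  - replace (g * (exp (N * L) + exp ((N + 1) * L)) * B * exp (exp L))
      with (B * (g * exp (N * L) * exp (exp L) + g * exp ((N + 1) * L) * exp (exp L))) by ring.
    replace (B * (B1 + B2) * exp (- Rabs t)) with (B * ((B1 + B2) * exp (- Rabs t))) by ring.
    apply Rmult_le_compat_l; auto. lra.
Qed.

Lemma tail_majorant_lim s d c q N B : 0 < s < 1 -> 0 < c -> 0 <= B -> 0 <= N -> 1 <= s * N + Re d ->
  is_lim_seq (fun n => Re (IntR (fun t => RtoC (tail_majorant s d c q N B n t)))) 0.
Proof.
  intros Hs Hc HB HN Hd. destruct (decR_tail_majorant s d c q N B) as [B' HB']; auto.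
  assert (Z : IntR (fun _ => RtoC 0) = RtoC 0).
  { rewrite (IntR_ext _ (fun t => 0 * gauss t)%C) by (intros; ring). rewrite (IntR_scal _ _ _ decR_gauss). ring. }
  assert (H : Clim (fun n => IntR (fun t => RtoC (tail_majorant s d c q N B n t))) (IntR (fun _ => RtoC 0))).
  { apply IntR_lim with B'; auto.
    - split; [apply Ccont_const|]. intros. rewrite Cmod_0. apply Rmult_le_pos; [eapply decR_pos, (HB' O)|left; apply exp_pos].
    - intros b Hb eps He.
      set (y := exp (Rabs q + b)). assert (Hy : 0 < y) by apply exp_pos.
      set (K := exp (Rabs (Re d) * b) * (exp (N * (Rabs q + b)) + exp ((N + 1) * (Rabs q + b))) * B).
      assert (HK : 0 <= K).
      { unfold K. apply Rmult_le_pos; auto. left. apply Rmult_lt_0_compat; [apply exp_pos|apply Rplus_lt_0_compat; apply exp_pos]. }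
      destruct (exp_sum_unif y (eps / (K + 1))) as [M HM]; [apply Rdiv_lt_0_compat; lra|lra|].
      exists M. intros n Hn t Ht. replace (RtoC (tail_majorant s d c q N B n t) - 0)%C with (RtoC (tail_majorant s d c q N B n t)) by ring.
      rewrite Cmod_R, Rabs_pos_eq by (apply tail_majorant_pos; auto). unfold tail_majorant. set (L := q + s * t).
      assert (HL : L <= Rabs q + b). { unfold L. pose proof (Rle_abs q). nra. }
      assert (HE : exp (exp L) - Rexp_sum n (exp L) <= eps / (K + 1)).
      { specialize (HM n Hn (RtoC (exp L))). rewrite Cmod_R, Rabs_pos_eq in HM by (left; apply exp_pos).
        specialize (HM ltac:(apply exp_le_exp; auto)). rewrite Cmod_minus_sym, Cexp_RtoC in HM.
        apply Rle_trans with (2 := HM). apply Rle_trans with (2 := Cmod_ge_Re _). rewrite Re_minus, Re_RtoC. unfold Rexp_sum. lra. }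
      pose proof (Rexp_sum_bounds n (exp L) ltac:(left; apply exp_pos)).
      apply Rle_trans with (K * (eps / (K + 1))).
      + apply Rmult_le_compat; [|lra| |auto].
        * apply Rmult_le_pos; auto. left. apply Rmult_lt_0_compat; [apply exp_pos|apply Rplus_lt_0_compat; apply exp_pos].
        * unfold K. apply Rmult_le_compat_r; auto.
          apply Rmult_le_compat; [left; apply exp_pos|left; apply Rplus_lt_0_compat; apply exp_pos| |].
          -- apply exp_le_exp. pose proof (exp_pos t). pose proof (Rle_abs (Re d)). pose proof (Rle_abs (- Re d)). rewrite Rabs_Ropp in *.
             assert (0 < c * exp t) by (apply Rmult_lt_0_compat; auto). pose proof (Rabs_pos (Re d)).
             assert (Re d * t <= Rabs (Re d) * b) by nra. lra.
          -- apply Rplus_le_compat; apply exp_le_exp, Rmult_le_compat_l; lra.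
      + apply Rmult_le_reg_r with (K + 1); [lra|]. field_simplify; [|lra]. nra. }
  rewrite Z in H. apply (Clim_Re _ _ H).
Qed.

Definition frac_exp_integrand (s : R) (d : C) (c q : R) (z : C) (t : R) : C := (Gam_fun c d t * frac_exp z (q + s * t))%C.

Lemma Ccont_affine_comp f (q s : R) : Ccont f -> Ccont (fun t => f (q + s * t)).
Proof.
  intros Hf. apply (Ccont_comp f (fun t => q + s * t)); auto. intro; apply continuous_R; reg.
Qed.

Lemma frac_exp_integrand_bound s d c q N B r t : 1 <= N -> 0 <= r <= 1 -> Cmod (rGamma (N + 1 + r)) <= B ->
  Cmod (frac_exp_integrand s d c q (N + r)%R t) <= exp (Re d * t - c * exp t) * (exp ((N + r) * (q + s * t)) * B * exp (exp (q + s * t))).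
Proof.
  intros HN Hr HB. unfold frac_exp_integrand. rewrite Cmod_mult, Cmod_Gam_fun.
  apply Rmult_le_compat_l; [left; apply exp_pos|].
  eapply Rle_trans; [apply frac_exp_bound; rewrite Re_RtoC; lra|]. rewrite Re_RtoC.
  replace (RtoC (N + r) + 1)%C with (N + 1 + r)%C by (rewrite RtoC_plus; ring).
  apply Rmult_le_compat_r; [left; apply exp_pos|]. apply Rmult_le_compat_l; [left; apply exp_pos|auto].
Qed.

Lemma decR_frac_exp_integrand s d c q N B r : 0 < s < 1 -> 0 < c -> 1 <= N -> 1 <= s * N + Re d -> 0 <= r <= 1 ->
  Cmod (rGamma (N + 1 + r)) <= B -> exists B', decR B' (frac_exp_integrand s d c q (N + r)%R).
Proof.
  intros Hs Hc HN Hd Hr HB. assert (HB0 : 0 <= B) by (apply Rle_trans with (2 := HB), Cmod_ge_0).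
  destruct (decR_tail_majorant s d c q N B) as [B' HB']; auto; try lra. exists B'. split.
  - apply Ccont_mult; [apply Ccont_Gam_fun|apply Ccont_affine_comp, Ccont_frac_exp].
  - intros t. apply Rle_trans with (2 := proj2 (HB' O) t). rewrite Cmod_R, Rabs_pos_eq by (apply tail_majorant_pos; auto).
    eapply Rle_trans; [apply (frac_exp_integrand_bound s d c q N B); auto|]. unfold tail_majorant.
    replace (Rexp_sum 0 (exp (q + s * t))) with 0 by reflexivity. rewrite Rminus_0_r, !Rmult_assoc.
    apply Rmult_le_compat_l; [left; apply exp_pos|]. apply Rmult_le_compat_r.
    + apply Rmult_le_pos; auto. left; apply exp_pos.
    + apply exp_between. lra.
Qed.

Lemma frac_exp_integrand_tail s d c q N B r n : 0 < s < 1 -> 0 < c -> 1 <= N -> 1 <= s * N + Re d -> 0 <= r <= 1 ->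
  Cmod (rGamma (N + 1 + r)) <= B ->
  (exists B', decR B' (fun t => Gam_fun c d t * frac_exp_sum n (N + r)%R (q + s * t))%C) ->
  Cmod (IntR (frac_exp_integrand s d c q (N + r)%R) - IntR (fun t => Gam_fun c d t * frac_exp_sum n (N + r)%R (q + s * t)%R)%C)
    <= Re (IntR (fun t => RtoC (tail_majorant s d c q N B n t))).
Proof.
  intros Hs Hc HN Hd Hr HB [B1 H1]. assert (HB0 : 0 <= B) by (apply Rle_trans with (2 := HB), Cmod_ge_0).
  destruct (decR_tail_majorant s d c q N B) as [B' HB']; auto; try lra.
  destruct (decR_frac_exp_integrand s d c q N B r) as [B2 H2]; auto.
  pose proof (decR_scal _ (- (1)) _ H1) as H3.
  replace (IntR (frac_exp_integrand s d c q (N + r)%R) - IntR (fun t => Gam_fun c d t * frac_exp_sum n (N + r)%R (q + s * t)%R))%C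
    with (IntR (fun t => frac_exp_integrand s d c q (N + r)%R t + - (1) * (Gam_fun c d t * frac_exp_sum n (N + r)%R (q + s * t)%R))%C).
  2:{ rewrite (IntR_plus B2 (Cmod (- (1)) * B1)) by auto. rewrite (IntR_scal B1) by auto. ring. }
  apply (IntR_le (B2 + Cmod (- (1)) * B1) B'); auto.
  - apply decR_plus; auto.
  - intros t. unfold frac_exp_integrand.
    replace (Gam_fun c d t * frac_exp (N + r)%R (q + s * t)%R + - (1) * (Gam_fun c d t * frac_exp_sum n (N + r)%R (q + s * t)%R))%C
      with (Gam_fun c d t * (frac_exp (N + r)%R (q + s * t)%R - frac_exp_sum n (N + r)%R (q + s * t)%R))%C by ring.
    rewrite Cmod_mult, Cmod_Gam_fun. unfold tail_majorant. rewrite !Rmult_assoc.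
    apply Rmult_le_compat_l; [left; apply exp_pos|].
    eapply Rle_trans; [apply frac_exp_sum_tail; rewrite Re_RtoC; lra|]. rewrite Re_RtoC.
    replace (RtoC (N + r) + 1)%C with (N + 1 + r)%C by (rewrite RtoC_plus; ring).
    pose proof (Rexp_sum_bounds n (exp (q + s * t)) ltac:(left; apply exp_pos)).
    rewrite Rmult_assoc. apply Rmult_le_compat.
    + left; apply exp_pos. + apply Rmult_le_pos; [apply Cmod_ge_0|lra].
    + apply exp_between; lra. + apply Rmult_le_compat_r; lra.
Qed.

(** * Laplace's method for the series *)

Definition gs (s t : R) : R := / (1 - s) * ((exp (s * t) - 1) / s - (exp t - 1)).

Lemma gs_derive s t : 0 < s < 1 -> is_derive (gs s) t (/ (1 - s) * (exp (s * t) - exp t)).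
Proof. intros Hs. unfold gs. auto_derive; auto. field. lra. Qed.

Lemma gs_MVT s a b : 0 < s < 1 -> a <= b -> exists c, a <= c <= b /\ gs s b - gs s a = / (1 - s) * (exp (s * c) - exp c) * (b - a).
Proof.
  intros Hs Hab. destruct (MVT_gen (gs s) a b (fun t => / (1 - s) * (exp (s * t) - exp t))) as (c & Hc & E).
  - intros y _. apply gs_derive; auto.
  - intros y _. apply continuity_pt_filterlim, (ex_derive_continuous (K := R_AbsRing) (V := R_NormedModule)).
    eexists. apply gs_derive; auto.
  - rewrite Rmin_left, Rmax_right in Hc by auto. exists c. auto.
Qed.

(** On [[- eta, eta]] the function [frac_exp] is replaced by [exp (exp (q + s t))]; with
    [exp q = c / s], its exponent minus [c exp t] is [(1 - s) c / s + (1 - s) c gs s t]. The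
    replacement costs only a power of [c / s], the summand 1; the part outside the segment is
    smaller than [exp ((1 - s) c / s)] by the factor [exp (- c1 * c)], up to such a power. *)
Lemma frac_exp_integral_laplace s d N eta : 0 < s < 1 -> 1 <= N -> 1 <= s * N + Re d -> 0 < eta <= 1 ->
  (forall w y, direction w -> Rabs y <= eta -> Re (w * w * Gs s (w * y)%C) <= - (y * y / 4)) ->
  exists B c0 c1, 0 <= B /\ 0 < c1 /\ forall c r, c0 <= c -> 0 <= r <= 1 ->
  Cmod (IntR (frac_exp_integrand s d c (ln (c / s)) (N + r)%R)
    - exp ((1 - s) * c / s) * laplace_int (Gs s) (fun z => Cexp (d * z)) eta 1 ((1 - s) * c))
  <= B * exp ((N + 1) * ln (c / s)) * (exp ((1 - s) * c / s - c1 * c) + 1).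
Proof.
  intros Hs HN Hd Heta Hloc.
  destruct (rGamma_segment_bound (N + 1)) as (B2 & HB2 & Hg2).
  destruct (rGamma_segment_bound N) as (Bg & HBg & Hg).
  destruct (frac_exp_approx (N + 1)) as (B1 & HB1 & HS).
  assert (Hk : 0 < / (1 - s)) by (apply Rinv_0_lt_compat; lra).
  assert (Hgloc : forall y, Rabs y <= eta -> gs s y <= - (y * y / 4)).
  { intros y Hy. specialize (Hloc (RtoC 1) y (or_introl eq_refl) Hy).
    rewrite !Cmult_1_l, Re_Gs in Hloc by auto. rewrite Re_RtoC, Im_RtoC, Rmult_0_r, cos_0, !Rmult_1_r in Hloc. exact Hloc. }
  set (c2 := / (1 - s) * (exp eta - exp (s * eta))).
  assert (Hc2 : 0 < c2). { apply Rmult_lt_0_compat; auto. assert (exp (s * eta) < exp eta) by (apply exp_increasing; nra). lra. }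
  (* The slope of [gs] decreases to the right of the saddle, so beyond [eta] it is at most its value
     [- c2] at [eta]. *)
  assert (Hright : forall t, eta <= t -> gs s t <= - (eta * eta / 4) - c2 * (t - eta)).
  { intros t Ht. destruct (gs_MVT s eta t Hs Ht) as (u & Hu & E).
    specialize (Hgloc eta ltac:(rewrite Rabs_pos_eq; lra)).
    assert (exp eta - exp (s * eta) <= exp u - exp (s * u)).
    { replace (exp eta) with (exp (s * eta) * exp ((1 - s) * eta)) by (rewrite <- exp_plus; f_equal; ring).
      replace (exp u) with (exp (s * u) * exp ((1 - s) * u)) by (rewrite <- exp_plus; f_equal; ring).
      assert (exp (s * eta) <= exp (s * u)) by (apply exp_le_exp; nra).
      assert (exp ((1 - s) * eta) <= exp ((1 - s) * u)) by (apply exp_le_exp; nra).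
      assert (1 <= exp ((1 - s) * eta)) by (rewrite <- exp_0 at 1; apply exp_le_exp; nra).
      pose proof (exp_pos (s * eta)).
      assert (exp (s * eta) * (exp ((1 - s) * eta) - 1) <= exp (s * u) * (exp ((1 - s) * u) - 1))
        by (apply Rmult_le_compat; lra). lra. }
    assert (c2 * (t - eta) <= / (1 - s) * (exp u - exp (s * u)) * (t - eta)).
    { apply Rmult_le_compat_r; [lra|]. apply Rmult_le_compat_l; lra. }
    lra. }
  (* Towards minus infinity the phase [gs] stays bounded, so the decay there has to come from the
     factor [exp ((Re d + (N + r) * s) * t)], whose rate is at least 1. *)
  assert (Hleft : forall t, t <= - eta -> gs s t <= - (eta * eta / 4)).
  { intros t Ht. destruct (gs_MVT s t (- eta) Hs Ht) as (u & Hu & E).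
    specialize (Hgloc (- eta) ltac:(rewrite Rabs_Ropp, Rabs_pos_eq; lra)).
    assert (exp u <= exp (s * u)) by (apply exp_le_exp; nra).
    assert (0 <= / (1 - s) * (exp (s * u) - exp u) * (- eta - t)).
    { apply Rmult_le_pos; [|lra]. apply Rmult_le_pos; lra. }
    lra. }
  set (m := Rabs (Re d) + (N + 1)). assert (Hm : 0 < m) by (unfold m; pose proof (Rabs_pos (Re d)); lra).
  set (K := exp (Rabs (Re d) * eta) * (B1 * Bg * exp (N + 1)) * (eta - - eta)).
  assert (HK : 0 <= K).
  { unfold K. apply Rmult_le_pos; [|lra]. apply Rmult_le_pos; [left; apply exp_pos|].
    apply Rmult_le_pos; [nra|left; apply exp_pos]. }
  (* [exp 1 <= c] makes [q >= 1], so that [q + s * t] is nonnegative for [|t| <= eta] as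
     [frac_exp_approx] requires; the other threshold makes the slope [c2] on the right beat the
     factors of growth at most [exp (m * t)]. *)
  exists (2 * (B2 * exp ((m + 1) * eta)) + K), (Rmax (exp 1) ((m + 1) / c2 / (1 - s))), ((1 - s) * (eta * eta / 4)).
  split; [assert (0 <= B2 * exp ((m + 1) * eta)) by (apply Rmult_le_pos; [auto|left; apply exp_pos]); lra|].
  split; [apply Rmult_lt_0_compat; [lra|nra]|].
  intros c r Hc Hr.
  assert (Hce : exp 1 <= c) by (apply Rle_trans with (2 := Hc), Rmax_l).
  assert (Hc0 : 0 < c) by (pose proof (exp_pos 1); lra).
  set (X := (1 - s) * c / s). set (Y := (1 - s) * c).
  assert (HYc2 : m + 1 <= Y * c2).
  { replace (m + 1) with ((1 - s) * ((m + 1) / c2 / (1 - s)) * c2) by (field; lra).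
    apply Rmult_le_compat_r; [lra|]. unfold Y. apply Rmult_le_compat_l; [lra|].
    apply Rle_trans with (2 := Hc), Rmax_r. }
  set (q := ln (c / s)).
  assert (Hq : 1 <= q).
  { unfold q. rewrite <- (ln_exp 1). apply Rcomplements.ln_le; [apply exp_pos|].
    apply Rle_trans with (1 := Hce). rewrite <- (Rmult_1_r c) at 1. apply Rmult_le_compat_l; [lra|].
    rewrite <- Rinv_1. apply Rinv_le_contravar; lra. }
  assert (Eq : forall t, exp (q + s * t) = c / s * exp (s * t)).
  { intros t. rewrite exp_plus. f_equal. unfold q. apply exp_ln. apply Rdiv_lt_0_compat; lra. }
  assert (EX : forall t, exp (q + s * t) - c * exp t = X + Y * gs s t).
  { intros t. rewrite Eq. unfold X, Y, gs. field. lra. }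
  destruct (decR_frac_exp_integrand s d c q N B2 r Hs Hc0 HN Hd Hr (Hg2 r Hr)) as [BF HF].
  set (F := frac_exp_integrand s d c q (N + r)%R) in *.
  set (b := B2 * exp ((m + 1) * eta) * exp ((N + 1) * q) * exp (X - Y * (eta * eta / 4))).
  assert (Hout : Cmod (IntR F - CI F (- eta) eta) <= 2 * b).
  { apply (IntR_outer BF); auto; [lra|]. intros t Ht.
    eapply Rle_trans; [apply (frac_exp_integrand_bound s d c q N B2); auto|].
    replace (exp (Re d * t - c * exp t) * (exp ((N + r) * (q + s * t)) * B2 * exp (exp (q + s * t))))
      with (B2 * (exp (Re d * t - c * exp t) * exp ((N + r) * (q + s * t)) * exp (exp (q + s * t)))) by ring.
    unfold b. rewrite !Rmult_assoc, <- !exp_plus. apply Rmult_le_compat_l; auto. apply exp_le_exp.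
    specialize (EX t).
    assert (Haq : (N + r) * q <= (N + 1) * q) by (apply Rmult_le_compat_r; lra).
    assert (HY : 0 < Y) by (unfold Y; nra).
    destruct (Rle_dec 0 t).
    - rewrite Rabs_pos_eq in * by auto. specialize (Hright t Ht).
      assert (Y * gs s t <= Y * (- (eta * eta / 4) - c2 * (t - eta))) by (apply Rmult_le_compat_l; lra).
      assert ((m + 1) * (t - eta) <= Y * c2 * (t - eta)) by (apply Rmult_le_compat_r; lra).
      assert (Re d * t + (N + r) * (s * t) <= m * t).
      { unfold m. replace ((Rabs (Re d) + (N + 1)) * t) with (Rabs (Re d) * t + (N + 1) * t) by ring. apply Rplus_le_compat.
        - apply Rmult_le_compat_r; auto. apply Rle_abs.
        - assert ((N + r) * s <= N + 1) by nra.
          apply Rle_trans with ((N + r) * s * t); [right; ring|apply Rmult_le_compat_r; auto]. }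
      nra.
    - rewrite Rabs_left in * by lra. specialize (Hleft t ltac:(lra)).
      assert (Y * gs s t <= Y * (- (eta * eta / 4))) by (apply Rmult_le_compat_l; lra).
      assert (0 <= r * s) by (apply Rmult_le_pos; lra).
      assert (Hge : 1 <= Re d + (N + r) * s) by lra.
      assert ((Re d + (N + r) * s) * t <= t) by nra.
      assert (0 <= (m + 1) * eta) by nra. nra. }
  set (F1 := fun t => (Gam_fun c d t * RtoC (exp (exp (q + s * t))))%C).
  assert (HF1 : Ccont F1).
  { apply Ccont_mult; [apply Ccont_Gam_fun|]. apply Ccont_RtoC. intro; apply continuous_R; reg. }
  assert (EJ : (exp X * laplace_int (Gs s) (fun z => Cexp (d * z)) eta 1 Y)%C = CI F1 (- eta) eta).
  { unfold laplace_int. rewrite <- CI_scal.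
    - apply CI_ext. intros t _. unfold F1, Gam_fun.
      rewrite <- (Cexp_RtoC X), <- (Cexp_RtoC (exp (q + s * t))), <- !Cexp_add. f_equal.
      replace (RtoC (exp (q + s * t))) with (RtoC (c * exp t + (X + Y * gs s t))) by (f_equal; specialize (EX t); lra).
      replace (Gs s (1 * t)) with (RtoC (gs s t)).
      + rewrite !RtoC_plus, !RtoC_mult. ring.
      + unfold Gs, gs. rewrite Cmult_1_l, <- RtoC_mult, !Cexp_RtoC.
        rewrite RtoC_mult, RtoC_inv, !RtoC_minus, RtoC_div, !RtoC_minus by lra. reflexivity.
    - apply Ccont_mult; [apply Ccont_Cexp, Ccont_mult; [apply Ccont_const|]|].
      + apply (continuous_along_0 _ (continuous_along_Gs s)).
      + apply (continuous_along_0 _ (continuous_along_Cexp d)). }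
  fold q X Y. fold F. rewrite EJ.
  assert (Hin : Cmod (CI F (- eta) eta - CI F1 (- eta) eta) <= K * exp ((N + 1) * q)).
  { rewrite <- CI_minus by (auto; apply HF).
    replace (K * exp ((N + 1) * q)) with
      (exp (Rabs (Re d) * eta) * (B1 * Bg * exp (N + 1) * exp ((N + 1) * q)) * (eta - - eta)) by (unfold K; ring).
    apply CI_bound_const; [lra|apply Ccont_minus; auto; apply HF|].
    intros t Ht. unfold F, frac_exp_integrand, F1.
    match goal with |- Cmod (?a * ?b - ?a * ?d)%C <= _ => replace (a * b - a * d)%C with (a * (b - d))%C by ring end.
    rewrite Cmod_mult, Cmod_Gam_fun. apply Rmult_le_compat; [left; apply exp_pos|apply Cmod_ge_0| |].
    - apply exp_le_exp. pose proof (exp_pos t). assert (0 < c * exp t) by (apply Rmult_lt_0_compat; auto).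
      assert (Rabs t <= eta) by (apply Rabs_le; lra).
      assert (Re d * t <= Rabs (Re d) * eta).
      { apply Rle_trans with (1 := Rle_abs _). rewrite Rabs_mult. apply Rmult_le_compat_l; auto. apply Rabs_pos. }
      lra.
    - assert (HL : 0 <= q + s * t <= q + 1) by nra.
      eapply Rle_trans; [apply HS; rewrite ?Re_RtoC; lra|]. rewrite Re_RtoC.
      rewrite Rmult_assoc, (Rmult_assoc (B1 * Bg)), Rmult_assoc. apply Rmult_le_compat_l; auto.
      apply Rmult_le_compat; [apply Cmod_ge_0|left; apply exp_pos| |].
      + replace (RtoC (N + r)) with (N + r)%C by (rewrite RtoC_plus; ring). auto.
      + rewrite <- exp_plus. apply exp_le_exp. nra. }
  eapply Rle_trans; [apply (Cmod_dist_triangle _ (CI F (- eta) eta))|].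
  assert (Hb : 2 * b <= (2 * (B2 * exp ((m + 1) * eta))) * exp ((N + 1) * q) * exp (X - (1 - s) * (eta * eta / 4) * c)).
  { unfold b. right. replace (Y * (eta * eta / 4)) with ((1 - s) * (eta * eta / 4) * c) by (unfold Y; ring). ring. }
  set (P := exp ((N + 1) * q)) in *. set (E1 := exp (X - (1 - s) * (eta * eta / 4) * c)) in *.
  assert (0 < P) by apply exp_pos. assert (0 < E1) by apply exp_pos.
  set (B2' := B2 * exp ((m + 1) * eta)) in *.
  assert (0 <= B2') by (unfold B2'; apply Rmult_le_pos; auto; left; apply exp_pos).
  assert (0 <= K * P * E1) by (apply Rmult_le_pos; [nra|lra]).
  assert (0 <= B2' * P) by nra. nra.
Qed.

(** * The coefficients of the inverse factorial expansion *)

Lemma csum_inv_pow_bound n (a : nat -> C) : exists D, 0 <= D /\ forall X, 1 <= X ->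
  Cmod (csum n (fun j => a j * / X ^ j)%C) <= D.
Proof.
  induction n.
  - exists 0. split; [lra|]. intros. cbn [csum]. rewrite Cmod_0. lra.
  - destruct IHn as (D & HD & H). exists (D + Cmod (a n)). pose proof (Cmod_ge_0 (a n)). split; [lra|].
    intros X HX. cbn [csum]. eapply Rle_trans; [apply Cmod_triangle|]. apply Rplus_le_compat; auto.
    rewrite Cmod_mult. assert (RtoC X <> 0) by (intros E; apply RtoC_inj in E; lra).
    rewrite Cmod_inv by (apply Cpow_nz; auto). rewrite Cmod_pow, Cmod_R, Rabs_pos_eq by lra.
    pose proof (pow_R1_Rle X n HX). assert (/ X ^ n <= 1) by (rewrite <- Rinv_1; apply Rinv_le_contravar; lra). nra.
Qed.

Lemma asymptotic_unique M (a : nat -> C) K X0 :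
  (forall X, X0 <= X -> 1 <= X -> Cmod (csum M (fun j => a j * / X ^ j)%C) <= K * / X ^ M) ->
  forall j, (j < M)%nat -> a j = RtoC 0.
Proof.
  revert a. induction M; intros a H j Hj; [lia|].
  destruct (csum_inv_pow_bound M (fun j => a (S j))) as (D & HD & HB).
  assert (split : forall X, 1 <= X -> csum (S M) (fun j => a j * / X ^ j)%C = (a O + / X * csum M (fun j => a (S j) * / X ^ j))%C).
  { intros X HX. rewrite csum_shift, <- csum_scal.
    assert (RtoC X <> 0) by (intros E; apply RtoC_inj in E; lra). f_equal.
    - simpl. field.
    - apply csum_ext. intros k _. simpl. assert (X ^ k <> 0)%C by (apply Cpow_nz; auto). field. auto. }
  assert (a0 : a O = RtoC 0).
  { set (X1 := Rmax 1 X0). assert (HX1 : 1 <= X1) by apply Rmax_l. assert (HX2 : X0 <= X1) by apply Rmax_r.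
    apply Cmod_small_0 with (D := Rabs K + D) (e0 := / X1); [apply Rinv_0_lt_compat; lra|].
    intros e He. set (X := / e). assert (HX : X1 <= X).
    { unfold X. rewrite <- (Rinv_inv X1). apply Rinv_le_contravar; lra. }
    assert (Ee : / X = e) by (unfold X; apply Rinv_inv).
    specialize (H X ltac:(lra) ltac:(lra)). rewrite split in H by lra.
    replace (a O) with ((a O + / X * csum M (fun j => a (S j) * / X ^ j)) - / X * csum M (fun j => a (S j) * / X ^ j))%C by ring.
    eapply Rle_trans; [apply Cmod_minus_le|]. rewrite Rmult_plus_distr_l. apply Rplus_le_compat.
    - apply Rle_trans with (1 := H). rewrite Rmult_comm. simpl. rewrite Rinv_mult, Ee.
      pose proof (pow_R1_Rle X M ltac:(lra)). assert (/ X ^ M <= 1) by (rewrite <- Rinv_1; apply Rinv_le_contravar; lra).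
      assert (0 < / X ^ M) by (apply Rinv_0_lt_compat; lra).
      pose proof (Rle_abs K). pose proof (Rabs_pos K).
      apply Rle_trans with (e * / X ^ M * Rabs K); [apply Rmult_le_compat_l; nra|].
      apply Rmult_le_compat_r; auto. nra.
    - rewrite Cmod_mult, <- RtoC_inv by lra. rewrite Ee, Cmod_R, Rabs_pos_eq by lra.
      apply Rmult_le_compat_l; [lra|]. apply HB; lra. }
  destruct j as [|j]; auto. apply (IHM (fun j => a (S j))); [|lia].
  intros X HX HX1. specialize (H X HX HX1). rewrite split, a0, Cplus_0_l in H by auto.
  rewrite Cmod_mult, <- RtoC_inv, Cmod_R, Rabs_pos_eq in H by (try lra; left; apply Rinv_0_lt_compat; lra).
  apply Rmult_le_reg_l with (/ X); [apply Rinv_0_lt_compat; lra|]. apply Rle_trans with (1 := H). right.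
  simpl. rewrite Rinv_mult. ring.
Qed.

Lemma Carg_pos t : 0 < t -> Carg (RtoC t) = 0.
Proof.
  intros Ht. unfold Carg. rewrite Im_RtoC, Re_RtoC, Cmod_R, Rabs_pos_eq by lra.
  destruct (Rle_dec 0 0); [|lra]. unfold Rdiv. rewrite Rinv_r by lra. apply acos_1.
Qed.

Lemma coeffs_real_axis s b A M : 0 < s < 1 -> inverse_factorial_coeffs s b A -> (1 <= M)%nat ->
  exists K T0, 0 <= K /\ forall t, T0 <= t -> exists rho, Cmod rho <= K /\
  (Gam (s * t + (1 - b)) * rGamma (t + 1))%C =
  ((1 - s)%R * Rcpow (Rpower s s * Rpower (1 - s) (1 - s)) t *
   (csum M (fun j => A j * rGamma (((1 - s) * t)%R + (1 / 2 + b + INR j))) +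
    rho * rGamma (((1 - s) * t)%R + (1 / 2 + b + INR M))))%C.
Proof.
  intros Hs HA HM. destruct (HA M HM) as (rho & Hrho). pose proof PI_RGT_0.
  (* With [eps = PI / 2] the sector contains the positive axis. The threshold on [t] also gives
     [1 <= Re (s * t + (1 - b))], so that [CGamma] is Euler's integral there. *)
  destruct (Hrho (PI / 2) ltac:(lra)) as (K & R0 & HK).
  exists (Rabs K), (Rmax 1 (Rmax R0 ((1 - Re (1 - b)%C) / s))). split; [apply Rabs_pos|].
  intros t Ht.
  assert (H1 : 1 <= t) by (apply Rle_trans with (2 := Ht), Rmax_l).
  assert (H2 : R0 <= t) by (eapply Rle_trans; [eapply Rle_trans; [apply Rmax_l|apply Rmax_r]|apply Ht]).
  assert (H3 : 1 - Re (1 - b)%C <= s * t).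
  { replace (1 - Re (1 - b)%C) with (s * ((1 - Re (1 - b)%C) / s)) by (field; lra).
    apply Rmult_le_compat_l; [lra|]. eapply Rle_trans; [eapply Rle_trans; [apply Rmax_r|apply Rmax_r]|apply Ht]. }
  destruct (HK (RtoC t)) as [E HE].
  { rewrite Cmod_R, Rabs_pos_eq; lra. }
  { rewrite Carg_pos by lra. rewrite Rabs_R0. lra. }
  exists (rho (RtoC t)). split; [apply Rle_trans with (1 := HE), Rle_abs|].
  rewrite CGamma_Gam in E.
  2:{ rewrite Re_plus, Re_mult, !Re_RtoC, !Im_RtoC. lra. }
  rewrite (Cplus_comm t 1), E.
  replace (csum M) with (csum (S (M - 1))) by (f_equal; lia). rewrite csum_sum_n.
  rewrite RtoC_mult, RtoC_minus.
  replace (1 - (RtoC (1 / 2) - b))%C with (1 / 2 + b)%C.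
  2:{ rewrite RtoC_div by lra. field. }
  f_equal. f_equal.
  - apply sum_n_ext. intros j. f_equal. f_equal. ring.
  - f_equal. f_equal. ring.
Qed.

(** * Averaging over the shift of the summation points *)

Lemma csum_swap n m (F : nat -> nat -> C) :
  csum n (fun k => csum m (fun j => F k j)) = csum m (fun j => csum n (fun k => F k j)).
Proof.
  induction n; cbn [csum].
  - induction m; cbn [csum]; [reflexivity|]. rewrite <- IHm. ring.
  - rewrite IHn, <- csum_plus. reflexivity.
Qed.

Lemma csum_le_Re n (a g : nat -> C) : (forall k, (k < n)%nat -> Cmod (a k) <= Re (g k)) -> Cmod (csum n a) <= Re (csum n g).
Proof.
  induction n; intros H; cbn [csum].
  - rewrite Cmod_0, Re_RtoC. lra.
  - eapply Rle_trans; [apply Cmod_triangle|]. rewrite Re_plus. apply Rplus_le_compat; auto.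
Qed.

(** The factor [k] is the step of the sum, so that integration over [r] gives an integral of
    [pow_rGamma] with weight 1. *)
Definition step_sum (k N : R) (b : C) (L : R) (n : nat) (r : R) : C :=
  csum n (fun j => k * pow_rGamma b L (k * (N + r + INR j))%R)%C.

Lemma Ccont_step_sum k N b L n : Ccont (step_sum k N b L n).
Proof.
  apply (Ccont_csum n (fun j r => k * pow_rGamma b L (k * (N + r + INR j))%R)%C). intros j.
  apply Ccont_mult; [apply Ccont_const|].
  apply (Ccont_comp (pow_rGamma b L) (fun r => k * (N + r + INR j))); [apply Ccont_pow_rGamma|]. intro; apply continuous_R; reg.
Qed.

Lemma pow_rGamma_vertical b : exists B, 0 <= B /\ forall L u, 1 <= u + Re b -> Cmod (pow_rGamma b L u) <= Re (B * pow_rGamma (Re b) L u)%C.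
Proof.
  destruct (rGamma_vertical b) as (B & HB & H). exists B. split; auto. intros L u Hu.
  unfold pow_rGamma. rewrite Cmod_mult, Cmod_Cexp. specialize (H u Hu). rewrite RtoC_plus in H.
  destruct (rGamma_real (u + Re b) ltac:(lra)) as [E _]. rewrite RtoC_plus in E. rewrite E.
  rewrite <- RtoC_mult, Cexp_RtoC, <- !RtoC_mult, !Re_RtoC.
  pose proof (exp_pos (u * L)).
  apply Rle_trans with (exp (u * L) * (B * Re (rGamma (u + Re b)%C))); [apply Rmult_le_compat_l; lra|right; ring].
Qed.

(* The averaged form of the expansion: integrating over a shift [r] of the summation points turns the sums with
   step [1 - s] in the argument of 1/Gamma into sums with step 1, which are explicit. *)
Lemma series_vs_coeffs s b A M K T0 N x L n r : 0 < s < 1 -> 0 <= K -> T0 <= N -> 0 <= r ->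
  (forall t, T0 <= t -> exists rho, Cmod rho <= K /\
  (Gam (s * t + (1 - b)) * rGamma (t + 1))%C =
  ((1 - s)%R * Rcpow (Rpower s s * Rpower (1 - s) (1 - s)) t *
   (csum M (fun j => A j * rGamma (((1 - s) * t)%R + (1 / 2 + b + INR j))) +
    rho * rGamma (((1 - s) * t)%R + (1 / 2 + b + INR M))))%C) ->
  ln x + ln (Rpower s s * Rpower (1 - s) (1 - s)) = (1 - s) * L ->
  forall B : R, 0 <= B ->
  (forall u, (1 - s) * N <= u -> Cmod (pow_rGamma (1 / 2 + b + INR M) L u) <= Re (B * pow_rGamma (Re (1 / 2 + b + INR M)%C) L u)%C) ->
  Cmod (csum n (fun k => Rcpow x ((N + r)%R + INR k) * Gam (s * ((N + r)%R + INR k) + (1 - b)) * rGamma ((N + r)%R + 1 + INR k))%C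
    - csum M (fun j => A j * step_sum (1 - s) N (1 / 2 + b + INR j) L n r)%C)
  <= K * (B * Re (step_sum (1 - s) N (Re (1 / 2 + b + INR M)%C) L n r)).
Proof.
  intros Hs HK HTN Hr H Hx B HB HM.
  set (h := Rpower s s * Rpower (1 - s) (1 - s)) in *.
  set (a := fun k => (Rcpow x ((N + r)%R + INR k) * Gam (s * ((N + r)%R + INR k) + (1 - b)) * rGamma ((N + r)%R + 1 + INR k))%C).
  assert (Ha : forall k, exists rho, Cmod rho <= K /\
     a k = (csum M (fun j => A j * ((1 - s)%R * pow_rGamma (1 / 2 + b + INR j) L ((1 - s) * (N + r + INR k))%R))
       + rho * ((1 - s)%R * pow_rGamma (1 / 2 + b + INR M) L ((1 - s) * (N + r + INR k))%R))%C).
  { intros k. set (t := N + r + INR k). pose proof (pos_INR k).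
    destruct (H t ltac:(unfold t; lra)) as (rho & Hrho & E). exists rho. split; auto.
    unfold a. replace (RtoC (N + r) + INR k)%C with (RtoC t) by (unfold t; rewrite !RtoC_plus; ring).
    replace (RtoC (N + r) + 1 + INR k)%C with (t + 1)%C by (unfold t; rewrite !RtoC_plus; ring).
    rewrite <- Cmult_assoc, E.
    assert (Ep : (Rcpow x t * Rcpow h t = Cexp (((1 - s) * t)%R * L))%C).
    { unfold Rcpow. rewrite <- Cexp_add. f_equal. rewrite <- Cmult_plus_distr_l, <- RtoC_plus.
      replace (ln x + ln h) with ((1 - s) * L). rewrite <- !RtoC_mult. f_equal. ring. }
    transitivity ((Rcpow x t * Rcpow h t) * ((1 - s)%R * (csum M (fun j => A j * rGamma (((1 - s) * t)%R + (1 / 2 + b + INR j))) +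
       rho * rGamma (((1 - s) * t)%R + (1 / 2 + b + INR M)))))%C; [ring|].
    rewrite Ep. unfold pow_rGamma. rewrite (csum_ext M (fun j => A j * ((1 - s)%R * (Cexp (((1 - s) * t)%R * L) * rGamma (((1 - s) * t)%R + (1 / 2 + b + INR j)))))%C
      (fun j => ((1 - s)%R * Cexp (((1 - s) * t)%R * L)) * (A j * rGamma (((1 - s) * t)%R + (1 / 2 + b + INR j))))%C)
      by (intros; ring).
    rewrite csum_scal. ring. }
  set (P := fun j k => ((1 - s)%R * pow_rGamma (1 / 2 + b + INR j) L ((1 - s) * (N + r + INR k))%R)%C).
  replace (csum M (fun j => A j * step_sum (1 - s) N (1 / 2 + b + INR j) L n r)%C)
    with (csum n (fun k => csum M (fun j => A j * P j k)%C)).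
  2:{ rewrite csum_swap. apply csum_ext. intros j _. rewrite csum_scal. reflexivity. }
  replace (csum n a - csum n (fun k => csum M (fun j => A j * P j k)%C))%C
    with (csum n (fun k => a k - csum M (fun j => A j * P j k))%C).
  2:{ rewrite (csum_ext n _ (fun k => a k + (- (1)) * csum M (fun j => A j * P j k))%C) by (intros; ring).
      rewrite (csum_plus n a), csum_scal. ring. }
  replace (K * (B * Re (step_sum (1 - s) N (Re (1 / 2 + b + INR M)%C) L n r)))
    with (Re (csum n (fun k => (K * B)%R * ((1 - s)%R * pow_rGamma (Re (1 / 2 + b + INR M)%C) L ((1 - s) * (N + r + INR k))%R)))%C).
  2:{ rewrite csum_scal. unfold step_sum. rewrite Re_mult, Re_RtoC, Im_RtoC. ring. }
  apply csum_le_Re. intros k _. destruct (Ha k) as (rho & Hrho & E). rewrite E. fold (P M k).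
  replace (csum M (fun j => A j * ((1 - s)%R * pow_rGamma (1 / 2 + b + INR j) L ((1 - s) * (N + r + INR k))%R))%C)
    with (csum M (fun j => A j * P j k)%C) by reflexivity.
  match goal with |- Cmod ?Q <= _ => replace Q with (rho * P M k)%C by ring end.
  rewrite Cmod_mult. unfold P. rewrite Cmod_mult, Cmod_R, Rabs_pos_eq by lra.
  set (u := (1 - s) * (N + r + INR k)). pose proof (pos_INR k).
  assert (Hu : (1 - s) * N <= u) by (unfold u; apply Rmult_le_compat_l; lra).
  specialize (HM u Hu). set (w := pow_rGamma (Re (1 / 2 + b + INR M)%C) L u) in *.
  rewrite Re_mult, Re_RtoC, Im_RtoC in HM.
  repeat progress Csimpl. rewrite ?Rmult_0_l, ?Rminus_0_r in *.
  pose proof (Cmod_ge_0 (pow_rGamma (1 / 2 + b + INR M) L u)).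
  apply Rle_trans with (K * ((1 - s) * (B * Re w))).
  - apply Rmult_le_compat; auto; [apply Cmod_ge_0|apply Rmult_le_pos; lra|apply Rmult_le_compat_l; lra].
  - right; ring.
Qed.

Lemma poly_exp_bound p a M : 0 < a -> exists K, 0 <= K /\ forall X, 1 <= X ->
  exp (p * ln X) * exp (- a * X) <= K * / X ^ M.
Proof.
  intros Ha. destruct (nfloor_ex (Rabs p) (Rabs_pos p)) as [k [_ Hk]].
  exists (INR (fact (S k + M)) / a ^ (S k + M)). split.
  { apply Rdiv_le_0_compat; [left; apply INR_fact_lt_0|apply pow_lt; auto]. }
  intros X HX. assert (HXM : 0 < X ^ M) by (apply pow_lt; lra).
  pose proof (pow_exp_bound a (S k + M) X Ha ltac:(lra)).
  assert (HL : 0 <= ln X) by (rewrite <- ln_1; apply Rcomplements.ln_le; lra).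
  assert (E1 : exp (p * ln X) <= X ^ S k).
  { rewrite <- (exp_ln X) at 2 by lra. rewrite <- exp_INR_mult. apply exp_le_exp.
    apply Rmult_le_compat_r; auto. pose proof (Rle_abs p). rewrite S_INR. lra. }
  apply Rmult_le_reg_r with (X ^ M); auto. rewrite (Rmult_assoc _ (/ X ^ M)), Rinv_l, Rmult_1_r by lra.
  apply Rle_trans with (2 := H). rewrite pow_add. pose proof (exp_pos (- a * X)).
  replace (X ^ S k * X ^ M * exp (- a * X)) with (X ^ S k * exp (- a * X) * X ^ M) by ring.
  apply Rmult_le_compat_r; [lra|]. apply Rmult_le_compat_r; lra.
Qed.

Lemma le_eps_scaled a b C : 0 <= C -> (forall eps, 0 < eps -> a <= b + C * eps) -> a <= b.
Proof.
  intros HC H. apply le_epsilon. intros eps He. specialize (H (eps / (C + 1)) ltac:(apply Rdiv_lt_0_compat; lra)).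
  apply Rle_trans with (1 := H). apply Rplus_le_compat_l.
  apply Rmult_le_reg_r with (C + 1); [lra|]. field_simplify; [|lra]. nra.
Qed.

(** A statement on the integral over a half line, made through its truncations: [eps] absorbs the
    truncation at [U], and the other error grows like a power of [exp L] only, against [exp (exp L)]
    in the main term. *)
Definition pow_rGamma_near (b : C) (u0 B L : R) : Prop := forall eps, 0 < eps ->
  exists U0, forall U, U0 <= U ->
  Cmod (CI (pow_rGamma b L) u0 (u0 + U) - Cexp ((1 - b) * L) * exp (exp L)) <= B * exp ((u0 + 1) * L) + eps.

Lemma CI_pow_rGamma_all M (b : nat -> C) u0 : (forall j, 2 <= u0 + Re (b j)) ->
  exists B, 0 <= B /\ forall j, (j < M)%nat -> forall L, 0 <= L -> pow_rGamma_near (b j) u0 B L.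
Proof.
  intros H. induction M.
  - exists 0. split; [lra|]. intros; lia.
  - destruct IHM as (B & HB & IH). destruct (CI_pow_rGamma (b M) u0 (H M)) as (B1 & HB1 & H1).
    exists (B + B1). split; [lra|]. intros j Hj L HL eps He.
    assert (P : 0 < exp ((u0 + 1) * L)) by apply exp_pos.
    assert (D : (j < M)%nat \/ j = M) by lia. destruct D as [D| ->].
    + destruct (IH j D L HL eps He) as [U0 HU]. exists U0. intros U HU'. specialize (HU U HU'). nra.
    + destruct (H1 L HL eps He) as [U0 HU]. exists U0. intros U HU'. specialize (HU U HU'). nra.
Qed.

Lemma pow_rGamma_near_sum M (A : nat -> C) (b : nat -> C) u0 k B L : 0 <= B -> 0 < k ->
  (forall j, (j < M)%nat -> pow_rGamma_near (b j) u0 B L) -> exists SA, 0 <= SA /\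
  SA = Re (csum M (fun j => RtoC (Cmod (A j)))) /\ forall eps, 0 < eps ->
  eventually (fun n => Cmod (csum M (fun j => A j * CI (pow_rGamma (b j) L) u0 (u0 + k * INR n))%C
     - csum M (fun j => A j * (Cexp ((1 - b j) * L) * exp (exp L)))%C) <= SA * (B * exp ((u0 + 1) * L) + eps)).
Proof.
  intros HB Hk. induction M; intros H.
  - exists 0. split; [lra|]. split; [reflexivity|]. intros eps He. exists O. intros n _. cbn [csum].
    replace (0 - 0)%C with (RtoC 0) by ring. rewrite Cmod_0. lra.
  - destruct IHM as (SA & HSA & E & IH); [intros; apply H; lia|].
    exists (SA + Cmod (A M)). pose proof (Cmod_ge_0 (A M)). split; [lra|]. split.
    { cbn [csum]. rewrite Re_plus, <- E, Re_RtoC. reflexivity. }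
    intros eps He. destruct (IH eps He) as [N1 H1]. destruct (H M ltac:(lia) eps He) as [U0 HU].
    destruct (nfloor_ex (Rmax 0 (U0 / k)) (Rmax_l _ _)) as [m [_ Hm]].
    exists (N1 + S m)%nat. intros n Hn. cbn [csum].
    match goal with |- Cmod (?a + ?b - (?c + ?d))%C <= _ => replace (a + b - (c + d))%C with ((a - c) + (b - d))%C by ring end.
    eapply Rle_trans; [apply Cmod_triangle|]. rewrite Rmult_plus_distr_r. apply Rplus_le_compat; [apply H1; lia|].
    match goal with |- Cmod (?a * ?b - ?a * ?d)%C <= _ => replace (a * b - a * d)%C with (a * (b - d))%C by ring end.
    rewrite Cmod_mult. apply Rmult_le_compat_l; auto. apply HU.
    assert (Hn2 : (S m <= n)%nat) by lia. apply le_INR in Hn2. rewrite S_INR in Hn2.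
    pose proof (Rmax_r 0 (U0 / k)). replace U0 with (k * (U0 / k)) by (field; lra). apply Rmult_le_compat_l; lra.
Qed.

Lemma RInt_cst_Re c K f a b : Ccont f ->
  RInt (fun r => c + K * Re (f r)) a b = c * (b - a) + K * Re (CI f a b).
Proof.
  intros Hf. etransitivity.
  - apply (RInt_plus (V := R_CompleteNormedModule) (fun _ => c) (fun r => K * Re (f r))).
    + apply (ex_RInt_const (V := R_NormedModule)).
    + apply (ex_RInt_scal (V := R_NormedModule) (fun r => Re (f r))), Ccont_ex_Re, Hf.
  - rewrite RInt_const. change (RInt (fun r => K * Re (f r)) a b) with (RInt (fun r => scal K (Re (f r))) a b).
    rewrite (RInt_scal (V := R_CompleteNormedModule) (fun r => Re (f r))) by (apply Ccont_ex_Re, Hf).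
    unfold plus, scal; simpl; unfold mult; simpl. ring.
Qed.

(** [Mn] does not depend on [r], so integrating over [r] in [0, 1] leaves it unchanged while each
    sum with step [1 - s] becomes an integral; the error is integrated in the same way, thanks to
    its majorant on the real axis. *)
Lemma averaged_bound s b A M K T0 N x c L n E (Mn : C) B : 0 < s < 1 -> 0 <= K -> T0 <= N -> 0 <= B ->
  (forall t, T0 <= t -> exists rho, Cmod rho <= K /\
  (Gam (s * t + (1 - b)) * rGamma (t + 1))%C =
  ((1 - s)%R * Rcpow (Rpower s s * Rpower (1 - s) (1 - s)) t *
   (csum M (fun j => A j * rGamma (((1 - s) * t)%R + (1 / 2 + b + INR j))) +
    rho * rGamma (((1 - s) * t)%R + (1 / 2 + b + INR M))))%C) ->
  ln x + ln (Rpower s s * Rpower (1 - s) (1 - s)) = (1 - s) * L ->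
  (forall u, (1 - s) * N <= u -> Cmod (pow_rGamma (1 / 2 + b + INR M) L u) <= Re (B * pow_rGamma (Re (1 / 2 + b + INR M)%C) L u)%C) ->
  (forall r, 0 <= r <= 1 ->
    Cmod (Mn - csum n (fun k => Rcpow x ((N + r)%R + INR k) * Gam (s * ((N + r)%R + INR k) + (1 - b)) * rGamma ((N + r)%R + 1 + INR k)))%C
    <= c + E) ->
  Cmod (Mn - csum M (fun j => A j * CI (pow_rGamma (1 / 2 + b + INR j) L) ((1 - s) * N) ((1 - s) * N + (1 - s) * INR n)))%C
  <= c + E + K * B * Re (CI (pow_rGamma (Re (1 / 2 + b + INR M)%C) L) ((1 - s) * N) ((1 - s) * N + (1 - s) * INR n)).
Proof.
  intros Hs HK HTN HB H Hx HM Hr.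
  set (S := fun r => csum M (fun j => A j * step_sum (1 - s) N (1 / 2 + b + INR j) L n r)%C).
  assert (HS : Ccont S).
  { apply (Ccont_csum M (fun j r => A j * step_sum (1 - s) N (1 / 2 + b + INR j) L n r)%C). intros j.
    apply Ccont_mult; [apply Ccont_const|apply Ccont_step_sum]. }
  assert (ES : CI S 0 1 = csum M (fun j => A j * CI (pow_rGamma (1 / 2 + b + INR j) L) ((1 - s) * N) ((1 - s) * N + (1 - s) * INR n))%C).
  { unfold S. rewrite (CI_csum M (fun j r => A j * step_sum (1 - s) N (1 / 2 + b + INR j) L n r)%C).
    - apply csum_ext. intros j _. rewrite CI_scal by apply Ccont_step_sum. f_equal. unfold step_sum.
      rewrite <- (CI_csum_steps (pow_rGamma (1 / 2 + b + INR j) L) (1 - s) N n) by apply Ccont_pow_rGamma. reflexivity.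
    - intros j. apply Ccont_mult; [apply Ccont_const|apply Ccont_step_sum]. }
  assert (EM : Mn = CI (fun _ => Mn) 0 1).
  { rewrite (CI_FTC (fun y => y * Mn)%C (fun _ => Mn)); [rewrite Cmult_0_l, Cmult_1_l; ring| |apply Ccont_const].
    eapply Cderiv_ext; [| |apply Cderiv_mult; [apply Cderiv_id|apply (Cderiv_const Mn)]]; intros; cbv beta; ring. }
  rewrite <- ES. rewrite EM. rewrite <- CI_minus by (auto; apply Ccont_const).
  set (T := step_sum (1 - s) N (Re (1 / 2 + b + INR M)%C) L n).
  assert (ET : CI T 0 1 = CI (pow_rGamma (Re (1 / 2 + b + INR M)%C) L) ((1 - s) * N) ((1 - s) * N + (1 - s) * INR n)).
  { unfold T, step_sum. apply CI_csum_steps. apply Ccont_pow_rGamma. }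
  rewrite <- ET.
  replace (c + E + K * B * Re (CI T 0 1)) with (RInt (fun r => (c + E) + (K * B) * Re (T r)) 0 1).
  2:{ rewrite RInt_cst_Re by apply Ccont_step_sum. match goal with |- @eq _ ?a ?b => change (@eq R a b) end. ring. }
  apply CI_bound; [lra|apply Ccont_minus; auto; apply Ccont_const| |].
  - intros y. apply (continuous_plus (V := R_NormedModule) (fun _ => c + E) (fun r => K * B * Re (T r))); [apply continuous_const|].
    apply (continuous_mult (K := R_AbsRing) (fun _ => K * B)); [apply continuous_const|]. apply (Ccont_step_sum _ _ _ _ _ y).
  - intros r Hr0. specialize (Hr r Hr0).
    pose proof (series_vs_coeffs s b A M K T0 N x L n r Hs HK HTN (proj1 Hr0) H Hx B HB HM) as HV.
    match type of Hr with Cmod (_ - ?m)%C <= _ => eapply Rle_trans; [apply (Cmod_dist_triangle Mn m)|] end.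
    apply Rplus_le_compat; [apply Hr|].
    apply Rle_trans with (1 := HV). right. unfold T. ring.
Qed.

Lemma Rcpow_INR X n : 0 < X -> Rcpow X (INR n) = (X ^ n)%C.
Proof. intros HX. rewrite Rcpow_RtoC, Rpower_pow, RtoC_pow by auto. reflexivity. Qed.

Lemma Rcpow_half X : 0 < X -> Rcpow X (1 / 2)%R = RtoC (sqrt X).
Proof.
  intros HX. rewrite Rcpow_RtoC. f_equal. replace (1 / 2) with (/ 2) by field. apply Rpower_sqrt; auto.
Qed.

Lemma Rcpow_mult_distr x y z : 0 < x -> 0 < y -> Rcpow (x * y) z = (Rcpow x z * Rcpow y z)%C.
Proof. intros. unfold Rcpow. rewrite ln_mult, RtoC_plus, <- Cexp_add by auto. f_equal. ring. Qed.

(** The averaged series is evaluated twice: Euler's integral and Laplace's method give the first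
    term, the inverse factorial expansion gives the sum over [j]. The three errors come from the
    former, from the remainder [rho], and from the powers of [X] left by [CI_pow_rGamma]. *)
Lemma coeffs_expansion_unscaled s b A M eta : 0 < s < 1 -> inverse_factorial_coeffs s b A -> (1 <= M)%nat -> 0 < eta <= 1 ->
  (forall w y, direction w -> Rabs y <= eta -> Re (w * w * Gs s (w * y)%C) <= - (y * y / 4)) ->
  exists K B N u c0 c1, 0 <= K /\ 0 <= B /\ 0 < c1 /\ forall X, 1 <= X -> c0 <= s * X / (1 - s) ->
  let c := s * X / (1 - s) in
  Cmod (Rcpow c (1 - b) * (exp X * laplace_int (Gs s) (fun z => Cexp ((1 - b) * z)) eta 1 (s * X)%R)
        - csum M (fun j => A j * (Rcpow X (1 / 2 - b - INR j) * exp X)))%C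
  <= Cmod (Rcpow c (1 - b)) * (B * exp ((N + 1) * ln (c / s)) * (exp (X - c1 * c) + 1))
     + K * (exp ((1 / 2 - Re b - INR M) * ln X) * exp X) + K * exp (u * ln X).
Proof.
  intros Hs HA HM Heta Hloc.
  destruct (coeffs_real_axis s b A M Hs HA HM) as (K & T0 & HK & HhA).
  set (d := (1 - b)%C) in *. set (k := 1 - s) in *. assert (Hk : 0 < k) by (unfold k; lra).
  (* Conditions on the first summation point: [1 <= N], validity of the expansion from [T0] on,
     convergence of Euler's integrals through [1 <= s * N + Re d], and [2 <= k * N + Re (be j)] for
     the integrals of 1/Gamma; the last one holds for all [j] because
     [Re (be j) >= 1 / 2 + Re b]. *)
  set (N := Rmax 1 (Rmax T0 (Rmax ((1 - Re d) / s) ((3 / 2 - Re b) / k)))).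
  assert (HN1 : 1 <= N) by apply Rmax_l.
  assert (HNr : Rmax T0 (Rmax ((1 - Re d) / s) ((3 / 2 - Re b) / k)) <= N) by apply Rmax_r.
  assert (HNT : T0 <= N) by (eapply Rle_trans; [apply Rmax_l|apply HNr]).
  assert (HNr2 : Rmax ((1 - Re d) / s) ((3 / 2 - Re b) / k) <= N) by (eapply Rle_trans; [apply Rmax_r|apply HNr]).
  assert (HNd : 1 <= s * N + Re d).
  { assert ((1 - Re d) / s <= N) by (eapply Rle_trans; [apply Rmax_l|apply HNr2]).
    assert (s * ((1 - Re d) / s) <= s * N) by (apply Rmult_le_compat_l; lra).
    replace (s * ((1 - Re d) / s)) with (1 - Re d) in H0 by (field; lra). lra. }
  assert (HNk : 3 / 2 <= k * N + Re b).
  { assert ((3 / 2 - Re b) / k <= N) by (eapply Rle_trans; [apply Rmax_r|apply HNr2]).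
    assert (k * ((3 / 2 - Re b) / k) <= k * N) by (apply Rmult_le_compat_l; lra).
    replace (k * ((3 / 2 - Re b) / k)) with (3 / 2 - Re b) in H0 by (field; lra). lra. }
  clearbody N. clear HNr HNr2.
  set (be := fun j => (1 / 2 + b + INR j)%C).
  assert (HRb : forall j, Re (be j) = 1 / 2 + Re b + INR j).
  { intros j. unfold be. rewrite <- RtoC_div by lra. repeat progress Csimpl. ring. }
  assert (HbN : forall j, 2 <= k * N + Re (be j)). { intros j. rewrite HRb. pose proof (pos_INR j). lra. }
  destruct (frac_exp_integral_laplace s d N eta Hs HN1 HNd Heta Hloc) as (B & c0 & c1 & HB & Hc1 & Hmain).
  destruct (rGamma_segment_bound (N + 1)) as (B2 & HB2 & Hg2).
  destruct (pow_rGamma_vertical (be M)) as (Bv & HBv & Hvert).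
  destruct (CI_pow_rGamma_all M be (k * N) HbN) as (BV & HBV & HV).
  destruct (CI_pow_rGamma (RtoC (Re (be M))) (k * N)) as (BV2 & HBV2 & HV2); [rewrite Re_RtoC; apply HbN|].
  set (SA := Re (csum M (fun j => RtoC (Cmod (A j))))).
  assert (HSA0 : 0 <= SA).
  { unfold SA. clear. induction M; cbn [csum]; [rewrite Re_RtoC; lra|]. rewrite Re_plus, Re_RtoC. pose proof (Cmod_ge_0 (A M)). lra. }
  exists (K * Bv + (K * Bv * BV2 + SA * BV)), B, N, (k * N + 1), (Rmax c0 1), c1.
  assert (HKB : 0 <= K * Bv) by nra. assert (HKB2 : 0 <= K * Bv * BV2) by nra. assert (HSB : 0 <= SA * BV) by nra.
  split; [lra|]. split; [auto|]. split; [auto|].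
  intros X HX Hc0 c. assert (Hcc0 : c0 <= c) by (apply Rle_trans with (2 := Hc0), Rmax_l).
  assert (Hc1' : 1 <= c) by (apply Rle_trans with (2 := Hc0), Rmax_r).
  set (L := ln X). assert (HL : 0 <= L) by (unfold L; rewrite <- ln_1; apply Rcomplements.ln_le; lra).
  assert (EL : exp L = X) by (apply exp_ln; lra).
  (* [x = c^k / s] is the value for which [c] is the saddle point. Equivalently [x s^s k^k = X^k],
     which is [Hx2], so that the powers of [x] and those in the inverse factorial expansion combine
     to powers of [X]. *)
  set (q := ln (c / s)). set (x := exp (k * ln c - ln s)).
  assert (Hlnx : ln x = k * ln c - ln s) by apply ln_exp.
  assert (Eq : q = ln c - ln s) by (unfold q; rewrite ln_div; lra).
  assert (Hx1 : ln x + s * ln c = q) by (rewrite Hlnx, Eq; unfold k; ring).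
  assert (ELc : L = ln c - ln s + ln k).
  { unfold L. replace X with (c / s * k) by (unfold c; fold k; field; lra).
    rewrite ln_mult, ln_div; try lra. apply Rdiv_lt_0_compat; lra. }
  assert (Hx2 : ln x + ln (Rpower s s * Rpower k k) = k * L).
  { rewrite ln_mult by apply exp_pos. unfold Rpower. rewrite !ln_exp, Hlnx, ELc. unfold k. ring. }
  set (J := laplace_int (Gs s) (fun z => Cexp (d * z)) eta 1 (s * X)).
  assert (EcX : k * c / s = X) by (unfold c; fold k; field; lra).
  assert (EcY : k * c = s * X) by (unfold c; fold k; field; lra).
  set (Mn := (Rcpow c d * (exp X * J))%C). set (R := Cmod (Rcpow c d)).
  assert (HR : 0 <= R) by apply Cmod_ge_0.
  set (E1 := B * exp ((N + 1) * q) * (exp (X - c1 * c) + 1)).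
  set (e := fun n => Re (IntR (fun t => RtoC (tail_majorant s d c q N B2 n t)))).
  assert (He : is_lim_seq e 0) by (apply tail_majorant_lim; auto; lra).
  assert (Hstep : forall n r, 0 <= r <= 1 ->
    Cmod (Mn - csum n (fun k => Rcpow x ((N + r)%R + INR k) * Gam (s * ((N + r)%R + INR k) + (1 - b)) * rGamma ((N + r)%R + 1 + INR k)))%C
    <= R * E1 + R * e n).
  { intros n r Hr. fold d.
    destruct (csum_Gam_rGamma_IntR s d c x q (RtoC (N + r)) n) as [HdS ES]; try lra.
    { rewrite Re_RtoC. nra. }
    rewrite ES. unfold Mn. rewrite <- Rmult_plus_distr_l.
    match goal with |- Cmod (?a * ?b - ?a * ?d)%C <= _ => replace (a * b - a * d)%C with (a * (b - d))%C by ring end.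
    rewrite Cmod_mult. fold R. apply Rmult_le_compat_l; auto.
    specialize (Hmain c r Hcc0 Hr). fold k in Hmain. rewrite EcX, EcY in Hmain. fold q J E1 in Hmain.
    eapply Rle_trans; [apply (Cmod_dist_triangle _ (IntR (frac_exp_integrand s d c q (N + r)%R)))|].
    apply Rplus_le_compat; [rewrite Cmod_minus_sym; exact Hmain|].
    apply (frac_exp_integrand_tail s d c q N B2 r n); auto; lra. }
  assert (Hav : forall n, Cmod (Mn - csum M (fun j => A j * CI (pow_rGamma (be j) L) (k * N) (k * N + k * INR n)))%C
     <= R * E1 + R * e n + K * Bv * Re (CI (pow_rGamma (Re (be M)) L) (k * N) (k * N + k * INR n))).
  { intros n. apply (averaged_bound s b A M K T0 N x (R * E1) L n (R * e n) Mn Bv); auto.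
    intros u Hu. apply Hvert. specialize (HbN M). fold k in Hu. lra. }
  set (P := exp ((1 / 2 - Re b - INR M) * L) * exp X). set (Q := exp ((k * N + 1) * L)).
  replace (csum M (fun j => A j * (Rcpow X (1 / 2 - b - INR j) * exp X))%C)
    with (csum M (fun j => A j * (Cexp ((1 - be j) * L) * exp (exp L)))%C).
  2:{ apply csum_ext. intros j _. rewrite EL. f_equal. f_equal. unfold Rcpow. fold L. f_equal. f_equal. unfold be. field. }
  apply Rle_trans with (R * E1 + K * Bv * (P + BV2 * Q) + SA * (BV * Q)).
  2:{ fold L P Q q E1 R. 
      assert (HP : 0 < P) by (unfold P; apply Rmult_lt_0_compat; apply exp_pos). assert (HQ : 0 < Q) by apply exp_pos.
      assert (0 <= K * Bv * Q) by (apply Rmult_le_pos; lra).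
      assert (0 <= (K * Bv * BV2 + SA * BV) * P) by (apply Rmult_le_pos; lra). lra. }
  (* At fixed [X] the number [n] of terms is now taken large: each of the three truncation errors is
     at most [eps], with these weights. *)
  apply (le_eps_scaled _ _ (R + K * Bv + SA)); [lra|]. intros eps Heps.
  destruct (pow_rGamma_near_sum M A be (k * N) k BV L HBV Hk (fun j Hj => HV j Hj L HL)) as (SA' & _ & ESA & HSum).
  fold SA in ESA. subst SA'.
  destruct (HSum eps Heps) as [N1 HN1'].
  destruct (HV2 L HL eps Heps) as [U0 HU0].
  apply is_lim_seq_spec in He. destruct (He (mkposreal _ Heps)) as [N2 HN2]. simpl in HN2.
  destruct (nfloor_ex (Rmax 0 (U0 / k)) (Rmax_l _ _)) as [m [_ Hm]].
  set (n := (N1 + N2 + S m)%nat).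
  specialize (HN1' n ltac:(lia)). specialize (HN2 n ltac:(lia)). rewrite Rminus_0_r in HN2.
  assert (HU : U0 <= k * INR n).
  { assert (Hn2 : (S m <= n)%nat) by lia. apply le_INR in Hn2. rewrite S_INR in Hn2.
    pose proof (Rmax_r 0 (U0 / k)). replace U0 with (k * (U0 / k)) by (field; lra). apply Rmult_le_compat_l; lra. }
  specialize (HU0 _ HU). specialize (Hav n).
  assert (HCI : Re (CI (pow_rGamma (Re (be M)) L) (k * N) (k * N + k * INR n)) <= P + BV2 * Q + eps).
  { apply Rle_trans with (1 := Cmod_ge_Re _).
    eapply Rle_trans; [apply (Cmod_triangle_sub _ (Cexp ((1 - Re (be M)) * L) * exp (exp L))%C)|].
    assert (EP : Cmod (Cexp ((1 - Re (be M)) * L) * exp (exp L)) = P).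
    { rewrite Cmod_mult, Cmod_Cexp, Cmod_R, Rabs_pos_eq, EL by (left; apply exp_pos). unfold P. f_equal. f_equal.
      rewrite <- RtoC_minus, <- RtoC_mult, Re_RtoC, HRb. f_equal. field. }
    rewrite EP. fold Q in HU0. lra. }
  assert (HeN : e n <= eps) by (pose proof (Rle_abs (e n)); lra).
  eapply Rle_trans; [apply (Cmod_dist_triangle _ (csum M (fun j => A j * CI (pow_rGamma (be j) L) (k * N) (k * N + k * INR n))%C))|].
  fold Q in HN1'.
  assert (K * Bv * Re (CI (pow_rGamma (Re (be M)) L) (k * N) (k * N + k * INR n)) <= K * Bv * (P + BV2 * Q + eps)) by (apply Rmult_le_compat_l; auto).
  assert (R * e n <= R * eps) by (apply Rmult_le_compat_l; auto).
  lra.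
Qed.

(** Division by [X^(1/2 - b) exp X] leaves errors that are exponentially small or of order
    [X^(- M)]. *)
Lemma coeffs_expansion s b A M eta : 0 < s < 1 -> inverse_factorial_coeffs s b A -> (1 <= M)%nat -> 0 < eta <= 1 ->
  (forall w y, direction w -> Rabs y <= eta -> Re (w * w * Gs s (w * y)%C) <= - (y * y / 4)) ->
  exists K X0, forall X, X0 <= X -> 1 <= X ->
  Cmod (Rcpow (s / (1 - s)) (1 - b) * sqrt X * laplace_int (Gs s) (fun z => Cexp ((1 - b) * z)) eta 1 (s * X)%R
    - csum M (fun j => A j * / X ^ j))%C <= K * / X ^ M.
Proof.
  intros Hs HA HM Heta Hloc.
  destruct (coeffs_expansion_unscaled s b A M eta Hs HA HM Heta Hloc) as (K & B & N & u & c0 & c1 & HK & HB & Hc1 & H).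
  set (k := 1 - s) in *. assert (Hk : 0 < k) by (unfold k; lra).
  assert (Hsk : 0 < s / k) by (apply Rdiv_lt_0_compat; lra).
  (* The power of [X] in the first error after the division: from [Rcpow c (1 - b)], from
     [(c / s)^(N + 1)], and from the divisor. *)
  set (p := Re (1 - b)%C + (N + 1) - (1 / 2 - Re b)).
  destruct (poly_exp_bound p (c1 * (s / k)) M) as (K1 & HK1 & H1); [apply Rmult_lt_0_compat; auto|].
  destruct (poly_exp_bound p 1 M) as (K2 & HK2 & H2); [lra|].
  destruct (poly_exp_bound (u - (1 / 2 - Re b)) 1 M) as (K3 & HK3 & H3); [lra|].
  set (C0 := B * exp (Re (1 - b)%C * ln (s / k) - (N + 1) * ln k)).
  assert (HC0 : 0 <= C0) by (apply Rmult_le_pos; auto; left; apply exp_pos).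
  exists (C0 * (K1 + K2) + K + K * K3), (c0 / (s / k)). intros X HX0 HX.
  set (c := s * X / k). assert (Ec : c = s / k * X) by (unfold c; field; lra).
  assert (Hcc : c0 <= c).
  { rewrite Ec. replace c0 with (s / k * (c0 / (s / k))) by (field; lra). apply Rmult_le_compat_l; lra. }
  specialize (H X HX Hcc). cbv zeta in H. fold c in H.
  set (L := ln X) in *. set (J := laplace_int (Gs s) (fun z => Cexp ((1 - b) * z)) eta 1 (s * X)) in *.
  set (w := (Rcpow X (- (1 / 2 - b)) * exp (- X))%C).
  assert (Hw : Cmod w = exp (- (1 / 2 - Re b) * L) * exp (- X)).
  { unfold w. rewrite Cmod_mult, Cmod_Rcpow, Cmod_R, Rabs_pos_eq by (left; apply exp_pos). f_equal.
    unfold Rpower. fold L. f_equal. f_equal. rewrite <- RtoC_div by lra. repeat progress Csimpl. ring. }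
  assert (Hcpos : 0 < c) by (rewrite Ec; apply Rmult_lt_0_compat; lra).
  assert (Elnc : ln c = ln (s / k) + L) by (rewrite Ec; apply ln_mult; lra).
  assert (Eq : ln (c / s) = L - ln k).
  { replace (c / s) with (X / k) by (unfold c; field; lra). apply ln_div; lra. }
  assert (EXX : (RtoC (exp X) * RtoC (exp (- X)) = 1)%C).
  { rewrite <- RtoC_mult, <- exp_plus. replace (X + - X) with 0 by ring. now rewrite exp_0. }
  assert (EU : (w * (Rcpow c (1 - b) * (exp X * J)) = Rcpow (s / k) (1 - b) * sqrt X * J)%C).
  { unfold w. rewrite Ec, Rcpow_mult_distr by lra.
    transitivity (Rcpow (s / k) (1 - b) * (Rcpow X (1 - b) * Rcpow X (- (1 / 2 - b))) * J * (exp X * exp (- X)))%C; [ring|].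
    rewrite EXX, <- Rcpow_add.
    replace (1 - b + - (1 / 2 - b))%C with (RtoC (1 / 2)) by (rewrite RtoC_div by lra; field).
    rewrite Rcpow_half by lra. ring. }
  assert (EV : (w * csum M (fun j => A j * (Rcpow X (1 / 2 - b - INR j) * exp X)) = csum M (fun j => A j * / X ^ j))%C).
  { rewrite <- csum_scal. apply csum_ext. intros j _. unfold w.
    transitivity (A j * (Rcpow X (1 / 2 - b - INR j) * Rcpow X (- (1 / 2 - b))) * (exp X * exp (- X)))%C; [ring|].
    rewrite EXX, <- Rcpow_add. replace (1 / 2 - b - INR j + - (1 / 2 - b))%C with (- INR j)%C by ring.
    rewrite Rcpow_opp, Rcpow_INR by lra. ring. }
  rewrite <- EU, <- EV.
  match goal with |- Cmod (w * ?a - w * ?d)%C <= _ => replace (w * a - w * d)%C with (w * (a - d))%C by ring end.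
  rewrite Cmod_mult.
  eapply Rle_trans; [apply Rmult_le_compat_l; [apply Cmod_ge_0|apply H]|].
  rewrite Hw, Cmod_Rcpow. unfold Rpower. rewrite Elnc, Eq.
  set (W := exp (- (1 / 2 - Re b) * L) * exp (- X)).
  match goal with |- W * (?t1 + ?t2 + ?t3) <= _ => replace (W * (t1 + t2 + t3)) with (W * t1 + W * t2 + W * t3) by ring end.
  replace ((C0 * (K1 + K2) + K + K * K3) * / X ^ M)
    with (C0 * (K1 + K2) * / X ^ M + K * / X ^ M + K * K3 * / X ^ M) by ring.
  apply Rplus_le_compat; [apply Rplus_le_compat|].
  - specialize (H1 X HX). specialize (H2 X HX). fold L in H1, H2.
    replace (W * (exp (Re (1 - b) * (ln (s / k) + L)) * (B * exp ((N + 1) * (L - ln k)) * (exp (X - c1 * c) + 1))))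
      with (C0 * (exp (p * L) * exp (- (c1 * (s / k)) * X) + exp (p * L) * exp (- (1) * X))).
    + apply Rle_trans with (C0 * (K1 * / X ^ M + K2 * / X ^ M)); [apply Rmult_le_compat_l; lra|right; ring].
    + unfold W, C0.
      transitivity (B * ((exp (Re (1 - b)%C * ln (s / k) - (N + 1) * ln k) * exp (p * L)) * (exp (- (c1 * (s / k)) * X) + exp (- (1) * X)))); [ring|].
      transitivity (B * ((exp (- (1 / 2 - Re b) * L) * exp (Re (1 - b)%C * (ln (s / k) + L)) * exp ((N + 1) * (L - ln k)))
         * (exp (- X) * exp (X - c1 * c) + exp (- X)))); [|ring].
      rewrite <- !exp_plus. f_equal. f_equal.
      * f_equal. unfold p. ring.
      * f_equal; f_equal; [rewrite Ec|]; ring.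
  - replace (W * (K * (exp ((1 / 2 - Re b - INR M) * L) * exp X)))
      with (K * ((exp (- (1 / 2 - Re b) * L) * exp ((1 / 2 - Re b - INR M) * L)) * (exp (- X) * exp X))) by (unfold W; ring).
    rewrite <- !exp_plus.
    replace (- (1 / 2 - Re b) * L + (1 / 2 - Re b - INR M) * L + (- X + X)) with (- (INR M * L)) by ring.
    rewrite exp_Ropp, exp_INR_mult. unfold L. rewrite exp_ln by lra. lra.
  - specialize (H3 X HX). fold L in H3.
    replace (W * (K * exp (u * L))) with (K * (exp ((u - (1 / 2 - Re b)) * L) * exp (- (1) * X))).
    + rewrite Rmult_assoc. apply Rmult_le_compat_l; auto.
    + unfold W. replace (exp ((u - (1 / 2 - Re b)) * L)) with (exp (- (1 / 2 - Re b) * L) * exp (u * L)) by (rewrite <- exp_plus; f_equal; ring).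
      replace (- (1) * X) with (- X) by ring. ring.
Qed.

(** * Asymptotics of the Wright function *)

Lemma RtoC_sqrt_neq_0 s : 0 < s -> RtoC (sqrt s) <> 0%C.
Proof. intros Hs E. apply RtoC_inj in E. pose proof (sqrt_lt_R0 s Hs). lra. Qed.

Lemma csum_rescale M (D : nat -> C) s X : s <> 0 -> X <> 0 ->
  csum M (fun j => D j * / (s * X)%R ^ j)%C = csum M (fun j => D j / s ^ j * / X ^ j)%C.
Proof.
  intros Hs HX. apply csum_ext. intros j _.
  assert (RtoC s ^ j <> 0)%C by (apply Cpow_nz; intros E; apply RtoC_inj in E; lra).
  assert (RtoC X ^ j <> 0)%C by (apply Cpow_nz; intros E; apply RtoC_inj in E; lra).
  rewrite RtoC_mult, Cpow_mult_l. field; auto.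
Qed.

(** The integral along the real axis has two expansions, one in [X] with coefficients [A j], the
    other in the large parameter [s * X] with coefficients [D j]; the change of parameter accounts
    for [s ^ j] and [sqrt s]. *)
Lemma coeffs_match s b A M eta D B : 0 < s < 1 -> inverse_factorial_coeffs s b A -> (1 <= M)%nat -> 0 < eta <= 1 ->
  (forall w y, direction w -> Rabs y <= eta -> Re (w * w * Gs s (w * y)%C) <= - (y * y / 4)) ->
  (forall X, 1 <= X -> Cmod (sqrt X * laplace_int (Gs s) (fun z => Cexp ((1 - b) * z)) eta 1 X
     - csum M (fun j => D j * / X ^ j))%C <= B * / X ^ M) ->
  forall j, (j < M)%nat -> A j = (Rcpow (s / (1 - s)) (1 - b) / sqrt s * (D j / s ^ j))%C.
Proof.
  intros Hs HA HM Heta Hloc HJ.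
  destruct (coeffs_expansion s b A M eta Hs HA HM Heta Hloc) as (K & X0 & HE).
  pose proof (RtoC_sqrt_neq_0 s ltac:(lra)) as Hss.
  set (Cd := (Rcpow (s / (1 - s)) (1 - b) / sqrt s)%C).
  assert (HU := asymptotic_unique M (fun j => A j - Cd * (D j / s ^ j))%C (K + Cmod Cd * (B / s ^ M)) (Rmax X0 (/ s))).
  intros j Hj. cut (A j - Cd * (D j / s ^ j) = 0)%C.
  { intros E. replace (A j) with ((A j - Cd * (D j / s ^ j)) + Cd * (D j / s ^ j))%C by ring. rewrite E. ring. }
  revert j Hj. apply HU. clear HU. intros X HX0 HX.
  assert (HX1 : X0 <= X) by (eapply Rle_trans; [apply Rmax_l|exact HX0]).
  assert (HX2 : / s <= X) by (eapply Rle_trans; [apply Rmax_r|exact HX0]).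
  assert (HY : 1 <= s * X). { replace 1 with (s * / s) by (field; lra). apply Rmult_le_compat_l; lra. }
  specialize (HE X HX1 HX). specialize (HJ _ HY). rewrite csum_rescale in HJ by lra.
  set (J := laplace_int (Gs s) (fun z => Cexp ((1 - b) * z)) eta 1 (s * X)) in *.
  assert (EF : (Rcpow (s / (1 - s)) (1 - b) * sqrt X * J = Cd * (sqrt (s * X) * J))%C).
  { rewrite sqrt_mult, RtoC_mult by lra. unfold Cd. field. auto. }
  rewrite EF in HE.
  set (S1 := csum M (fun j => A j * / X ^ j)%C) in *. set (S2 := csum M (fun j => D j / s ^ j * / X ^ j)%C) in *.
  replace (csum M (fun j => (A j - Cd * (D j / s ^ j)) * / X ^ j)%C) with (S1 - Cd * S2)%C.
  2:{ unfold S1, S2. rewrite <- csum_scal. 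
      replace (csum M (fun j => A j * / X ^ j)%C - csum M (fun i => Cd * (D i / s ^ i * / X ^ i))%C)%C
       with (csum M (fun j => A j * / X ^ j)%C + (- (1)) * csum M (fun i => Cd * (D i / s ^ i * / X ^ i))%C)%C by ring.
      rewrite <- csum_scal, <- csum_plus. apply csum_ext. intros j _. ring. }
  replace (S1 - Cd * S2)%C with (- (Cd * (sqrt (s * X) * J) - S1) + Cd * (sqrt (s * X) * J - S2))%C by ring.
  eapply Rle_trans; [apply Cmod_triangle|]. rewrite Cmod_opp, Cmod_mult, Rmult_plus_distr_r.
  apply Rplus_le_compat; auto. rewrite Rmult_assoc. apply Rmult_le_compat_l; [apply Cmod_ge_0|].
  eapply Rle_trans; [exact HJ|]. right. rewrite Rpow_mult_distr. field. split; apply pow_nonzero; lra.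
Qed.

(** The factor in front of the sum is the one of [coeffs_match]; with the coefficients [D j] of the
    imaginary direction the sum therefore reproduces the [A j] up to sign. *)
Lemma Psi_expansion s b M eta D B : 0 < s < 1 -> 0 < eta <= 1 ->
  (forall w y, direction w -> Rabs y <= eta -> Re (w * w * Gs s (w * y)%C) <= - (y * y / 4)) ->
  (forall X, 1 <= X -> Cmod (sqrt X * laplace_int (Gs s) (fun z => Cexp ((1 - b) * z)) eta Ci X
     - csum M (fun j => D j * / X ^ j))%C <= B * / X ^ M) ->
  exists K X0, forall X x, X0 <= X -> x * Rpower (s * X / (1 - s)) s = X / (1 - s) ->
  Cmod (Psi01 (- s) b (RtoC (- x)) * (2 * PI) / (Rcpow X (RtoC (1 / 2) - b) * exp (- X))
     - Rcpow (s / (1 - s)) (1 - b) / sqrt s * csum M (fun j => D j / s ^ j * / X ^ j))%C <= K * / X ^ M.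
Proof.
  intros Hs Heta Hloc HJ.
  destruct (Gs_HU s (1 - b)%C eta Hs Heta Hloc) as (c1 & B1 & Y0 & Hc1 & HB1 & HH).
  pose proof (RtoC_sqrt_neq_0 s ltac:(lra)) as Hss.
  destruct (poly_exp_bound (1 / 2) (c1 * s) M) as (K1 & HK1 & Hexp); [apply Rmult_lt_0_compat; lra|].
  set (Cd := (Rcpow (s / (1 - s)) (1 - b) / sqrt s)%C).
  set (R1 := Rcpow (s / (1 - s)) (1 - b)).
  (* The thresholds ensure in turn [1 <= X], [Y0 <= s * X], [1 <= s * X] and [1 <= c]. *)
  exists (Cmod R1 * (B1 * K1) + Cmod Cd * (B / s ^ M)), (Rmax (Rmax 1 (Y0 / s)) (Rmax (/ s) ((1 - s) / s))).
  intros X x HX0 Hx. set (k := 1 - s) in *. assert (Hk : 0 < k) by (unfold k; lra).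
  pose proof (Rmax_l (Rmax 1 (Y0 / s)) (Rmax (/ s) (k / s))). pose proof (Rmax_r (Rmax 1 (Y0 / s)) (Rmax (/ s) (k / s))).
  pose proof (Rmax_l 1 (Y0 / s)). pose proof (Rmax_r 1 (Y0 / s)).
  pose proof (Rmax_l (/ s) (k / s)). pose proof (Rmax_r (/ s) (k / s)).
  assert (HX : 1 <= X) by lra.
  assert (HY : 1 <= s * X). { replace 1 with (s * / s) by (field; lra). apply Rmult_le_compat_l; lra. }
  assert (HYY : Y0 <= s * X). { replace Y0 with (s * (Y0 / s)) by (field; lra). apply Rmult_le_compat_l; lra. }
  set (c := s * X / k) in *.
  assert (Hc : 1 <= c). { unfold c. replace 1 with (s * (k / s) / k) by (field; lra).
    unfold Rdiv at 1 3. apply Rmult_le_compat_r; [left; apply Rinv_0_lt_compat; auto|]. apply Rmult_le_compat_l; lra. }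
  rewrite (Psi_saddle s b c x Hs Hc) by (rewrite Hx; unfold c; field; lra).
  fold k. replace (k * c / s) with X by (unfold c; field; lra). replace (k * c) with (s * X) by (unfold c; field; lra).
  destruct (HH _ HYY) as [_ HH1]. specialize (HJ _ HY). rewrite csum_rescale in HJ by lra.
  set (Q := HU (psis s) (saddle_fun (Gs s) (1 - b) (s * X))) in *.
  set (J := laplace_int (Gs s) (fun z => Cexp ((1 - b) * z)) eta Ci (s * X)) in *.
  set (S2 := csum M (fun j => D j / s ^ j * / X ^ j)%C) in *.
  assert (Ec : Rcpow c (1 - b) = (R1 * (Rcpow X (RtoC (1 / 2) - b) * sqrt X))%C).
  { replace c with (s / k * X) by (unfold c; field; lra).
    rewrite Rcpow_mult_distr by (try apply Rdiv_lt_0_compat; lra). fold R1. f_equal.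
    rewrite <- Rcpow_half, <- Rcpow_add by lra. f_equal. rewrite RtoC_div by lra. field. }
  assert (Hsp : (2 * PI * Ci)%C <> 0%C) by apply C_2PI_neq_0.
  assert (HCi : Ci <> 0%C) by (intros E; apply Hsp; rewrite E; ring).
  assert (HPI : RtoC PI <> 0%C) by (intros E; apply Hsp; rewrite E; ring).
  assert (HeX : RtoC (exp (- X)) <> 0%C) by (intros E; apply RtoC_inj in E; pose proof (exp_pos (- X)); lra).
  pose proof (Rcpow_neq_0 X (RtoC (1 / 2) - b)%C) as HRX.
  replace (Rcpow c (1 - b) * exp (- X) / (2 * PI * Ci) * Q * (2 * PI) / (Rcpow X (RtoC (1 / 2) - b) * exp (- X)) - Cd * S2)%C
    with (R1 * (sqrt X * ((Q - Ci * J) * / Ci)) + Cd * (sqrt (s * X) * J - S2))%C.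
  2:{ rewrite Ec, sqrt_mult, RtoC_mult by lra. unfold Cd. fold k. fold R1. field. auto. }
  eapply Rle_trans; [apply Cmod_triangle|]. rewrite !Cmod_mult, Rmult_plus_distr_r.
  apply Rplus_le_compat; rewrite Rmult_assoc; (apply Rmult_le_compat_l; [apply Cmod_ge_0|]).
  - rewrite Cmod_inv, Cmod_Ci, Rinv_1, Rmult_1_r, Cmod_R, Rabs_pos_eq by (try apply sqrt_pos; auto).
    specialize (Hexp X HX).
    replace (sqrt X) with (exp (1 / 2 * ln X)).
    2:{ rewrite <- Rpower_sqrt by lra. unfold Rpower. f_equal. field. }
    apply Rle_trans with (exp (1 / 2 * ln X) * (B1 * exp (- c1 * (s * X)))).
    { apply Rmult_le_compat_l; [left; apply exp_pos|exact HH1]. }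
    replace (- c1 * (s * X)) with (- (c1 * s) * X) by ring.
    apply Rle_trans with (B1 * (K1 * / X ^ M)); [|right; ring].
    replace (exp (1 / 2 * ln X) * (B1 * exp (- (c1 * s) * X))) with (B1 * (exp (1 / 2 * ln X) * exp (- (c1 * s) * X))) by ring.
    apply Rmult_le_compat_l; auto.
  - eapply Rle_trans; [exact HJ|]. right. rewrite Rpow_mult_distr. field. split; apply pow_nonzero; lra.
Qed.

(** This is the saddle equation [x c^s = c / s] for [c = s X / (1 - s)]; taking logarithms makes it
    linear. *)
Lemma saddle_scale s x : 0 < s < 1 -> 0 < x ->
  let X := (1 - s) * Rpower (Rpower s s * x) (1 / (1 - s)) in
  x * Rpower (s * X / (1 - s)) s = X / (1 - s).
Proof.
  intros Hs Hx X. set (y := Rpower (Rpower s s * x) (1 / (1 - s))).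
  assert (Hy : 0 < y) by apply exp_pos. assert (Hh : 0 < Rpower s s) by apply exp_pos.
  replace (s * X / (1 - s)) with (s * y) by (unfold X, y; field; lra).
  replace (X / (1 - s)) with y by (unfold X, y; field; lra).
  apply ln_inv; auto. { apply Rmult_lt_0_compat; auto; apply exp_pos. }
  assert (Ey : ln y = 1 / (1 - s) * (s * ln s + ln x)).
  { unfold y, Rpower at 1. rewrite ln_exp, ln_mult by auto. unfold Rpower. now rewrite ln_exp. }
  rewrite ln_mult by (auto; apply exp_pos). unfold Rpower. rewrite ln_exp, ln_mult by lra. rewrite Ey. field. lra.
Qed.

Lemma scale_unbounded s X0 : 0 < s < 1 -> exists x0, 0 < x0 /\ forall x, x0 < x ->
  X0 <= (1 - s) * Rpower (Rpower s s * x) (1 / (1 - s)).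
Proof.
  intros Hs. set (h := Rpower s s). assert (Hh : 0 < h) by apply exp_pos.
  set (u := (Rabs X0 + 1) / (1 - s)). pose proof (Rabs_pos X0). pose proof (Rle_abs X0).
  assert (Hu : 0 < u) by (apply Rdiv_lt_0_compat; lra).
  exists (Rpower u (1 - s) / h). split; [apply Rdiv_lt_0_compat; auto; apply exp_pos|].
  intros x Hx. assert (Hux : Rpower u (1 - s) <= h * x).
  { replace (Rpower u (1 - s)) with (h * (Rpower u (1 - s) / h)) by (field; lra). apply Rmult_le_compat_l; lra. }
  apply Rle_trans with ((1 - s) * u); [unfold u; replace ((1 - s) * ((Rabs X0 + 1) / (1 - s))) with (Rabs X0 + 1) by (field; lra); lra|].
  apply Rmult_le_compat_l; [lra|].
  replace u with (Rpower (Rpower u (1 - s)) (1 / (1 - s))).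
  - apply Rle_Rpower_l; [left; apply Rdiv_lt_0_compat; lra|]. split; [apply exp_pos|auto].
  - rewrite Rpower_mult. replace ((1 - s) * (1 / (1 - s))) with 1 by (field; lra). now apply Rpower_1.
Qed.

Theorem theorem6 (sigma : R) (hsigma : 0 < sigma < 1) (b : C) (A : nat -> C)
    (hA : inverse_factorial_coeffs sigma b A) (M : nat) (hM : (1 <= M)%nat) :
  let theta := (RtoC (1 / 2) - b)%C in
  let kappa := 1 - sigma in
  let h := Rpower sigma sigma in
  let X := fun x : R => kappa * Rpower (h * x) (1 / kappa) in
  A 0%nat = (RtoC (sqrt (2 * PI / kappa)) * Rcpow (sigma / kappa) theta)%C /\
  exists (r : R -> C) (K : R),
    Rbar_locally p_infty (fun x : R =>
      Psi01 (- sigma) b (RtoC (- x)) =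
        (Rcpow (X x) theta * RtoC (exp (- X x)) / RtoC (2 * PI) *
         (sum_n (fun j => RtoC ((-1) ^ j) * A j * RtoC (/ X x ^ j)) (M - 1) + r x))%C
      /\ Cmod (r x) <= K * / X x ^ M).
Proof.
  intros theta kappa h X.
  assert (Hk : 0 < kappa) by (unfold kappa; lra). pose proof PI_RGT_0 as HPI.
  destruct (laplace_local (Gs sigma)
    (fun z => / (1 - sigma) * (sigma * sigma * exp_tail 3 (sigma * z) + - (1) * exp_tail 3 (1 * z)))%C) as (eta & Heta & HG).
  { apply continuous_along_0, continuous_along_Gs. }
  { intros z _. now apply Gs_taylor. }
  { intros K. apply jet_scal, jet_plus; apply jet_scal, jet_exp_tail. }
  destruct (HG eta ltac:(lra)) as [Hloc HJ]. clear HG.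
  (* One family [D] for both directions: it is compared with [A] at [w = 1] and with Psi at
     [w = Ci]. *)
  destruct (HJ (fun z => Cexp ((1 - b) * z))) with (M := M) as (D & B & _ & HD0 & HD); auto.
  { intros v; apply (continuous_along_0 _ (continuous_along_Cexp _) v). } { intros; apply jet_Cexp. }
  assert (Hmatch := coeffs_match sigma b A M eta D B hsigma hA hM Heta Hloc).
  assert (HA : forall j, (j < M)%nat -> A j = (Rcpow (sigma / kappa) (1 - b) / sqrt sigma * (D j / sigma ^ j))%C).
  { apply Hmatch. intros Y HY. specialize (HD (RtoC 1) Y (or_introl eq_refl) HY).
    erewrite csum_ext; [exact HD|]. intros j _. cbv beta. rewrite Cmult_1_l, Cpow_1_l. ring. }
  clear Hmatch. split.
  (* [D 0] is [sqrt (2 PI)], and [(sigma / kappa)^(theta + 1/2) / sqrt sigma] is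
     [(sigma / kappa)^theta / sqrt kappa]. *)
  - rewrite (HA 0%nat) by lia. rewrite HD0, Cmult_0_r, Cexp_0.
    replace (1 - b)%C with (theta + RtoC (1 / 2))%C by (unfold theta; rewrite RtoC_div by lra; field).
    assert (0 < sigma / kappa) by (apply Rdiv_lt_0_compat; lra).
    rewrite Rcpow_add, Rcpow_half by auto.
    rewrite !sqrt_div_alt, !RtoC_div by (auto; try apply Rgt_not_eq, sqrt_lt_R0; lra).
    pose proof (RtoC_sqrt_neq_0 sigma ltac:(lra)). pose proof (RtoC_sqrt_neq_0 kappa Hk).
    simpl Cpow. field. auto.
  (* Along [Ci] the coefficients carry the sign [(Ci * Ci) ^ j = (-1) ^ j]. *)
  - destruct (Psi_expansion sigma b M eta (fun j => (-1) ^ j * D j)%C B hsigma Heta Hloc) as (K & X0 & HP).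
    { intros Y HY. specialize (HD Ci Y (or_intror eq_refl) HY).
      erewrite csum_ext; [exact HD|]. intros j _. cbv beta. replace (Ci * Ci)%C with (- (1))%C by (Ceq; ring). replace (RtoC (-1)) with (- (1))%C by (Ceq; ring). ring. }
    destruct (scale_unbounded sigma X0 hsigma) as (x0 & Hx0 & HX0).
    set (S := fun x => sum_n (fun j => RtoC ((-1) ^ j) * A j * RtoC (/ X x ^ j))%C (M - 1)).
    set (F := fun x => (Rcpow (X x) theta * RtoC (exp (- X x)) / RtoC (2 * PI))%C).
    assert (HF : forall x, F x <> 0%C).
    { intros x. unfold F, Cdiv. repeat apply Cmult_neq_0; [apply Rcpow_neq_0| |].
      - intros E. apply RtoC_inj in E. pose proof (exp_pos (- X x)). lra.
      - rewrite <- RtoC_inv by lra. intros E. apply RtoC_inj in E. pose proof (Rinv_0_lt_compat (2 * PI)). lra. }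
    (* The remainder is forced by the identity, as [F x] is nonzero; only its size remains to be
       estimated. *)
    exists (fun x => Psi01 (- sigma) b (RtoC (- x)) / F x - S x)%C, K.
    exists x0. intros x Hx. split.
    { fold (F x) (S x). specialize (HF x). field. auto. }
    assert (HXp : 0 < X x) by (apply Rmult_lt_0_compat; [auto|apply exp_pos]).
    specialize (HP (X x) x (HX0 x Hx) (saddle_scale sigma x hsigma ltac:(lra))).
    fold theta kappa in HP. eapply Rle_trans; [right|exact HP]. f_equal. f_equal.
    + unfold F. specialize (HF x). unfold F in HF. rewrite RtoC_mult in HF |- *.
      assert (RtoC (exp (- X x)) <> 0%C) by (intros E; apply HF; rewrite E; unfold Cdiv; ring).
      pose proof (Rcpow_neq_0 (X x) theta). assert (RtoC PI <> 0%C) by (intros E; apply RtoC_inj in E; lra).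
      field. auto.
    + f_equal. unfold S. rewrite <- csum_scal, <- csum_sum_n. replace (Datatypes.S (M - 1)) with M by lia.
      apply csum_ext. intros j Hj. rewrite (HA j Hj), RtoC_inv, !RtoC_pow by (apply pow_nonzero; lra). 
      fold kappa. unfold Cdiv. ring.
Qed.
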